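(* Let $(\Gamma_k)_{k\in\mathbb{N}}$ be the unfolded radii of a rotation-invariant determinantal process as in the context, $N\in\mathbb{N}\cup\{\infty\}$ and $\Xi_R^{(N)}=\sum_{k=1}^N(\mathbf{1}_{\Gamma_k\le R}-\mathbb{P}[\Gamma_k\le R])$. Assume Assumption (A) with $\vartheta=0$ and, if $N<\infty$, that $R=R(N)$ satisfies condition (N). Then, as $R\to\infty$, \[ \Bigl(\frac{\Xi_{tR}^{(N)}}{\sqrt{\Sigma_R}}\Bigr)_{t\in\mathbb{R}_+}\longrightarrow(G_t)_{t\in\mathbb{R}_+} \] in the Skorokhod topology on $\mathbb{R}_+$, where $(G_t)$ is a centred Gaussian process with \[ \operatorname{Cov}(G_s,G_t)=\int_I\Phi\bigl(\tfrac{x}{s}\bigr)\Bigl(1-\Phi\bigl(\tfrac{x}{t}\bigr)\Bigr)\mathrm{d}x\qquad\text{for }0<s\le t, \] and $I=(0,a^+)$.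
   Context: Setting: $\alpha\in\mathbb{N}_0$, $\mu$ a Radon measure on $\mathbb{C}$, $\xi$ a rotation-invariant determinantal point process on $\mathbb{C}$ with kernel $K(z,w)=\sum_{k\ge-\alpha}\rho_k(|z|)z^k\rho_k(|w|)\bar w^k$ w.r.t. $\mu$, with $\int\rho_k(|z|)^2|z|^{2k}\mathrm{d}\mu=1$; $\lambda_k(r)=\int_{|z|<r}\rho_k(|z|)^2|z|^{2k}\mathrm{d}\mu$, with $\sum_k\lambda_k(r)<\infty$; $T(r)=\sum_k\lambda_k(r)=\mathbb{E}[\xi(D_r)]$. Let $(X_k)_{k\ge-\alpha}$ be independent with $\mathbb{P}[X_k<r]=\lambda_k(r)$, $\Gamma_{k+\alpha+1}=T(X_k)$. Assumption (A): there exist $\vartheta\in\{0,1\}$ and an increasing continuous $\Sigma\colon\mathbb{R}_+\to\mathbb{R}_+$ with $\Sigma_R\to\infty$ such that for all $k\in\mathbb{N}$, $\mathbb{P}[\Gamma_k\le R]=\Phi(\tfrac{k-\vartheta R}{\Sigma_R})+\tfrac1{\Sigma_R}\Psi(\tfrac{k-\vartheta R}{\Sigma_R})+O(\theta_{R,k})$ with $\sum_k\theta_{R,k}\to0$, $\Phi(x)=\mathbb{P}[Z>x]$ for an absolutely continuous real random variable $Z$ with $\mathbb{E}|Z|<\infty$, $\Psi\in W^{1,1}(\mathbb{R})$; if $\vartheta=1$ also $\Sigma_R=o(R)$ and there is $m>1$ with $\mathbb{E}|Z|^m<\infty$, $\Sigma_R^{m+1}=o(R^m)$. Condition (N) (for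 $N<\infty$): one of (i) $\Sigma_R\Phi(\frac{N-\vartheta R}{\Sigma_R})\to0$; (ii) $\frac{N-\vartheta R}{\Sigma_R}=a^++o(\Sigma_R^{-1})$, $a^+\in\mathbb{R}$; (iii) $\Sigma_R(1-\Phi(\frac{N-\vartheta R}{\Sigma_R}))\to0$. Here $a^+=\lim\frac{N-\vartheta R}{\Sigma_R}$ if $N<\infty$, and $a^+=+\infty$ if $N=\infty$. *)

(* Defs.v *)
From HB Require Import structures.
From mathcomp Require Import all_boot all_order all_algebra.
From mathcomp Require Import all_classical all_reals all_analysis.
Set Implicit Arguments. Unset Strict Implicit. Unset Printing Implicit Defensive.
Import Order.TTheory GRing.Theory Num.Theory Num.Def.
Import numFieldNormedType.Exports.
Local Open Scope classical_set_scope.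
Local Open Scope ring_scope.

Section Defs.
Context {R : realType}.

(** The complex plane is modelled as R * R (product of Borel sigma-algebras,
    which is the Borel sigma-algebra of C); |z| is the Euclidean modulus. *)
Definition cabs (z : R * R) : R := Num.sqrt (z.1 ^+ 2 + z.2 ^+ 2).

Definition radon_on_C (mu : {measure set (R * R)%type -> \bar R}) : Prop :=
  forall r : R, (mu [set z | (cabs z < r)%R] < +oo)%E.

Definition lam (mu : {measure set (R * R)%type -> \bar R}) (rho : int -> R -> R)
    (k : int) (r : R) : \bar R :=
  (\int[mu]_(z in [set z | (cabs z < r)%R])
      ((rho k (cabs z)) ^+ 2 * (cabs z ^+ 2) ^ k)%R%:E)%E.

Definition lam_total (mu : {measure set (R * R)%type -> \bar R}) (rho : int -> R -> R)
    (k : int) : \bar R :=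
  (\int[mu]_z ((rho k (cabs z)) ^+ 2 * (cabs z ^+ 2) ^ k)%R%:E)%E.

(** T(r) = sum_{k >= -alpha} lambda_k(r) = E[xi(D_r)]  (k = j - alpha) *)
Definition Tfun (alpha : nat) (mu : {measure set (R * R)%type -> \bar R})
    (rho : int -> R -> R) (r : R) : R :=
  fine (\sum_(0 <= j <oo) lam mu rho (j%:Z - alpha%:Z) r)%E.

(** Unfolded radii: Gamma_{k+alpha+1} = T(X_k), i.e. Gamma_j = T(X_{j-alpha-1}), j >= 1. *)
Definition Gam (alpha : nat) (mu : {measure set (R * R)%type -> \bar R})
    (rho : int -> R -> R) {T : Type} (X : int -> T -> R) (j : nat) (w : T) : R :=
  Tfun alpha mu rho (X (j%:Z - alpha%:Z - 1) w).

Definition mutually_independent {d} {T : measurableType d} (P : probability T R)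
    (D : set int) (X : int -> T -> R) : Prop :=
  forall (S : seq int) (B : int -> set R), uniq S ->
    (forall i, i \in S -> D i) -> (forall i, measurable (B i)) ->
    P [set w | forall i, i \in S -> B i (X i w)] =
    (\big[*%E/1%E]_(i <- S) P (X i @^-1` B i))%E.

Definition prob_le {d} {T : measurableType d} (P : probability T R)
    (Gm : nat -> T -> R) (k : nat) (r : R) : R :=
  fine (P [set w | Gm k w <= r]).

Definition XiN {d} {T : measurableType d} (P : probability T R)
    (Gm : nat -> T -> R) (N : nat) (r : R) (w : T) : R :=
  \sum_(1 <= k < N.+1) (((Gm k w <= r)%R)%:R - prob_le P Gm k r).

Definition XiInf {d} {T : measurableType d} (P : probability T R)
    (Gm : nat -> T -> R) (r : R) (w : T) : R :=
  limn (fun n => \sum_(1 <= k < n.+1) (((Gm k w <= r)%R)%:R - prob_le P Gm k r)).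

(** Phi(x) = P[Z > x] for an absolutely continuous real r.v. Z with E|Z| < oo,
    expressed through the law mu_Z of Z. *)
Definition Phi_tail (Phi : R -> R) : Prop :=
  exists muZ : probability R R,
    muZ `<< (@lebesgue_measure R) /\
    (\int[muZ]_x (`|x|)%:E < +oo)%E /\
    forall x, Phi x = fine (muZ `]x, +oo[%classic).

(** Psi in W^{1,1}(R) (continuous representative): Psi integrable and
    absolutely continuous with integrable derivative g. *)
Definition W11 (Psi : R -> R) : Prop :=
  (@lebesgue_measure R).-integrable setT (EFin \o Psi) /\
  exists g : R -> R, (@lebesgue_measure R).-integrable setT (EFin \o g) /\
    forall x y, x <= y ->
      (\int[@lebesgue_measure R]_(u in `[x, y]) (g u)%:E)%E = (Psi y - Psi x)%:E.

Definition assumptionA0 {d} {T : measurableType d} (P : probability T R)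
    (Gm : nat -> T -> R) (Sig Phi Psi : R -> R) (theta : R -> nat -> R) : Prop :=
  (forall x, 0 <= x -> 0 <= Sig x) /\
  (forall x y, 0 <= x -> x < y -> Sig x < Sig y) /\
  {within `[0, +oo[, continuous Sig} /\
  Sig x @[x --> +oo] --> +oo /\
  Phi_tail Phi /\ W11 Psi /\
  (forall r k, 0 <= theta r k) /\
  (fun r => \sum_(1 <= k <oo) (theta r k)%:E)%E x @[x --> +oo] --> 0%E /\
  exists C : R, 0 < C /\
    \forall r \near +oo, forall k : nat, (0 < k)%N ->
      `| prob_le P Gm k r - Phi (k%:R / Sig r) - (Sig r)^-1 * Psi (k%:R / Sig r) |
        <= C * theta r k.

Definition conditionN (Sig Phi : R -> R) (RN : nat -> R) (ap : \bar R) : Prop :=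
  (fun N : nat => Sig (RN N) * Phi (N%:R / Sig (RN N))) n @[n --> \oo] --> 0
  \/ (exists a : R, ap = a%:E /\
        (fun N : nat => Sig (RN N) * (N%:R / Sig (RN N) - a)) n @[n --> \oo] --> 0)
  \/ (fun N : nat => Sig (RN N) * (1 - Phi (N%:R / Sig (RN N)))) n @[n --> \oo] --> 0.

(** Skorokhod space D(R_+): paths are functions R -> R of which only t >= 0 matters. *)
Definition cadlag (x : R -> R) : Prop :=
  (forall t, 0 <= t -> x @ at_right t --> x t) /\
  (forall t, 0 < t -> cvg (x @ at_left t)).

Definition time_change (l : R -> R) : Prop :=
  l 0 = 0 /\ {within `[0, +oo[, continuous l} /\
  (forall s t, 0 <= s -> s < t -> l s < l t) /\
  (forall u, 0 <= u -> exists2 t, 0 <= t & l t = u).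

(** Convergence in the Skorokhod J1 topology on D([0,oo)),
    Ethier-Kurtz, Prop. 3.5.3 (c). *)
Definition skorokhod_cvg (x : nat -> R -> R) (y : R -> R) : Prop :=
  forall T, 0 < T -> exists l : nat -> R -> R, (forall n, time_change (l n)) /\
    forall e, 0 < e -> \forall n \near \oo, forall t, 0 <= t <= T ->
      `|l n t - t| <= e /\ `|x n (l n t) - y t| <= e.

(** (sequential) continuity w.r.t. the Skorokhod topology (metrizable). *)
Definition skorokhod_continuous (H : (R -> R) -> R) : Prop :=
  forall (x : nat -> R -> R) (y : R -> R),
    (forall n, cadlag (x n)) -> cadlag y -> skorokhod_cvg x y ->
    H (x n) @[n --> \oo] --> H y.

Definition cvg_law_skorokhod {I : Type} (F : set_system I)
    {d} {T : measurableType d} (P : probability T R) (X : I -> T -> R -> R)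
    {d'} {T' : measurableType d'} (P' : probability T' R) (G : T' -> R -> R) : Prop :=
  forall H : (R -> R) -> R, (exists M, forall x, `|H x| <= M) -> skorokhod_continuous H ->
    (fun i => \int[P]_w (H (X i w))%:E)%E @ F --> (\int[P']_w (H (G w))%:E)%E.

Definition centred_gaussian_process {d'} {T' : measurableType d'} (P' : probability T' R)
    (G : T' -> R -> R) : Prop :=
  (forall t, 0 <= t -> measurable_fun setT (fun w => G w t)) /\
  (forall w, cadlag (G w)) /\
  forall s : seq (R * R), (forall p, p \in s -> 0 <= p.1) ->
    exists sd : R, 0 <= sd /\ forall A : set R, measurable A ->
      P' [set w | A (\sum_(p <- s) p.2 * G w p.1)] =
      (if sd == 0 then \d_(0 : R) A else normal_prob 0 sd A).

Definition covariance_spec {d'} {T' : measurableType d'} (P' : probability T' R)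
    (G : T' -> R -> R) (Phi : R -> R) (ap : \bar R) : Prop :=
  forall s t : R, 0 < s -> s <= t ->
    (\int[P']_w (G w s * G w t)%R%:E)%E =
    (\int[@lebesgue_measure R]_(x in [set x : R | (0 < x)%R /\ (x%:E < ap)%E])
        (Phi (x / s) * (1 - Phi (x / t)))%R%:E)%E.

End Defs.

(* Main.v *)
Require Import Defs.
From HB Require Import structures.
From mathcomp Require Import all_boot all_order all_algebra.
From mathcomp Require Import all_classical all_reals all_analysis.
From mathcomp Require Import measurable_realfun.
From mathcomp Require Import ring lra zify.
Set Implicit Arguments. Unset Strict Implicit. Unset Printing Implicit Defensive.
Import Order.TTheory GRing.Theory Num.Theory Num.Def.
Import numFieldNormedType.Exports.
Local Open Scope classical_set_scope.
Local Open Scope ring_scope.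

(** The indicators of the events {Gamma_k <= r} are independent, so the centred count is a sum
    of independent bounded centred terms. Since T is the sum of the distribution functions of
    the moduli X_k, the sum over k of P[Gamma_k <= r] is r up to the jumps of T, while
    assumption (A) gives c Sig_r + O(1) with Sig continuous; hence the jumps are bounded and
    Sig_r = r / c + O(1). Therefore P[Gamma_k <= tR] is close to Phi(k / (t Sig_R)), and the
    covariances of Xi_{tR} / sqrt(Sig_R) are Riemann sums of the announced integral.
    Characteristic functions give the finite-dimensional convergence. The number of Gamma_k in
    (sR, tR] has mean at most (t - s) R + O(1): fourth moments and dyadic chaining down to mesh
    sqrt(Sig_R) / R, plus monotonicity of the counting function between grid points, control
    the modulus of continuity.

    The limiting covariance satisfies E (G_t - G_s)^2 <= c |t - s|. The process is built at
    dyadic times by Cholesky factorization from independent normal variables, which are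
    themselves functions of one uniform variable, and extended by chaining.

    A bounded Skorokhod-continuous H is the increasing limit, at cadlag paths, of its
    inf-convolutions with the uniform distance on [0, j]; along a path with small modulus these
    are Lipschitz functions of finitely many coordinates, which trigonometric polynomials
    approximate. This gives liminf E H(X_n) >= E H(G), and -H gives the other half. For
    N = oo the sum is cut at some N(R) beyond which the expected number of Gamma_k <= nR is
    negligible. *)

Lemma near_infty_natSinv_le {R : realType} (e : R) : 0 < e ->
  \forall n \near \oo, n.+1%:R^-1 <= e.
Proof.
move=> e0; have /cvgr0Pnorm_le/(_ _ e0) := @cvg_harmonic R; apply: filterS => n.
exact: le_trans (ler_norm _).
Qed.

Section Expectation.
Context {R : realType} {d : measure_display} {T : measurableType d}.
Implicit Types (f g : T -> R).

Definition bmfun f := measurable_fun setT f /\ exists M : R, forall w, `|f w| <= M.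

Lemma bmfun_cst (c : R) : bmfun (fun=> c).
Proof. by split => //; exists `|c|. Qed.

Lemma bmfunN f : bmfun f -> bmfun (fun w => - f w).
Proof.
move=> [mf [M fM]]; split; first exact: measurableT_comp.
by exists M => w; rewrite normrN.
Qed.

Lemma bmfunD f g : bmfun f -> bmfun g -> bmfun (fun w => f w + g w).
Proof.
move=> [mf [M fM]] [mg [M' gM]]; split; first exact: measurable_funD.
by exists (M + M') => w; rewrite (le_trans (ler_normD _ _))// lerD.
Qed.

Lemma bmfunB f g : bmfun f -> bmfun g -> bmfun (fun w => f w - g w).
Proof. by move=> hf hg; apply: bmfunD => //; exact: bmfunN. Qed.

Lemma bmfunM f g : bmfun f -> bmfun g -> bmfun (fun w => f w * g w).
Proof.
move=> [mf [M fM]] [mg [M' gM]]; split; first exact: measurable_funM.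
by exists (M * M') => w; rewrite normrM ler_pM.
Qed.

Lemma bmfunZ (c : R) f : bmfun f -> bmfun (fun w => c * f w).
Proof. by move=> hf; apply: bmfunM => //; exact: bmfun_cst. Qed.

Lemma bmfunX f n : bmfun f -> bmfun (fun w => f w ^+ n).
Proof.
move=> hf; elim: n => [|n IH].
  by under eq_fun do rewrite expr0; exact: bmfun_cst.
by under eq_fun do rewrite exprS; exact: bmfunM.
Qed.

Lemma bmfun_norm f : bmfun f -> bmfun (fun w => `|f w|).
Proof.
move=> [mf [M fM]]; split; first exact: measurableT_comp.
by exists M => w; rewrite normr_id.
Qed.

Lemma bmfun_sum (I : Type) (s : seq I) (p : pred I) (F : I -> T -> R) :
  (forall i, bmfun (F i)) -> bmfun (fun w => \sum_(i <- s | p i) F i w).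
Proof.
move=> hF; elim: s => [|i s IH].
  by under eq_fun do rewrite big_nil; exact: bmfun_cst.
under eq_fun do rewrite big_cons.
by case: (p i) => //; exact: bmfunD.
Qed.

Lemma bmfun_indic (A : set T) : measurable A -> bmfun (\1_A : T -> R).
Proof.
move=> mA; split; first exact: measurable_indic.
by exists 1 => w; rewrite indicE; case: (w \in A); rewrite /= ?normr1 ?normr0.
Qed.

Lemma bmfun_cos f : measurable_fun setT f -> bmfun (fun w => cos (f w)).
Proof.
move=> mf; split.
  by apply: (measurableT_comp _ mf); apply: continuous_measurable_fun; exact: continuous_cos.
by exists 1 => w; rewrite ler_norml cos_geN1 cos_le1.
Qed.

Lemma bmfun_sin f : measurable_fun setT f -> bmfun (fun w => sin (f w)).
Proof.
move=> mf; split.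
  by apply: (measurableT_comp _ mf); apply: continuous_measurable_fun; exact: continuous_sin.
by exists 1 => w; rewrite ler_norml sin_geN1 sin_le1.
Qed.

Lemma measurable_preimage f (B : set R) :
  measurable_fun setT f -> measurable B -> measurable (f @^-1` B).
Proof. by move=> mf mB; rewrite -[X in measurable X]setTI; exact: mf. Qed.

Lemma measurable_set_lt f (x : R) : measurable_fun setT f -> measurable [set w | f w < x].
Proof.
move=> mf; have -> : [set w | f w < x] = f @^-1` `]-oo, x[%classic.
  by apply/seteqP; split => w /=; rewrite in_itv.
exact: measurable_preimage.
Qed.

Lemma measurable_set_le f (x : R) : measurable_fun setT f -> measurable [set w | f w <= x].
Proof.
move=> mf; have -> : [set w | f w <= x] = f @^-1` `]-oo, x]%classic.
  by apply/seteqP; split => w /=; rewrite in_itv.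
exact: measurable_preimage.
Qed.

Lemma measurable_norm_gt f (x : R) : measurable_fun setT f -> measurable [set w | x < `|f w|].
Proof.
move=> mf; have -> : [set w | x < `|f w|] = (fun w => `|f w|) @^-1` `]x, +oo[%classic.
  by apply/seteqP; split => w /=; rewrite in_itv/= andbT.
by apply: measurable_preimage => //; exact: measurableT_comp.
Qed.

Lemma indic_set_le f (x : R) w : \1_[set w | f w <= x] w = ((f w <= x)%R)%:R :> R.
Proof. by rewrite indicE -[w \in _]/(`[< _ >]) asboolb. Qed.

Variable P : probability T R.

Definition expect f : R := \int[P]_w f w.

Lemma bmfun_integrable f : bmfun f -> P.-integrable setT (EFin \o f).
Proof.
move=> [mf [M fM]]; apply: measurable_bounded_integrable => //.
  by rewrite [ltLHS]probability_setT ltry.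
exists M; split; first by rewrite num_real.
by move=> x Mx w _ /=; rewrite (le_trans (fM w))// ltW.
Qed.

Lemma integral_expect f : bmfun f -> (\int[P]_w (f w)%:E)%E = (expect f)%:E.
Proof.
by move=> hf; rewrite /expect /Rintegral fineK//; apply: integrable_fin_num => //;
  exact: bmfun_integrable.
Qed.

Lemma expect_cst (c : R) : expect (fun=> c) = c.
Proof.
rewrite /expect Rintegral_cst// -[RHS]mulr1; congr (_ * _).
exact: (congr1 fine (probability_setT P)).
Qed.

Lemma expectD f g : bmfun f -> bmfun g -> expect (fun w => f w + g w) = expect f + expect g.
Proof. by move=> hf hg; rewrite /expect RintegralD//; exact: bmfun_integrable. Qed.

Lemma expectB f g : bmfun f -> bmfun g -> expect (fun w => f w - g w) = expect f - expect g.
Proof. by move=> hf hg; rewrite /expect RintegralB//; exact: bmfun_integrable. Qed.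

Lemma expectZ (c : R) f : bmfun f -> expect (fun w => c * f w) = c * expect f.
Proof. by move=> hf; rewrite /expect RintegralZl//; exact: bmfun_integrable. Qed.

Lemma expectN f : bmfun f -> expect (fun w => - f w) = - expect f.
Proof. by move=> hf; under eq_fun do rewrite -mulN1r; rewrite expectZ// mulN1r. Qed.

Lemma expect_sum (I : Type) (s : seq I) (p : pred I) (F : I -> T -> R) :
  (forall i, bmfun (F i)) ->
  expect (fun w => \sum_(i <- s | p i) F i w) = \sum_(i <- s | p i) expect (F i).
Proof.
move=> hF; elim: s => [|i s IH].
  by under eq_fun do rewrite big_nil; rewrite big_nil expect_cst.
under eq_fun do rewrite big_cons; rewrite big_cons.
by case: (p i) => //; rewrite expectD ?IH//; exact: bmfun_sum.
Qed.

Lemma le_expect f g : bmfun f -> bmfun g -> (forall w, f w <= g w) -> expect f <= expect g.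
Proof.
by move=> hf hg fg; apply: le_Rintegral => //; exact: bmfun_integrable.
Qed.

Lemma expect_ge0 f : (forall w, 0 <= f w) -> 0 <= expect f.
Proof. by move=> f0; apply: Rintegral_ge0. Qed.

Lemma norm_expect_le f : bmfun f -> `|expect f| <= expect (fun w => `|f w|).
Proof. by move=> hf; apply: le_normr_Rintegral => //; exact: bmfun_integrable. Qed.

Lemma norm_expect_bound f (M : R) : bmfun f -> (forall w, `|f w| <= M) -> `|expect f| <= M.
Proof.
move=> hf fM; rewrite (le_trans (norm_expect_le hf))// -[leRHS]expect_cst.
by apply: le_expect => //; [exact: bmfun_norm|exact: bmfun_cst].
Qed.

Definition prob (A : set T) : R := fine (P A).

Lemma EFin_prob A : measurable A -> P A = (prob A)%:E.
Proof.
move=> mA; rewrite /prob fineK// fin_num_abs.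
by rewrite (le_lt_trans _ (ltry 1))// gee0_abs// probability_le1.
Qed.

Lemma expect_indic (A : set T) : measurable A -> expect (\1_A : T -> R) = prob A.
Proof. by move=> mA; rewrite /expect /Rintegral integral_indic// setIT. Qed.

Lemma prob_ge0 A : 0 <= prob A.
Proof. exact: fine_ge0. Qed.

Lemma prob_le1 A : measurable A -> prob A <= 1.
Proof. by move=> mA; rewrite -lee_fin -EFin_prob// probability_le1. Qed.

Lemma prob_setT : prob setT = 1.
Proof. by rewrite /prob probability_setT. Qed.

Lemma le_prob A B : measurable A -> measurable B -> A `<=` B -> prob A <= prob B.
Proof. by move=> mA mB AB; rewrite -lee_fin -!EFin_prob// le_measure// inE. Qed.

Lemma prob_setC A : measurable A -> prob (~` A) = 1 - prob A.
Proof.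
move=> mA; apply: EFin_inj; rewrite EFinB -!EFin_prob//; last exact: measurableC.
by rewrite probability_setC.
Qed.

Lemma prob_setU_le A B : measurable A -> measurable B -> prob (A `|` B) <= prob A + prob B.
Proof.
move=> mA mB; rewrite -lee_fin EFinD -!EFin_prob//; last exact: measurableU.
exact: measureU2.
Qed.

Lemma prob_bigcup_ord_le (A : nat -> set T) (n : nat) (u : nat -> R) :
  (forall k, measurable (A k)) -> (forall k, (k < n)%N -> prob (A k) <= u k) ->
  measurable [set w | exists2 k, (k < n)%N & A k w] /\
  prob [set w | exists2 k, (k < n)%N & A k w] <= \sum_(k < n) u k.
Proof.
move=> mA Au; have -> : [set w | exists2 k, (k < n)%N & A k w] = \big[setU/set0]_(i < n) A i.
  by rewrite -bigcup_mkord; apply/seteqP; split => w [k kn Ak]; exists k.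
have mU : measurable (\big[setU/set0]_(i < n) A i) by exact: bigsetU_measurable.
split => //; rewrite -lee_fin -EFin_prob//; apply: le_trans (Boole_inequality _ _) _ => //.
rewrite (eq_bigr (fun i : 'I_n => (prob (A i))%:E)); last by move=> i _; exact: EFin_prob.
by rewrite sumEFin lee_fin; apply: ler_sum => i _; exact: Au.
Qed.

Lemma expect_dominated_cvg (f_ : nat -> T -> R) f (M : R) :
  (forall n, measurable_fun setT (f_ n)) -> measurable_fun setT f ->
  (forall n w, `|f_ n w| <= M) ->
  {ae P, forall w, f_ n w @[n --> \oo] --> f w} ->
  expect (f_ n) @[n --> \oo] --> expect f.
Proof.
move=> mf_ mf fM f_f.
have M0 : 0 <= M by rewrite (le_trans _ (fM 0%N point)).
have [iF _ cF] : [/\ P.-integrable setT (EFin \o f),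
    (\int[P]_w `|(f_ n w)%:E - (f w)%:E|)%E @[n --> \oo] --> 0%E &
    (\int[P]_w (f_ n w)%:E)%E @[n --> \oo] --> (\int[P]_w (f w)%:E)%E].
  apply: (@dominated_convergence _ _ _ P setT measurableT
    (fun n w => (f_ n w)%:E) (EFin \o f) (EFin \o cst M)).
  - by move=> n; exact/measurable_EFinP.
  - exact/measurable_EFinP.
  - move: f_f; apply: filterS => w h _ /=.
    exact: cvg_EFin (nearW _ _) h.
  - exact: bmfun_integrable (bmfun_cst M).
  - by apply/aeW => w n _ /=; rewrite lee_fin.
apply: fine_cvg; rewrite fineK//.
exact: integrable_fin_num.
Qed.

Lemma prob_cvg_ae (A_ : nat -> set T) (A : set T) : (forall n, measurable (A_ n)) -> measurable A ->
  {ae P, forall w, \forall n \near \oo, (w \in A_ n) = (w \in A)} ->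
  prob (A_ n) @[n --> \oo] --> prob A.
Proof.
move=> mA_ mA A_A; rewrite -expect_indic//; under eq_fun do rewrite -expect_indic//.
apply: (@expect_dominated_cvg _ _ 1).
- by move=> n; exact: measurable_indic.
- exact: measurable_indic.
- by move=> n w; rewrite indicE; case: (_ \in _); rewrite ?normr0 ?normr1.
- move: A_A; apply: filterS => w A_Aw; apply: cvg_near_cst.
  by move: A_Aw; apply: filterS => n An; rewrite !indicE An.
Qed.

Lemma markov_pow f (e : R) n : bmfun f -> 0 < e ->
  prob [set w | e < `|f w|] <= expect (fun w => `|f w| ^+ n) / e ^+ n.
Proof.
move=> bf e0; have mA := measurable_norm_gt e bf.1.
rewrite ler_pdivlMr ?exprn_gt0// mulrC -expect_indic// -expectZ; last exact: bmfun_indic.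
apply: le_expect; [exact/bmfunZ/bmfun_indic|exact/bmfunX/bmfun_norm|move=> w].
rewrite indicE; have [|] := boolP (w \in _); last by rewrite mulr0 exprn_ge0.
by rewrite inE /= mulr1 => ef; apply: lerXn2r; rewrite ?nnegrE ?normr_ge0// ltW.
Qed.

Lemma prob_norm_gt_anti f (a b : R) : measurable_fun setT f -> a <= b ->
  prob [set w | b < `|f w|] <= prob [set w | a < `|f w|].
Proof.
move=> mf ab; apply: le_prob; [exact: measurable_norm_gt..|].
by move=> w /=; exact: le_lt_trans.
Qed.

Lemma exists_tail_prob_le f : measurable_fun setT f ->
  forall e : R, 0 < e -> exists A : R, 0 < A /\ prob [set w | A < `|f w|] <= e.
Proof.
move=> mf e e0.
have : prob [set w | n.+1%:R < `|f w|] @[n --> \oo] --> prob set0.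
  apply: prob_cvg_ae => //; first by move=> n; exact: measurable_norm_gt.
  apply/aeW => w; near=> n; rewrite in_set0 memNset//=.
  apply/negP; rewrite -leNgt (@le_trans _ _ n%:R)// ?ler_nat//.
  by near: n; exact: nbhs_infty_ger.
rewrite {2}/prob measure0 => /cvgr0Pnorm_le/(_ _ e0)[n _ /(_ n (leqnn n))] /= tail_le.
by exists n.+1%:R; split => //; exact: le_trans (ler_norm _) tail_le.
Unshelve. all: by end_near. Qed.

Lemma le_integral_ge0 f g : (forall w, 0 <= f w) -> (forall w, f w <= g w) ->
  ((\int[P]_w (f w)%:E) <= \int[P]_w (g w)%:E)%E.
Proof.
move=> f0 fg; rewrite !ge0_integralTE; last 2 first.
- by move=> w; rewrite lee_fin (le_trans (f0 w)).
- by move=> w; rewrite lee_fin.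
apply: ereal_sup_le => _ [h /= hf <-]; exists h => //= w.
by rewrite (le_trans (hf w))// lee_fin.
Qed.

(* Test functionals on the path space are not known to be measurable along a process,
   so their expectations are only lower integrals. *)
Lemma integral_between_expect f g1 g2 : bmfun g1 -> bmfun g2 ->
  (forall w, g1 w <= f w) -> (forall w, f w <= g2 w) ->
  ((expect g1)%:E <= \int[P]_w (f w)%:E)%E /\ ((\int[P]_w (f w)%:E) <= (expect g2)%:E)%E.
Proof.
move=> bg1 bg2 g1f fg2; rewrite -!integral_expect// !(integralE _ _ (EFin \o _)).
have posE (u : T -> R) : (EFin \o u)^\+%E = (fun w => (maxr (u w) 0)%:E).
  by apply/funext => w; rewrite funeposE /= EFin_max.
have negE (u : T -> R) : (EFin \o u)^\-%E = (fun w => (maxr (- u w) 0)%:E).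
  by apply/funext => w; rewrite funenegE /= EFin_max.
rewrite !posE !negE.
have le_max0 (a b : R) : a <= b -> maxr a 0 <= maxr b 0.
  by move=> ab; rewrite ge_max !le_max ab lexx orbT.
have max0_ge0 (a : R) : 0 <= maxr a 0 by rewrite le_max lexx orbT.
by split; apply: leeB; apply: le_integral_ge0 => w //; apply: le_max0; rewrite ?lerN2.
Qed.

End Expectation.

Section TrigBounds.
Context {R : realType}.
Implicit Types y : R.

Lemma sin_le_id y : 0 <= y -> sin y <= y.
Proof.
rewrite le_eqVlt => /predU1P[<-|y0]; first by rewrite sin0.
have [c _] := @MVT _ (@sin R) (@cos R) 0 y y0 (fun x _ => is_derive_sin x)
  (continuous_subspaceT (@continuous_sin R)).
rewrite sin0 !subr0 => ->.
by rewrite ler_piMl ?cos_le1// ltW.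
Qed.

Lemma norm_sin_le y : `|sin y| <= `|y|.
Proof.
wlog y0 : y / 0 <= y => [H|].
  have [/H//|/ltW y0] := leP 0 y.
  by rewrite -normrN -sinN -(normrN y) H// oppr_ge0.
rewrite (ger0_norm y0) ler_norml sin_le_id// andbT.
have [y1|y1] := leP y pi; first by rewrite (le_trans _ (sin_ge0_pi _))// ?oppr_le0 ?y0.
by rewrite (le_trans _ (sin_geN1 _))// lerN2 (le_trans _ (ltW y1))//
  (le_trans _ (pi_ge2 _))// ler1n.
Qed.

Lemma cos_ge_quadratic y : 1 - y ^+ 2 / 2 <= cos y.
Proof.
have -> : cos y = 1 - 2 * (sin (y / 2)) ^+ 2.
  have := @cos_mulr2n _ (y / 2); have -> : (y / 2) *+ 2 = y by rewrite -mulr_natr divfK.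
  move=> ->.
  by have := cos2Dsin2 (y / 2); lra.
have : `|sin (y / 2)| ^+ 2 <= `|y / 2| ^+ 2 by rewrite lerXn2r ?nnegrE// norm_sin_le.
by rewrite !real_normK ?num_real//; lra.
Qed.

Lemma sin_taylor1_bound y : `|sin y - y| <= `|y| ^+ 3 / 2.
Proof.
wlog y0 : y / 0 <= y => [H|].
  have [/H//|/ltW y0] := leP 0 y.
  have -> : sin y - y = - (sin (- y) - (- y)) by rewrite sinN; ring.
  by rewrite normrN -(normrN y) H// oppr_ge0.
rewrite (ger0_norm y0).
have : sin y - y <= 0 by rewrite subr_le0 sin_le_id.
move/ler0_norm ->.
move: y0; rewrite le_eqVlt => /predU1P[<-|y0].
  by rewrite sin0 expr0n/= mul0r subrr oppr0.
have [c cin] := @MVT _ (@sin R) (@cos R) 0 y y0 (fun x _ => is_derive_sin x)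
  (continuous_subspaceT (@continuous_sin R)).
rewrite sin0 !subr0 => ->.
move: cin; rewrite in_itv/= => /andP[c0 cy].
have := cos_ge_quadratic c => hc.
have : c ^+ 2 <= y ^+ 2 by rewrite lerXn2r ?nnegrE// ltW.
by rewrite expr2 => c2; rewrite !exprS expr0 in hc *; nra.
Qed.

Lemma cos_taylor2_bound y : `|cos y - 1 + y ^+ 2 / 2| <= `|y| ^+ 4 / 2.
Proof.
wlog y0 : y / 0 <= y => [H|].
  have [/H//|/ltW y0] := leP 0 y.
  by have := H (- y); rewrite cosN sqrrN normrN; apply; rewrite oppr_ge0.
rewrite (ger0_norm y0) ger0_norm; last by have := cos_ge_quadratic y; lra.
move: y0; rewrite le_eqVlt => /predU1P[<-|y0].
  by rewrite cos0 !expr0n/= !mul0r addr0 subrr.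
pose f (x : R) := cos x - 1 + x ^+ 2 / 2.
have df x : is_derive x (1 : R) f (x - sin x).
  rewrite /f; apply: is_derive_eq.
  by rewrite /GRing.scale/=; lra.
have cf : {within `[0, y], continuous f}.
  apply: derivable_within_continuous => x _.
  by have [] := df x.
have [c cin] := @MVT _ f (fun x => x - sin x) 0 y y0 (fun x _ => df x) cf.
rewrite /f cos0 expr0n/= mul0r subrr addr0 !subr0 => ->.
move: cin; rewrite in_itv/= => /andP[c0 cy].
have := sin_taylor1_bound c; rewrite distrC (ger0_norm (ltW c0)).
move/(le_trans (ler_norm _)) => sin_le.
have c3 : c ^+ 3 <= y ^+ 3 by rewrite lerXn2r ?nnegrE// ltW.
rewrite (exprS y 3); nra.
Qed.

End TrigBounds.

Section TrigPoly.
Context {R : realType}.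
Implicit Types (x y : R -> R) (D : R -> Prop).

Definition linform (s : seq (R * R)) x : R := \sum_(p <- s) p.2 * x p.1.

Definition scale_coefs (a : R) (s : seq (R * R)) := [seq (p.1, a * p.2) | p <- s].

Lemma linform_cat s s' x : linform (s ++ s') x = linform s x + linform s' x.
Proof. by rewrite /linform big_cat. Qed.

Lemma linform_scale (a : R) s x : linform (scale_coefs a s) x = a * linform s x.
Proof. by rewrite /linform big_map mulr_sumr; apply: eq_bigr => p _; rewrite mulrA. Qed.

Definition times_in D (s : seq (R * R)) := forall p, p \in s -> D p.1.

Lemma times_in_cat D s s' : times_in D s -> times_in D s' -> times_in D (s ++ s').
Proof. by move=> sD s'D p; rewrite mem_cat => /orP[/sD|/s'D]. Qed.

Lemma times_in_scale D (a : R) s : times_in D s -> times_in D (scale_coefs a s).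
Proof. by move=> sD p /mapP[q qs ->]; exact: (sD q). Qed.

Inductive trigpoly D : ((R -> R) -> R) -> Prop :=
| trigpoly_cos s b : times_in D s -> trigpoly D (fun x => cos (linform s x + b))
| trigpolyD f g : trigpoly D f -> trigpoly D g -> trigpoly D (fun x => f x + g x)
| trigpolyZ c f : trigpoly D f -> trigpoly D (fun x => c * f x).

Lemma trigpoly_cst D c : trigpoly D (fun=> c).
Proof.
have -> : (fun=> c) = (fun x : R -> R => c * cos (linform [::] x + 0)).
  by apply/funext => x; rewrite /linform big_nil add0r cos0 mulr1.
by apply: trigpolyZ; apply: trigpoly_cos.
Qed.

Lemma trigpolyB D f g : trigpoly D f -> trigpoly D g -> trigpoly D (fun x => f x - g x).
Proof.
move=> hf hg; have -> : (fun x => f x - g x) = (fun x => f x + (-1) * g x).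
  by apply/funext => x; rewrite mulN1r.
by apply: trigpolyD => //; apply: trigpolyZ.
Qed.

Lemma trigpolyM D f g : trigpoly D f -> trigpoly D g -> trigpoly D (fun x => f x * g x).
Proof.
move=> hf; elim: hf g => {f} [s b hs g hg|f f' hf IH hf' IH' g hg|c f hf IH g hg].
- elim: hg => {g} [s' b' hs'|g g' hg IH hg' IH'|c g hg IH].
  + have -> : (fun x => cos (linform s x + b) * cos (linform s' x + b')) =
      (fun x => 2^-1 * (cos (linform (s ++ s') x + (b + b')) +
         cos (linform (s ++ scale_coefs (-1) s') x + (b - b')))).
      apply/funext => x; rewrite !linform_cat linform_scale mulN1r.
      have -> : linform s x + linform s' x + (b + b') =
        (linform s x + b) + (linform s' x + b') by ring.
      have -> : linform s x - linform s' x + (b - b') =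
        (linform s x + b) - (linform s' x + b') by ring.
      by move: (linform s x + b) (linform s' x + b') => u v; rewrite cosD cosB; field.
    by apply/trigpolyZ/trigpolyD; apply: trigpoly_cos; apply: times_in_cat => //;
      apply: times_in_scale.
  + under eq_fun do rewrite mulrDr; exact: trigpolyD.
  + under eq_fun do rewrite mulrCA; exact: trigpolyZ.
- by under eq_fun do rewrite mulrDl; apply: trigpolyD; [exact: IH|exact: IH'].
- by under eq_fun do rewrite -mulrA; apply: trigpolyZ; exact: IH.
Qed.

Lemma trigpoly_sin D t a : D t -> trigpoly D (fun x => sin (a * x t)).
Proof.
move=> Dt; have -> : (fun x => sin (a * x t)) =
    (fun x : R -> R => cos (linform [:: (t, a)] x + (- (pi / 2)))).
  by apply/funext => x; rewrite /linform big_seq1/= cosB cos_pihalf sin_pihalf mulr0 add0r mulr1.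
by apply: trigpoly_cos => p; rewrite inE => /eqP ->.
Qed.

(* [bernstein n u f] is the expectation of [f] under the binomial law of parameters n, u. *)
Fixpoint bernstein (n : nat) (u : R) (f : nat -> R) : R :=
  if n is n'.+1 then (1 - u) * bernstein n' u f + u * bernstein n' u (fun k => f k.+1) else f 0%N.

Lemma le_bernstein n u f g : 0 <= u <= 1 -> (forall k, (k <= n)%N -> f k <= g k) ->
  bernstein n u f <= bernstein n u g.
Proof.
move=> /andP[u0 u1]; elim: n f g => /= [|n IH] f g fg; first exact: fg.
apply: lerD; apply: ler_wpM2l; rewrite ?subr_ge0//; apply: IH => k kn; apply: fg => //.
exact: leqW.
Qed.

Lemma bernsteinD n u f g : bernstein n u (fun k => f k + g k) = bernstein n u f + bernstein n u g.
Proof. by elim: n f g => //= n IH f g; rewrite !IH; ring. Qed.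

Lemma bernsteinZ n u c f : bernstein n u (fun k => c * f k) = c * bernstein n u f.
Proof. by elim: n f => //= n IH f; rewrite !IH; ring. Qed.

Lemma bernstein_cst n u c : bernstein n u (fun=> c) = c.
Proof. by elim: n => //= n ->; ring. Qed.

Lemma bernstein_sqr_dist n u a : bernstein n u (fun k => (k%:R - a) ^+ 2) =
  (n%:R * u - a) ^+ 2 + n%:R * u * (1 - u).
Proof.
elim: n a => [|n IH] a /=; first by rewrite !mul0r; ring.
have -> : (fun k : nat => (k.+1%:R - a) ^+ 2) = (fun k => (k%:R - (a - 1)) ^+ 2).
  by apply/funext => k; rewrite -natr1; congr (_ ^+ 2); ring.
by rewrite !IH -natr1; ring.
Qed.

Lemma norm_bernstein_le n u f : 0 <= u <= 1 ->
  `|bernstein n u f| <= bernstein n u (fun k => `|f k|).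
Proof.
move=> u01; rewrite ler_norml; apply/andP; split.
  rewrite -mulN1r -bernsteinZ; apply: le_bernstein => // k _.
  by rewrite mulN1r lerNl ler_normr lexx orbT.
by apply: le_bernstein => // k _; rewrite ler_norm.
Qed.

Lemma bernstein_dist_le n u (e : R) : (0 < n)%N -> 0 <= u <= 1 -> 0 < e ->
  bernstein n u (fun k => `|u - k%:R / n%:R|) <= e + (n%:R * e)^-1.
Proof.
move=> n0 u01 e0.
have nr0 : 0 < n%:R :> R by rewrite ltr0n.
have dist_le k : `|u - k%:R / n%:R| <= e + (n%:R ^+ 2 * e)^-1 * (k%:R - n%:R * u) ^+ 2.
  set v := u - k%:R / n%:R.
  have -> : (k%:R - n%:R * u) ^+ 2 = n%:R ^+ 2 * `|v| ^+ 2.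
    by rewrite real_normK ?num_real// /v; field; rewrite gt_eqF.
  have -> : (n%:R ^+ 2 * e)^-1 * (n%:R ^+ 2 * `|v| ^+ 2) = `|v| ^+ 2 / e.
    by field; rewrite !gt_eqF.
  rewrite -(ler_pM2r e0) mulrDl mulfVK ?gt_eqF//.
  by have := sqr_ge0 (`|v| - e); have := normr_ge0 v; nra.
apply: (le_trans (le_bernstein u01 (fun k _ => dist_le k))).
rewrite bernsteinD bernstein_cst bernsteinZ bernstein_sqr_dist subrr expr0n/= add0r lerD2l.
case/andP: u01 => u0 u1.
have -> : (n%:R * e)^-1 = (n%:R ^+ 2 * e)^-1 * n%:R by field; rewrite !gt_eqF.
apply: ler_wpM2l; first by rewrite invr_ge0 mulr_ge0 ?ltW// exprn_gt0.
by nra.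
Qed.

Lemma dist_bernstein_le n u c f : 0 <= u <= 1 ->
  `|c - bernstein n u f| <= bernstein n u (fun k => `|c - f k|).
Proof.
move=> u01; have -> : c - bernstein n u f = bernstein n u (fun k => c + (-1) * f k).
  by rewrite bernsteinD bernstein_cst bernsteinZ mulN1r.
apply: le_trans (norm_bernstein_le _ _ u01) _.
by apply: le_bernstein => // k _; rewrite mulN1r.
Qed.

Lemma exists_inv_le (eta : R) : 0 < eta -> exists2 n : nat, (0 < n)%N & (n%:R * eta)^-1 <= eta.
Proof.
move=> eta0; exists (Num.truncn ((eta * eta)^-1)).+1 => //.
have := truncnS_gt ((eta * eta)^-1); set m := (_.+1%:R : R) => m_gt.
have m0 : 0 < m by rewrite ltr0n.
have : 1 < m * (eta * eta) by rewrite -ltr_pdivrMr ?mulr_gt0// mul1r.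
by move=> ?; rewrite -[leLHS]mul1r ler_pdivrMr ?mulr_gt0// mulrCA ltW.
Qed.

Lemma norm_sub_scaled_sin_le (B v : R) : 0 < B ->
  `|v - B * sin (B^-1 * v)| <= `|v| ^+ 3 / 2 / B ^+ 2.
Proof.
move=> B0; have -> : v - B * sin (B^-1 * v) = B * (B^-1 * v - sin (B^-1 * v)).
  by rewrite mulrBr mulVKf// gt_eqF.
rewrite normrM (gtr0_norm B0) distrC (le_trans (ler_wpM2l (ltW B0) (sin_taylor1_bound _)))//.
rewrite normrM gtr0_norm ?invr_gt0// exprMn le_eqVlt; apply/orP; left; apply/eqP.
by field; rewrite gt_eqF.
Qed.

Lemma exists_scaled_sin_approx (A q : R) : 0 < A -> 0 < q ->
  exists2 B : R, 0 < B & forall v : R, `|v| <= A -> `|v - B * sin (B^-1 * v)| <= q.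
Proof.
move=> A0 q0; pose B := 1 + A ^+ 3 / q.
have B1 : 1 <= B by rewrite lerDl divr_ge0 ?exprn_ge0 ?ltW.
have B0 : 0 < B by lra.
have A3 : A ^+ 3 <= q * B by rewrite /B mulrDr mulr1 mulrCA divff ?gt_eqF// mulr1 lerDr ltW.
exists B => // y yA; apply: le_trans (norm_sub_scaled_sin_le y B0) _.
rewrite ler_pdivrMr ?exprn_gt0//.
have : `|y| ^+ 3 <= A ^+ 3 by rewrite lerXn2r ?nnegrE// ltW.
have : q * B <= q * B ^+ 2 by rewrite ler_pM2l// expr2 ler_peMl// ltW.
have : 0 <= `|y| ^+ 3 by rewrite exprn_ge0.
by lra.
Qed.

Lemma sin_half01 (a v : R) : 0 <= (1 + sin (a * v)) / 2 <= 1.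
Proof. by have := sin_geN1 (a * v); have := sin_le1 (a * v); lra. Qed.

(* Rounds a bounded coordinate [y] at random to one of the points [v k], the probabilities
   being trigonometric polynomials of [y]. *)
Lemma exists_bernstein_rounding (A q : R) : 0 < A -> 0 < q ->
  exists n a (v : nat -> R), forall y : R, `|y| <= A ->
    bernstein n ((1 + sin (a * y)) / 2) (fun k => `|y - v k|) <= q.
Proof.
move=> A0 q0; have q2 : 0 < q / 2 by rewrite divr_gt0.
have [B B0 sin_approx] := exists_scaled_sin_approx A0 q2.
pose eta := q / (8 * B); have eta0 : 0 < eta by rewrite divr_gt0// mulr_gt0.
have [n n0 n_eta] := exists_inv_le eta0.
exists n, B^-1, (fun k => B * (2 * (k%:R / n%:R) - 1)) => y yA.
have u01 := sin_half01 B^-1 y; set u := _ / 2 in u01 *.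
have dist_v k : `|y - B * (2 * (k%:R / n%:R) - 1)| <= q / 2 + 2 * B * `|u - k%:R / n%:R|.
  have -> : y - B * (2 * (k%:R / n%:R) - 1) =
      (y - B * sin (B^-1 * y)) + 2 * B * (u - k%:R / n%:R).
    by rewrite /u; field; rewrite pnatr_eq0 -lt0n.
  rewrite (le_trans (ler_normD _ _))// lerD ?sin_approx//.
  by rewrite normrM gtr0_norm// mulr_gt0.
apply: le_trans (le_bernstein u01 (fun k _ => dist_v k)) _.
rewrite bernsteinD bernstein_cst bernsteinZ.
have : 2 * B * bernstein n u (fun k => `|u - k%:R / n%:R|) <= 2 * B * (eta + eta).
  rewrite ler_wpM2l ?mulr_ge0 ?(ltW B0)//.
  by rewrite (le_trans (bernstein_dist_le n0 u01 eta0))// lerD2l.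
have -> : 2 * B * (eta + eta) = q / 2 by rewrite /eta; field; rewrite gt_eqF.
by lra.
Qed.

Definition update_at x (t v : R) : R -> R := fun s => if s == t then v else x s.

Lemma trigpoly_bernstein D n t a (F : nat -> (R -> R) -> R) : D t ->
  (forall k, trigpoly D (F k)) ->
  trigpoly D (fun x => bernstein n ((1 + sin (a * x t)) / 2) (fun k => F k x)).
Proof.
move=> Dt; elim: n F => [|n IH] F hF /=; first exact: hF.
have hu : trigpoly D (fun x => (1 + sin (a * x t)) / 2).
  under eq_fun do rewrite mulrC; apply/trigpolyZ/trigpolyD;
    [exact: trigpoly_cst|exact: trigpoly_sin].
apply: trigpolyD; apply: trigpolyM => //; last exact: (IH (fun k => F k.+1)).
  by apply: trigpolyB => //; exact: trigpoly_cst.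
exact: IH.
Qed.

Definition coord_lipschitz (C : R) (s : seq R) (L : (R -> R) -> R) :=
  forall x y, `|L x - L y| <= C * \sum_(t <- s) `|x t - y t|.

Lemma coord_lipschitz_update_at C t s L v : 0 <= C ->
  coord_lipschitz C (t :: s) L -> coord_lipschitz C s (fun x => L (update_at x t v)).
Proof.
move=> C0 lipL x y; rewrite (le_trans (lipL _ _))// ler_wpM2l//.
rewrite big_cons /update_at eqxx subrr normr0 add0r; apply: ler_sum => u _.
by case: eqP => // _; rewrite subrr normr0.
Qed.

Lemma dist_update_at_le C t s L x v : t \notin s -> coord_lipschitz C (t :: s) L ->
  `|L x - L (update_at x t v)| <= C * `|x t - v|.
Proof.
move=> ts lipL; rewrite (le_trans (lipL _ _))// big_cons /update_at eqxx.
rewrite big_seq big1 ?addr0// => u us.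
by case: eqP => [ut|_]; [rewrite ut (negbTE ts) in us|rewrite subrr normr0].
Qed.

Definition trigpoly_approx D (s : seq R) (L : (R -> R) -> R) (M A e : R) :=
  exists F, [/\ trigpoly D F,
  (forall x, `|F x| <= M) &
  forall x, (forall t, t \in s -> `|x t| <= A) -> `|L x - F x| <= e].

Lemma trigpoly_approx_cons D t s L (C M A e : R) :
  D t -> t \notin s -> 0 <= C -> coord_lipschitz C (t :: s) L -> 0 < A -> 0 < e ->
  (forall v, trigpoly_approx D s (fun x => L (update_at x t v)) M A (e / 2)) ->
  trigpoly_approx D (t :: s) L M A e.
Proof.
move=> Dt ts C0 lipL A0 e0 approx.
pose q := e / 2 / (C + 1); have q0 : 0 < q by rewrite divr_gt0 ?divr_gt0//; lra.
have Cq : C * q <= e / 2 by rewrite /q mulrA ler_pdivrMr; [nra|lra].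
have [n [a [v rounding]]] := exists_bernstein_rounding A0 q0.
have [F F_approx] := choice (fun k => approx (v k)).
exists (fun x => bernstein n ((1 + sin (a * x t)) / 2) (fun k => F k x)); split.
- by apply: trigpoly_bernstein => // k; have [] := F_approx k.
- move=> x; have u01 := sin_half01 a (x t).
  rewrite (le_trans (norm_bernstein_le _ _ u01))//
    -[leRHS](bernstein_cst n ((1 + sin (a * x t)) / 2)).
  by apply: le_bernstein => // k _; have [] := F_approx k.
move=> x xA; have u01 := sin_half01 a (x t).
have LF k : `|L x - F k x| <= C * `|x t - v k| + e / 2.
  rewrite (le_trans (ler_distD (L (update_at x t (v k))) _ _))// lerD//.
    exact: dist_update_at_le _ _ ts lipL.
  by have [_ _] := F_approx k; apply=> u us; apply: xA; rewrite inE us orbT.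
apply: le_trans (dist_bernstein_le _ _ _ u01) _.
apply: le_trans (le_bernstein u01 (fun k _ => LF k)) _.
rewrite bernsteinD bernstein_cst bernsteinZ [leRHS]splitr lerD2r (le_trans _ Cq)// ler_wpM2l//.
by apply: rounding; apply: xA; rewrite inE eqxx.
Qed.

Lemma coord_lipschitz_trigpoly_approx D s L (C M A e : R) :
  uniq s -> (forall t, t \in s -> D t) -> 0 <= C -> coord_lipschitz C s L ->
  (forall x, `|L x| <= M) -> 0 < A -> 0 < e -> trigpoly_approx D s L M A e.
Proof.
move=> us Ds C0 lipL LM A0; elim: s us Ds L lipL LM e => [|t s IH] us Ds L lipL LM e e0.
  exists (fun=> L (fun=> 0)); split => [|x|x _]; [exact: trigpoly_cst|exact: LM|].
  by rewrite (le_trans (lipL _ _))// big_nil mulr0 ltW.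
have /andP[ts us'] := us.
apply: (trigpoly_approx_cons (C := C)) => //; first by apply: Ds; rewrite inE eqxx.
move=> v; apply: IH => //; last by rewrite divr_gt0.
- by move=> u us0; apply: Ds; rewrite inE us0 orbT.
- exact: coord_lipschitz_update_at.
Qed.

End TrigPoly.

(** * Convergence in law on the Skorokhod space *)

Section Regularization.
Context {R : realType}.
Implicit Types (x y : R -> R).

Lemma cadlag_cst (c : R) : cadlag (fun=> c).
Proof.
split => t _; first exact: cvg_cst.
by apply/cvg_ex; exists c; exact: cvg_cst.
Qed.

Variables (H : (R -> R) -> R) (M : R).
Hypothesis HM : forall x, `|H x| <= M.
Hypothesis Hc : skorokhod_continuous H.

(* The values whose infimum is the inf-convolution of [H] with [j] times the uniform distance on
   [[0, j]], capped at 1. *)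
Definition infconv_values (j : nat) x : set R :=
  [set v | exists (y : R -> R) (e : R), [/\ cadlag y, 0 <= e,
  1 <= e \/ (forall t : R, 0 <= t <= j%:R -> `|y t - x t| <= e) & v = H y + j%:R * e]].

Definition infconv (j : nat) x : R := inf (infconv_values j x).

Lemma infconv_values_lbound j x : lbound (infconv_values j x) (- M).
Proof.
move=> v [y [e [_ e0 _ ->]]].
have := HM y; rewrite ler_norml => /andP[Hy _].
by rewrite (le_trans Hy)// lerDl mulr_ge0.
Qed.

Lemma infconv_values_has_inf j x : has_inf (infconv_values j x).
Proof.
split; last by exists (- M); exact: infconv_values_lbound.
exists (H (fun=> 0) + j%:R * 1), (fun=> 0), 1; split => //; last by left.
exact: cadlag_cst.
Qed.

Lemma infconv_ge j x : - M <= infconv j x.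
Proof.
by apply: lb_le_inf; [have [] := infconv_values_has_inf j x|exact: infconv_values_lbound].
Qed.

Lemma infconv_le_near j x y (e : R) : cadlag y -> 0 <= e ->
  (forall t : R, 0 <= t <= j%:R -> `|y t - x t| <= e) -> infconv j x <= H y + j%:R * e.
Proof.
move=> cy e0 ye; apply: ge_inf; first by have [] := infconv_values_has_inf j x.
by exists y, e; split => //; right.
Qed.

Lemma infconv_le j x : infconv j x <= M + j%:R.
Proof.
apply: (@le_trans _ _ (H (fun=> 0) + j%:R * 1)).
  apply: ge_inf; first by have [] := infconv_values_has_inf j x.
  by exists (fun=> 0), 1; split => //; [exact: cadlag_cst|left].
by rewrite mulr1 lerD2r (le_trans (ler_norm _)).
Qed.

Lemma norm_infconv_le j x : `|infconv j x| <= M + j%:R.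
Proof.
by rewrite ler_norml infconv_le andbT (le_trans _ (infconv_ge j x))// lerN2 lerDl.
Qed.

Lemma infconv_lipschitz_half j x x' (e : R) : 0 <= e ->
  (forall t : R, 0 <= t <= j%:R -> `|x t - x' t| <= e) -> infconv j x' - j%:R * e <= infconv j x.
Proof.
move=> e0 xx'; apply: lb_le_inf; first by have [] := infconv_values_has_inf j x.
move=> v [y [d [cy d0 yd ->]]].
rewrite lerBlDr -addrA -mulrDr; apply: ge_inf; first by have [] := infconv_values_has_inf j x'.
exists y, (d + e); split => //; first exact: addr_ge0.
case: yd => [d_ge1|yd]; first by left; rewrite (le_trans d_ge1)// lerDl.
right => t tj; rewrite (le_trans (ler_distD (x t) _ _))// lerD//; [exact: yd|exact: xx'].
Qed.

Lemma infconv_lipschitz j x x' (e : R) : 0 <= e ->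
  (forall t : R, 0 <= t <= j%:R -> `|x t - x' t| <= e) -> `|infconv j x - infconv j x'| <= j%:R * e.
Proof.
move=> e0 xx'; rewrite ler_distl (infconv_lipschitz_half e0 xx')/=.
rewrite -lerBlDr; apply: infconv_lipschitz_half => // t tj.
by rewrite distrC; exact: xx'.
Qed.

Lemma infconv_le_at j x : cadlag x -> infconv j x <= H x.
Proof.
move=> cx; have := @infconv_le_near j x x 0 cx (lexx _).
by rewrite mulr0 addr0; apply => t _; rewrite subrr normr0.
Qed.

Lemma time_change_id : time_change (id : R -> R).
Proof.
split => //; split; first by apply: continuous_subspaceT => x; exact: cvg_id.
by split => // u u0; exists u.
Qed.

Lemma skorokhod_cvg_uniform (y : nat -> R -> R) x :
  (forall T e : R, 0 < T -> 0 < e ->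
     \forall n \near \oo, forall t, 0 <= t <= T -> `|y n t - x t| <= e) -> skorokhod_cvg y x.
Proof.
move=> yx T T0; exists (fun=> id); split; first by move=> _; exact: time_change_id.
move=> e e0; have := yx T e T0 e0; apply: filterS => n yxn t tT.
by rewrite subrr normr0 ltW//; split => //; exact: yxn.
Qed.

Lemma infconv_near_minimizer j x : cadlag x -> exists y, exists e : R, [/\ cadlag y,
  1 <= e \/ (forall t : R, 0 <= t <= j%:R -> `|y t - x t| <= e),
  H y <= infconv j x + j.+1%:R^-1 & j%:R * e <= 2 * M + 1].
Proof.
move=> cx; have j0 : 0 < j.+1%:R^-1 :> R by rewrite invr_gt0.
have [_ [y [e [cy e0 ye ->]]] /ltW value_le] := inf_adherent j0 (infconv_values_has_inf j x).
exists y, e; split => //; first by apply: le_trans value_le; rewrite lerDl mulr_ge0.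
have := infconv_le_at j cx; have := HM x; rewrite ler_norml => /andP[_ Hx].
have := HM y; rewrite ler_norml => /andP[Hy _].
have : j.+1%:R^-1 <= 1 :> R by rewrite invf_le1 ?ltr0n// ler1n.
by move: value_le; move: (j.+1%:R^-1) (j%:R * e) => q z; lra.
Qed.

Lemma near_minimizers_cvg (y : nat -> R -> R) (e : nat -> R) x :
  (forall n, 1 <= e n \/ (forall t : R, 0 <= t <= n%:R -> `|y n t - x t| <= e n)) ->
  (forall n, n%:R * e n <= 2 * M + 1) -> skorokhod_cvg y x.
Proof.
move=> near_x ne_le; apply: skorokhod_cvg_uniform => T d T0 d0; near=> n => t /andP[t0 tT].
have n0 : 0 < n%:R :> R by rewrite ltr0n; near: n; exact: nbhs_infty_gt.
have nd : 2 * M + 2 <= n%:R * d by rewrite -ler_pdivrMr//; near: n; exact: nbhs_infty_ger.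
have nM : 2 * M + 2 <= n%:R :> R by near: n; exact: nbhs_infty_ger.
have Tn : T <= n%:R by near: n; exact: nbhs_infty_ger.
have := ne_le n; case: (near_x n) => [e1|yx] ne.
  by exfalso; have : n%:R <= n%:R * e n; [rewrite ler_peMr// ltW|lra].
apply: (@le_trans _ _ (e n)); first by apply: yx; rewrite t0 (le_trans tT).
by rewrite -(ler_pM2l n0); lra.
Unshelve. all: by end_near. Qed.

Lemma infconv_cvg x : cadlag x -> infconv j x @[j --> \oo] --> H x.
Proof.
move=> cx; have [y y_min] := choice (fun j => infconv_near_minimizer j cx).
have [e ye_min] := choice y_min.
have cy n : cadlag (y n) by have [] := ye_min n.
have Hyx : H (y n) @[n --> \oo] --> H x.
  by apply: Hc => //; apply: (near_minimizers_cvg (e := e)) => n; have [] := ye_min n.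
apply: (@squeeze_cvgr _ _ _ _ (fun n => H (y n) - n.+1%:R^-1) (fun=> H x)).
- by apply: nearW => n; rewrite infconv_le_at// andbT lerBlDr; have [] := ye_min n.
- by rewrite -[X in _ --> X]subr0; apply: cvgB => //; exact: cvg_harmonic.
- exact: cvg_cst.
Qed.

End Regularization.

Section Grid.
Context {R : realType}.

Definition dyadic_floor (m : nat) (t : R) : R := (Num.truncn (2 ^+ m * t))%:R / 2 ^+ m.

Lemma dyadic_floor_ge0 m (t : R) : 0 <= dyadic_floor m t.
Proof. by rewrite divr_ge0// exprn_ge0. Qed.

Lemma dyadic_floor_itv m (t : R) : 0 <= t -> dyadic_floor m t <= t < dyadic_floor m t + 2 ^- m.
Proof.
move=> t0; have p0 : 0 < 2 ^+ m :> R by rewrite exprn_gt0.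
have := truncn_itv (mulr_ge0 (ltW p0) t0); rewrite /dyadic_floor => /andP[floor_le floor_gt].
rewrite ler_pdivrMr// (mulrC t) floor_le/=.
by rewrite -[X in _ + X]mul1r -mulrDl ltr_pdivlMr// natr1 (mulrC t).
Qed.

Definition dyadic_grid (j m : nat) : seq R := [seq k%:R / 2 ^+ m | k <- iota 0 (j * 2 ^ m).+1].

Lemma dyadic_grid_uniq j m : uniq (dyadic_grid j m).
Proof.
rewrite map_inj_uniq ?iota_uniq// => a b /mulIf a_eq_b.
by apply/eqP; rewrite -(eqr_nat R); apply/eqP/a_eq_b; rewrite invr_eq0 expf_neq0.
Qed.

Lemma dyadic_grid_ge0 j m (t : R) : t \in dyadic_grid j m -> 0 <= t.
Proof. by move=> /mapP[k _ ->]; rewrite divr_ge0// exprn_ge0. Qed.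

Lemma dyadic_floor_grid j m (t : R) : 0 <= t <= j%:R -> dyadic_floor m t \in dyadic_grid j m.
Proof.
move=> /andP[t0 tj]; apply/mapP; exists (Num.truncn (2 ^+ m * t)) => //.
rewrite mem_iota add0n leq0n/= ltnS -(ler_nat R) natrM natrX (mulrC j%:R).
have p0 : 0 < 2 ^+ m :> R by rewrite exprn_gt0.
have /andP[floor_le _] := truncn_itv (mulr_ge0 (ltW p0) t0).
by rewrite (le_trans floor_le)// ler_pM2l.
Qed.

Definition sampled (m : nat) (x : R -> R) : R -> R := fun t => x (dyadic_floor m t).

Lemma infconv_sampled_lipschitz (H : (R -> R) -> R) (M : R) (HM : forall x, `|H x| <= M) j m :
  coord_lipschitz j%:R (dyadic_grid j m) (fun x => infconv H j (sampled m x)).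
Proof.
move=> x y; apply: (infconv_lipschitz HM); first exact: sumr_ge0.
move=> t tj; rewrite /sampled (bigD1_seq (dyadic_floor m t)) ?dyadic_floor_grid
  ?dyadic_grid_uniq//=.
by rewrite lerDl sumr_ge0.
Qed.

Definition dyadic_uniform (x : R -> R) := forall (j : nat) (dl : R), 0 < dl ->
  exists m0 : nat, forall m, (m0 <= m)%N ->
  forall t, 0 <= t <= j%:R -> `|x t - x (dyadic_floor m t)| <= dl.

Lemma infconv_sampled_cvg (H : (R -> R) -> R) (M : R) (HM : forall x, `|H x| <= M) j x :
  dyadic_uniform x -> infconv H j (sampled m x) @[m --> \oo] --> infconv H j x.
Proof.
move=> ux; apply/cvgrPdist_le => e e0.
have [m0 x_near] := ux j _ (divr_gt0 e0 (ltr0Sn R j)); exists m0 => // m m0m.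
apply: (le_trans (infconv_lipschitz HM _ (x_near m m0m))); first exact/ltW/divr_gt0.
by rewrite mulrA ler_pdivrMr// mulrC ler_pM2l// ler_nat.
Qed.

End Grid.

Definition nonneg_times {R : realType} (s : seq (R * R)) := forall p, p \in s -> 0 <= p.1.

Definition measurable_process {R : realType} {d : measure_display} {T : measurableType d}
  (X : T -> R -> R) := forall t : R, 0 <= t -> measurable_fun setT (X ^~ t).

Section FunctionalsOfProcess.
Context {R : realType} {d : measure_display} {T : measurableType d}.
Variable Z : T -> R -> R.
Hypothesis mZ : measurable_process Z.

Local Notation trig_nonneg := (trigpoly (fun t : R => 0 <= t)).

Lemma measurable_linform s : nonneg_times s -> measurable_fun setT (fun w => linform s (Z w)).
Proof.
rewrite /linform; elim: s => [|p s IH] s0.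
  by under eq_fun do rewrite big_nil; exact: measurable_cst.
under eq_fun do rewrite big_cons.
apply: measurable_funD; last by apply: IH => q qs; apply: s0; rewrite inE qs orbT.
by apply: measurable_funM => //; apply: mZ; apply: s0; rewrite inE eqxx.
Qed.

Lemma bmfun_trigpoly f : trig_nonneg f -> bmfun (fun w => f (Z w)).
Proof.
elim => {f} [s b s0|f g _ bf _ bg|c f _ bf].
- by apply: bmfun_cos; apply: measurable_funD => //; exact: measurable_linform.
- exact: bmfunD.
- exact: bmfunZ.
Qed.

Lemma bmfun_coord_lipschitz (s : seq R) (L : (R -> R) -> R) (C M : R) : uniq s ->
  (forall t, t \in s -> 0 <= t) -> 0 <= C ->
  coord_lipschitz C s L -> (forall x, `|L x| <= M) -> bmfun (fun w => L (Z w)).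
Proof.
move=> us s0 C0 lipL LM; split; last by exists M => w.
have approx n := coord_lipschitz_trigpoly_approx us s0 C0 lipL LM (ltr0Sn R n)
  (eqbRL (invr_gt0 n.+1%:R) (ltr0Sn R n)).
have [F FP] := choice approx.
apply: (@measurable_fun_cvg _ _ _ setT (fun n w => F n (Z w))) => //.
  by move=> n; have [/bmfun_trigpoly[]] := FP n.
move=> w _; apply/cvgrPdist_le => e e0; near=> n.
have [_ _ LF] := FP n; apply: (@le_trans _ _ (n.+1%:R^-1)).
  apply: LF => t ts; apply: (@le_trans _ _ (\sum_(t <- s) `|Z w t|)).
    by rewrite (bigD1_seq t)//= lerDl sumr_ge0.
  apply: (@le_trans _ _ n%:R); first by near: n; exact: nbhs_infty_ger.
  by rewrite ler_nat.
by near: n; exact: near_infty_natSinv_le.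
Unshelve. all: by end_near. Qed.

Lemma dist_expect_approx (P : probability T R) (s : seq R) (L F : (R -> R) -> R) (M A e q : R) :
  (forall t, t \in s -> 0 <= t) -> bmfun (fun w => L (Z w)) -> bmfun (fun w => F (Z w)) ->
  (forall x, `|L x| <= M) -> (forall x, `|F x| <= M) -> 0 <= e ->
  (forall x, (forall t, t \in s -> `|x t| <= A) -> `|L x - F x| <= e) ->
  (forall t, t \in s -> prob P [set w | A < `|Z w t|] <= q) ->
  `|expect P (fun w => L (Z w)) - expect P (fun w => F (Z w))| <= e + 2 * M * ((size s)%:R * q).
Proof.
move=> s0 bL bF LM FM e0 LF tail_le.
have mA t : t \in s -> measurable [set w | A < `|Z w t|].
  by move=> ts; apply: measurable_norm_gt; apply: mZ; exact: s0.
pose I t : T -> R := if t \in s then \1_[set w | A < `|Z w t|] else fun=> 0.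
have bI t : bmfun (I t).
  by rewrite /I; case: ifPn => [ts|_]; [exact/bmfun_indic/mA|exact: bmfun_cst].
have M0 : 0 <= M by exact: le_trans (LM (fun=> 0)).
have I0 t w : 0 <= I t w by rewrite /I; case: ifP => // _; rewrite indicE.
rewrite -expectB// (le_trans (norm_expect_le _ (bmfunB bL bF)))//.
apply: (@le_trans _ _ (expect P (fun w => e + 2 * M * \sum_(t <- s) I t w))).
  apply: le_expect; first exact/bmfun_norm/bmfunB.
    by apply: bmfunD; [exact: bmfun_cst|apply/bmfunZ/bmfun_sum].
  move=> w; have [ZA|/existsNP[t /not_implyP[ts /negP]]] :=
      pselect (forall t, t \in s -> `|Z w t| <= A).
    by rewrite (le_trans (LF _ ZA))// lerDl mulr_ge0 ?mulr_ge0// sumr_ge0.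
  rewrite -ltNge => AZ.
  have : 1 <= \sum_(t <- s) I t w.
    by rewrite (big_rem t)//= {1}/I ts indicE mem_set//= lerDl sumr_ge0.
  move=> one_le; rewrite (le_trans (ler_normB _ _))// (le_trans (lerD (LM _) (FM _)))//.
  by nra.
rewrite expectD; [|exact: bmfun_cst|by apply/bmfunZ/bmfun_sum].
rewrite expect_cst expectZ ?expect_sum//; last exact: bmfun_sum.
rewrite lerD2l ler_wpM2l ?mulr_ge0//.
rewrite mulr_natl -iter_addr_0 -(count_predT s) -big_const_seq big_seq [leRHS]big_seq.
by apply: ler_sum => t ts; rewrite /I ts expect_indic; [exact: tail_le|exact: mA].
Qed.

End FunctionalsOfProcess.

Section UniformlyClose.
Context {R : realType} {d : measure_display} {T : measurableType d} (P : probability T R).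
Implicit Types (X Y Z : T -> R -> R).

Definition uniformly_close Y X (j : nat) (dl e : R) := exists A : set T,
  [/\ measurable A, prob P (~` A) <= e &
   forall w, A w -> forall t, 0 <= t <= j%:R -> `|Y w t - X w t| <= dl].

Lemma uniformly_close_trans X Y Z j (dl dl' e e' : R) :
  uniformly_close X Y j dl e -> uniformly_close Y Z j dl' e' ->
  uniformly_close X Z j (dl + dl') (e + e').
Proof.
move=> [A [mA PA XY]] [B [mB PB YZ]]; exists (A `&` B); split; first exact: measurableI.
  by rewrite setCI (le_trans (prob_setU_le _ _ _))//; [exact: measurableC..|exact: lerD].
move=> w [Aw Bw] t tj; rewrite (le_trans (ler_distD (Y w t) _ _))// lerD//; first exact: XY.
exact: YZ.
Qed.

(* [g] is [f] on [A] and the lower bound [- M] of [h] elsewhere. *)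
Lemma exists_minorant_off_event (f h : T -> R) (A : set T) (M b q : R) : measurable A ->
  bmfun f -> (forall w, - M <= h w) -> (forall w, f w <= b) -> 0 <= M + b ->
  (forall w, A w -> f w <= h w) -> prob P (~` A) <= q ->
  exists g, [/\ bmfun g, forall w, g w <= h w & expect P f - (M + b) * q <= expect P g].
Proof.
move=> mA bf Mh fb Mb fh PA; have mCA : measurable (~` A) by exact: measurableC.
have bC : bmfun (\1_(~` A) : T -> R) by exact: bmfun_indic.
have bfM : bmfun (fun w => f w + M) by apply: bmfunD => //; exact: bmfun_cst.
exists (fun w => f w - (f w + M) * \1_(~` A) w); split.
- by apply: bmfunB => //; exact: bmfunM.
- move=> w; rewrite indicE; have [Aw|nAw] := pselect (A w).
    by rewrite memNset ?mulr0 ?subr0; [exact: fh|move/(_ Aw)].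
  by rewrite mem_set//= mulr1 opprD addrA subrr sub0r.
apply: (@le_trans _ _ (expect P (fun w => f w - (M + b) * \1_(~` A) w))).
  rewrite expectB//; last exact: bmfunZ.
  by rewrite expectZ// expect_indic// lerD2l lerN2 ler_wpM2l.
apply: le_expect; [by apply: bmfunB => //; exact: bmfunZ|by apply: bmfunB => //; exact: bmfunM|].
by move=> w; rewrite lerD2l lerN2 ler_wpM2r// ?indicE// addrC lerD2l.
Qed.

End UniformlyClose.

Section Criterion.
Context {R : realType} {d : measure_display} {T : measurableType d} (P : probability T R).
Context {d' : measure_display} {T' : measurableType d'} (P' : probability T' R).
Variables (X Y : nat -> T -> R -> R) (G : T' -> R -> R).
Hypothesis mX : forall n, measurable_process (X n).
Hypothesis mG : measurable_process G.
Hypothesis X_char : forall s b, nonneg_times s ->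
  expect P (fun w => cos (linform s (X n w) + b)) @[n --> \oo] -->
  expect P' (fun w => cos (linform s (G w) + b)).
Hypothesis X_tight : forall t e : R, 0 <= t -> 0 < e -> exists A : R, 0 < A /\
  \forall n \near \oo, prob P [set w | A < `|X n w t|] <= e.

Lemma expect_trigpoly_cvg f : trigpoly (fun t => 0 <= t) f ->
  expect P (fun w => f (X n w)) @[n --> \oo] --> expect P' (fun w => f (G w)).
Proof.
elim => {f} [s b s0|f g tf cf tg cg|c f tf cf]; first exact: X_char.
- rewrite expectD; [|exact: bmfun_trigpoly..].
  under eq_fun do rewrite (expectD _ (bmfun_trigpoly (mX _) tf) (bmfun_trigpoly (mX _) tg)).
  exact: cvgD.
- rewrite expectZ; last exact: bmfun_trigpoly.
  by under eq_fun do rewrite (expectZ _ _ (bmfun_trigpoly (mX _) tf)); exact: cvgMl_tmp.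
Qed.

Lemma exists_common_tail_bound (s : seq R) (q : R) : (forall t, t \in s -> 0 <= t) -> 0 < q ->
  exists A : R, [/\ 0 < A,
    (\forall n \near \oo, forall t, t \in s -> prob P [set w | A < `|X n w t|] <= q) &
    forall t, t \in s -> prob P' [set w | A < `|G w t|] <= q].
Proof.
move=> s0 q0; elim: s s0 => [|t s IH] s0; first by exists 1; split => //; exact: nearW.
have t0 : 0 <= t by apply: s0; rewrite inE eqxx.
have s'0 u : u \in s -> 0 <= u by move=> us; apply: s0; rewrite inE us orbT.
have [A [A0 AX AG]] := IH s'0.
have [B [B0 BX]] := X_tight t0 q0; have [D [D0 DG]] := exists_tail_prob_le P' (mG t0) q0.
have le_tail (d0 : measure_display) (T0 : measurableType d0) (Q : probability T0 R)
    (f : T0 -> R) (a : R) : measurable_fun setT f -> prob Q [set w | a < `|f w|] <= q ->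
    a <= A + B + D -> prob Q [set w | A + B + D < `|f w|] <= q.
  by move=> mf aq aABD; exact: le_trans (prob_norm_gt_anti _ mf aABD) aq.
exists (A + B + D); split; first by rewrite !addr_gt0.
- near=> n => u; rewrite inE => /orP[/eqP ->|us].
    by apply: (le_tail _ _ _ _ B); [exact: mX|near: n|lra].
  apply: (le_tail _ _ _ _ A); [exact/mX/s'0| |lra].
  by move: u us; near: n.
- move=> u; rewrite inE => /orP[/eqP ->|us]; first by apply: (le_tail _ _ _ _ D) => //;
    [exact: mG|lra].
  by apply: (le_tail _ _ _ _ A); [exact/mG/s'0|exact: AG|lra].
Unshelve. all: by end_near. Qed.

Lemma expect_coord_lipschitz_cvg (s : seq R) (L : (R -> R) -> R) (C M : R) :
  uniq s -> (forall t, t \in s -> 0 <= t) -> 0 <= C -> coord_lipschitz C s L ->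
  (forall x, `|L x| <= M) ->
  expect P (fun w => L (X n w)) @[n --> \oo] --> expect P' (fun w => L (G w)).
Proof.
move=> us s0 C0 lipL LM; have M0 : 0 <= M by exact: le_trans (LM (fun=> 0)).
have bLX n := bmfun_coord_lipschitz (mX n) us s0 C0 lipL LM.
have bLG := bmfun_coord_lipschitz mG us s0 C0 lipL LM.
apply/cvgrPdist_le => e e0; have e4 : 0 < e / 4 by rewrite divr_gt0.
pose D := 2 * M * (size s)%:R + 1.
have D0 : 0 < D by rewrite ltr_wpDl// !mulr_ge0.
pose q := e / 8 / D; have q0 : 0 < q by rewrite divr_gt0 ?divr_gt0.
have qM : 2 * M * ((size s)%:R * q) <= e / 8.
  by rewrite mulrA /q mulrA ler_pdivrMr// mulrC ler_pM2l ?divr_gt0// lerDl.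
have [A [A0 AX AG]] := exists_common_tail_bound s0 q0.
have e8 : 0 < e / 8 by rewrite divr_gt0.
have [F [tF FM LF]] := coord_lipschitz_trigpoly_approx us s0 C0 lipL LM A0 e8.
have dist_G := dist_expect_approx mG s0 bLG (bmfun_trigpoly mG tF) LM FM (ltW e8) LF AG.
have /cvgrPdist_le/(_ _ e4) F_cvg := expect_trigpoly_cvg tF.
near=> n; have AXn : forall t, t \in s -> prob P [set w | A < `|X n w t|] <= q by near: n.
have dist_X := dist_expect_approx (mX n) s0 (bLX n) (bmfun_trigpoly (mX n) tF) LM FM
  (ltW e8) LF AXn.
have dist_F : `|expect P' (fun w => F (G w)) - expect P (fun w => F (X n w))| <= e / 4 by near: n.
apply: (le_trans (ler_distD (expect P' (fun w => F (G w))) _ _)).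
rewrite distrC in dist_X; have := ler_distD (expect P (fun w => F (X n w)))
  (expect P' (fun w => F (G w))) (expect P (fun w => L (X n w))).
move: dist_G dist_X dist_F qM; move: `|_| `|_| `|_| `|_| => a b c r; lra.
Unshelve. all: by end_near. Qed.

Hypothesis Y_cadlag : forall n, {ae P, forall w, cadlag (Y n w)}.
Hypothesis Y_near_X : forall (j : nat) (dl e : R), 0 < dl -> 0 < e -> exists m0 : nat,
  forall m, (m0 <= m)%N ->
  \forall n \near \oo, uniformly_close P (Y n) (fun w => sampled m (X n w)) j dl e.
Hypothesis G_cadlag : forall w, cadlag (G w).
Hypothesis G_uniform : forall w, dyadic_uniform (G w).

Section OneFunctional.
Variables (H : (R -> R) -> R) (M : R).
Hypothesis HM : forall x, `|H x| <= M.
Hypothesis Hc : skorokhod_continuous H.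

Let infconv_grid j m x := infconv H j (sampled m x).

Let bmfun_infconv_grid {d0 : measure_display} {T0 : measurableType d0} (Z : T0 -> R -> R) j m :
  measurable_process Z -> bmfun (fun w => infconv_grid j m (Z w)).
Proof.
move=> mZ; apply: (bmfun_coord_lipschitz (C := j%:R) (M := M + j%:R) mZ (dyadic_grid_uniq j m))
  => //.
- by move=> t; exact: dyadic_grid_ge0.
- exact: (infconv_sampled_lipschitz HM).
- by move=> x; exact: (norm_infconv_le HM).
Qed.

Let bmfun_infconv j : bmfun (fun w => infconv H j (G w)).
Proof.
split; last by exists (M + j%:R) => w; exact: (norm_infconv_le HM).
apply: (@measurable_fun_cvg _ _ _ setT (fun m w => infconv_grid j m (G w))) => //.
  by move=> m; have [] := bmfun_infconv_grid j m mG.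
by move=> w _; exact: (infconv_sampled_cvg HM).
Qed.

Lemma bmfun_skorokhod_continuous : bmfun (fun w => H (G w)).
Proof.
split; last by exists M.
apply: (@measurable_fun_cvg _ _ _ setT (fun j w => infconv H j (G w))) => //.
  by move=> j; have [] := bmfun_infconv j.
by move=> w _; exact: (infconv_cvg HM Hc).
Qed.

Let exists_infconv_grid_close (e : R) : 0 < e -> exists j m1, forall m, (m1 <= m)%N ->
  expect P' (fun w => H (G w)) - e <= expect P' (fun w => infconv_grid j m (G w)).
Proof.
move=> e0; have e2 : 0 < e / 2 by rewrite divr_gt0.
have : expect P' (fun w => infconv H j (G w)) @[j --> \oo] --> expect P' (fun w => H (G w)).
  apply: (@expect_dominated_cvg _ _ _ _ _ _ M).
  - by move=> j; have [] := bmfun_infconv j.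
  - by have [] := bmfun_skorokhod_continuous.
  - move=> j w; rewrite ler_norml (infconv_ge HM)/= (le_trans (infconv_le_at HM _ (G_cadlag w)))//.
    by rewrite (le_trans (ler_norm _)).
  - by apply/aeW => w; exact: (infconv_cvg HM Hc).
move=> /cvgrPdist_le/(_ _ e2)[j _ /(_ j (leqnn j))]; rewrite /= ler_norml => /andP[_ H_close].
have : expect P' (fun w => infconv_grid j m (G w)) @[m --> \oo] -->
    expect P' (fun w => infconv H j (G w)).
  apply: (@expect_dominated_cvg _ _ _ _ _ _ (M + j%:R)).
  - by move=> m; have [] := bmfun_infconv_grid j m mG.
  - by have [] := bmfun_infconv j.
  - by move=> m w; exact: (norm_infconv_le HM).
  - by apply/aeW => w; exact: (infconv_sampled_cvg HM).
move=> /cvgrPdist_le/(_ _ e2)[m1 _ grid_close]; exists j, m1 => m /grid_close.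
by rewrite /= ler_norml => /andP[_ ?]; lra.
Qed.

Let exists_minorant n j m (dl e : R) : 0 <= dl ->
  uniformly_close P (Y n) (fun w => sampled m (X n w)) j dl e ->
  exists g : T -> R, [/\ bmfun g, forall w, g w <= H (Y n w) &
    expect P (fun w => infconv_grid j m (X n w)) - j%:R * dl - (2 * M + j%:R) * e <= expect P g].
Proof.
move=> dl0 [A [mA PA Y_close]]; have [B [mB PB nB_cadlag]] := Y_cadlag n.
have M0 : 0 <= M by exact: le_trans (HM (fun=> 0)).
have bX := bmfun_infconv_grid j m (mX n).
have := @exists_minorant_off_event _ _ _ P (fun w => infconv_grid j m (X n w) - j%:R * dl)
  (fun w => H (Y n w)) (A `\` B) M (M + j%:R) e.
rewrite expectB//; last exact: bmfun_cst.
have -> : M + (M + j%:R) = 2 * M + j%:R by ring.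
rewrite expect_cst; apply.
- exact: measurableD.
- by apply: bmfunB => //; exact: bmfun_cst.
- by move=> w; have := HM (Y n w); rewrite ler_norml => /andP[].
- by move=> w; rewrite lerBlDr ler_wpDr ?mulr_ge0//; exact: (infconv_le HM).
- by rewrite addr_ge0// mulr_ge0.
- move=> w [Aw nBw]; rewrite lerBlDr; apply: (infconv_le_near HM) => //.
    by apply: contrapT => nY; exact: (nBw (nB_cadlag _ nY)).
  exact: Y_close.
- rewrite setDE setCI setCK (le_trans (prob_setU_le _ _ _))//; first exact: measurableC.
  by rewrite {2}/prob PB addr0.
Qed.

Lemma near_exists_minorant (e : R) : 0 < e -> \forall n \near \oo, exists g : T -> R,
  [/\ bmfun g, forall w, g w <= H (Y n w) & expect P' (fun w => H (G w)) - e <= expect P g].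
Proof.
move=> e0; have e4 : 0 < e / 4 by rewrite divr_gt0.
have M0 : 0 <= M by exact: le_trans (HM (fun=> 0)).
have [j [m1 grid_close]] := exists_infconv_grid_close e4.
pose D : R := 2 * M + j%:R + 1; have D0 : 0 < D by rewrite ltr_wpDl// addr_ge0// mulr_ge0.
pose dl := e / 4 / D; have dl0 : 0 < dl by rewrite divr_gt0.
have D_dl (a : R) : a <= D -> a * dl <= e / 4.
  by move=> aD; rewrite /dl mulrA ler_pdivrMr// mulrC ler_pM2l.
have [m0 Y_near] := Y_near_X j dl0 dl0.
have Y_close := Y_near (maxn m0 m1) (leq_maxl _ _); have := grid_close (maxn m0 m1) (leq_maxr _ _).
move: (maxn m0 m1) Y_close => m Y_close G_le.
have : expect P (fun w => infconv_grid j m (X n w)) @[n --> \oo] -->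
    expect P' (fun w => infconv_grid j m (G w)).
  apply: (expect_coord_lipschitz_cvg (dyadic_grid_uniq j m) _ (ler0n R j)
    (infconv_sampled_lipschitz HM j m) (M := M + j%:R)).
    by move=> t; exact: dyadic_grid_ge0.
  by move=> x; exact: (norm_infconv_le HM).
move=> /cvgrPdist_le/(_ _ e4) X_cvg; near=> n.
have [|g [bg g_le g_ge]] := @exists_minorant n j m dl dl (ltW dl0); first by near: n.
exists g; split => //; apply: le_trans g_ge.
have : `|expect P' (fun w => infconv_grid j m (G w)) -
    expect P (fun w => infconv_grid j m (X n w))| <= e / 4 by near: n.
rewrite ler_norml => /andP[_ ?].
have : j%:R * dl <= e / 4 by apply: D_dl; rewrite /D; lra.
have : (2 * M + j%:R) * dl <= e / 4 by apply: D_dl; rewrite /D; lra.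
by lra.
Unshelve. all: by end_near. Qed.

End OneFunctional.

Lemma near_integral_between H (M e : R) : (forall x, `|H x| <= M) -> skorokhod_continuous H ->
  0 < e -> \forall n \near \oo,
  ((expect P' (fun w => H (G w)) - e)%:E <= \int[P]_w (H (Y n w))%:E)%E /\
  ((\int[P]_w (H (Y n w))%:E) <= (expect P' (fun w => H (G w)) + e)%:E)%E.
Proof.
move=> HM Hc e0; have NHM x : `|- H x| <= M by rewrite normrN.
have NHc : skorokhod_continuous (fun x => - H x).
  by move=> x y cx cy xy; apply: cvgN; exact: Hc.
near=> n.
have [g [bg gH g_ge]] : exists g : T -> R, [/\ bmfun g, forall w, g w <= H (Y n w) &
    expect P' (fun w => H (G w)) - e <= expect P g].
  by near: n; exact: (near_exists_minorant HM Hc).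
have [h [bh hH h_ge]] : exists h : T -> R, [/\ bmfun h, forall w, h w <= - H (Y n w) &
    expect P' (fun w => - H (G w)) - e <= expect P h].
  by near: n; exact: (near_exists_minorant NHM NHc).
have Hh w : H (Y n w) <= - h w by rewrite lerNr; exact: hH.
have [int_ge int_le] := integral_between_expect P bg (bmfunN bh) gH Hh.
rewrite expectN// in h_ge; last exact: bmfun_skorokhod_continuous HM Hc.
split; first by apply: le_trans int_ge; rewrite lee_fin.
by apply: le_trans int_le _; rewrite expectN// lee_fin; lra.
Unshelve. all: by end_near. Qed.

Theorem cvg_law_criterion : cvg_law_skorokhod \oo P Y P' G.
Proof.
move=> H [M HM] Hc; rewrite integral_expect; last exact: bmfun_skorokhod_continuous HM Hc.
apply: cvg_EFin.
  have := near_integral_between HM Hc ltr01; apply: filterS => n [int_ge int_le].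
  by rewrite fin_numE -ltNye -ltey (lt_le_trans (ltNyr _) int_ge) (le_lt_trans int_le (ltry _)).
apply/cvgrPdist_le => e e0; have := near_integral_between HM Hc e0; apply: filterS => n [].
rewrite /=; case: (integral P setT _) => [r| |] //=.
by rewrite !lee_fin => int_ge int_le; rewrite ler_norml; apply/andP; split; lra.
Qed.

End Criterion.

(** * Functionals of bounded measurable functions *)

Lemma dist_sum_thresholds (R : realType) (N : nat) (v : R) : 0 <= v <= N%:R ->
  `|v - \sum_(i < N) ((i.+1%:R <= v)%R%:R : R)| <= 1.
Proof.
elim: N v => [|N IH] v /andP[v0 vN].
  by rewrite big_ord0 subr0 (_ : v = 0) ?normr0//; apply/eqP; rewrite eq_le vN v0.
rewrite big_ord_recr/=; have [Nv|vN'] := leP N.+1%:R v.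
  have -> : v = N.+1%:R by apply/eqP; rewrite eq_le vN Nv.
  rewrite (eq_bigr (fun=> 1)); last by move=> i _; rewrite ler_nat ltnS ltnW.
  by rewrite sumr_const card_ord natr1 subrr normr0.
rewrite addr0; have [v_le|v_gt] := leP v N%:R; first by apply: IH; rewrite v0.
rewrite (eq_bigr (fun=> 1)); last first.
  by move=> i _; rewrite (@le_trans _ _ N%:R) ?ler_nat// ltW.
rewrite sumr_const card_ord -natr1 in vN' *.
by rewrite ger0_norm; lra.
Qed.

Section BoundedFunctional.
Context {R : realType} {d : measure_display} {T : measurableType d}.
Implicit Types (F : (T -> R) -> R) (f g : T -> R).

Definition bounded_linear_functional F :=
  [/\ forall f g, bmfun f -> bmfun g -> F (fun w => f w + g w) = F f + F g,
      forall c f, bmfun f -> F (fun w => c * f w) = c * F f &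
      exists K : R, forall f (M : R), bmfun f -> (forall w, `|f w| <= M) -> `|F f| <= K * M].

Definition step_approx (N : nat) g w : R :=
  N%:R^-1 * \sum_(i < N) \1_[set x | i.+1%:R <= N%:R * g x] w.

Lemma measurable_step N g (a : R) : bmfun g -> measurable [set x | a <= N%:R * g x].
Proof.
move=> bg; have -> : [set x | a <= N%:R * g x] = (fun x => N%:R * g x) @^-1` `[a, +oo[.
  by apply/seteqP; split => x /=; rewrite in_itv/= andbT.
by apply: measurable_preimage => //; exact: (bmfunZ N%:R bg).1.
Qed.

Lemma bmfun_step_approx N g : bmfun g -> bmfun (step_approx N g).
Proof. by move=> bg; apply/bmfunZ/bmfun_sum => i; exact/bmfun_indic/measurable_step. Qed.

Lemma dist_step_approx_le N g w : (0 < N)%N -> 0 <= g w <= 1 ->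
  `|g w - step_approx N g w| <= N%:R^-1.
Proof.
move=> N0 /andP[g0 g1]; have NR0 : 0 < N%:R :> R by rewrite ltr0n.
have -> : g w - step_approx N g w =
    N%:R^-1 * (N%:R * g w - \sum_(i < N) ((i.+1%:R <= N%:R * g w)%R%:R : R)).
  rewrite mulrBr mulKf ?gt_eqF//; congr (_ - _ * _).
  by apply: eq_bigr => i _; rewrite indicE -[w \in _]/(`[< _ >]) asboolb.
rewrite normrM ger0_norm ?invr_ge0// -[leRHS]mulr1 ler_wpM2l ?invr_ge0//.
by apply: dist_sum_thresholds; rewrite mulr_ge0//= -[leRHS]mulr1 ler_wpM2l.
Qed.

Section EqZero.
Variable F : (T -> R) -> R.
Hypotheses (linF : bounded_linear_functional F)
  (F_indic : forall B, measurable B -> F (\1_B) = 0).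

Lemma functional_step_approx_eq0 N g : bmfun g -> F (step_approx N g) = 0.
Proof.
move=> bg; have [FD FZ _] := linF.
have bI i : bmfun (\1_[set x | i.+1%:R <= N%:R * g x] : T -> R).
  exact/bmfun_indic/measurable_step.
rewrite FZ; last by apply: bmfun_sum => i.
suff sum_eq0 n : F (fun w => \sum_(i < n) \1_[set x | i.+1%:R <= N%:R * g x] w) = 0.
  by rewrite sum_eq0 mulr0.
elim: n => [|n IH].
  under eq_fun do rewrite big_ord0 -(mul0r 1).
  by rewrite (FZ 0 (fun=> 1) (bmfun_cst 1)) mul0r.
under eq_fun do rewrite big_ord_recr.
by rewrite FD ?IH ?add0r ?F_indic//; [exact: measurable_step|exact: bmfun_sum].
Qed.

Lemma functional01_eq0 g : bmfun g -> (forall w, 0 <= g w <= 1) -> F g = 0.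
Proof.
move=> bg g01; have [FD FZ [K FK]] := linF.
have K_cvg : K * n.+1%:R^-1 @[n --> \oo] --> (0 : R).
  by rewrite -(mulr0 K); apply: cvgMl_tmp; exact: cvg_harmonic.
apply/eqP; rewrite -normr_le0 -(cvg_lim (@Rhausdorff R) K_cvg).
apply: limr_ge; [exact: cvgP K_cvg|apply: nearW => n].
have bN := bmfun_step_approx n.+1 bg.
have -> : F g = F (fun w => g w + (-1) * step_approx n.+1 g w).
  by rewrite (FD g _ bg (bmfunZ (-1) bN)) (FZ (-1) _ bN) functional_step_approx_eq0// mulr0 addr0.
apply: FK; first by apply: bmfunD => //; exact: bmfunZ.
by move=> w; rewrite mulN1r; exact: dist_step_approx_le.
Qed.

Lemma bounded_functional_eq0 g : bmfun g -> F g = 0.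
Proof.
move=> bg; have [FD FZ _] := linF; have [_ [M gM]] := bg.
have M0 : 0 <= M by exact: le_trans (gM point).
have b1 := @bmfun_cst R d T 1.
pose u w := (2 * (M + 1))^-1 * (g w + (M + 1) * 1).
have bu : bmfun u by apply/bmfunZ/bmfunD => //; exact: bmfunZ.
have u0 : F u = 0.
  apply: functional01_eq0 => // w; rewrite /u mulrC.
  have := gM w; rewrite ler_norml => /andP[? ?].
  by rewrite ler_pdivlMr ?ler_pdivrMr ?mul0r ?mul1r; first (apply/andP; split); lra.
have -> : g = (fun w => 2 * (M + 1) * u w + - (M + 1) * 1).
  by apply/funext => w; rewrite /u; field; rewrite gt_eqF//; lra.
rewrite FD; [|exact: bmfunZ|exact: bmfunZ].
by rewrite FZ// u0 FZ// functional01_eq0 ?mulr0 ?addr0// => w; rewrite ler01 lexx.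
Qed.

End EqZero.
End BoundedFunctional.

Lemma cvg_indic_nondecreasing {R : realType} {T : Type} (A : (set T)^nat) (x : T) :
  nondecreasing_seq A -> \1_(A n) x @[n --> \oo] --> (\1_(\bigcup_i A i) x : R).
Proof.
move=> ndA; have [[n _ Anx]|nAx] := pselect ((\bigcup_i A i) x).
  apply: cvg_near_cst; exists n => // k /= nk; rewrite !indicE !mem_set//; first by exists n.
  by have /subsetPset := ndA _ _ nk; exact.
by apply: cvg_near_cst; apply: nearW => k; rewrite !indicE !memNset// => Akx; apply: nAx; exists k.
Qed.

Section DominatedFunctional.
Context {R : realType}.
Implicit Types (F G : (R -> R) -> R).

Lemma bmfun_comp {d : measure_display} {T : measurableType d} (g : R -> R) (V : T -> R) :
  bmfun g -> measurable_fun setT V -> bmfun (fun w => g (V w)).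
Proof.
move=> [mg [M gM]] mV; split; first exact: measurableT_comp mg mV.
by exists M.
Qed.

Definition dominated_functional F := bounded_linear_functional F /\
  forall (f_ : nat -> R -> R) (f : R -> R) (M : R), (forall n, measurable_fun setT (f_ n)) ->
    measurable_fun setT f -> (forall n x, `|f_ n x| <= M) ->
    (forall x, f_ n x @[n --> \oo] --> f x) -> F (f_ n) @[n --> \oo] --> F f.

Lemma dominated_functionalD F G :
  dominated_functional F -> dominated_functional G -> dominated_functional (fun f => F f + G f).
Proof.
move=> [[FD FZ [K FK]] F_cvg] [[GD GZ [L GL]] G_cvg]; split; first split.
- by move=> f g bf bg; rewrite FD// GD//; ring.
- by move=> c f bf; rewrite FZ// GZ//; ring.
- exists (K + L) => f M bf fM; rewrite mulrDl (le_trans (ler_normD _ _))// lerD//; first exact: FK.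
  exact: GL.
- by move=> f_ f M mf_ mf fM f_f; apply: cvgD; [exact: (F_cvg f_ f M)|exact: (G_cvg f_ f M)].
Qed.

Lemma dominated_functionalZ c F :
  dominated_functional F -> dominated_functional (fun f => c * F f).
Proof.
move=> [[FD FZ [K FK]] F_cvg]; split; first split.
- by move=> f g bf bg; rewrite FD//; ring.
- by move=> a f bf; rewrite FZ//; ring.
- by exists (`|c| * K) => f M bf fM; rewrite normrM -mulrA ler_wpM2l//; exact: FK.
- by move=> f_ f M mf_ mf fM f_f; apply: cvgMl_tmp; exact: (F_cvg f_ f M).
Qed.

Lemma dominated_functionalB F G :
  dominated_functional F -> dominated_functional G -> dominated_functional (fun f => F f - G f).
Proof.
move=> domF domG; have -> : (fun f => F f - G f) = (fun f => F f + (-1) * G f).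
  by apply/funext => f; rewrite mulN1r.
by apply: dominated_functionalD => //; exact: dominated_functionalZ.
Qed.

Lemma dominated_functional_expectM {d : measure_display} {T : measurableType d}
    (P : probability T R) (W Y : T -> R) : bmfun W -> measurable_fun setT Y ->
  dominated_functional (fun f => expect P (fun w => W w * f (Y w))).
Proof.
move=> bW mY; have [mW [M WM]] := bW; split; first split.
- move=> f g bf bg; under eq_fun do rewrite mulrDr.
  by rewrite (expectD P (bmfunM bW (bmfun_comp bf mY)) (bmfunM bW (bmfun_comp bg mY))).
- move=> c f bf; under eq_fun do rewrite mulrCA.
  by rewrite (expectZ P c (bmfunM bW (bmfun_comp bf mY))).
- exists M => f K bf fK; apply: norm_expect_bound.
    by apply: bmfunM => //; exact: bmfun_comp.
  by move=> w; rewrite normrM ler_pM.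
- move=> f_ f K mf_ mf fK f_f; apply: (@expect_dominated_cvg _ _ _ _ _ _ (M * K)).
  + by move=> n; apply: measurable_funM => //; exact: (measurableT_comp (mf_ n) mY).
  + by apply: measurable_funM => //; exact: (measurableT_comp mf mY).
  + by move=> n w; rewrite normrM ler_pM.
  + by apply/aeW => w; apply: cvgMl_tmp; exact: f_f.
Qed.

Lemma dominated_functional_expect {d : measure_display} {T : measurableType d}
    (P : probability T R) (Y : T -> R) : measurable_fun setT Y ->
  dominated_functional (fun f => expect P (fun w => f (Y w))).
Proof.
move=> mY; have := @dominated_functional_expectM _ _ P (fun=> 1) Y (bmfun_cst 1) mY.
by congr dominated_functional; apply/funext => f; congr expect; apply/funext => w; exact: mul1r.
Qed.

Lemma dominated_functional_eq0_rays F : dominated_functional F -> F (fun=> 1) = 0 ->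
  (forall a : R, F (\1_(`]a, +oo[%classic)) = 0) -> forall f, bmfun f -> F f = 0.
Proof.
move=> [linF F_cvg] F1 F_ray; apply: bounded_functional_eq0 => //.
have [FD FZ _] := linF.
have bI (A : set R) : measurable A -> bmfun (\1_A : R -> R) by exact: bmfun_indic.
pose H := [set A : set R | measurable A /\ F (\1_A) = 0].
suff GH : <<s (@RGenOInfty.G R) >> `<=` H.
  by move=> B mB; have [] : H B by apply: GH; rewrite -[X in X B]RGenOInfty.measurableE.
apply: lambda_system_subset => //.
- move=> B C [x ->] [y ->]; exists (Order.max x y).
  apply/seteqP; split => u /=; rewrite !in_itv/= !andbT gt_max; first by move=> [-> ->].
  by move=> /andP[].
- split => //.
  + by split => //; rewrite -F1; congr F; apply/funext => x; rewrite indicE in_setT.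
  + move=> A B BA [mA FA] [mB FB]; split; first exact: measurableD.
    have -> : (\1_(A `\` B) : R -> R) = (fun x => \1_A x + (-1) * \1_B x).
      apply/funext => x; rewrite !indicE in_setD mulN1r.
      have [Bx|nBx] := boolP (x \in B); last by rewrite andbT subr0.
      by rewrite andbF (_ : x \in A) ?subrr// inE; apply: BA; exact/set_mem.
    by rewrite FD ?FZ ?FA ?FB ?mulr0 ?addr0//; [exact: bI|exact: bI|exact/bmfunZ/bI].
  + move=> A ndA HA; have mA n : measurable (A n) by have [] := HA n.
    have mU : measurable (\bigcup_i A i) by exact: bigcupT_measurable.
    split => //; have : F (\1_(A n)) @[n --> \oo] --> F (\1_(\bigcup_i A i)).
      apply: (F_cvg _ _ 1); [by move=> n; exact: (bI _ (mA n)).1|exact: (bI _ mU).1| |].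
        by move=> n x; rewrite indicE; case: (x \in _); rewrite ?normr1 ?normr0.
      by move=> x; exact: cvg_indic_nondecreasing.
    under eq_fun do rewrite (HA _).2.
    by move=> F_bigcup; apply/esym; apply: (cvg_unique _ (cvg_cst _) F_bigcup).
- by move=> A [x ->]; split => //; exact: F_ray.
Qed.

Definition ramp (a : R) (k : nat) (x : R) := minr (maxr (k%:R * (x - a)) 0) 1.

Lemma ramp01 a k x : 0 <= ramp a k x <= 1.
Proof. by rewrite /ramp ge_min lexx orbT andbT le_min le_max lexx orbT ler01. Qed.

Lemma measurable_ramp a k : measurable_fun setT (ramp a k).
Proof.
apply: measurable_minr => //; apply: measurable_maxr => //.
by apply: measurable_funM => //; exact: measurable_funB.
Qed.

Lemma ramp_cvg a x : ramp a k x @[k --> \oo] --> (\1_(`]a, +oo[%classic) x : R).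
Proof.
rewrite indicE; have [xa|ax] := leP x a.
  rewrite memNset; last by rewrite /= in_itv/= andbT ltNge xa.
  have -> : ramp a ^~ x = fun=> 0.
    apply/funext => k; rewrite /ramp max_r ?min_l//.
    by rewrite mulr_ge0_le0// subr_le0.
  exact: cvg_cst.
rewrite mem_set; last by rewrite /= in_itv/= andbT.
apply/cvgrPdist_le => e e0; near=> k.
have ramp_ge1 : 1 <= k%:R * (x - a).
  by rewrite -ler_pdivrMr ?subr_gt0//; near: k; exact: nbhs_infty_ger.
rewrite /ramp min_r; last by rewrite le_max ramp_ge1.
by rewrite subrr normr0 ltW.
Unshelve. all: by end_near. Qed.

Definition lipschitz_by (C : R) (f : R -> R) := forall x y, `|f x - f y| <= C * `|x - y|.

Lemma lipschitz_by_ramp a k : lipschitz_by k%:R (ramp a k).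
Proof.
move=> x y; have -> : k%:R * `|x - y| = `|k%:R * (x - a) - k%:R * (y - a)|.
  by rewrite -mulrBr normrM (ger0_norm (ler0n R k)); congr (_ * `|_|); ring.
rewrite /ramp; move: (k%:R * (x - a)) (k%:R * (y - a)) => u v.
wlog uv : u v / v <= u => [H|].
  by have [/H//|/ltW /H] := leP v u; rewrite distrC [leRHS]distrC.
rewrite [X in _ <= X]ger0_norm ?subr_ge0// /Order.max /Order.min.
by repeat case: ifPn; rewrite -?leNgt => *; rewrite ler_norml; apply/andP; split; lra.
Qed.

Lemma dominated_functional_eq0_lipschitz F : dominated_functional F ->
  (forall (f : R -> R) (C M : R), 0 <= C -> lipschitz_by C f ->
    (forall x, `|f x| <= M) -> F f = 0) ->
  forall f, bmfun f -> F f = 0.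
Proof.
move=> domF F_lip; apply: dominated_functional_eq0_rays => //.
  by apply: (F_lip _ 0 1) => //; [move=> x y; rewrite subrr normr0 mul0r|move=> x; rewrite normr1].
have ramp_le1 a k x : `|ramp a k x| <= 1.
  by have /andP[r0 r1] := ramp01 a k x; rewrite ger0_norm.
move=> a; have : F (ramp a k) @[k --> \oo] --> F (\1_(`]a, +oo[%classic)).
  apply: (domF.2 _ _ 1) => //; first exact: measurable_ramp.
  exact: ramp_cvg.
under eq_fun => k do rewrite (F_lip _ _ _ (ler0n R k) (lipschitz_by_ramp a k) (ramp_le1 a k)).
by move=> F_ray; apply/esym; apply: (cvg_unique _ (cvg_cst _) F_ray).
Qed.

End DominatedFunctional.

(** * Sums of independent variables *)

Lemma expR_taylor1_bound {R : realType} (x : R) : 0 <= x -> `|1 - x - expR (- x)| <= x ^+ 2.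
Proof.
move=> x0; have exp_ge := expR_ge1Dx (- x); rewrite ler0_norm; last by lra.
rewrite opprB lerBlDr; have : expR (- x) * (1 + x) <= 1.
  rewrite -[leRHS](expR0 R) -(addNr x) expRD ler_pM2l ?expR_gt0//; exact: expR_ge1Dx.
have := expR_gt0 (- x); move: (expR (- x)) => y y0 yx.
have : y * (1 + x) <= (x ^+ 2 + (1 - x)) * (1 + x).
  have : 0 <= x ^+ 3 by rewrite exprn_ge0.
  by rewrite !exprS expr0; lra.
by rewrite ler_pM2r//; lra.
Qed.

Section CentredBoundedVariable.
Context {R : realType} {d : measure_display} {T : measurableType d} (P : probability T R).
Variables (V : T -> R) (b : R).
Hypotheses (bV : bmfun V) (Vb : forall w, `|V w| <= b) (V0 : expect P V = 0).
Local Notation variance := (expect P (fun w => V w ^+ 2)).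

Let bcos : bmfun (fun w => cos (V w)). Proof. exact/bmfun_cos/bV.1. Qed.
Let bsin : bmfun (fun w => sin (V w)). Proof. exact/bmfun_sin/bV.1. Qed.

Lemma norm_expect_sin_le : `|expect P (fun w => sin (V w))| <= b / 2 * variance.
Proof.
have -> : expect P (fun w => sin (V w)) = expect P (fun w => sin (V w) - V w).
  by rewrite expectB// V0 subr0.
have bsinV : bmfun (fun w => sin (V w) - V w) by exact: bmfunB.
rewrite (le_trans (norm_expect_le _ bsinV))// -expectZ; last exact: bmfunX.
apply: le_expect; [exact: bmfun_norm|exact/bmfunZ/bmfunX|move=> w].
rewrite (le_trans (sin_taylor1_bound _))// -real_normK ?num_real//.
have := Vb w; have := normr_ge0 (V w); move: (`|_|) => y y0 yb.
by rewrite exprS; have := sqr_ge0 y; nra.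
Qed.

Lemma dist_expect_cos_le : 0 <= b <= 1 ->
  `|expect P (fun w => cos (V w)) - expR (- (variance / 2))| <= b * variance.
Proof.
move=> /andP[b0 b1]; set s := variance.
have s0 : 0 <= s by apply: expect_ge0 => w; exact: sqr_ge0.
have s_le : s <= b ^+ 2.
  rewrite -[leRHS](expect_cst P); apply: le_expect; [exact: bmfunX|exact: bmfun_cst|move=> w].
  by rewrite -real_normK ?num_real// lerXn2r ?nnegrE.
have b2 : b ^+ 2 <= b by rewrite expr2 ler_piMl.
have bcosV : bmfun (fun w => cos (V w) - 1 + 2^-1 * V w ^+ 2).
  by apply: bmfunD; [apply: bmfunB => //; exact: bmfun_cst|exact/bmfunZ/bmfunX].
have cos_quadratic : `|expect P (fun w => cos (V w)) - (1 - s / 2)| <= b ^+ 2 / 2 * s.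
  have -> : expect P (fun w => cos (V w)) - (1 - s / 2) =
      expect P (fun w => cos (V w) - 1 + 2^-1 * V w ^+ 2).
    rewrite expectD; [|by apply: bmfunB => //; exact: bmfun_cst|exact/bmfunZ/bmfunX].
    rewrite expectB//; last exact: bmfun_cst.
    by rewrite expect_cst expectZ; [rewrite -/s; lra|exact: bmfunX].
  rewrite (le_trans (norm_expect_le _ bcosV))// /s -expectZ; last exact: bmfunX.
  apply: le_expect; [exact: bmfun_norm|exact/bmfunZ/bmfunX|move=> w].
  rewrite (mulrC 2^-1) (le_trans (cos_taylor2_bound _))// -[V w ^+ 2]real_normK ?num_real//.
  have := Vb w; have := normr_ge0 (V w); move: (`|_|) => y y0 yb.
  have : y ^+ 2 <= b ^+ 2 by rewrite lerXn2r ?nnegrE.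
  by rewrite -[4%N]/(2 + 2)%N exprD; have := sqr_ge0 y; nra.
have exp_quadratic : `|1 - s / 2 - expR (- (s / 2))| <= (s / 2) ^+ 2.
  by apply: expR_taylor1_bound; lra.
rewrite (le_trans (ler_distD (1 - s / 2) _ _))// (le_trans (lerD cos_quadratic exp_quadratic))//.
by rewrite expr2; nra.
Qed.

End CentredBoundedVariable.

Lemma angle_addition_perturbation {R : realType} (c s c' s' e e' b V v : R) :
  `|c - e| <= 2 * b * V -> `|s| <= b * V -> `|c' - e'| <= b * v -> `|s'| <= b / 2 * v ->
  `|c| <= 1 -> `|s| <= 1 -> `|c'| <= 1 -> 0 <= e' <= 1 ->
  `|c * c' - s * s' - e * e'| <= 2 * b * (V + v) /\ `|s * c' + c * s'| <= b * (V + v).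
Proof.
move=> ce sb ce' sb' c1 s1 c1' /andP[e0' e1'].
have bv : 0 <= b * v by exact: le_trans ce'.
have ss' : `|s * s'| <= b / 2 * v by rewrite normrM -[leRHS]mul1r ler_pM.
have cs' : `|c * s'| <= b / 2 * v by rewrite normrM -[leRHS]mul1r ler_pM.
have sc' : `|s * c'| <= b * V by rewrite normrM -[leRHS]mulr1 ler_pM.
split; last by rewrite (le_trans (ler_normD _ _))// (le_trans (lerD sc' cs'))//; lra.
have -> : c * c' - s * s' - e * e' = c * (c' - e') + (c - e) * e' - s * s' by ring.
have cc' : `|c * (c' - e')| <= b * v by rewrite normrM -[leRHS]mul1r ler_pM.
have ee' : `|(c - e) * e'| <= 2 * b * V by rewrite normrM (ger0_norm e0') -[leRHS]mulr1 ler_pM.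
rewrite (le_trans (ler_normB _ _))// (le_trans (lerD (ler_normD _ _) (lexx _)))//.
by rewrite (le_trans (lerD (lerD cc' ee') ss'))//; lra.
Qed.

Section Independence.
Context {R : realType} {d : measure_display} {T : measurableType d} (P : probability T R).

Definition independent_seq (z : nat -> T -> R) :=
  forall n (B : nat -> set R), (forall i, measurable (B i)) ->
  prob P [set w | forall i, (i < n)%N -> B i (z i w)] = \prod_(i < n) prob P (z i @^-1` B i).

Lemma expect_mul_of_indic (W V : T -> R) (c : R) : bmfun W -> measurable_fun setT V ->
  (forall B : set R, measurable B ->
     expect P (fun w => W w * \1_(V @^-1` B) w) = c * prob P (V @^-1` B)) ->
  forall g, bmfun g -> expect P (fun w => W w * g (V w)) = c * expect P (fun w => g (V w)).
Proof.
move=> bW mV W_indic g bg; apply/eqP; rewrite -subr_eq0; apply/eqP.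
have [linF _] := dominated_functionalB (dominated_functional_expectM P bW mV)
  (dominated_functionalZ c (dominated_functional_expect P mV)).
apply: (bounded_functional_eq0 linF) => // B mB.
have := W_indic B mB; rewrite -expect_indic; last exact: measurable_preimage.
by move=> W_B; apply/eqP; rewrite subr_eq0; exact/eqP.
Qed.

Variable z : nat -> T -> R.
Hypothesis mz : forall i, measurable_fun setT (z i).
Hypothesis indz : independent_seq z.

Definition future_event (m n : nat) (B : nat -> set R) : set T :=
  [set w | forall i, (m <= i < m + n)%N -> B i (z i w)].

Lemma measurable_future_event m n (B : nat -> set R) : (forall i, measurable (B i)) ->
  measurable (future_event m n B).
Proof.
move=> mB; have -> : future_event m n B =
  \bigcap_(i in [set i | (m <= i < m + n)%N]) (z i @^-1` B i).
  by apply/seteqP; split => w h i /=; exact: h.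
by apply: bigcap_measurableType => i _; exact: measurable_preimage.
Qed.

Lemma bmfun_future_event m n (B : nat -> set R) : (forall i, measurable (B i)) ->
  bmfun (\1_(future_event m n B) : T -> R).
Proof. by move=> mB; exact/bmfun_indic/measurable_future_event. Qed.

Definition indep_future (m : nat) (Z : T -> R) := bmfun Z /\
  forall n (B : nat -> set R), (forall i, measurable (B i)) ->
  expect P (fun w => Z w * \1_(future_event m n B) w) =
    expect P Z * \prod_(m <= i < m + n) prob P (z i @^-1` B i).

Lemma indep_future1 : indep_future 0 (fun=> 1).
Proof.
split; first exact: bmfun_cst.
move=> n B mB; rewrite expect_cst mul1r add0n big_mkord -indz//.
under eq_fun do rewrite mul1r.
by rewrite expect_indic//; exact: measurable_future_event.
Qed.

Lemma indep_futureD m Z Z' :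
  indep_future m Z -> indep_future m Z' -> indep_future m (fun w => Z w + Z' w).
Proof.
move=> [bZ indZ] [bZ' indZ']; split; first exact: bmfunD.
move=> n B mB; have bI := bmfun_future_event m n mB.
under eq_fun do rewrite mulrDl.
by rewrite (expectD P (bmfunM bZ bI) (bmfunM bZ' bI)) indZ// indZ'// expectD// mulrDl.
Qed.

Lemma indep_futureZ m c Z : indep_future m Z -> indep_future m (fun w => c * Z w).
Proof.
move=> [bZ indZ]; split; first exact: bmfunZ.
move=> n B mB; have bI := bmfun_future_event m n mB.
under eq_fun do rewrite -mulrA.
by rewrite (expectZ P c (bmfunM bZ bI)) indZ// expectZ// mulrA.
Qed.

Lemma indep_future0 : indep_future 0 (fun=> 0).
Proof. by have := indep_futureZ 0 indep_future1; under eq_fun do rewrite mul0r. Qed.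

Lemma indic_future_eventS m n (B : nat -> set R) (A : set R) w :
  \1_(future_event m n.+1 (fun i => if i == m then A else B i)) w =
  \1_(future_event m.+1 n B) w * \1_(z m @^-1` A) w :> R.
Proof.
rewrite !indicE -natrM mulnb; congr ((nat_of_bool _)%:R).
apply/idP/andP; rewrite !inE.
  move=> future; split.
    move=> i /andP[mi im]; have := future i; rewrite gt_eqF//; apply.
    by rewrite ltnW//= addnS -addSn.
  by have := future m; rewrite eqxx leqnn addnS ltnS leq_addr; apply.
move=> [future zm] i; rewrite addnS ltnS => /andP[mi im].
case: eqP => [->//|/eqP nim]; apply: future.
by rewrite ltn_neqAle eq_sym nim mi addSn ltnS im.
Qed.

Lemma expect_future_event_mul m Z g n (B : nat -> set R) : indep_future m Z -> bmfun g ->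
  (forall i, measurable (B i)) ->
  expect P (fun w => Z w * \1_(future_event m.+1 n B) w * g (z m w)) =
  expect P Z * \prod_(m.+1 <= i < m.+1 + n) prob P (z i @^-1` B i) * expect P (fun w => g (z m w)).
Proof.
move=> [bZ indZ] bg mB; have bI := bmfun_future_event m.+1 n mB.
apply: expect_mul_of_indic => //; first exact: bmfunM.
move=> A mA; pose B' i := if i == m then A else B i.
have mB' i : measurable (B' i) by rewrite /B'; case: ifP.
have := indZ n.+1 B' mB'; rewrite big_ltn ?addnS ?ltnS ?leq_addr//.
rewrite {2}/B' eqxx (eq_big_nat _ _ (F2 := fun i => prob P (z i @^-1` B i))); last first.
  by move=> i /andP[mi _]; rewrite /B' gt_eqF.
rewrite -addSn -mulrA [_ * prob _ _]mulrC => <-.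
by congr expect; apply/funext => w; rewrite -mulrA indic_future_eventS.
Qed.

Lemma indep_future_mul m Z g : indep_future m Z -> bmfun g ->
  indep_future m.+1 (fun w => Z w * g (z m w)) /\
  expect P (fun w => Z w * g (z m w)) = expect P Z * expect P (fun w => g (z m w)).
Proof.
move=> indZ bg; have bgz := bmfun_comp bg (mz m).
have expect_mul : expect P (fun w => Z w * g (z m w)) = expect P Z * expect P (fun w => g (z m w)).
  have := expect_future_event_mul 0 (B := fun=> setT) indZ bg (fun=> measurableT).
  rewrite addn0 big_geq// mulr1 => <-; congr expect; apply/funext => w.
  by rewrite indicE mem_set ?mulr1//= => i /=; rewrite addn0 => /andP[/leq_trans /[apply]];
    rewrite ltnn.
split => //; split; first exact: bmfunM indZ.1 bgz.
move=> n B mB; rewrite expect_mul mulrAC -expect_future_event_mul//.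
by congr expect; apply/funext => w; ring.
Qed.

Lemma indep_futureS m Z : indep_future m Z -> indep_future m.+1 Z.
Proof.
move=> indZ; have [] := indep_future_mul indZ (bmfun_cst 1).
by under eq_fun do rewrite mulr1.
Qed.

Variable phi : nat -> R -> R.
Hypothesis mphi : forall i, measurable_fun setT (phi i).

Definition partial_sum n w := \sum_(i < n) phi i (z i w).

Lemma partial_sumS n w : partial_sum n.+1 w = partial_sum n w + phi n (z n w).
Proof. by rewrite /partial_sum big_ord_recr. Qed.

Lemma indep_future_cos_sin n :
  indep_future n (fun w => cos (partial_sum n w)) /\
    indep_future n (fun w => sin (partial_sum n w)).
Proof.
elim: n => [|n [indc inds]].
  have -> : partial_sum 0 = fun=> 0 by apply/funext => w; rewrite /partial_sum big_ord0.
  by rewrite cos0 sin0; split; [exact: indep_future1|exact: indep_future0].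
have bc := bmfun_cos (mphi n); have bs := bmfun_sin (mphi n).
split.
  under eq_fun do rewrite partial_sumS cosD -mulN1r.
  apply: indep_futureD; first exact: (indep_future_mul indc bc).1.
  exact: indep_futureZ (indep_future_mul inds bs).1.
under eq_fun do rewrite partial_sumS sinD.
by apply: indep_futureD; [exact: (indep_future_mul inds bc).1|exact: (indep_future_mul indc bs).1].
Qed.

Lemma expect_cos_partial_sumS n : expect P (fun w => cos (partial_sum n.+1 w)) =
  expect P (fun w => cos (partial_sum n w)) * expect P (fun w => cos (phi n (z n w))) -
  expect P (fun w => sin (partial_sum n w)) * expect P (fun w => sin (phi n (z n w))).
Proof.
have [indc inds] := indep_future_cos_sin n.
have [cc <-] := indep_future_mul indc (bmfun_cos (mphi n)).
have [ss <-] := indep_future_mul inds (bmfun_sin (mphi n)).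
by under eq_fun do rewrite partial_sumS cosD; exact: expectB cc.1 ss.1.
Qed.

Lemma expect_sin_partial_sumS n : expect P (fun w => sin (partial_sum n.+1 w)) =
  expect P (fun w => sin (partial_sum n w)) * expect P (fun w => cos (phi n (z n w))) +
  expect P (fun w => cos (partial_sum n w)) * expect P (fun w => sin (phi n (z n w))).
Proof.
have [indc inds] := indep_future_cos_sin n.
have [sc <-] := indep_future_mul inds (bmfun_cos (mphi n)).
have [cs <-] := indep_future_mul indc (bmfun_sin (mphi n)).
by under eq_fun do rewrite partial_sumS sinD; exact: expectD sc.1 cs.1.
Qed.

Hypothesis bphi : forall i, bmfun (phi i).

Lemma bmfun_partial_sum n : bmfun (partial_sum n).
Proof. by apply: bmfun_sum => i; exact: bmfun_comp. Qed.

Lemma partial_sumS_pow n k w : partial_sum n.+1 w ^+ k =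
  \sum_(i < k.+1) 'C(k, i)%:R * (partial_sum n w ^+ (k - i) * phi n (z n w) ^+ i).
Proof. by rewrite partial_sumS exprDn; apply: eq_bigr => i _; rewrite mulr_natl. Qed.

Lemma indep_future_pow n k : indep_future n (fun w => partial_sum n w ^+ k).
Proof.
elim: n k => [|n IH] k.
  under eq_fun do rewrite /partial_sum big_ord0 expr0n.
  by case: k => [|k]; [exact: indep_future1|exact: indep_future0].
under eq_fun do rewrite partial_sumS_pow.
elim: (k.+1) => [|j IHj].
  under eq_fun do rewrite big_ord0.
  by elim: n.+1 => [|m /indep_futureS//]; exact: indep_future0.
under eq_fun do rewrite big_ord_recr.
apply: indep_futureD => //; apply: indep_futureZ.
exact: (indep_future_mul (IH _) (bmfunX j (bphi n))).1.
Qed.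

Lemma expect_pow_partial_sumS n k : expect P (fun w => partial_sum n.+1 w ^+ k) =
  \sum_(i < k.+1) 'C(k, i)%:R *
    (expect P (fun w => partial_sum n w ^+ (k - i)) * expect P (fun w => phi n (z n w) ^+ i)).
Proof.
have mul i := indep_future_mul (indep_future_pow n (k - i)) (bmfunX i (bphi n)).
under eq_fun do rewrite partial_sumS_pow.
rewrite expect_sum; last by move=> i; exact: bmfunZ (mul i).1.1.
by apply: eq_bigr => i _; rewrite (expectZ _ _ (mul i).1.1) (mul i).2.
Qed.

Hypothesis centred : forall i, expect P (fun w => phi i (z i w)) = 0.

Local Notation variance i := (expect P (fun w => phi i (z i w) ^+ 2)).

Lemma expect_partial_sum n : expect P (fun w => partial_sum n w) = 0.
Proof.
rewrite /partial_sum expect_sum; last by move=> i; exact: bmfun_comp.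
by rewrite big1.
Qed.

Let expect_phi_pow0 n : expect P (fun w => phi n (z n w) ^+ 0) = 1.
Proof. by under eq_fun do rewrite expr0; exact: expect_cst. Qed.

Let expect_phi_pow1 n : expect P (fun w => phi n (z n w) ^+ 1) = 0.
Proof. by under eq_fun do rewrite expr1; exact: centred. Qed.

Lemma expect_partial_sum_sqr n :
  expect P (fun w => partial_sum n w ^+ 2) = \sum_(i < n) variance i.
Proof.
elim: n => [|n IH].
  by rewrite big_ord0; under eq_fun do rewrite /partial_sum big_ord0 expr0n/=; exact: expect_cst.
rewrite expect_pow_partial_sumS [RHS]big_ord_recr/= -IH !big_ord_recr big_ord0/= add0r.
have -> : expect P (fun w => partial_sum n w ^+ (2 - 2)) = 1 by exact: expect_cst.
by rewrite bin0 binn expect_phi_pow1 ?expect_phi_pow0 subn0 !mulr0 !mulr1 addr0 !mul1r.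
Qed.

Lemma expect_partial_sum_pow4_le (q : nat -> R) n :
  (forall i x, `|phi i x| <= 1) -> (forall i, variance i <= q i) ->
  expect P (fun w => partial_sum n w ^+ 4) <= 3 * (\sum_(i < n) q i) ^+ 2 + \sum_(i < n) q i.
Proof.
move=> phi1 var_le; have var_ge0 i : 0 <= variance i by apply: expect_ge0 => w; exact: sqr_ge0.
elim: n => [|n IH].
  rewrite !big_ord0 expr0n/= mulr0 addr0; under eq_fun do rewrite /partial_sum big_ord0 expr0n/=.
  by rewrite expect_cst.
rewrite expect_pow_partial_sumS !(big_ord_recr n)/= !big_ord_recr big_ord0/= add0r.
have -> : expect P (fun w => partial_sum n w ^+ (4 - 3)) = 0.
  by under eq_fun do rewrite expr1; exact: expect_partial_sum.
have -> : (4 - 2 = 2)%N by [].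
rewrite expect_phi_pow0 expect_phi_pow1 expect_partial_sum_sqr subn0.
have pow4_le : expect P (fun w => phi n (z n w) ^+ 4) <= variance n.
  apply: le_expect; [exact/(bmfun_comp (bmfunX 4 (bphi n)))|
    exact/(bmfun_comp (bmfunX 2 (bphi n)))|].
  move=> w; have := phi1 n (z n w); move: (phi _ _) => y y1.
  have : y ^+ 2 <= 1 by rewrite -real_normK ?num_real// expr_le1.
  by rewrite -[4%N]/(2 * 2)%N exprM; have := sqr_ge0 y; nra.
have var0 : 0 <= \sum_(i < n) variance i by exact: sumr_ge0.
have sum_le : \sum_(i < n) variance i <= \sum_(i < n) q i by exact: ler_sum.
have := var_ge0 n; have := var_le n.
have -> : 'C(4, 0)%:R = 1 :> R by [].
have -> : 'C(4, 2)%:R = 6 :> R by [].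
rewrite !mulr0 !mul0r !mulr0 !addr0 !mulr1 !mul1r.
move: IH var0 sum_le pow4_le.
move: (\sum_(i < n) variance i) (\sum_(i < n) q i) (variance n) (q n) => S Q s r.
by move: (expect _ _) (expect _ _) => A B ? ? ? ? ? ?; nra.
Qed.

Lemma char_partial_sum_bound (b : R) n : 0 <= b <= 1 -> (forall i x, `|phi i x| <= b) ->
  let V := \sum_(i < n) variance i in
  `|expect P (fun w => cos (partial_sum n w)) - expR (- (V / 2))| <= 2 * b * V /\
  `|expect P (fun w => sin (partial_sum n w))| <= b * V.
Proof.
move=> b01 phib /=.
have norm_cos_le1 (f : T -> R) : bmfun f -> `|expect P (fun w => cos (f w))| <= 1.
  move=> bf; apply: norm_expect_bound; first exact/bmfun_cos/bf.1.
  by move=> w; rewrite ler_norml cos_geN1 cos_le1.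
have norm_sin_le1 (f : T -> R) : bmfun f -> `|expect P (fun w => sin (f w))| <= 1.
  move=> bf; apply: norm_expect_bound; first exact/bmfun_sin/bf.1.
  by move=> w; rewrite ler_norml sin_geN1 sin_le1.
elim: n => [|n [cos_IH sin_IH]].
  rewrite !big_ord0 !mulr0 mul0r oppr0 expR0.
  have -> : partial_sum 0 = fun=> 0 by apply/funext => w; rewrite /partial_sum big_ord0.
  by rewrite cos0 sin0 !expect_cst subrr normr0.
have bphin := bmfun_comp (bphi n) (mz n).
rewrite !big_ord_recr/= expect_cos_partial_sumS expect_sin_partial_sumS mulrDl opprD expRD.
apply: angle_addition_perturbation => //.
- exact: dist_expect_cos_le.
- exact: norm_expect_sin_le.
- exact/norm_cos_le1/bmfun_partial_sum.
- exact/norm_sin_le1/bmfun_partial_sum.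
- exact: norm_cos_le1.
- rewrite expR_ge0 -expR0 ler_expR oppr_le0 divr_ge0//.
  by apply: expect_ge0 => w; exact: sqr_ge0.
Qed.

End Independence.

Lemma expect_cosD {R : realType} {d : measure_display} {T : measurableType d} (P : probability T R)
    (V : T -> R) (b : R) : measurable_fun setT V ->
  expect P (fun w => cos (V w + b)) =
  expect P (fun w => cos (V w)) * cos b - expect P (fun w => sin (V w)) * sin b.
Proof.
move=> mV; have bcos := bmfun_cos mV; have bsin := bmfun_sin mV.
rewrite mulrC [X in _ - X]mulrC -!expectZ// -expectB; [|exact: bmfunZ..].
by congr expect; apply/funext => w; rewrite cosD; ring.
Qed.

(** * Laws on the line *)

Section EqualityInLaw.
Context {R : realType} {d : measure_display} {T : measurableType d} (P : probability T R).
Context {d' : measure_display} {T' : measurableType d'} (P' : probability T' R).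
Variables (Y : T -> R) (Y' : T' -> R).
Hypotheses (mY : measurable_fun setT Y) (mY' : measurable_fun setT Y').

Lemma eq_law_of_expect :
  (forall f, bmfun f -> expect P (fun w => f (Y w)) = expect P' (fun w => f (Y' w))) ->
  forall A, measurable A -> P (Y @^-1` A) = P' (Y' @^-1` A).
Proof.
move=> eq_expect A mA.
have mYA := measurable_preimage mY mA; have mYA' := measurable_preimage mY' mA.
by rewrite !EFin_prob// -!expect_indic//; congr (_%:E); exact: (eq_expect \1_A (bmfun_indic mA)).
Qed.

Lemma eq_expect_of_lipschitz :
  (forall (f : R -> R) (C M : R), 0 <= C -> lipschitz_by C f -> (forall x, `|f x| <= M) ->
     expect P (fun w => f (Y w)) = expect P' (fun w => f (Y' w))) ->
  forall f, bmfun f -> expect P (fun w => f (Y w)) = expect P' (fun w => f (Y' w)).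
Proof.
move=> eq_lip f bf; apply/eqP; rewrite -subr_eq0; apply/eqP.
apply: (dominated_functional_eq0_lipschitz (dominated_functionalB
  (dominated_functional_expect P mY) (dominated_functional_expect P' mY'))) => // g C M C0 gC gM.
by rewrite (eq_lip g C M)// subrr.
Qed.

Lemma eq_expect_of_cos :
  (forall a b : R, expect P (fun w => cos (a * Y w + b)) =
    expect P' (fun w => cos (a * Y' w + b))) ->
  forall f, bmfun f -> expect P (fun w => f (Y w)) = expect P' (fun w => f (Y' w)).
Proof.
move=> eq_cos; apply: eq_expect_of_lipschitz => f C M C0 fC fM.
have linform_cst s (y : R) : linform s (fun=> y) = (\sum_(p <- s) p.2) * y.
  by rewrite /linform mulr_suml.
have cst_cvg : expect P (fun w => f (Y w)) @[n --> \oo] --> expect P' (fun w => f (Y' w)).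
  apply: (@expect_coord_lipschitz_cvg _ _ _ P _ _ P' (fun n w t => Y w) (fun w t => Y' w) _ _ _ _
    [:: 0] (fun x => f (x 0)) C M) => //.
  - by move=> n t _.
  - move=> s b _.
    have -> : expect P' (fun w => cos (linform s (fun=> Y' w) + b)) =
        expect P (fun w => cos (linform s (fun=> Y w) + b)).
      under eq_fun do rewrite linform_cst; under [in RHS]eq_fun do rewrite linform_cst.
      by rewrite eq_cos.
    exact: cvg_cst.
  - move=> t e _ e0; have [A [A0 PA]] := exists_tail_prob_le P mY e0.
    by exists A; split => //; exact: nearW.
  - by move=> t; rewrite inE => /eqP ->.
  - by move=> x y; rewrite big_seq1; exact: fC.
by apply: (cvg_unique _ (cvg_cst _) cst_cvg).
Qed.

End EqualityInLaw.

Section IntegralOnLine.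
Context {R : realType}.
Notation mu := (@lebesgue_measure R).

Lemma integral_symmetric_itv_cvg (f : R -> R) : mu.-integrable setT (EFin \o f) ->
  (\int[mu]_(x in `[(- n.+1%:R)%R, n.+1%:R%R]) (f x)%:E)%E @[n --> \oo] --> (\int[mu]_x (f x)%:E)%E.
Proof.
move=> fi; have mf : measurable_fun setT f by have /measurable_EFinP := measurable_int _ fi.
under eq_fun do rewrite integral_mkcond.
have [|||||_ _ //] := @dominated_convergence _ _ _ mu setT measurableT
  (fun n => (EFin \o f) \_ `[(- n.+1%:R), n.+1%:R]) (EFin \o f) (fun x => `|f x|%:E).
- move=> n; apply: (measurable_restrictT (EFin \o f) _).1 => //.
  by apply: (@measurable_funS _ _ _ _ setT) => //; exact/measurable_EFinP.
- exact/measurable_EFinP.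
- apply/aeW => x _; apply: cvg_near_cst; near=> n.
  rewrite patchE mem_set//= in_itv/= -ler_norml.
  by rewrite (@le_trans _ _ n%:R) ?ler_nat//; near: n; exact: nbhs_infty_ger.
- by have /integrable_norm := fi.
- by apply/aeW => x n _; rewrite patchE; case: ifP; rewrite /= ?lee_fin// normr0.
Unshelve. all: by end_near. Qed.

Lemma Rintegral_is_derive_eq0 (h h' : R -> R) :
  (forall x, is_derive x (1 : R) h (h' x)) -> continuous h' -> mu.-integrable setT (EFin \o h') ->
  h n.+1%:R @[n --> \oo] --> 0 -> h (- n.+1%:R) @[n --> \oo] --> 0 -> \int[mu]_x h' x = 0.
Proof.
move=> dh ch' ih' h_pinfty h_ninfty.
have ch : continuous h.
  by move=> x; apply: differentiable_continuous; apply/derivable1_diffP; have [] := dh x.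
have FTC n : (\int[mu]_(x in `[(- n.+1%:R)%R, n.+1%:R%R]) (h' x)%:E)%E =
    (h n.+1%:R - h (- n.+1%:R))%:E.
  rewrite EFinB; apply: continuous_FTC2.
  - by rewrite ltrNl (lt_trans (_ : _ < 0))// ?oppr_lt0 ltr0n.
  - exact: continuous_subspaceT.
  - split; first by move=> x _; have [] := dh x.
    + exact: cvg_at_right_filter (ch _).
    + exact: cvg_at_left_filter (ch _).
  - by move=> x _; rewrite derive1E; exact: derive_val.
have int_cvg := integral_symmetric_itv_cvg ih'.
have : (\int[mu]_(x in `[(- n.+1%:R)%R, n.+1%:R%R]) (h' x)%:E)%E @[n --> \oo] --> 0%E.
  under eq_fun do rewrite FTC.
  by apply: cvg_EFin; [exact: nearW|rewrite -[X in _ --> X](subrr 0); exact: cvgB].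
by move=> /(cvg_unique _ int_cvg); rewrite /Rintegral => ->.
Qed.

End IntegralOnLine.

Section NormalCharacteristicFunction.
Context {R : realType}.
Notation mu := (@lebesgue_measure R).
Variable s : R.
Hypothesis s0 : 0 < s.

Let pdf := normal_pdf 0 s.
Let s_neq0 : s != 0. Proof. by rewrite gt_eqF. Qed.

Let pdfE x : pdf x = normal_peak s * expR (- x ^+ 2 / (s ^+ 2 *+ 2)).
Proof. by rewrite /pdf normal_pdfE// /normal_fun subr0. Qed.

Let pdf_ge0 x : 0 <= pdf x. Proof. exact: normal_pdf_ge0. Qed.

Let integrable_bmfun_pdf (f : R -> R) : bmfun f ->
  mu.-integrable setT (EFin \o (fun x => f x * pdf x)).
Proof.
move=> [mf [M fM]].
have M0 : 0 <= M by exact: le_trans (fM 0).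
have int_bound := integrableZl measurableT M (integrable_normal_pdf 0 s).
apply: le_integrable int_bound => //.
  by apply/measurable_EFinP; apply: measurable_funM => //; exact: measurable_normal_pdf.
move=> x _ /=; rewrite lee_fin !normrM ler_wpM2r// (le_trans (fM x))// ler_norm//.
Qed.

Lemma expect_normal (nu : probability R R) :
  (forall V : set R, measurable V -> nu V = normal_prob 0 s V) ->
  forall f, bmfun f -> expect nu f = \int[mu]_x (f x * pdf x).
Proof.
move=> nuE f bf; apply/eqP; rewrite -subr_eq0; apply/eqP.
apply: (bounded_functional_eq0 (F := fun f => expect nu f - \int[mu]_x (f x * pdf x))) => //.
  split.
  - move=> g h bg bh; rewrite expectD//; under eq_Rintegral do rewrite mulrDl.
    by rewrite RintegralD//; [ring|exact: integrable_bmfun_pdf..].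
  - move=> c g bg; rewrite expectZ//; under eq_Rintegral do rewrite -mulrA.
    by rewrite RintegralZl//; [ring|exact: integrable_bmfun_pdf].
  - exists 2 => g M bg gM; rewrite mulr_natl mulr2n (le_trans (ler_normB _ _))// lerD//.
      exact: norm_expect_bound.
    rewrite (le_trans (le_normr_Rintegral _ _))//; first exact: integrable_bmfun_pdf.
    have -> : M = \int[mu]_x (M * pdf x).
      rewrite RintegralZl//; last exact: integrable_normal_pdf.
      by rewrite /Rintegral integral_normal_pdf mulr1.
    apply: le_Rintegral => //.
    + have := integrable_bmfun_pdf (bmfun_norm bg); apply: eq_integrable => // x _ /=.
      by rewrite normrM [X in _ = (_ * X)%:E]ger0_norm.
    + exact: integrable_bmfun_pdf (bmfun_cst M).
    + by move=> x _; rewrite normrM [X in _ * X]ger0_norm// ler_wpM2r.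
move=> B mB; rewrite expect_indic// /prob nuE//.
have -> : \int[mu]_x (\1_B x * pdf x) = \int[mu]_(x in B) pdf x.
  rewrite [RHS]Rintegral_mkcond; apply: eq_Rintegral => x _; rewrite /patch indicE.
  by case: (x \in B); rewrite ?mul1r ?mul0r.
exact: subrr.
Qed.

Let id_pdf_bound (x : R) : `|x| * pdf x <=
  (s * normal_peak s / normal_peak (2 * s)) * normal_pdf 0 (2 * s) x.
Proof.
have s20 : 2 * s != 0 by rewrite mulf_neq0.
rewrite pdfE normal_pdfE// /normal_fun subr0 (mulrA _ (normal_peak (2 * s))) divfK; last first.
  by rewrite gt_eqF// normal_peak_gt0.
rewrite mulrCA -(mulrA s) (mulrCA s); apply: ler_wpM2l; first exact: normal_peak_ge0.
pose y := x ^+ 2 / (8 * s ^+ 2).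
have -> : - x ^+ 2 / (s ^+ 2 *+ 2) = - (3 * y) + (- y) by rewrite /y; field.
have -> : - x ^+ 2 / ((2 * s) ^+ 2 *+ 2) = - y by rewrite /y; field.
rewrite expRD mulrA; apply: ler_wpM2r; first exact: expR_ge0.
have exp_ge := expR_ge1Dx (3 * y).
have exp_gt0 := expR_gt0 (3 * y).
rewrite expRN ler_pdivrMr//; apply: (@le_trans _ _ (s * (1 + 3 * y))); last by rewrite ler_pM2l.
have yv : y = (`|x| / s) ^+ 2 / 8 by rewrite /y exprMn real_normK ?num_real//; field.
have xv : `|x| = s * (`|x| / s) by rewrite mulrCA mulfV// mulr1.
by rewrite {1}xv ler_pM2l// yv; by have := sqr_ge0 (3 * (`|x| / s) - 4); rewrite !expr2; lra.
Qed.

Let integrable_id_bmfun_pdf (f : R -> R) : bmfun f ->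
  mu.-integrable setT (EFin \o (fun x => x * f x * pdf x)).
Proof.
move=> [mf [M fM]].
have M0 : 0 <= M by exact: le_trans (fM 0).
have int_bound := integrableZl measurableT (M * (s * normal_peak s / normal_peak (2 * s)))
  (integrable_normal_pdf 0 (2 * s)).
apply: le_integrable int_bound => //.
  apply/measurable_EFinP; apply: measurable_funM; last exact: measurable_normal_pdf.
  exact: measurable_funM.
move=> x _ /=; rewrite lee_fin (le_trans _ (ler_norm _))//.
have -> : `|x * f x * pdf x| = `|f x| * (`|x| * pdf x).
  by rewrite !normrM (ger0_norm (pdf_ge0 x)); ring.
by rewrite -[leRHS]mulrA; apply: ler_pM; [by []|by rewrite mulr_ge0|exact: fM|exact: id_pdf_bound].
Qed.

Let is_derive_pdf (x : R) : is_derive x (1 : R) pdf (- (x / s ^+ 2) * pdf x).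
Proof.
have -> : pdf = (fun x => normal_peak s * expR (- x ^+ 2 / (s ^+ 2 *+ 2))).
  by apply/funext => y; rewrite pdfE.
apply: is_derive_eq.
by rewrite /GRing.scale/=; field; exact: s_neq0.
Qed.

Let pdf_cvg0 : pdf n%:R @[n --> \oo] --> 0.
Proof.
apply: (@squeeze_cvgr _ _ _ _ (fun=> 0) (fun n => s * normal_peak s * n%:R^-1)).
- near=> n; rewrite pdf_ge0/=.
  have n0 : 0 < n%:R :> R by rewrite ltr0n; near: n; exact: nbhs_infty_gt.
  rewrite ler_pdivlMr//.
  have := id_pdf_bound n%:R; rewrite ger0_norm// mulrC => /le_trans; apply.
  rewrite -[leRHS]mulr1 -mulrA ler_wpM2l//.
    by rewrite mulr_ge0 ?normal_peak_ge0// ltW.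
  rewrite mulrC ler_pdivrMr ?mul1r; last by rewrite normal_peak_gt0// mulf_neq0.
  by apply: normal_pdf_ub; rewrite mulf_neq0.
- exact: cvg_cst.
- rewrite -[X in _ --> X](mulr0 (s * normal_peak s)); apply: cvgMl_tmp.
  by rewrite -cvg_shiftS; exact: cvg_harmonic.
Unshelve. all: by end_near. Qed.

Let bmfun_cos_affine (a b : R) : bmfun (fun x : R => cos (a * x + b)).
Proof. by apply: bmfun_cos; apply: measurable_funD => //; exact: measurable_funM. Qed.

Let bmfun_sin_affine (a b : R) : bmfun (fun x : R => sin (a * x + b)).
Proof. by apply: bmfun_sin; apply: measurable_funD => //; exact: measurable_funM. Qed.

Let norm_sin_pdf_le a b x : `|sin (a * x + b) * pdf x| <= pdf x.
Proof. by rewrite normrM (ger0_norm (pdf_ge0 x)) ler_piMl// ler_norml sin_geN1 sin_le1. Qed.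

Let continuous_pdf_mul (f : R -> R) : continuous f -> continuous (fun x => f x * pdf x).
Proof. by move=> cf x; apply: cvgM; [exact: cf|exact: continuous_normal_pdf]. Qed.

Let continuous_affine (a b : R) : continuous (fun x : R => a * x + b).
Proof. by move=> x; apply: cvgD; [apply: cvgMl_tmp; exact: cvg_id|exact: cvg_cst]. Qed.

Let continuous_cos_affine a b : continuous (fun x : R => cos (a * x + b)).
Proof.
move=> x; apply: (@continuous_comp R R R (fun x => a * x + b) cos).
  exact: continuous_affine.
exact: continuous_cos.
Qed.

Let continuous_sin_affine a b : continuous (fun x : R => sin (a * x + b)).
Proof.
move=> x; apply: (@continuous_comp R R R (fun x => a * x + b) sin).
  exact: continuous_affine.
exact: continuous_sin.
Qed.

Let is_derive_sin_pdf a b (x : R) : is_derive x (1 : R) (fun x => sin (a * x + b) * pdf x)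
  (a * (cos (a * x + b) * pdf x) - s ^- 2 * (x * sin (a * x + b) * pdf x)).
Proof.
have dsin : is_derive x (1 : R) (fun x => sin (a * x + b)) (a * cos (a * x + b)).
  have -> : (fun x => sin (a * x + b)) = sin \o (fun x => a * x + b) by [].
  by apply: is_derive_eq; rewrite /GRing.scale/=; ring.
apply: (@is_derive_eq _ _ _ _ _ _ _ _ (is_deriveM dsin (is_derive_pdf x))).
by rewrite /GRing.scale/=; field; exact: s_neq0.
Qed.

Lemma normal_integration_by_parts (a b : R) :
  \int[mu]_x (x * sin (a * x + b) * pdf x) = a * s ^+ 2 * \int[mu]_x (cos (a * x + b) * pdf x).
Proof.
have icos := integrable_bmfun_pdf (bmfun_cos_affine a b).
have isin := integrable_id_bmfun_pdf (bmfun_sin_affine a b).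
have ccos := continuous_pdf_mul (@continuous_cos_affine a b).
have csin : continuous (fun x : R => x * sin (a * x + b) * pdf x).
  apply: (@continuous_pdf_mul (fun x : R => x * sin (a * x + b))) => x.
  by apply: cvgM; [exact: cvg_id|exact: continuous_sin_affine].
have pdf_cvg : pdf n.+1%:R @[n --> \oo] --> 0 by rewrite (cvg_shiftS (fun n => pdf n%:R)).
have vanish (u : R^nat) : (forall n, `|u n| <= pdf n.+1%:R) -> u n @[n --> \oo] --> 0.
  move=> u_le; apply: (@squeeze_cvgr _ _ _ _ (fun n => - pdf n.+1%:R) (fun n => pdf n.+1%:R)) => //.
    by apply: nearW => n; rewrite -ler_norml.
  by rewrite -oppr0; exact: cvgN.
have := Rintegral_is_derive_eq0 (is_derive_sin_pdf a b).
rewrite RintegralB//; [|exact: (integrableZl measurableT a icos)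
  |exact: (integrableZl measurableT (s ^- 2) isin)].
rewrite RintegralZl// RintegralZl// => derive_int.
have {derive_int}/eqP : a * \int[mu]_x (cos (a * x + b) * pdf x) -
    s ^- 2 * \int[mu]_x (x * sin (a * x + b) * pdf x) = 0.
  apply: derive_int.
  - by move=> x; apply: cvgB; apply: cvgMl_tmp; [exact: ccos|exact: csin].
  - exact: (integrableB measurableT (integrableZl measurableT a icos)
      (integrableZl measurableT (s ^- 2) isin)).
  - by apply: vanish => n; exact: norm_sin_pdf_le.
  - by apply: vanish => n; rewrite (le_trans (norm_sin_pdf_le _ _ _))// !pdfE sqrrN.
rewrite subr_eq0 => /eqP int_eq.
apply: (@mulfI _ (s ^- 2)); first by rewrite invr_eq0 expf_neq0.
by rewrite -int_eq; field; exact: s_neq0.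
Qed.

Let is_derive_cos_integral b (a0 : R) : is_derive a0 (1 : R)
  (fun a => \int[mu]_x (cos (a * x + b) * pdf x))
  (- (a0 * s ^+ 2 * \int[mu]_x (cos (a0 * x + b) * pdf x))).
Proof.
have Ia : `]a0 - 1, a0 + 1[%classic a0 by rewrite /= in_itv/=; lra.
pose f (a y : R) := cos (a * y + b) * pdf y.
have df (a y : R) : is_derive a (1 : R) (f ^~ y) (- (y * sin (a * y + b)) * pdf y).
  have -> : f ^~ y = (fun a => (cos \o (fun a => a * y + b)) a * pdf y) by [].
  by apply: is_derive_eq; rewrite /GRing.scale/=; ring.
have partialE a y : partial1of2 f a y = - (y * sin (a * y + b)) * pdf y.
  by rewrite partial1of2E; exact: derive_val.
have f_int a (_ : `]a0 - 1, a0 + 1[%classic a) : mu.-integrable setT (EFin \o f a).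
  exact: integrable_bmfun_pdf (bmfun_cos_affine a b).
have f_derivable (a y : R) (_ : `]a0 - 1, a0 + 1[%classic a) (_ : [set: R] y) :
  derivable (f ^~ y) a (1 : R) by have [] := df a y.
pose bound y := `|y * 1 * pdf y|.
have bound_int : mu.-integrable setT (EFin \o bound).
  by have /integrable_norm := integrable_id_bmfun_pdf (bmfun_cst 1).
have partial_le a y (_ : `]a0 - 1, a0 + 1[%classic a) (_ : [set: R] y) :
    `|partial1of2 f a y| <= bound y.
  rewrite partialE /bound !normrM normrN normrM normr1 mulr1 ler_wpM2r//.
  by rewrite ler_piMr// ler_norml sin_geN1 sin_le1.
split; first exact: (derivable_under_integral measurableT Ia f_int f_derivable
  (fun y => normr_ge0 _) bound_int partial_le).
rewrite -derive1E (differentiation_under_integral measurableT Ia f_int f_derivable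
  (fun y => normr_ge0 _) bound_int partial_le).
under eq_Rintegral do rewrite partialE mulNr -mulN1r.
rewrite RintegralZl//; last exact: integrable_id_bmfun_pdf (bmfun_sin_affine a0 b).
by rewrite normal_integration_by_parts mulN1r.
Qed.

Lemma Rintegral_cos_normal_pdf (a b : R) :
  \int[mu]_x (cos (a * x + b) * pdf x) = expR (- (a ^+ 2 * s ^+ 2 / 2)) * cos b.
Proof.
pose f a := \int[mu]_x (cos (a * x + b) * pdf x).
have : f a * expR (a ^+ 2 * (s ^+ 2 / 2)) = f 0 * expR (0 ^+ 2 * (s ^+ 2 / 2)).
  apply: (@is_derive_0_is_cst _ (fun a => f a * expR (a ^+ 2 * (s ^+ 2 / 2)))) => x.
  have dexp : is_derive x (1 : R) (fun a => expR (a ^+ 2 * (s ^+ 2 / 2)))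
      (x * s ^+ 2 * expR (x ^+ 2 * (s ^+ 2 / 2))).
    have -> : (fun a => expR (a ^+ 2 * (s ^+ 2 / 2))) =
      expR \o (fun a => a ^+ 2 * (s ^+ 2 / 2)) by [].
    by apply: is_derive_eq; rewrite /GRing.scale/=; field.
  apply: (@is_derive_eq _ _ _ _ _ _ _ _ (is_deriveM (is_derive_cos_integral b x) dexp)).
  by rewrite /GRing.scale/= -/(f x); ring.
have -> : f 0 = cos b.
  rewrite /f; under eq_Rintegral do rewrite mul0r add0r.
  rewrite RintegralZl//; last exact: integrable_normal_pdf.
  by rewrite /Rintegral integral_normal_pdf mulr1.
rewrite expr0n/= mul0r expR0 mulr1 -/(f a) => <-.
by rewrite mulrCA -expRD (_ : _ + _ = 0) ?expR0 ?mulr1//; ring.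
Qed.

End NormalCharacteristicFunction.

(* The type [measurableTypeR R] carrying the library measures and [R] itself have
   the same measurable sets but are not unifiable structures: transport by [id]. *)
Lemma exists_probability_on_R {R : realType} (U : probability (measurableTypeR R) R) :
  exists U' : probability R R, forall V : set R, measurable V -> U' V = U V.
Proof.
pose f (x : measurableTypeR R) : R := x.
have mid : measurable_fun setT f by move=> _ Y mY; rewrite setTI.
pose U' : probability R R := distribution U (mfun_Sub (mem_set mid)).
by exists U'.
Qed.

Lemma exists_normal {R : realType} (s : R) : 0 < s -> exists nu : probability R R,
  (forall V : set R, measurable V -> nu V = normal_prob 0 s V) /\
  forall a b, expect nu (fun x => cos (a * x + b)) = expR (- (a ^+ 2 * s ^+ 2 / 2)) * cos b.
Proof.
move=> s0; have [nu nuE] := exists_probability_on_R (normal_prob 0 s); exists nu; split => // a b.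
rewrite (expect_normal nuE); first exact: Rintegral_cos_normal_pdf s0 a b.
by apply: bmfun_cos; apply: measurable_funD => //; exact: measurable_funM.
Qed.

(** * Independent normal variables from one uniform variable *)

Lemma exists_uniform {R : realType} : exists U : probability R R,
  forall V : set R, measurable V -> U V = @lebesgue_measure R (V `&` `[0, 1]%classic).
Proof.
have [U UE] := exists_probability_on_R (uniform_prob (@ltr01 R)).
exists U => V mV; rewrite UE// [LHS]integral_uniform_pdf.
rewrite (eq_integral (fun=> 1%:E)); last first.
  move=> x; rewrite inE/= in_itv/= => -[_ x01].
  by rewrite /uniform_pdf x01 subr0 invr1.
by rewrite integral_cst ?mul1e//; exact: measurableI.
Qed.

Lemma cvg_half_pow {R : realType} (B : R) : B * 2 ^- m @[m --> \oo] --> 0.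
Proof.
rewrite -(mulr0 B); apply: cvgMl_tmp; under eq_fun do rewrite -exprVn.
by apply: cvg_expr; rewrite ger0_norm ?invf_lt1 ?invr_ge0 ?ltr1n.
Qed.

Lemma le0_half_pow {R : realType} (x c : R) : (forall n, x <= c / 2 ^+ n) -> x <= 0.
Proof.
move=> x_le; rewrite -(cvg_lim (@Rhausdorff R) (cvg_half_pow c)).
by apply: limr_ge; [exact: cvgP (cvg_half_pow c)|exact: nearW].
Qed.

Lemma bmfun_lipschitz {R : realType} (g : R -> R) (L M : R) :
  lipschitz_by L g -> (forall x, `|g x| <= M) -> bmfun g.
Proof.
move=> gL gM; split; last by exists M.
apply: continuous_measurable_fun => x; apply/cvgrPdist_le => e e0.
have L1 : 0 < `|L| + 1 by have := normr_ge0 L; lra.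
near=> y; rewrite (le_trans (gL _ _))// (@le_trans _ _ ((`|L| + 1) * `|x - y|))//.
  by rewrite ler_wpM2r// (le_trans (ler_norm L))// lerDl.
rewrite mulrC -ler_pdivlMr//; near: y.
by apply: cvgr_dist_le; [exact: cvg_id|rewrite divr_gt0].
Unshelve. all: by end_near. Qed.

Section DigitContraction.
Context {R : realType}.
Implicit Types (f g k p : R -> R).

Definition prepend_digit (e : R) f : R -> R := fun x => f ((e + x) / 2).

Lemma bmfun_prepend_digit e f : bmfun f -> bmfun (prepend_digit e f).
Proof.
move=> bf; apply: (@bmfun_comp _ _ _ f (fun x => (e + x) / 2)) => //.
by apply: measurable_funM => //; exact: measurable_funD.
Qed.

Lemma prepend_digit_lipschitz e f (C : R) :
  lipschitz_by C f -> lipschitz_by (C / 2) (prepend_digit e f).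
Proof.
move=> fC x y; rewrite (le_trans (fC _ _))//.
have -> : (e + x) / 2 - (e + y) / 2 = 2^-1 * (x - y) by lra.
by rewrite normrM ger0_norm ?invr_ge0// mulrA.
Qed.

(* Prepending a digit halves the Lipschitz constant, so that iterating the averaging
   inequality drives the bound [K * L] to zero. *)
Lemma digit_contraction_eq0 (F : (R -> R) -> (R -> R) -> R)
  (admissible : (R -> R) -> Prop) (M K : R) :
  (forall g p L, 0 <= L -> lipschitz_by L g -> (forall x, `|g x| <= M) -> admissible p ->
     `|F g p| <= K * L) ->
  (forall g p L B, 0 <= L -> lipschitz_by L g -> (forall x, `|g x| <= M) -> admissible p ->
     (forall e p', admissible p' -> `|F (prepend_digit e g) p'| <= B) -> `|F g p| <= B) ->
  forall g p L, 0 <= L -> lipschitz_by L g -> (forall x, `|g x| <= M) -> admissible p -> F g p = 0.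
Proof.
move=> F_le F_avg g p L L0 gL gM adm; apply/eqP; rewrite -normr_le0.
apply: (@le0_half_pow _ _ (K * L)) => n.
elim: n g p L L0 gL gM adm => [|n IH] g p L L0 gL gM adm; first by rewrite expr0 divr1; exact: F_le.
apply: (F_avg g p L) => // e p' adm'.
have -> : K * L / 2 ^+ n.+1 = K * (L / 2) / 2 ^+ n by rewrite exprS; field; rewrite expf_neq0.
by apply: IH; [exact: divr_ge0|exact: prepend_digit_lipschitz|move=> x; exact: gM|].
Qed.

End DigitContraction.

Section Uniform.
Context {R : realType}.
Notation mu := (@lebesgue_measure R).
Implicit Types (f h k : R -> R).
Variable uniform : probability R R.
Hypothesis uniform_setI : forall V : set R, measurable V -> uniform V = mu (V `&` `[0, 1]%classic).

Lemma uniform_gt (a : R) : prob uniform `]a, +oo[%classic = 1 - minr (maxr a 0) 1.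
Proof.
rewrite /prob uniform_setI//.
have [a0|a0] := ltP a 0.
  rewrite (min_l ler01) subr0.
  have -> : `]a, +oo[%classic `&` `[0, 1]%classic = `[0, 1]%classic :> set R.
    apply/seteqP; split => x /=; rewrite !in_itv/= ?andbT; first by case.
    by move=> /andP[x0 x1]; rewrite x0 x1; split => //; exact: lt_le_trans x0.
  by rewrite lebesgue_measure_itv/= lte_fin ltr01 -EFinB subr0.
have -> : `]a, +oo[%classic `&` `[0, 1]%classic = `]a, 1]%classic :> set R.
  apply/seteqP; split => x /=; rewrite !in_itv/= ?andbT; first by move=> [-> /andP[]].
  by move=> /andP[ax x1]; rewrite ax x1 (le_trans a0 (ltW ax)).
rewrite lebesgue_measure_itv/= lte_fin; have [a1|a1] := ltP a 1.
  by rewrite -EFinB.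
by rewrite subrr.
Qed.

Lemma uniform_lt (s : R) : 0 <= s <= 1 -> prob uniform `]-oo, s[%classic = s.
Proof.
move=> /andP[s0 s1]; rewrite /prob uniform_setI//.
have -> : `]-oo, s[%classic `&` `[0, 1]%classic = `[0, s[%classic :> set R.
  apply/seteqP; split => x /=; rewrite !in_itv/=; first by move=> [-> /andP[->]].
  by move=> /andP[x0 xs]; rewrite x0 xs (le_trans (ltW xs) s1).
rewrite lebesgue_measure_itv/= lte_fin; have [a1|a1] := ltP 0 s.
  by rewrite -EFinB subr0.
by apply/eqP; rewrite eq_le a1 s0.
Qed.

Lemma expect_uniform_ext (f g : R -> R) : bmfun f -> bmfun g ->
  (forall x, 0 < x < 1 -> f x = g x) -> expect uniform f = expect uniform g.
Proof.
move=> bf bg fg; apply/eqP; rewrite -subr_eq0 -expectB// -normr_le0.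
have [_ [M fgM]] := bmfunB bf bg.
have mI : measurable (~` `]0, 1[%classic : set R) by exact: measurableC.
rewrite (le_trans (norm_expect_le _ (bmfunB bf bg)))//.
rewrite (@le_trans _ _ (expect uniform (fun x => M * \1_(~` `]0, 1[%classic) x)))//.
  apply: le_expect; [exact/bmfun_norm/bmfunB|exact/bmfunZ/bmfun_indic|move=> x].
  rewrite indicE; have [x01|x01] := boolP (0 < x < 1); last first.
    by rewrite mem_set ?mulr1//= in_itv/=; exact/negP.
  by rewrite fg// subrr normr0 memNset ?mulr0//= in_itv/= x01; apply.
rewrite expectZ; last exact: bmfun_indic.
rewrite expect_indic// prob_setC//.
suff -> : prob uniform `]0, 1[%classic = 1 by rewrite subrr mulr0.
rewrite /prob uniform_setI// setIidl; last exact: subset_itv_oo_cc.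
by rewrite lebesgue_measure_itv/= lte_fin ltr01 -EFinB subr0.
Qed.

Let measurable_shift_half (e : R) : measurable_fun setT (fun x : R => (e + x) / 2).
Proof. by apply: measurable_funM => //; exact: measurable_funD. Qed.

Lemma expect_uniform_halves f : bmfun f -> expect uniform f =
  2^-1 * expect uniform (prepend_digit 0 f) + 2^-1 * expect uniform (prepend_digit 1 f).
Proof.
move=> bf; apply/eqP; rewrite -subr_eq0; apply/eqP.
have dom e := dominated_functionalZ 2^-1
  (dominated_functional_expect uniform (measurable_shift_half e)).
have domB := dominated_functionalB (dominated_functional_expect uniform (@measurable_id _ _ setT))
  (dominated_functionalD (dom 0) (dom 1)).
apply: (dominated_functional_eq0_rays domB) => //; first by rewrite !expect_cst; lra.
move=> a; have expect_ray (h : R -> R) (c : R) : (forall x, (a < h x) = (c < x)) ->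
    expect uniform (fun x => \1_(`]a, +oo[%classic) (h x)) = 1 - minr (maxr c 0) 1.
  move=> hc; rewrite -uniform_gt -expect_indic//; congr expect; apply/funext => x.
  rewrite !indicE; congr ((nat_of_bool _)%:R).
  by apply/idP/idP; rewrite !inE/= !in_itv/= !andbT hc.
rewrite (expect_ray id a)// (expect_ray _ (2 * a)); last first.
  by move=> x; rewrite add0r ltr_pdivlMr// mulrC.
rewrite (expect_ray _ (2 * a - 1)); last first.
  by move=> x; rewrite ltr_pdivlMr// mulrC ltrBlDl.
rewrite /Order.max /Order.min.
by repeat case: ifPn; rewrite -?leNgt => *; lra.
Qed.

Definition leading_bit (u : R) : R := if 2^-1 <= u then 1 else 0.
Definition doubling (u : R) : R := 2 * u - leading_bit u.

Lemma measurable_leading_bit : measurable_fun setT leading_bit.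
Proof. by apply: measurable_fun_if => //; exact: measurable_fun_ler. Qed.

Lemma measurable_doubling : measurable_fun setT doubling.
Proof. by apply: measurable_funB; [exact: measurable_funM|exact: measurable_leading_bit]. Qed.

Lemma leading_bit01 u : 0 <= leading_bit u <= 1.
Proof. by rewrite /leading_bit; case: ifP; rewrite lexx ler01. Qed.

Lemma leading_bitE e x : e = 0 \/ e = 1 -> 0 < x < 1 -> leading_bit ((e + x) / 2) = e.
Proof. by move=> [] -> /andP[x0 x1]; rewrite /leading_bit; case: ifPn; rewrite -?ltNge; lra. Qed.

Lemma expect_uniform_bit (g : R -> R -> R) :
  bmfun (g 0) -> bmfun (g 1) -> bmfun (fun u => g (leading_bit u) (doubling u)) ->
  expect uniform (fun u => g (leading_bit u) (doubling u)) =
  2^-1 * expect uniform (g 0) + 2^-1 * expect uniform (g 1).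
Proof.
move=> bg0 bg1 bg; rewrite expect_uniform_halves//.
have ext e : e = 0 \/ e = 1 -> bmfun (g e) ->
    expect uniform (prepend_digit e (fun u => g (leading_bit u) (doubling u))) =
      expect uniform (g e).
  move=> e01 bge; apply: expect_uniform_ext => //; first exact: bmfun_prepend_digit.
  by move=> x x01; rewrite /prepend_digit /doubling leading_bitE//; congr g; lra.
by rewrite !ext//; [right|left].
Qed.

Fixpoint odd_digits_upto (n : nat) (u : R) : R :=
  if n is n'.+1 then (leading_bit u + odd_digits_upto n' (doubling (doubling u))) / 2 else 0.

Lemma odd_digits_upto01 n u : 0 <= odd_digits_upto n u <= 1.
Proof.
elim: n u => [|n IH] u /=; first by rewrite lexx ler01.
by have := IH (doubling (doubling u)); have := leading_bit01 u;
  move: (odd_digits_upto _ _) (leading_bit _) => a b; lra.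
Qed.

Lemma odd_digits_upto_nondecreasing n u : odd_digits_upto n u <= odd_digits_upto n.+1 u.
Proof.
elim: n u => [|n IH] u; first by have /andP[] := odd_digits_upto01 1 u.
rewrite -[odd_digits_upto n.+2 u]/
  ((leading_bit u + odd_digits_upto n.+1 (doubling (doubling u))) / 2).
rewrite -[odd_digits_upto n.+1 u]/((leading_bit u + odd_digits_upto n (doubling (doubling u))) / 2).
by have := IH (doubling (doubling u)); lra.
Qed.

Definition odd_digits (u : R) : R := limn (odd_digits_upto ^~ u).

Lemma odd_digits_cvg u : odd_digits_upto n u @[n --> \oo] --> odd_digits u.
Proof.
apply: nondecreasing_is_cvgn; first by apply/nondecreasing_seqP => n;
  exact: odd_digits_upto_nondecreasing.
by exists 1 => _ [n _ <-]; have /andP[] := odd_digits_upto01 n u.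
Qed.

Lemma measurable_odd_digits_upto n : measurable_fun setT (odd_digits_upto n).
Proof.
elim: n => [|n IH]; first exact: measurable_cst.
apply: measurable_funM => //; apply: measurable_funD; first exact: measurable_leading_bit.
apply: (measurableT_comp IH); apply: (measurableT_comp measurable_doubling);
  exact: measurable_doubling.
Qed.

Lemma measurable_odd_digits : measurable_fun setT odd_digits.
Proof.
apply: (@measurable_fun_cvg _ _ _ setT odd_digits_upto) => //; first by move=> n;
  exact: measurable_odd_digits_upto.
by move=> u _; exact: odd_digits_cvg.
Qed.

Lemma odd_digits01 u : 0 <= odd_digits u <= 1.
Proof.
apply/andP; split.
  by apply: limr_ge; [exact: odd_digits_cvg|apply: nearW => n;
    have /andP[] := odd_digits_upto01 n u].
by apply: limr_le; [exact: odd_digits_cvg|apply: nearW => n; have /andP[] := odd_digits_upto01 n u].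
Qed.

Lemma odd_digitsE u : odd_digits u = (leading_bit u + odd_digits (doubling (doubling u))) / 2.
Proof.
have odd_digits_cvgS : odd_digits_upto n.+1 u @[n --> \oo] --> odd_digits u.
  by rewrite (cvg_shiftS (odd_digits_upto ^~ u)); exact: odd_digits_cvg.
apply: (cvg_unique _ odd_digits_cvgS) => //=; rewrite ![_ / 2]mulrC.
under eq_fun do rewrite mulrC.
by apply: cvgMl_tmp; apply: cvgD; [exact: cvg_cst|exact: odd_digits_cvg].
Qed.

Definition even_digits (u : R) : R := odd_digits (doubling u).

Lemma measurable_even_digits : measurable_fun setT even_digits.
Proof. exact: (measurableT_comp measurable_odd_digits measurable_doubling). Qed.

Lemma expect_uniform_doubling f : bmfun f ->
  expect uniform (fun u => f (doubling u)) = expect uniform f.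
Proof.
move=> bf; rewrite (expect_uniform_bit (g := fun _ x => f x))//; first by lra.
exact: (bmfun_comp bf measurable_doubling).
Qed.

Lemma bmfun_odd_digits f : bmfun f -> bmfun (fun u => f (odd_digits u)).
Proof. by move=> bf; exact: bmfun_comp bf measurable_odd_digits. Qed.

Lemma bmfun_even_digits f : bmfun f -> bmfun (fun u => f (even_digits u)).
Proof. by move=> bf; exact: bmfun_comp bf measurable_even_digits. Qed.

Lemma expect_odd_digits_split f : bmfun f -> expect uniform (fun u => f (odd_digits u)) =
  2^-1 * expect uniform (fun u => prepend_digit 0 f (odd_digits u)) +
  2^-1 * expect uniform (fun u => prepend_digit 1 f (odd_digits u)).
Proof.
move=> bf.
have expect_even e : expect uniform (fun u => prepend_digit e f (even_digits u)) =
    expect uniform (fun u => prepend_digit e f (odd_digits u)).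
  apply: (expect_uniform_doubling (f := fun u => prepend_digit e f (odd_digits u))).
  exact/bmfun_odd_digits/bmfun_prepend_digit.
rewrite -!expect_even -(expect_uniform_bit (g := fun e x => prepend_digit e f (even_digits x))).
- by congr expect; apply/funext => u; rewrite /prepend_digit /even_digits -odd_digitsE.
- exact/bmfun_even_digits/bmfun_prepend_digit.
- exact/bmfun_even_digits/bmfun_prepend_digit.
- by under eq_fun do rewrite /prepend_digit /even_digits -odd_digitsE; exact: bmfun_odd_digits.
Qed.

Let expect_odd_even_swap e h k : bmfun h -> bmfun k ->
  expect uniform (fun v => prepend_digit e h (even_digits v) * k (odd_digits v)) =
  2^-1 * expect uniform
    (fun u => prepend_digit e h (odd_digits u) * prepend_digit 0 k (even_digits u)) +
  2^-1 * expect uniform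
    (fun u => prepend_digit e h (odd_digits u) * prepend_digit 1 k (even_digits u)).
Proof.
move=> bh bk.
have bhk e' : bmfun
    (fun u => prepend_digit e h (odd_digits u) * prepend_digit e' k (even_digits u)).
  by apply: bmfunM;
    [exact/bmfun_odd_digits/bmfun_prepend_digit|exact/bmfun_even_digits/bmfun_prepend_digit].
rewrite -(expect_uniform_bit
  (g := fun e' u => prepend_digit e h (odd_digits u) * prepend_digit e' k (even_digits u)))//.
  by congr expect; apply/funext => u; rewrite /even_digits {3}/prepend_digit -odd_digitsE.
under eq_fun do rewrite /even_digits {2}/prepend_digit -odd_digitsE.
by apply: bmfunM; [exact/bmfun_even_digits/bmfun_prepend_digit|exact: bmfun_odd_digits].
Qed.

Lemma expect_digits_split h k : bmfun h -> bmfun k ->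
  let split_expect e e' := expect uniform
    (fun u => prepend_digit e h (odd_digits u) * prepend_digit e' k (even_digits u)) in
  expect uniform (fun u => h (odd_digits u) * k (even_digits u)) =
  2^-1 * (2^-1 * split_expect 0 0 + 2^-1 * split_expect 0 1) +
  2^-1 * (2^-1 * split_expect 1 0 + 2^-1 * split_expect 1 1).
Proof.
move=> bh bk /=; rewrite -!expect_odd_even_swap//.
have bhk e : bmfun (fun v => prepend_digit e h (even_digits v) * k (odd_digits v)).
  by apply: bmfunM; [exact/bmfun_even_digits/bmfun_prepend_digit|exact: bmfun_odd_digits].
rewrite -(expect_uniform_bit (g := fun e v =>
  prepend_digit e h (even_digits v) * k (odd_digits v)))//.
  by congr expect; apply/funext => u; rewrite /even_digits {1}/prepend_digit -odd_digitsE.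
under eq_fun do rewrite /even_digits {1}/prepend_digit -odd_digitsE.
by apply: bmfunM; [exact: bmfun_odd_digits|exact: bmfun_even_digits].
Qed.

Lemma dist_expect_lipschitz_le (g : R -> R) (V : R -> R) (L M : R) : 0 <= L -> lipschitz_by L g ->
  (forall x, `|g x| <= M) -> measurable_fun setT V -> (forall u, 0 <= V u <= 1) ->
  `|expect uniform (fun u => g (V u)) - g 0| <= L.
Proof.
move=> L0 gL gM mV V01; have bgV := bmfun_comp (bmfun_lipschitz gL gM) mV.
rewrite -[X in _ - X](expect_cst uniform) -expectB//; last exact: bmfun_cst.
apply: norm_expect_bound; first by apply: bmfunB => //; exact: bmfun_cst.
move=> u; rewrite (le_trans (gL _ _))// subr0 ler_piMr//.
by have /andP[V0 V1] := V01 u; rewrite ger0_norm.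
Qed.

Lemma expect_odd_digits f : bmfun f -> expect uniform (fun u => f (odd_digits u)) =
  expect uniform f.
Proof.
apply: (eq_expect_of_lipschitz measurable_odd_digits (@measurable_id _ _ setT)).
move=> {}f C M C0 fC fM.
pose gap g (_ : R -> R) := expect uniform (fun u => g (odd_digits u)) - expect uniform g.
apply/eqP; rewrite -subr_eq0; apply/eqP.
apply: (digit_contraction_eq0 (F := gap) (admissible := fun=> True) (M := M) (K := 2) _ _
  (p := id) C0 fC fM) => // g p L => [|B] L0 gL gM _.
- have bg := bmfun_lipschitz gL gM.
  pose clamp (x : R) := minr (maxr x 0) 1.
  have mclamp : measurable_fun setT clamp by apply: measurable_minr => //; exact: measurable_maxr.
  have clamp01 x : 0 <= clamp x <= 1.
    by rewrite /clamp ge_min lexx orbT andbT le_min le_max lexx orbT ler01.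
  have clampE : expect uniform g = expect uniform (fun u => g (clamp u)).
    apply: expect_uniform_ext => //; first exact: bmfun_comp bg mclamp.
    by move=> x /andP[x0 x1]; rewrite /clamp max_l ?min_l ?ltW.
  have := dist_expect_lipschitz_le L0 gL gM measurable_odd_digits odd_digits01.
  have := dist_expect_lipschitz_le L0 gL gM mclamp clamp01; rewrite -clampE distrC /gap.
  move=> dist_clamp dist_digits; rewrite (le_trans (ler_distD (g 0) _ _))//.
  by rewrite (le_trans (lerD dist_digits dist_clamp))//; lra.
- have bg := bmfun_lipschitz gL gM => gap_le.
  rewrite /gap (expect_odd_digits_split bg) (expect_uniform_halves bg).
  have := gap_le 0 id I; have := gap_le 1 id I; rewrite /gap.
  move: (expect _ _) (expect _ _) (expect _ _) (expect _ _) => a b c r.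
  by rewrite !ler_norml => /andP[? ?] /andP[? ?]; apply/andP; split; lra.
Qed.

Lemma expect_even_digits f : bmfun f -> expect uniform (fun u => f (even_digits u)) =
  expect uniform f.
Proof.
move=> bf; rewrite (expect_uniform_doubling (f := fun u => f (odd_digits u))).
  exact: expect_odd_digits.
exact: bmfun_odd_digits.
Qed.

Let digits_cov h k := expect uniform (fun u => h (odd_digits u) * k (even_digits u)) -
  expect uniform h * expect uniform k.

Let norm_digits_cov_le h k (L K M : R) : 0 <= L -> lipschitz_by L h -> (forall x, `|h x| <= M) ->
  bmfun k -> (forall x, `|k x| <= K) -> `|digits_cov h k| <= 2 * K * L.
Proof.
move=> L0 hL hM bk kK; have bh := bmfun_lipschitz hL hM.
have bodd := bmfun_odd_digits bh; have beven := bmfun_even_digits bk.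
have bres : bmfun (fun u => h (odd_digits u) - h 0) by apply: bmfunB => //; exact: bmfun_cst.
have res_le u : `|h (odd_digits u) - h 0| <= L.
  rewrite (le_trans (hL _ _))// subr0 ler_piMr//.
  by have /andP[t0 t1] := odd_digits01 u; rewrite ger0_norm.
have -> : digits_cov h k = expect uniform (fun u => (h (odd_digits u) - h 0) * k (even_digits u)) -
    expect uniform (fun u => h (odd_digits u) - h 0) * expect uniform (fun u => k (even_digits u)).
  have -> : (fun u => (h (odd_digits u) - h 0) * k (even_digits u)) =
      (fun u => h (odd_digits u) * k (even_digits u) - h 0 * k (even_digits u)).
    by apply/funext => u; rewrite mulrBl.
  rewrite (expectB uniform (bmfunM bodd beven) (bmfunZ (h 0) beven)) expectZ//.
  rewrite (expectB uniform bodd (bmfun_cst (h 0))) expect_cst.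
  by rewrite /digits_cov -(expect_odd_digits bh) -(expect_even_digits bk); ring.
have K_norm (a c : R) : `|a| <= L * K -> `|c| <= L * K -> `|a - c| <= 2 * K * L.
  by move=> aLK cLK; rewrite (le_trans (ler_normB _ _))// (le_trans (lerD aLK cLK))//; lra.
apply: K_norm; first by apply: norm_expect_bound; [exact: bmfunM|move=> u; rewrite normrM ler_pM].
by rewrite normrM; apply: ler_pM => //; exact: norm_expect_bound.
Qed.

Let digits_cov_split h k : bmfun h -> bmfun k -> digits_cov h k =
  2^-1 * (2^-1 * digits_cov (prepend_digit 0 h) (prepend_digit 0 k) +
          2^-1 * digits_cov (prepend_digit 0 h) (prepend_digit 1 k)) +
  2^-1 * (2^-1 * digits_cov (prepend_digit 1 h) (prepend_digit 0 k) +
          2^-1 * digits_cov (prepend_digit 1 h) (prepend_digit 1 k)).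
Proof.
move=> bh bk; rewrite /digits_cov (expect_digits_split bh bk).
by rewrite (expect_uniform_halves bh) (expect_uniform_halves bk); ring.
Qed.

Lemma expect_digits_mul h k : bmfun h -> bmfun k ->
  expect uniform (fun u => h (odd_digits u) * k (even_digits u)) =
  expect uniform h * expect uniform k.
Proof.
move=> bh bk; apply/eqP; rewrite -subr_eq0; apply/eqP.
under eq_fun do rewrite mulrC; rewrite (mulrC (expect uniform h)).
apply: (dominated_functional_eq0_lipschitz (dominated_functionalB
  (dominated_functional_expectM uniform (bmfun_even_digits bk) measurable_odd_digits)
  (dominated_functionalZ (expect uniform k)
    (dominated_functional_expect uniform (@measurable_id _ _ setT))))) => // {h bh} f C M C0 fC fM.
under eq_fun do rewrite mulrC; rewrite (mulrC (expect uniform k)) -/(digits_cov f k).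
have [_ [K kK]] := bk.
apply: (digit_contraction_eq0 (F := digits_cov) (M := M) (K := 2 * K)
  (admissible := fun p => bmfun p /\ forall x, `|p x| <= K) _ _ C0 fC fM) => //.
  by move=> g p L L0 gL gM [bp pK]; exact: norm_digits_cov_le gL gM bp pK.
move=> g p L B L0 gL gM [bp pK] cov_le; rewrite (digits_cov_split (bmfun_lipschitz gL gM) bp).
have cov_p e e' := cov_le e (prepend_digit e' p) (conj (bmfun_prepend_digit e' bp) (fun x => pK _)).
have := cov_p 0 0; have := cov_p 0 1; have := cov_p 1 0; have := cov_p 1 1.
move: (digits_cov _ _) (digits_cov _ _) (digits_cov _ _) (digits_cov _ _) => a b c r.
rewrite !ler_norml => /andP[? ?] /andP[? ?] /andP[? ?] /andP[? ?].
by apply/andP; split; lra.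
Qed.

Definition uniform_seq (j : nat) (u : R) : R := odd_digits (iter j even_digits u).

Lemma measurable_uniform_seq j : measurable_fun setT (uniform_seq j).
Proof.
apply: (measurableT_comp measurable_odd_digits); elim: j => [|j IH]; first exact: measurable_id.
exact: (measurableT_comp measurable_even_digits IH).
Qed.

Lemma uniform_seqS j u : uniform_seq j.+1 u = uniform_seq j (even_digits u).
Proof. by rewrite /uniform_seq iterSr. Qed.

Lemma expect_uniform_seq j f : bmfun f ->
  expect uniform (fun u => f (uniform_seq j u)) = expect uniform f.
Proof.
move=> bf; elim: j => [|j IH]; first exact: expect_odd_digits.
under eq_fun do rewrite uniform_seqS.
rewrite (expect_even_digits (f := fun u => f (uniform_seq j u)))//.
exact: (bmfun_comp bf (measurable_uniform_seq j)).
Qed.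

Lemma prob_uniform_seq j C : measurable C -> prob uniform (uniform_seq j @^-1` C) = prob uniform C.
Proof.
move=> mC; rewrite -(expect_indic uniform mC) -(expect_uniform_seq j (bmfun_indic mC)).
by rewrite -expect_indic//; exact: measurable_preimage (measurable_uniform_seq j) mC.
Qed.

Lemma indic_uniform_seqS n (B : nat -> set R) u :
  \1_[set u | forall i, (i < n.+1)%N -> B i (uniform_seq i u)] u =
  \1_(B 0%N) (odd_digits u) *
  \1_[set u | forall i, (i < n)%N -> B i.+1 (uniform_seq i u)] (even_digits u) :> R.
Proof.
rewrite !indicE -natrM mulnb; congr ((nat_of_bool _)%:R); apply/idP/andP; rewrite !inE/=.
  by move=> seqB; split; [exact: (seqB 0%N)|move=> i ni; rewrite -uniform_seqS; exact: seqB].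
by move=> [B0 seqB] [|i] ni//; rewrite uniform_seqS; exact: seqB.
Qed.

Lemma uniform_seq_independent : independent_seq uniform uniform_seq.
Proof.
have mI m (C : nat -> set R) : (forall i, measurable (C i)) ->
    measurable [set u | forall i, (i < m)%N -> C i (uniform_seq i u)].
  move=> mC; have -> : [set u | forall i, (i < m)%N -> C i (uniform_seq i u)] =
      \bigcap_(i in [set i | (i < m)%N]) (uniform_seq i @^-1` C i).
    by apply/seteqP; split => w wC i /=; exact: wC.
  apply: bigcap_measurableType => i _.
  exact: measurable_preimage (measurable_uniform_seq i) (mC i).
elim=> [|n IH] B mB.
  by rewrite big_ord0 -[RHS](prob_setT uniform); congr prob; apply/seteqP; split.
have mBS i : measurable (B i.+1) by [].
rewrite big_ord_recl/= -expect_indic; last exact: mI.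
rewrite (funext (indic_uniform_seqS n B)).
rewrite (expect_digits_mul (bmfun_indic (mB 0%N)) (bmfun_indic (mI n (fun i => B i.+1) mBS))).
rewrite !expect_indic ?prob_uniform_seq//; last exact: (mI n (fun i => B i.+1)).
rewrite (IH (fun i => B i.+1))//; congr (_ * _); apply: eq_bigr => i _.
by rewrite !prob_uniform_seq.
Qed.

End Uniform.

Section Quantile.
Context {R : realType} (nu : probability R R).

Definition survival (x : R) : R := prob nu `]x, +oo[%classic.

Lemma survival_nonincreasing x y : x <= y -> survival y <= survival x.
Proof. by move=> xy; apply: le_prob => // z /=; rewrite !in_itv/= !andbT; exact: le_lt_trans. Qed.

Lemma survival_cvg_ae (x_ : nat -> R) (A : set R) : measurable A ->
  {ae nu, forall z, \forall n \near \oo, (x_ n < z) = (z \in A)} ->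
  survival (x_ n) @[n --> \oo] --> prob nu A.
Proof.
move=> mA x_A; apply: prob_cvg_ae => //; move: x_A; apply: filterS => z; apply: filterS => n <-.
by apply/idP/idP; rewrite inE/= in_itv/= andbT.
Qed.

Lemma survival_right_cvg a : survival (a + n.+1%:R^-1) @[n --> \oo] --> survival a.
Proof.
apply: survival_cvg_ae => //; apply/aeW => z; have [az|za] := ltP a z.
  have za0 : 0 < (z - a) / 2 by rewrite divr_gt0 ?subr_gt0.
  have := near_infty_natSinv_le za0; apply: filterS => n n_le.
  by rewrite mem_set/= ?in_itv/= ?az// -ltrBrDl (le_lt_trans n_le)//; lra.
apply: nearW => n; rewrite memNset/=; last by rewrite in_itv/= ltNge za.
by apply/negbTE; rewrite -leNgt (le_trans za)// lerDl invr_ge0.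
Qed.

Lemma has_sup_survival u : 0 < u < 1 -> has_sup [set x | u < survival x].
Proof.
move=> /andP[u0 u1]; split.
  have : survival (- n%:R) @[n --> \oo] --> prob nu setT.
    apply: survival_cvg_ae => //; apply/aeW => z; near=> n.
    by rewrite in_setT ltrNl; near: n; exact: nbhs_infty_gtr.
  rewrite prob_setT => /cvgrPdist_lt/(_ (1 - u)); rewrite subr_gt0 => /(_ u1)[n _ /(_ n (leqnn n))].
  by rewrite /= ltr_norml => /andP[_ ?]; exists (- n%:R) => /=; lra.
have : survival n%:R @[n --> \oo] --> prob nu set0.
  apply: survival_cvg_ae => //; apply/aeW => z; near=> n.
  by rewrite in_set0 ltNge; apply/negbTE; rewrite negbK; near: n; exact: nbhs_infty_ger.
rewrite /prob measure0 => /cvgr0Pnorm_lt/(_ _ u0)[n _ /(_ n (leqnn n))] /= n_lt.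
exists n%:R => x /= ux; rewrite leNgt; apply/negP => /ltW/survival_nonincreasing.
by have := ler_norm (survival n%:R); lra.
Unshelve. all: by end_near. Qed.

Definition quantile (u : R) : R := if 0 < u < 1 then sup [set x | u < survival x] else 0.

Lemma quantile_gt u a : 0 < u < 1 -> (a < quantile u) = (u < survival a).
Proof.
move=> u01; have sup_u := has_sup_survival u01; rewrite /quantile u01; apply/idP/idP => [|ua].
  rewrite -subr_gt0 => /sup_adherent/(_ sup_u)[x ux]; rewrite opprB addrCA subrr addr0.
  by move=> /ltW/survival_nonincreasing; exact: lt_le_trans.
have /cvgrPdist_lt/(_ (survival a - u)) := @survival_right_cvg a.
rewrite subr_gt0 => /(_ ua)[n _ /(_ n (leqnn n))] /=; rewrite ltr_norml => /andP[_ ?].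
apply: (@lt_le_trans _ _ (a + n.+1%:R^-1)); first by rewrite ltrDl invr_gt0.
by apply: ub_le_sup; [exact: sup_u.2|rewrite /=; lra].
Qed.

Lemma measurable_quantile : measurable_fun setT quantile.
Proof.
apply: (measurability (@RGenOInfty.G R) (@RGenOInfty.measurableE R)).
move=> _ [_ [a ->] <-]; rewrite setTI.
have -> : quantile @^-1` `]a, +oo[%classic =
    (`]0, 1[%classic `&` `]-oo, survival a[%classic) `|`
    (~` `]0, 1[%classic `&` (if a < 0 then setT else set0)).
  apply/seteqP; split => u /=; rewrite !in_itv/= ?andbT.
    have [u01|u01] := boolP (0 < u < 1); first by rewrite quantile_gt// => ua; left.
    by rewrite /quantile (negbTE u01) => a0; right; rewrite a0.
  move=> [[u01 ua]|[/negP u01]]; first by rewrite quantile_gt.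
  by rewrite /quantile (negbTE u01); case: ifP.
by apply: measurableU; apply: measurableI => //; [exact: measurableC|case: ifP].
Qed.

Lemma expect_quantile (uniform : probability R R) (f : R -> R) :
  (forall V : set R, measurable V -> uniform V = @lebesgue_measure R (V `&` `[0, 1]%classic)) ->
  bmfun f -> expect uniform (fun u => f (quantile u)) = expect nu f.
Proof.
move=> uniformE bf; apply/eqP; rewrite -subr_eq0; apply/eqP.
apply: (dominated_functional_eq0_rays (dominated_functionalB
  (dominated_functional_expect uniform measurable_quantile)
  (dominated_functional_expect nu (@measurable_id _ _ setT)))) => //.
  by rewrite !expect_cst subrr.
move=> a; rewrite [X in _ - X]expect_indic// -/(survival a).
have surv01 : 0 <= survival a <= 1 by rewrite prob_ge0 prob_le1.
rewrite -[X in _ - X](uniform_lt uniformE surv01) -expect_indic//; apply/eqP;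
  rewrite subr_eq0; apply/eqP.
apply: (expect_uniform_ext uniformE); [|exact: bmfun_indic|].
  exact: (bmfun_comp (bmfun_indic (measurable_itv _)) measurable_quantile).
move=> u u01; rewrite !indicE; congr ((nat_of_bool _)%:R).
by apply/idP/idP; rewrite !inE/= !in_itv/= andbT quantile_gt.
Qed.

End Quantile.

Definition standard_normal_seq {R : realType} {d : measure_display} {T : measurableType d}
    (P : probability T R) (xi : nat -> T -> R) :=
  [/\ forall i, measurable_fun setT (xi i), independent_seq P xi &
      forall i a b, expect P (fun w => cos (a * xi i w + b)) = expR (- (a ^+ 2 / 2)) * cos b].

Lemma exists_standard_normal_seq {R : realType} :
  exists (P : probability R R) (xi : nat -> R -> R), standard_normal_seq P xi.
Proof.
have [U UE] := @exists_uniform R; have [nu [_ nu_cos]] := exists_normal (@ltr01 R).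
have mq := measurable_quantile nu.
exists U, (fun i u => quantile nu (uniform_seq i u)); split.
- by move=> i; exact: measurableT_comp mq (measurable_uniform_seq i).
- move=> n B mB; have mqB i : measurable (quantile nu @^-1` B i) by exact: measurable_preimage.
  exact: (uniform_seq_independent UE n mqB).
- move=> i a b; have bcos : bmfun (fun x => cos (a * x + b)).
    by apply: bmfun_cos; apply: measurable_funD => //; exact: measurable_funM.
  have bq : bmfun (fun u => cos (a * quantile nu u + b)) by exact: bmfun_comp bcos mq.
  by rewrite (expect_uniform_seq UE i bq) (expect_quantile nu UE bcos) nu_cos expr1n mulr1.
Qed.

(** * Nonnegative definite kernels *)

Section QuadraticForm.
Context {R : realType}.
Implicit Types (K : R -> R -> R) (s : seq (R * R)).

Definition quadform K s : R := \sum_(p <- s) \sum_(q <- s) p.2 * q.2 * K p.1 q.1.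

Definition symmetric_kernel K := forall a b, K a b = K b a.

Definition nonneg_definite K := forall s, nonneg_times s -> 0 <= quadform K s.

Lemma quadform_cons K (t l : R) s : symmetric_kernel K ->
  quadform K ((t, l) :: s) = l ^+ 2 * K t t + 2 * l * linform s (K t) + quadform K s.
Proof.
move=> symK; rewrite /quadform !big_cons/= /linform.
have -> : \sum_(q <- s) l * q.2 * K t q.1 = l * \sum_(q <- s) q.2 * K t q.1.
  by rewrite mulr_sumr; apply: eq_bigr => q _; rewrite mulrA.
have -> : \sum_(p <- s) \sum_(q <- (t, l) :: s) p.2 * q.2 * K p.1 q.1 =
    l * \sum_(q <- s) q.2 * K t q.1 + \sum_(p <- s) \sum_(q <- s) p.2 * q.2 * K p.1 q.1.
  rewrite mulr_sumr -big_split; apply: eq_bigr => p _ /=.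
  by rewrite big_cons/= (symK p.1 t); ring.
by ring.
Qed.

Lemma quadform_rank1 (x : R -> R) s : quadform (fun a b => x a * x b) s = linform s x ^+ 2.
Proof.
rewrite expr2 /linform /quadform mulr_suml; apply: eq_bigr => p _.
by rewrite mulr_sumr; apply: eq_bigr => q _; ring.
Qed.

Lemma quadformD K K' s :
  quadform (fun a b => K a b + K' a b) s = quadform K s + quadform K' s.
Proof.
rewrite /quadform -big_split; apply: eq_bigr => p _; rewrite -big_split.
by apply: eq_bigr => q _ /=; ring.
Qed.

Lemma quadformZ (c : R) K s : quadform (fun a b => c * K a b) s = c * quadform K s.
Proof.
rewrite /quadform mulr_sumr; apply: eq_bigr => p _; rewrite mulr_sumr.
by apply: eq_bigr => q _; ring.
Qed.

Lemma quadform_scale K (a : R) s : quadform K (scale_coefs a s) = a ^+ 2 * quadform K s.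
Proof.
rewrite /quadform big_map mulr_sumr; apply: eq_bigr => p _.
by rewrite big_map mulr_sumr; apply: eq_bigr => q _ /=; ring.
Qed.

Definition increment_coefs (a b : R) : seq (R * R) := [:: (b, 1); (a, -1)].

Lemma nonneg_times_increment (a b : R) : 0 <= a -> 0 <= b -> nonneg_times (increment_coefs a b).
Proof. by move=> a0 b0 p; rewrite !inE => /orP[] /eqP ->. Qed.

Lemma linform_increment (a b : R) x : linform (increment_coefs a b) x = x b - x a.
Proof. by rewrite /linform !big_cons big_nil/=; ring. Qed.

Lemma quadform_increment K (a b : R) : symmetric_kernel K ->
  quadform K (increment_coefs a b) = K a a + K b b - 2 * K a b.
Proof.
by move=> symK; rewrite quadform_cons// /quadform /linform !big_seq1/= (symK b a); ring.
Qed.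

Section NonnegDefinite.
Variable K : R -> R -> R.
Hypotheses (symK : symmetric_kernel K) (pK : nonneg_definite K).

Lemma nonneg_definite_diag (t : R) : 0 <= t -> 0 <= K t t.
Proof.
move=> t0; have := pK (_ : nonneg_times [:: (t, 1)]).
rewrite /quadform !big_seq1/= !mul1r; apply.
by move=> p; rewrite inE => /eqP ->.
Qed.

(* The quadratic polynomial [l |-> quadform K ((t, l) :: s)] is nonnegative. *)
Lemma nonneg_definite_cauchy_schwarz (t : R) s : 0 <= t -> nonneg_times s ->
  linform s (K t) ^+ 2 <= K t t * quadform K s.
Proof.
move=> t0 s0; have poly_ge0 (l : R) : 0 <= l ^+ 2 * K t t + 2 * l * linform s (K t) + quadform K s.
  rewrite -quadform_cons//; apply: pK => p; rewrite inE => /predU1P[->//|]; exact: s0.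
move: (linform s (K t)) (quadform K s) (pK s0) poly_ge0 => x V V0 poly_ge0.
have [Ktt0|Ktt_neq0] := eqVneq (K t t) 0.
  have [->|x_neq0] := eqVneq x 0; first by rewrite expr0n Ktt0 mul0r.
  have := poly_ge0 (- ((V + 1) / (2 * x))); rewrite Ktt0 mulr0 add0r.
  have -> : 2 * - ((V + 1) / (2 * x)) * x + V = -1 by field.
  lra.
have Ktt_gt0 : 0 < K t t by rewrite lt_neqAle eq_sym Ktt_neq0 nonneg_definite_diag.
have := poly_ge0 (- (x / K t t)).
have -> : (- (x / K t t)) ^+ 2 * K t t + 2 * - (x / K t t) * x + V = (K t t * V - x ^+ 2) / K t t.
  by field.
by rewrite pmulr_lge0 ?invr_gt0// subr_ge0.
Qed.

Lemma nonneg_definite_null (t a : R) : 0 <= t -> 0 <= a -> K t t = 0 -> K a t = 0.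
Proof.
move=> t0 a0 Ktt0; apply/eqP; rewrite -sqrf_eq0 eq_le sqr_ge0 andbT symK.
have := @nonneg_definite_cauchy_schwarz t [:: (a, 1)] t0.
rewrite Ktt0 mul0r /linform big_seq1 mul1r; apply.
by move=> p; rewrite inE => /eqP ->.
Qed.

End NonnegDefinite.

Definition schur_complement K (q : R) : R -> R -> R := fun a b => K a b - K a q * K q b / K q q.

Section SchurComplement.
Variables (K : R -> R -> R) (q : R).
Hypotheses (symK : symmetric_kernel K) (pK : nonneg_definite K) (q0 : 0 <= q).

Lemma schur_complement_sym : symmetric_kernel (schur_complement K q).
Proof.
move=> a b; rewrite /schur_complement (symK a b) (symK a q) (symK q b).
by congr (_ - _ / _); rewrite mulrC.
Qed.

Lemma schur_complement_nonneg : nonneg_definite (schur_complement K q).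
Proof.
move=> s s0.
have -> : quadform (schur_complement K q) s = quadform K s - linform s (K q) ^+ 2 / K q q.
  rewrite -quadform_rank1 [X in _ - X]mulrC -mulNr -quadformZ -quadformD.
  congr quadform; apply/funext => a; apply/funext => b.
  by rewrite /schur_complement (symK a q); ring.
have [->|Kqq_neq0] := eqVneq (K q q) 0; first by rewrite invr0 mulr0 subr0; exact: pK.
rewrite subr_ge0 ler_pdivrMr; first by rewrite mulrC nonneg_definite_cauchy_schwarz.
by rewrite lt_neqAle eq_sym Kqq_neq0 nonneg_definite_diag.
Qed.

Lemma schur_complement_pivot (a : R) : 0 <= a -> schur_complement K q a q = 0.
Proof.
move=> a0; rewrite /schur_complement; have [Kqq0|Kqq_neq0] := eqVneq (K q q) 0.
  by rewrite (nonneg_definite_null symK pK q0 a0 Kqq0) !mul0r subr0.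
by rewrite mulfK// subrr.
Qed.

Lemma schur_complement_null (u : R) : (forall a : R, 0 <= a -> K a u = 0) ->
  forall a : R, 0 <= a -> schur_complement K q a u = 0.
Proof. by move=> Ku0 a a0; rewrite /schur_complement !Ku0// mulr0 mul0r subr0. Qed.

End SchurComplement.

Section Cholesky.
Variables (C : R -> R -> R) (q : nat -> R).
Hypotheses (symC : symmetric_kernel C) (pC : nonneg_definite C) (q0 : forall n, 0 <= q n).

Fixpoint cholesky_residual n : R -> R -> R :=
  if n is n'.+1 then schur_complement (cholesky_residual n') (q n') else C.

Lemma cholesky_residual_sym_nonneg n :
  symmetric_kernel (cholesky_residual n) /\ nonneg_definite (cholesky_residual n).
Proof.
elim: n => [//|n [symn pn]]; split; first exact: schur_complement_sym.
exact: schur_complement_nonneg.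
Qed.

Lemma cholesky_residual_eq0 n i (t : R) : (i < n)%N -> 0 <= t -> cholesky_residual n t (q i) = 0.
Proof.
elim: n t => [//|n IH] t; have [symn pn] := cholesky_residual_sym_nonneg n.
rewrite ltnS leq_eqVlt => /predU1P[->|ni] t0; first exact: schur_complement_pivot.
by apply: schur_complement_null => // a a0; exact: IH.
Qed.

Definition cholesky j (t : R) :=
  cholesky_residual j t (q j) / Num.sqrt (cholesky_residual j (q j) (q j)).

Lemma cholesky_decomposition n (s t : R) :
  C s t = \sum_(j < n) cholesky j s * cholesky j t + cholesky_residual n s t.
Proof.
elim: n => [|n ->]; first by rewrite big_ord0 add0r.
rewrite big_ord_recr/= -addrA; congr (_ + _); rewrite /schur_complement.
have [symn pn] := cholesky_residual_sym_nonneg n.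
have -> : cholesky n s * cholesky n t =
    cholesky_residual n s (q n) * cholesky_residual n (q n) t / cholesky_residual n (q n) (q n).
  rewrite /cholesky (symn t) -[in RHS](sqr_sqrtr (nonneg_definite_diag pn (q0 n))) expr2 invfM.
  ring.
by ring.
Qed.

Lemma cholesky_eq0 n i j : (i < n)%N -> (n <= j)%N -> cholesky j (q i) = 0.
Proof.
move=> ni nj; have [symj _] := cholesky_residual_sym_nonneg j.
by rewrite /cholesky symj cholesky_residual_eq0 ?mul0r//; exact: leq_trans nj.
Qed.

Lemma quadform_cholesky n s : (forall p, p \in s -> exists2 i, (i < n)%N & p.1 = q i) ->
  quadform C s = \sum_(j < n) linform s (cholesky j) ^+ 2.
Proof.
move=> sn; transitivity (quadform (fun a b => \sum_(j < n) cholesky j a * cholesky j b) s).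
  rewrite /quadform big_seq [RHS]big_seq; apply: eq_bigr => p ps.
  rewrite big_seq [RHS]big_seq; apply: eq_bigr => r rs.
  rewrite (cholesky_decomposition n); have [i ni ->] := sn r rs; have [k _ ->] := sn p ps.
  by rewrite cholesky_residual_eq0// addr0.
elim: n {sn} => [|n IH].
  by rewrite big_ord0 /quadform big1// => p _; rewrite big1// => r _; rewrite big_ord0 mulr0.
rewrite big_ord_recr/= -IH -quadform_rank1 -quadformD; congr quadform.
by apply/funext => a; apply/funext => b; rewrite big_ord_recr.
Qed.

End Cholesky.

Lemma cvg_sum_seq (I : eqType) (r : seq I) (F_ : nat -> I -> R) (F : I -> R) :
  (forall i, i \in r -> F_ n i @[n --> \oo] --> F i) ->
  \sum_(i <- r) F_ n i @[n --> \oo] --> \sum_(i <- r) F i.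
Proof.
elim: r => [|i r IH] F_F.
  by rewrite big_nil; under eq_fun do rewrite big_nil; exact: cvg_cst.
rewrite big_cons; under eq_fun do rewrite big_cons.
apply: cvgD; first by apply: F_F; rewrite mem_head.
by apply: IH => k kr; apply: F_F; rewrite inE kr orbT.
Qed.

Lemma cvg_linform s (x_ : nat -> R -> R) (x : R -> R) :
  (forall p, p \in s -> x_ n p.1 @[n --> \oo] --> x p.1) ->
  linform s (x_ n) @[n --> \oo] --> linform s x.
Proof.
move=> x_x; apply: (@cvg_sum_seq _ s (fun n p => p.2 * x_ n p.1)) => p ps.
by apply: cvgMl_tmp; exact: x_x.
Qed.

Lemma cvg_quadform s (K_ : nat -> R -> R -> R) K : nonneg_times s ->
  (forall a b : R, 0 <= a -> 0 <= b -> K_ n a b @[n --> \oo] --> K a b) ->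
  quadform (K_ n) s @[n --> \oo] --> quadform K s.
Proof.
move=> s0 K_K; apply: cvg_sum_seq => p ps.
apply: (@cvg_sum_seq _ s (fun n q => p.2 * q.2 * K_ n p.1 q.1)) => q qs.
by apply: cvgMl_tmp; apply: K_K; exact: s0.
Qed.

End QuadraticForm.

(** * Dyadic chaining *)

Section Dyadic.
Context {R : realType}.
Implicit Types (m : nat) (t : R) (x y : R -> R).

Lemma dyadic_floor_eq m n t :
  n%:R / 2 ^+ m <= t -> t < n.+1%:R / 2 ^+ m -> dyadic_floor m t = n%:R / 2 ^+ m.
Proof.
have p0 : 0 < 2 ^+ m :> R by rewrite exprn_gt0.
rewrite ler_pdivrMr// ltr_pdivlMr// => n_le n_gt; rewrite /dyadic_floor (@truncn_def _ _ n)//.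
by rewrite mulrC n_le.
Qed.

Lemma dyadic_floor_dyadic m p k :
  (m <= p)%N -> dyadic_floor p (k%:R / 2 ^+ m : R) = k%:R / 2 ^+ m.
Proof.
move=> mp; have -> : k%:R / 2 ^+ m = (k * 2 ^ (p - m))%:R / 2 ^+ p :> R.
  rewrite natrM natrX -{2}(subnK mp) exprD; field.
  by rewrite !expf_neq0.
by apply: dyadic_floor_eq => //; rewrite ltr_pM2r ?ltr_nat// invr_gt0 exprn_gt0.
Qed.

Lemma dyadic_succB m k : k.+1%:R / 2 ^+ m - k%:R / 2 ^+ m = 2 ^- m :> R.
Proof. by rewrite -natr1 mulrDl mul1r addrAC subrr add0r. Qed.

Definition dyadic_increment m x k := x (k.+1%:R / 2 ^+ m) - x (k%:R / 2 ^+ m).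

Lemma dist_dyadic_floorS m j y (e : R) : 0 <= e ->
  (forall k, (k < j * 2 ^ m.+1)%N -> `|dyadic_increment m.+1 y k| <= e) ->
  forall t, 0 <= t <= j%:R -> `|y (dyadic_floor m.+1 t) - y (dyadic_floor m t)| <= e.
Proof.
move=> e0 y_incr t /andP[t0 tj].
have p0 : 0 < 2 ^+ m :> R by rewrite exprn_gt0.
have p1 : 0 < 2 ^+ m.+1 :> R by rewrite exprn_gt0.
set k := Num.truncn (2 ^+ m * t).
have /andP[k_le k_gt] := truncn_itv (mulr_ge0 (ltW p0) t0); rewrite -/k in k_le k_gt.
have -> : dyadic_floor m t = (2 * k)%:R / 2 ^+ m.+1.
  rewrite /dyadic_floor -/k natrM exprS; field; exact: expf_neq0.
have [t_left|t_right] := ltP (2 ^+ m.+1 * t) (2 * k).+1%:R.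
  rewrite (@dyadic_floor_eq m.+1 (2 * k)) ?subrr ?normr0//.
  - by rewrite ler_pdivrMr// natrM exprS [X in _ <= X]mulrCA ler_pM2l// mulrC.
  - by rewrite ltr_pdivlMr// mulrC.
rewrite (@dyadic_floor_eq m.+1 (2 * k).+1).
- apply: y_incr; rewrite -(ltr_nat R) (natrM R j) natrX.
  apply: (@lt_le_trans _ _ (2 ^+ m.+1 * t)); first by rewrite (lt_le_trans _ t_right)// ltr_nat.
  by rewrite mulrC ler_pM2r.
- by rewrite ler_pdivrMr// mulrC.
- rewrite ltr_pdivlMr// mulrC exprS -mulrA.
  have -> : (2 * k).+2%:R = 2 * k.+1%:R :> R by rewrite -natrM; congr (_%:R); lia.
  by rewrite ltr_pM2l.
Qed.

(* The factor [9 / 10] is admissible because [2 * (9 / 10) ^ 4 > 1], see [chaining_ratio]. *)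
Lemma dyadic_chaining m j i y :
  (forall p k, (m <= p < m + i)%N -> (k < j * 2 ^ p.+1)%N ->
     `|dyadic_increment p.+1 y k| <= (9 / 10) ^+ p) ->
  forall t, 0 <= t <= j%:R ->
  `|y (dyadic_floor (m + i) t) - y (dyadic_floor m t)| <=
    10 * ((9 / 10) ^+ m - (9 / 10) ^+ (m + i)).
Proof.
elim: i => [|i IH] y_incr t tj; first by rewrite addn0 !subrr normr0 mulr0.
have dist_i : `|y (dyadic_floor (m + i) t) - y (dyadic_floor m t)| <=
    10 * ((9 / 10) ^+ m - (9 / 10) ^+ (m + i)).
  by apply: IH => // p k /andP[mp pi]; apply: y_incr; rewrite mp/= (leq_trans pi)//; lia.
have dist_last : `|y (dyadic_floor (m + i).+1 t) - y (dyadic_floor (m + i) t)| <=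
  (9 / 10) ^+ (m + i).
  by apply: (@dist_dyadic_floorS _ j) => // k; apply: y_incr; lia.
rewrite addnS (le_trans (ler_distD (y (dyadic_floor (m + i) t)) _ _))//.
rewrite (le_trans (lerD dist_last dist_i))//.
have -> : (9 / 10) ^+ (m + i).+1 = (9 / 10) * (9 / 10) ^+ (m + i) :> R by rewrite exprS.
by move: ((9 / 10) ^+ (m + i)) ((9 / 10) ^+ m) => u v; lra.
Qed.

Lemma chaining_radius_cvg (c : R) : c * (9 / 10) ^+ m @[m --> \oo] --> 0.
Proof. by rewrite -(mulr0 c); apply: cvgMl_tmp; apply: cvg_expr; rewrite ger0_norm; lra. Qed.

Lemma dyadic_floor_left m t :
  0 < t -> exists a : R, a < t /\ forall u, a <= u -> u < t -> dyadic_floor m u = a.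
Proof.
move=> t0; have p0 : 0 < 2 ^+ m :> R by rewrite exprn_gt0.
set k := Num.truncn (2 ^+ m * t).
have /andP[k_le k_gt] := truncn_itv (mulr_ge0 (ltW p0) (ltW t0)); rewrite -/k in k_le k_gt.
have [kt|tk] := ltP (k%:R / 2 ^+ m) t.
  exists (k%:R / 2 ^+ m); split => // u ku ut; apply: dyadic_floor_eq => //.
  by rewrite (lt_trans ut)// ltr_pdivlMr// mulrC.
have tE : t = k%:R / 2 ^+ m by apply/eqP; rewrite eq_le tk/= ler_pdivrMr// mulrC.
have k0 : (0 < k)%N by rewrite lt0n; apply: contraL t0 => /eqP k0; rewrite tE k0 mul0r ltxx.
exists (k.-1%:R / 2 ^+ m); split.
  by rewrite tE ltr_pM2r ?invr_gt0// ltr_nat prednK.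
by move=> u ku ut; apply: dyadic_floor_eq => //; rewrite prednK// -tE.
Qed.

Lemma dyadic_uniform_right_cvg x t : dyadic_uniform x -> 0 <= t -> x @ at_right t --> x t.
Proof.
move=> ux t0; apply/cvgrPdist_le => e e0.
have [m /(_ m (leqnn m)) x_near] := ux (Num.truncn t).+2 _ (divr_gt0 e0 (@ltr0n R 2)).
have /andP[floor_le floor_gt] := dyadic_floor_itv m t0.
have tj : t < (Num.truncn t).+2%:R.
  by have /andP[_ /lt_trans] := truncn_itv t0; apply; rewrite ltr_nat.
near=> u.
have tu : t < u by near: u; exact: nbhs_right_gt.
have uj : u <= (Num.truncn t).+2%:R by near: u; exact: nbhs_right_le.
have u_lt : u < dyadic_floor m t + 2 ^- m by near: u; exact: nbhs_right_lt.
have floorE : dyadic_floor m u = dyadic_floor m t.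
  rewrite {2}/dyadic_floor; apply: dyadic_floor_eq; first exact: le_trans floor_le (ltW tu).
  by rewrite -natr1 mulrDl mul1r.
rewrite (le_trans (ler_distD (x (dyadic_floor m t)) _ _))// [leRHS]splitr lerD//.
  by apply: x_near; rewrite t0 ltW.
by rewrite distrC -floorE; apply: x_near; rewrite uj (ltW (le_lt_trans t0 tu)).
Unshelve. all: by end_near. Qed.

Lemma dyadic_uniform_left_cvg x t : dyadic_uniform x -> 0 < t -> cvg (x @ at_left t).
Proof.
move=> ux t0; apply: cauchy_cvg; apply: cauchy_exP => e e0.
have [m /(_ m (leqnn m)) x_near] := ux (Num.truncn t).+1 _ (divr_gt0 e0 (@ltr0n R 2)).
have [a [at_ floorE]] := dyadic_floor_left m t0.
have /andP[_ tj] := truncn_itv (ltW t0).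
exists (x a); rewrite /nbhs/=; near=> u.
have ut : u < t by near: u; exact: nbhs_left_lt.
have au : a <= u by near: u; exact: nbhs_left_ge.
have u0 : 0 < u by near: u; exact: nbhs_left_gt.
have := x_near u; rewrite (floorE u)// => xu.
rewrite -ball_normE/= distrC (le_lt_trans (xu _))//; last by lra.
by rewrite (ltW u0) (ltW (lt_trans ut tj)).
Unshelve. all: by end_near. Qed.

Lemma dyadic_uniform_cadlag x : dyadic_uniform x -> cadlag x.
Proof.
by move=> ux; split=> t; [exact: dyadic_uniform_right_cvg|exact: dyadic_uniform_left_cvg].
Qed.

End Dyadic.

Section LargeIncrements.
Context {R : realType} {d : measure_display} {T : measurableType d} (P : probability T R).
Variable Y : T -> R -> R.
Hypothesis mY : forall m k, measurable_fun setT (fun w => dyadic_increment m (Y w) k).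

Definition large_increment j m : set T :=
  [set w | exists2 k, (k < j * 2 ^ m.+1)%N & (9 / 10) ^+ m < `|dyadic_increment m.+1 (Y w) k|].

Definition chaining_ratio : R := 2^-1 * (9 / 10) ^- 4.

Lemma chaining_ratio_itv : 0 < chaining_ratio < 1.
Proof.
have -> : chaining_ratio = 10000 / 13122 by rewrite /chaining_ratio; field.
lra.
Qed.

Lemma measurable_large_increment j m : measurable (large_increment j m).
Proof.
apply: (@bigcup_measurable _ _ _ [set k | (k < j * 2 ^ m.+1)%N]) => k _.
exact: measurable_norm_gt.
Qed.

Lemma prob_large_increment_le j m (B : R) :
  (forall k (e : R), 0 < e ->
     prob P [set w | e < `|dyadic_increment m.+1 (Y w) k|] <= B * (2 ^- m.+1) ^+ 2 / e ^+ 4) ->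
  prob P (large_increment j m) <= B / 2 * j%:R * chaining_ratio ^+ m.
Proof.
move=> tail; have r0 : 0 < (9 / 10) ^+ m :> R by rewrite exprn_gt0.
have [_] := @prob_bigcup_ord_le _ _ _ P _ (j * 2 ^ m.+1) _
  (fun k => measurable_norm_gt _ (mY m.+1 k)) (fun k _ => tail k _ r0).
move=> /le_trans; apply; rewrite sumr_const card_ord -[leLHS]mulr_natr le_eqVlt;
  apply/predU1P; left.
have -> : chaining_ratio ^+ m = (2 ^- m) * ((9 / 10) ^+ m) ^- 4 :> R.
  by rewrite exprMn !exprVn -!exprM mulnC.
have p0 : 2 ^+ m != 0 :> R by rewrite expf_neq0.
move: r0; move: ((9 / 10) ^+ m) => r r0; rewrite natrM natrX !(exprS 2 m).
by move: (2 ^+ m) p0 => x p0; field; rewrite p0 lt0r_neq0.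
Qed.

Lemma not_large_increment_dist j m i w :
  (forall p, (m <= p < m + i)%N -> ~ large_increment j p w) ->
  forall t, 0 <= t <= j%:R ->
  `|Y w (dyadic_floor (m + i) t) - Y w (dyadic_floor m t)| <= 10 * (9 / 10) ^+ m.
Proof.
move=> not_large t tj.
apply: (@le_trans _ _ (10 * ((9 / 10) ^+ m - (9 / 10) ^+ (m + i)))).
  apply: (@dyadic_chaining _ m j i) => // p k mpi kj.
  by rewrite leNgt; apply/negP => large; apply: (not_large p) => //; exists k.
have : 0 <= (9 / 10) ^+ (m + i) :> R by rewrite exprn_ge0.
lra.
Qed.

End LargeIncrements.

(** * Construction of Gaussian processes *)

Lemma one_sub_cos_ge {R : realType} (y : R) : `|y| <= 2^-1 -> `|y| ^+ 2 / 4 <= 1 - cos y.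
Proof.
move=> y_le; have := cos_taylor2_bound y; rewrite ler_norml => /andP[_].
rewrite -[y ^+ 2]real_normK ?num_real//.
have := normr_ge0 y; move: (`|y|) (cos y) y_le => u c u_le u0.
have : u ^+ 4 / 2 <= u ^+ 2 / 8.
  have -> : u ^+ 4 / 2 = u ^+ 2 * (u ^+ 2 / 2) by field.
  by apply: ler_wpM2l; [exact: sqr_ge0|nra].
by have := sqr_ge0 u; lra.
Qed.

Section GaussianVariable.
Context {R : realType} {d : measure_display} {T : measurableType d} (P : probability T R).
Variables (Z : T -> R) (V : R).
Hypotheses (mZ : measurable_fun setT Z) (V0 : 0 <= V)
  (Z_char : forall a : R, expect P (fun w => cos (a * Z w)) = expR (- (a ^+ 2 * V / 2))).

Let bmfun_cosZ (a : R) : bmfun (fun w => cos (a * Z w)).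
Proof. by apply: bmfun_cos; exact: measurable_funM. Qed.

Lemma gaussian_one_sub_cos_sqr (a : R) :
  expect P (fun w => (1 - cos (a * Z w)) ^+ 2) <= 3 * (a ^+ 2 * V / 2) ^+ 2.
Proof.
have -> : (fun w => (1 - cos (a * Z w)) ^+ 2) =
    (fun w => (3 / 2 - 2 * cos (a * Z w)) + 2^-1 * cos (2 * a * Z w)).
  apply/funext => w; have -> : 2 * a * Z w = a * Z w + a * Z w by ring.
  rewrite cosD; have := cos2Dsin2 (a * Z w); move: (cos _) (sin _) => c s c2s2.
  have -> : s * s = 1 - c ^+ 2 by rewrite -c2s2; ring.
  by field.
have b1 := bmfun_cosZ a; have b2 := bmfun_cosZ (2 * a).
rewrite expectD; [|by apply: bmfunB; [exact: bmfun_cst|exact: bmfunZ]|exact: bmfunZ].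
rewrite expectB; [|exact: bmfun_cst|exact: bmfunZ].
rewrite expect_cst !expectZ// !Z_char.
have -> : - ((2 * a) ^+ 2 * V / 2) = 4%:R * - (a ^+ 2 * V / 2) by field.
rewrite expRM_natl; set x := a ^+ 2 * V / 2.
have x0 : 0 <= x by rewrite divr_ge0// mulr_ge0// sqr_ge0.
have exp_ge : 1 - x <= expR (- x) by exact: expR_ge1Dx.
have exp_le1 : expR (- x) <= 1 by rewrite -expR0 ler_expR oppr_le0.
have exp_gt0 := expR_gt0 (- x).
move: (expR (- x)) exp_ge exp_le1 exp_gt0 => y y_ge y_le1 y0.
have -> : 3 / 2 - 2 * y + 2^-1 * y ^+ 4 = (1 - y) ^+ 2 * ((y ^+ 2 + 2 * y + 3) / 2) by field.
have sqr_le : (1 - y) ^+ 2 <= x ^+ 2 by rewrite ler_sqr ?nnegrE//; lra.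
have factor_le : (y ^+ 2 + 2 * y + 3) / 2 <= 3 by nra.
rewrite [leRHS]mulrC; apply: ler_pM => //; first exact: sqr_ge0.
by have := sqr_ge0 y; lra.
Qed.

Lemma gaussian_prob_between (e A : R) : 0 < e -> 0 < A ->
  prob P ([set w | e < `|Z w|] `\` [set w | A < `|Z w|]) <= 12 * V ^+ 2 / e ^+ 4.
Proof.
move=> e0 A0; pose a := (2 * A)^-1.
have a0 : 0 < a by rewrite invr_gt0 mulr_gt0.
have aA : a * A = 2^-1 by rewrite /a; field; lra.
have b1 : bmfun (fun w => 1 - cos (a * Z w)) by apply: bmfunB; [exact: bmfun_cst|exact: bmfun_cosZ].
have threshold0 : 0 < (a * e) ^+ 2 / 4 by rewrite divr_gt0// exprn_gt0// mulr_gt0.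
apply: (@le_trans _ _ (prob P [set w | (a * e) ^+ 2 / 4 < `|1 - cos (a * Z w)|])).
  apply: le_prob; [apply: measurableD; exact: measurable_norm_gt|exact: measurable_norm_gt b1.1|].
  move=> w [/= eZ /negP]; rewrite -leNgt => ZA.
  apply: lt_le_trans (ler_norm _); apply: (@lt_le_trans _ _ (`|a * Z w| ^+ 2 / 4)).
    by rewrite ltr_pM2r// ltr_sqr ?nnegrE ?mulr_ge0 ?(ltW a0) ?(ltW e0)// normrM
      (gtr0_norm a0) ltr_pM2l.
  by apply: one_sub_cos_ge; rewrite normrM (gtr0_norm a0) -aA ler_pM2l.
apply: (le_trans (markov_pow P 2 b1 threshold0)); rewrite ler_pdivrMr ?exprn_gt0//.
have -> : 12 * V ^+ 2 / e ^+ 4 * ((a * e) ^+ 2 / 4) ^+ 2 = 3 * (a ^+ 2 * V / 2) ^+ 2 by field; lra.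
apply: le_trans (gaussian_one_sub_cos_sqr a).
by rewrite le_eqVlt; apply/predU1P; left; congr expect; apply/funext => w;
  rewrite real_normK ?num_real.
Qed.

Lemma gaussian_tail (e : R) : 0 < e -> prob P [set w | e < `|Z w|] <= 12 * V ^+ 2 / e ^+ 4.
Proof.
move=> e0; apply/ler_addgt0Pr => eta eta0.
have [A [A0 tail_le]] := exists_tail_prob_le P mZ eta0.
have me := measurable_norm_gt e mZ; have mA := measurable_norm_gt A mZ.
have mB : measurable ([set w | e < `|Z w|] `\` [set w | A < `|Z w|]) by exact: measurableD.
apply: (@le_trans _ _ (prob P (([set w | e < `|Z w|] `\` [set w | A < `|Z w|]) `|`
  [set w | A < `|Z w|]))).
  apply: le_prob => //; first exact: measurableU.
  by move=> w eZ; have [AZ|AZ] := pselect (A < `|Z w|); [right|left].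
by rewrite (le_trans (prob_setU_le _ _ _))// lerD// gaussian_prob_between.
Qed.

End GaussianVariable.

Lemma standard_normal_sum_char {R : realType} {d : measure_display} {T : measurableType d}
    (P : probability T R) (xi : nat -> T -> R) (a : nat -> R) n (b : R) :
  standard_normal_seq P xi ->
  expect P (fun w => cos (\sum_(i < n) a i * xi i w + b)) =
  expR (- ((\sum_(i < n) a i ^+ 2) / 2)) * cos b.
Proof.
move=> [mxi indxi xi_char]; pose phi i (x : R) := a i * x.
have mphi i : measurable_fun setT (phi i) by exact: measurable_funM.
have phi_cos i : expect P (fun w => cos (phi i (xi i w))) = expR (- (a i ^+ 2 / 2)).
  have := xi_char i (a i) 0; rewrite cos0 mulr1 => <-.
  by congr expect; apply/funext => w; rewrite addr0.
have phi_sin i : expect P (fun w => sin (phi i (xi i w))) = 0.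
  have := xi_char i (a i) (- (pi / 2)); rewrite cosN cos_pihalf mulr0 => <-.
  by congr expect; apply/funext => w; rewrite cosB cos_pihalf sin_pihalf mulr0 add0r mulr1.
have [sum_cos sum_sin] :
    expect P (fun w => cos (partial_sum xi phi n w)) = expR (- ((\sum_(i < n) a i ^+ 2) / 2)) /\
    expect P (fun w => sin (partial_sum xi phi n w)) = 0.
  elim: n => [|n [cosn sinn]].
    rewrite big_ord0 mul0r oppr0 expR0.
    have -> : partial_sum xi phi 0 = fun=> 0 by apply/funext => w; rewrite /partial_sum big_ord0.
    by rewrite !expect_cst cos0 sin0.
  rewrite (expect_cos_partial_sumS mxi indxi mphi) (expect_sin_partial_sumS mxi indxi mphi).
  rewrite cosn sinn phi_cos phi_sin !mul0r mulr0 addr0 subr0; split => //.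
  by rewrite -expRD big_ord_recr/=; congr expR; ring.
rewrite (@expect_cosD _ _ _ _ (partial_sum xi phi n)) ?sum_cos ?sum_sin ?mul0r ?subr0//.
by apply: measurable_sum => i; exact: measurableT_comp.
Qed.

Lemma cvg0_of_sqr_le {R : realType} (u v : nat -> R) :
  (forall n, u n ^+ 2 <= v n) -> v n @[n --> \oo] --> 0 -> u n @[n --> \oo] --> 0.
Proof.
move=> uv v0; apply/cvgr0Pnorm_lt => e e0.
have /cvgr0Pnorm_lt/(_ _ (exprn_gt0 2 e0)) := v0.
apply: filterS => n v_lt; rewrite -(@ltr_pXn2r _ 2)// ?nnegrE ?(ltW e0)//.
rewrite real_normK ?num_real// (le_lt_trans (uv n))//.
exact: le_lt_trans (ler_norm _) v_lt.
Qed.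

Lemma borel_cantelli_geometric {R : realType} {d : measure_display} {T : measurableType d}
    (P : probability T R) (F : nat -> set T) (a rho : R) : 0 <= a -> 0 < rho < 1 ->
  (forall n, measurable (F n)) -> (forall n, prob P (F n) <= a * rho ^+ n) ->
    P (lim_sup_set F) = 0%E.
Proof.
move=> a0 /andP[rho0 rho1] mF PF; apply: lim_sup_set_cvg0 => //.
apply: (@le_lt_trans _ _ (a / (1 - rho))%:E); last exact: ltry.
apply: lime_le; first by apply: is_cvg_nneseries => n _ _.
apply: nearW => n.
rewrite (@le_trans _ _ (\sum_(0 <= i < n) (a * rho ^+ i)%:E)%E)//.
  by apply: lee_sum => i _; have := PF i; rewrite -lee_fin -(EFin_prob P (mF i)).
rewrite sumEFin lee_fin.
by have := @geometric_le_lim R n a rho a0 rho0; rewrite (ger0_norm (ltW rho0)) => /(_ rho1).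
Qed.

Record lipschitz_covariance {R : realType} (C : R -> R -> R) (c0 : R) : Prop := {
  covariance_sym : symmetric_kernel C;
  covariance_nonneg : nonneg_definite C;
  covariance_const_ge0 : 0 <= c0;
  covariance_at0 : forall t, C 0 t = 0;
  covariance_increment_le : forall s t : R, 0 <= s -> s <= t ->
    C s s + C t t - 2 * C s t <= c0 * (t - s) }.

Definition gaussian_char {R : realType} {d : measure_display} {T : measurableType d}
    (P : probability T R) (G : T -> R -> R) (C : R -> R -> R) :=
  forall s b, nonneg_times s ->
  expect P (fun w => cos (linform s (G w) + b)) = expR (- (quadform C s / 2)) * cos b.

Section LipschitzCovariance.
Context {R : realType} (C : R -> R -> R) (c0 : R).
Hypothesis covC : lipschitz_covariance C c0.

Let symC := covariance_sym covC.
Let pC := covariance_nonneg covC.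
Let c00 := covariance_const_ge0 covC.

Lemma covariance_diag_le (t : R) : 0 <= t -> C t t <= c0 * t.
Proof.
move=> t0; have := covariance_increment_le covC (lexx 0) t0.
by rewrite !(covariance_at0 covC) mulr0 subr0 add0r subr0.
Qed.

Lemma covariance_sqr_increment_le (a b t : R) : 0 <= a -> a <= b -> 0 <= t ->
  (C b t - C a t) ^+ 2 <= (c0 * t) * (c0 * (b - a)).
Proof.
move=> a0 ab t0; have abs := nonneg_times_increment a0 (le_trans a0 ab).
rewrite !(symC _ t) -linform_increment.
apply: (le_trans (nonneg_definite_cauchy_schwarz symC pC t0 abs)); apply: ler_pM.
- exact: nonneg_definite_diag.
- exact: pC.
- exact: covariance_diag_le.
- by rewrite quadform_increment//; exact: (covariance_increment_le covC).
Qed.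

Lemma covariance_dyadic_floor_cvg (s t : R) : 0 <= s -> 0 <= t ->
  C (dyadic_floor m s) (dyadic_floor m t) @[m --> \oo] --> C s t.
Proof.
move=> s0 t0.
have approx_left (v : nat -> R) (a b : R) : 0 <= a -> (forall m, 0 <= v m <= b) ->
    C a (v m) - C (dyadic_floor m a) (v m) @[m --> \oo] --> 0.
  move=> a0 vb; apply: (@cvg0_of_sqr_le _ _ (fun m => (c0 * b * c0) * 2 ^- m));
    last exact: cvg_half_pow.
  move=> m; have /andP[v0 v_le] := vb m; have /andP[floor_le floor_gt] := dyadic_floor_itv m a0.
  apply: (le_trans (covariance_sqr_increment_le (dyadic_floor_ge0 m a) floor_le v0)).
  rewrite -[leRHS]mulrA; apply: ler_pM; rewrite ?mulr_ge0// ?subr_ge0//; first exact: ler_wpM2l.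
  by apply: ler_wpM2l => //; lra.
have dist_s : C s (dyadic_floor m t) - C (dyadic_floor m s) (dyadic_floor m t) @[m --> \oo] --> 0.
  apply: (approx_left (dyadic_floor ^~ t) s t) => // m.
  by rewrite dyadic_floor_ge0; have /andP[] := dyadic_floor_itv m t0.
have dist_t : C t s - C (dyadic_floor m t) s @[m --> \oo] --> 0.
  by apply: (approx_left (fun=> s) t s) => // m; rewrite s0 lexx.
have -> : (fun m => C (dyadic_floor m s) (dyadic_floor m t)) =
    (fun m => C s t - ((C t s - C (dyadic_floor m t) s) +
       (C s (dyadic_floor m t) - C (dyadic_floor m s) (dyadic_floor m t)))).
  by apply/funext => m; rewrite !(symC _ s); ring.
rewrite -[X in _ --> X]subr0; apply: cvgB; first exact: cvg_cst.
by rewrite -[X in _ --> X]addr0; exact: cvgD.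
Qed.

End LipschitzCovariance.

Section DyadicEnumeration.
Context {R : realType}.

Definition dyadic_enum (n : nat) : R :=
  if unpickle n is Some km then (km : nat * nat).1%:R / 2 ^+ km.2 else 0.

Lemma dyadic_enum_ge0 n : 0 <= dyadic_enum n.
Proof. by rewrite /dyadic_enum; case: unpickle => // km; rewrite divr_ge0// exprn_ge0. Qed.

Definition is_dyadic (t : R) := exists n, t = dyadic_enum n.

Lemma is_dyadic_dyadic k m : is_dyadic (k%:R / 2 ^+ m).
Proof. by exists (pickle (k, m)); rewrite /dyadic_enum pickleK. Qed.

Lemma dyadic_times_bound (s : seq (R * R)) : times_in is_dyadic s ->
  exists n, forall p, p \in s -> exists2 i, (i < n)%N & p.1 = dyadic_enum i.
Proof.
elim: s => [|p s IH] ds; first by exists 0%N.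
have [|n s_lt] := IH; first by move=> r rs; apply: ds; rewrite inE rs orbT.
have [i pi] := ds p (mem_head _ _).
exists (maxn n i.+1) => r; rewrite inE => /predU1P[->|/s_lt[k kn rk]].
  by exists i => //; rewrite leq_max ltnSn orbT.
by exists k => //; rewrite leq_max kn.
Qed.

End DyadicEnumeration.

(* At dyadic times the process is a finite combination, by the Cholesky factors of [C], of the
   normal variables [xi]; chaining extends it to all times, away from the null set
   [irregular] where increments of size [(9 / 10) ^ m] between consecutive dyadics of
   level [m] occur for infinitely many [m]. *)
Section GaussianProcess.
Context {R : realType} {d : measure_display} {T : measurableType d} (P : probability T R).
Variables (C : R -> R -> R) (c0 : R) (xi : nat -> T -> R).
Hypotheses (covC : lipschitz_covariance C c0) (normal_xi : standard_normal_seq P xi).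

Let symC := covariance_sym covC.
Let pC := covariance_nonneg covC.
Let c00 := covariance_const_ge0 covC.
Let L := cholesky C dyadic_enum.

Definition dyadic_process (w : T) (t : R) : R := limn (fun n => \sum_(j < n) L j t * xi j w).

Lemma dyadic_process_sum n i w : (i < n)%N ->
  dyadic_process w (dyadic_enum i) = \sum_(j < n) L j (dyadic_enum i) * xi j w.
Proof.
move=> ni; apply: (cvg_lim (@Rhausdorff R)); apply: cvg_near_cst; near=> p.
have np : (n <= p)%N by near: p; exact: nbhs_infty_ge.
rewrite -(subnKC np) big_split_ord/= [X in _ + X]big1 ?addr0// => j _.
rewrite /L (cholesky_eq0 symC pC dyadic_enum_ge0 ni) ?mul0r//=; exact: leq_addr.
Unshelve. all: by end_near. Qed.

Lemma dyadic_process_char s b : times_in is_dyadic s ->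
  expect P (fun w => cos (linform s (dyadic_process w) + b)) = expR (- (quadform C s / 2)) * cos b.
Proof.
move=> ds; have [n s_lt] := dyadic_times_bound ds.
rewrite (quadform_cholesky symC pC dyadic_enum_ge0 s_lt).
rewrite -(standard_normal_sum_char (fun j => linform s (L j)) n b normal_xi).
congr expect; apply/funext => w; congr (cos (_ + _)).
rewrite /linform; under [RHS]eq_bigr do rewrite mulr_suml.
rewrite exchange_big/= big_seq [RHS]big_seq; apply: eq_bigr => p ps.
have [i ni ->] := s_lt p ps; rewrite (dyadic_process_sum w ni) mulr_sumr.
by apply: eq_bigr => j _; rewrite mulrA.
Qed.

Lemma measurable_dyadic_process (t : R) :
  is_dyadic t -> measurable_fun setT (fun w => dyadic_process w t).
Proof.
have [mxi _ _] := normal_xi.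
move=> [i ->]; under eq_fun do rewrite (dyadic_process_sum _ (ltnSn i)).
by apply: measurable_sum => j; exact: measurable_funM.
Qed.

Lemma measurable_dyadic_process_increment m k :
  measurable_fun setT (fun w => dyadic_increment m (dyadic_process w) k).
Proof.
by apply: measurable_funB; apply: measurable_dyadic_process; exact: is_dyadic_dyadic.
Qed.

Lemma dyadic_process_increment_tail m k (e : R) : 0 < e ->
  prob P [set w | e < `|dyadic_increment m (dyadic_process w) k|] <=
  12 * c0 ^+ 2 * (2 ^- m) ^+ 2 / e ^+ 4.
Proof.
move=> e0; pose s : seq (R * R) := increment_coefs (k%:R / 2 ^+ m) (k.+1%:R / 2 ^+ m).
have kE := @dyadic_succB R m k.
have p0 : 0 <= 2 ^- m :> R by rewrite invr_ge0 exprn_ge0.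
have k0 : 0 <= k%:R / 2 ^+ m :> R by rewrite divr_ge0// exprn_ge0.
have kk : k%:R / 2 ^+ m <= k.+1%:R / 2 ^+ m :> R by lra.
have s0 : nonneg_times s by apply: nonneg_times_increment => //; exact: le_trans kk.
have ds : times_in is_dyadic s by move=> p; rewrite !inE => /orP[] /eqP ->; exact: is_dyadic_dyadic.
have Q_le : quadform C s <= c0 * 2 ^- m.
  by rewrite quadform_increment// -[X in c0 * X]kE; exact: (covariance_increment_le covC).
have incr_char (a : R) : expect P (fun w => cos (a * dyadic_increment m (dyadic_process w) k)) =
    expR (- (a ^+ 2 * quadform C s / 2)).
  have := dyadic_process_char 0 (@times_in_scale _ _ a _ ds);
    rewrite cos0 mulr1 quadform_scale => <-.
  by congr expect; apply/funext => w; rewrite linform_scale linform_increment addr0.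
apply: (le_trans (gaussian_tail (measurable_dyadic_process_increment m k) (pC s0) incr_char e0)).
rewrite ler_pM2r ?invr_gt0 ?exprn_gt0// -mulrA -exprMn ler_pM2l// ler_sqr ?nnegrE//;
  first exact: pC.
exact: mulr_ge0.
Qed.

Definition irregular : set T := \bigcup_j lim_sup_set (large_increment dyadic_process j).

Let m_large j m : measurable (large_increment dyadic_process j m).
Proof. exact: measurable_large_increment measurable_dyadic_process_increment _ _. Qed.

Let m_lim_sup j : measurable (lim_sup_set (large_increment dyadic_process j)).
Proof. by apply: bigcap_measurable => // n _; exact: bigcup_measurable. Qed.

Lemma measurable_irregular : measurable irregular.
Proof. exact: bigcup_measurable. Qed.

Lemma irregular_null : P irregular = 0%E.
Proof.
apply/(negligibleP _ measurable_irregular)/negligible_bigcup => j; apply/negligibleP => //.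
apply: (@borel_cantelli_geometric _ _ _ _ _ (12 * c0 ^+ 2 / 2 * j%:R) chaining_ratio) => //.
- by rewrite !mulr_ge0// sqr_ge0.
- exact: chaining_ratio_itv.
- move=> m; apply: (prob_large_increment_le measurable_dyadic_process_increment) => k e.
  exact: dyadic_process_increment_tail.
Qed.

Lemma regular_uniform_cauchy w : ~ irregular w -> forall j, exists m0, forall m i, (m0 <= m)%N ->
  forall t, 0 <= t <= j%:R ->
  `|dyadic_process w (dyadic_floor (m + i) t) - dyadic_process w (dyadic_floor m t)| <=
    10 * (9 / 10) ^+ m.
Proof.
move=> regw j.
have [m0 not_large] : exists m0, forall m, (m0 <= m)%N -> ~ large_increment dyadic_process j m w.
  apply: contra_notP regw => /forallNP large; exists j => // n _.
  by have /existsNP[m /not_implyP[nm /contrapT large_m]] := large n; exists m.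
exists m0 => m i m0m; apply: not_large_increment_dist => p /andP[mp _].
exact/not_large/(leq_trans m0m).
Qed.

Definition gaussian_path (w : T) (t : R) : R :=
  if w \in irregular then 0 else limn (fun m => dyadic_process w (dyadic_floor m t)).

Lemma gaussian_path_regular w t :
  ~ irregular w -> gaussian_path w t = limn (fun m => dyadic_process w (dyadic_floor m t)).
Proof. by rewrite /gaussian_path; case: ifP => //; rewrite inE. Qed.

Lemma regular_cvg w (t : R) : ~ irregular w -> 0 <= t ->
  dyadic_process w (dyadic_floor m t) @[m --> \oo] --> gaussian_path w t.
Proof.
move=> regw t0; rewrite gaussian_path_regular//.
have [m0 cauchy] := regular_uniform_cauchy regw (Num.truncn t).+1.
have tj : 0 <= t <= (Num.truncn t).+1%:R.
  by rewrite t0 ltW//; have /andP[] := truncn_itv t0.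
apply: cauchy_cvg; apply: cauchy_exP => e e0.
have /cvgr0Pnorm_lt/(_ _ e0)[m1 _ radius_lt] := @chaining_radius_cvg R 10.
exists (dyadic_process w (dyadic_floor (maxn m0 m1) t)); exists (maxn m0 m1) => // p /= p_ge.
rewrite -ball_normE/= distrC -(subnKC p_ge) (le_lt_trans (cauchy _ _ _ _ tj)) ?leq_maxl//.
by apply: le_lt_trans (ler_norm _) (radius_lt _ _); rewrite /= leq_maxr.
Qed.

Lemma regular_uniform_dist w : ~ irregular w -> forall j, exists m0, forall m, (m0 <= m)%N ->
  forall t, 0 <= t <= j%:R ->
  `|gaussian_path w t - dyadic_process w (dyadic_floor m t)| <= 10 * (9 / 10) ^+ m.
Proof.
move=> regw j; have [m0 cauchy] := regular_uniform_cauchy regw j.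
exists m0 => m m0m t tj; have /andP[t0 _] := tj.
have dist_cvg : `|dyadic_process w (dyadic_floor p t) - dyadic_process w (dyadic_floor m t)|
    @[p --> \oo] --> `|gaussian_path w t - dyadic_process w (dyadic_floor m t)|.
  by apply: cvg_norm; apply: cvgB; [exact: regular_cvg|exact: cvg_cst].
rewrite -(cvg_lim (@Rhausdorff R) dist_cvg); apply: limr_le; first exact: cvgP dist_cvg.
by exists m => // p /= mp; rewrite -(subnKC mp); exact: cauchy.
Qed.

Lemma measurable_gaussian_path : measurable_process gaussian_path.
Proof.
move=> t t0; apply: (@measurable_fun_cvg _ _ _ _
  (fun m w => \1_(~` irregular) w * dyadic_process w (dyadic_floor m t))).
  move=> m; apply: measurable_funM; last exact/measurable_dyadic_process/is_dyadic_dyadic.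
  exact/measurable_indic/measurableC/measurable_irregular.
move=> w _; rewrite indicE; have [irrw|regw] := pselect (irregular w).
  rewrite memNset//= /gaussian_path mem_set//; under eq_fun do rewrite mul0r; exact: cvg_cst.
by rewrite mem_set//; under eq_fun do rewrite mul1r; exact: regular_cvg.
Qed.

Lemma gaussian_path_dyadic_uniform w : dyadic_uniform (gaussian_path w).
Proof.
move=> j dl dl0; have [irrw|regw] := pselect (irregular w).
  by exists 0%N => m _ t _; rewrite /gaussian_path mem_set// subrr normr0 ltW.
have [m0 dist] := regular_uniform_dist regw j.
have /cvgr0Pnorm_lt/(_ _ dl0)[m1 _ radius_lt] := @chaining_radius_cvg R 10.
exists (maxn m0 m1) => m; rewrite geq_max => /andP[m0m m1m] t tj.
have -> : gaussian_path w (dyadic_floor m t) = dyadic_process w (dyadic_floor m t).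
  rewrite gaussian_path_regular//; apply: (cvg_lim (@Rhausdorff R)); apply: cvg_near_cst.
  by exists m => // p /= mp; rewrite dyadic_floor_dyadic.
by rewrite (le_trans (dist m m0m t tj))// ltW//; apply: le_lt_trans (ler_norm _) (radius_lt m m1m).
Qed.

Lemma gaussian_path_char : gaussian_char P gaussian_path C.
Proof.
move=> s b s0; pose floors m : seq (R * R) := [seq (dyadic_floor m p.1, p.2) | p <- s].
have dyadic_floors m : times_in is_dyadic (floors m) by move=> p /mapP[q _ ->];
  exact: is_dyadic_dyadic.
have floors_linform m x : linform (floors m) x = linform s (sampled m x).
  by rewrite /linform big_map.
have floors_quadform m :
    quadform C (floors m) = quadform (fun a b => C (dyadic_floor m a) (dyadic_floor m b)) s.
  by rewrite /quadform big_map; apply: eq_bigr => p _; rewrite big_map.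
have m_floors m : measurable_fun setT (fun w => linform (floors m) (dyadic_process w)).
  rewrite (funext (fun w => floors_linform m (dyadic_process w))) /linform.
  apply: measurable_sum => p; apply: measurable_funM => //.
  exact/measurable_dyadic_process/is_dyadic_dyadic.
have cos_cvg : expect P (fun w => cos (linform (floors m) (dyadic_process w) + b)) @[m --> \oo] -->
    expect P (fun w => cos (linform s (gaussian_path w) + b)).
  apply: (@expect_dominated_cvg _ _ _ _ _ _ 1).
  - by move=> m; apply: (bmfun_cos _).1; exact: measurable_funD.
  - apply: (bmfun_cos _).1; apply: measurable_funD => //.
    exact: measurable_linform measurable_gaussian_path _ s0.
  - by move=> m w; rewrite ler_norml cos_geN1 cos_le1.
  - exists irregular; split=> [||w /= ncvg]; [exact: measurable_irregular|exact: irregular_null|].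
    apply: contrapT => regw; apply: ncvg; apply: continuous_cvg; first exact: continuous_cos.
    apply: cvgD; last exact: cvg_cst.
    under eq_fun do rewrite floors_linform; apply: cvg_linform => p ps.
    by apply: regular_cvg => //; exact: s0.
have char_cvg : expR (- (quadform C (floors m) / 2)) * cos b @[m --> \oo] -->
  expR (- (quadform C s / 2)) * cos b.
  apply: cvgMr_tmp; apply: continuous_cvg; first exact: continuous_expR.
  apply: cvgN; apply: cvgMr_tmp; under eq_fun do rewrite floors_quadform.
  by apply: cvg_quadform => // a a'; exact: (covariance_dyadic_floor_cvg covC).
apply: (cvg_unique (@Rhausdorff R) cos_cvg).
by rewrite (funext (fun m => dyadic_process_char b (dyadic_floors m))).
Qed.

End GaussianProcess.

Theorem exists_gaussian_process {R : realType} (C : R -> R -> R) (c0 : R) :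
  lipschitz_covariance C c0 ->
  exists (P : probability R R) (G : R -> R -> R),
  [/\ measurable_process G, forall w, dyadic_uniform (G w) & gaussian_char P G C].
Proof.
move=> covC; have [P [xi normal_xi]] := @exists_standard_normal_seq R.
exists P, (gaussian_path C xi); split.
- exact: measurable_gaussian_path covC normal_xi.
- exact: gaussian_path_dyadic_uniform.
- exact: gaussian_path_char covC normal_xi.
Qed.

(** * Laws and covariances of Gaussian processes *)

Section GaussianSecondMoment.
Context {R : realType} {d : measure_display} {T : measurableType d} (P : probability T R).
Variables (Y : T -> R) (V : R).
Hypotheses (mY : measurable_fun setT Y) (V0 : 0 <= V)
  (Y_char : forall a : R, expect P (fun w => cos (a * Y w)) = expR (- (a ^+ 2 * V / 2))).

Let a n : R := 2 ^- n.

(* Increases to [Y ^ 2], with an expectation given by the characteristic function. *)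
Let f n w := 2 / a n ^+ 2 * (1 - cos (a n * Y w)).

Let a_gt0 n : 0 < a n. Proof. by rewrite invr_gt0 exprn_gt0. Qed.

Let a_sqr_cvg (B : R) : B * a n ^+ 2 @[n --> \oo] --> 0.
Proof.
rewrite -(mulr0 B); apply: cvgMl_tmp.
have -> : (fun n => a n ^+ 2) = (fun n => 4^-1 ^+ n :> R).
  by apply/funext => n; rewrite /a -exprVn -exprM mulnC exprM; congr (_ ^+ _); field.
by apply: cvg_expr; rewrite ger0_norm ?invr_ge0//; lra.
Qed.

Let f_nondecreasing w n : f n w <= f n.+1 w.
Proof.
have aE : a n = 2 * a n.+1 by rewrite /a exprS; field; exact: expf_neq0.
rewrite /f aE; move: (a n.+1) (a_gt0 n.+1) => b b0.
have -> : 2 * b * Y w = b * Y w + b * Y w by ring.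
rewrite cosD; have := cos2Dsin2 (b * Y w); have := cos_le1 (b * Y w); have := cos_geN1 (b * Y w).
move: (cos _) (sin _) => c s c_ge c_le c2s2.
have -> : s * s = 1 - c ^+ 2 by rewrite -c2s2; ring.
have -> : 2 / (2 * b) ^+ 2 * (1 - (c * c - (1 - c ^+ 2))) = b ^- 2 * (1 - c) * (1 + c).
  by field; lra.
have -> : 2 / b ^+ 2 * (1 - c) = b ^- 2 * (1 - c) * 2 by ring.
by apply: ler_wpM2l; [rewrite mulr_ge0 ?invr_ge0 ?sqr_ge0//|]; lra.
Qed.

Let f_cvg w : f n w @[n --> \oo] --> Y w ^+ 2.
Proof.
apply/cvgrPdist_le => e e0.
have /cvgr0Pnorm_lt/(_ _ e0) := a_sqr_cvg (Y w ^+ 4).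
apply: filterS => n /ltW; rewrite ger0_norm; last by rewrite mulr_ge0 ?sqr_ge0// exprn_even_ge0.
apply: le_trans; have := cos_taylor2_bound (a n * Y w); have := a_gt0 n.
rewrite /f; move: (a n) => b b0 taylor.
have b2 : 0 < b ^+ 2 by rewrite exprn_gt0.
have -> : Y w ^+ 2 - 2 / b ^+ 2 * (1 - cos (b * Y w)) =
  (2 / b ^+ 2) * (cos (b * Y w) - 1 + (b * Y w) ^+ 2 / 2) by field; lra.
rewrite normrM ger0_norm; last by rewrite divr_ge0// ltW.
have -> : Y w ^+ 4 * b ^+ 2 = (2 / b ^+ 2) * (`|b * Y w| ^+ 4 / 2).
  rewrite normrM exprMn (gtr0_norm b0) -normrX (ger0_norm (_ : 0 <= Y w ^+ 4)) ?exprn_even_ge0//.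
  by field; lra.
by rewrite ler_wpM2l// divr_ge0// ltW.
Qed.

Let bmfun_f n : bmfun (f n).
Proof.
by apply: bmfunZ; apply: bmfunB; [exact: bmfun_cst|apply: bmfun_cos; exact: measurable_funM].
Qed.

Let expect_f n : expect P (f n) = 2 / a n ^+ 2 * (1 - expR (- (a n ^+ 2 * V / 2))).
Proof.
have b1 : bmfun (fun w => cos (a n * Y w)) by apply: bmfun_cos; exact: measurable_funM.
rewrite /f expectZ; last by apply: bmfunB => //; exact: bmfun_cst.
by rewrite expectB// ?expect_cst ?Y_char//; exact: bmfun_cst.
Qed.

Let expect_f_cvg : expect P (f n) @[n --> \oo] --> V.
Proof.
apply/cvgrPdist_le => e e0.
have /cvgr0Pnorm_lt/(_ _ e0) := a_sqr_cvg (V ^+ 2 / 2).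
apply: filterS => n /ltW; rewrite ger0_norm; last by rewrite mulr_ge0 ?sqr_ge0// divr_ge0// sqr_ge0.
apply: le_trans; rewrite expect_f; have := a_gt0 n; move: (a n) => b b0.
have b2 : 0 < b ^+ 2 by rewrite exprn_gt0.
have x0 : 0 <= b ^+ 2 * V / 2 by rewrite divr_ge0// mulr_ge0// ltW.
have taylor := expR_taylor1_bound x0.
have -> : V - 2 / b ^+ 2 * (1 - expR (- (b ^+ 2 * V / 2))) =
  - (2 / b ^+ 2) * (1 - (b ^+ 2 * V / 2) - expR (- (b ^+ 2 * V / 2))) by field; lra.
have b3 : 0 <= 2 / b ^+ 2 by rewrite divr_ge0// ltW.
rewrite normrM normrN (ger0_norm b3).
have -> : V ^+ 2 / 2 * b ^+ 2 = (2 / b ^+ 2) * (b ^+ 2 * V / 2) ^+ 2 by field; lra.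
by rewrite ler_wpM2l// divr_ge0// ltW.
Qed.

Lemma gaussian_second_moment : (\int[P]_w (Y w ^+ 2)%:E)%E = V%:E.
Proof.
have mf n : measurable_fun setT (EFin \o f n) by exact/measurable_EFinP/(bmfun_f n).1.
have int_cvg : (\int[P]_w (f n w)%:E)%E @[n --> \oo] --> (\int[P]_w (Y w ^+ 2)%:E)%E.
  have -> : (fun w => (Y w ^+ 2)%:E) = (fun w => limn (fun n => (f n w)%:E)).
    apply/funext => w; apply/esym; apply: (cvg_lim (@ereal_hausdorff R)).
    by apply: cvg_EFin; [exact: nearW|exact: f_cvg].
  apply: (@cvg_monotone_convergence _ _ _ P setT measurableT (fun n w => (f n w)%:E) mf).
    move=> n w _; rewrite lee_fin; apply: mulr_ge0; last by rewrite subr_ge0 cos_le1.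
    by rewrite divr_ge0// sqr_ge0.
  move=> w _ p q pq; rewrite lee_fin.
  exact: (@homo_leq _ (fun n => f n w) <=%R (@lexx _ _) (@le_trans _ _) (f_nondecreasing w)).
apply: (cvg_unique (@ereal_hausdorff R) int_cvg).
rewrite (funext (fun n => integral_expect P (bmfun_f n))).
by apply: cvg_EFin; [exact: nearW|exact: expect_f_cvg].
Qed.

End GaussianSecondMoment.

Section GaussianLaw.
Context {R : realType} {d : measure_display} {T : measurableType d} (P : probability T R).
Variables (Y : T -> R) (V : R).
Hypotheses (mY : measurable_fun setT Y) (V0 : 0 <= V)
  (Y_char : forall a b : R, expect P (fun w => cos (a * Y w + b)) =
    expR (- (a ^+ 2 * V / 2)) * cos b).

Lemma gaussian_law_degenerate (A : set R) : V = 0 -> measurable A -> P (Y @^-1` A) = \d_(0 : R) A.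
Proof.
move=> V_eq0 mA; have mc : measurable_fun setT (fun _ : T => (0 : R)) by exact: measurable_cst.
have Y_cos a b : expect P (fun w => cos (a * Y w + b)) = expect P (fun w => cos (a * 0 + b)).
  rewrite Y_char V_eq0 mulr0 mul0r oppr0 expR0 mul1r -[LHS](expect_cst P).
  by congr expect; apply/funext => w; rewrite mulr0 add0r.
rewrite (eq_law_of_expect mY mc (eq_expect_of_cos mY mc Y_cos) mA) diracE /preimage.
have [A0|nA0] := pselect (A 0).
  rewrite mem_set//; have -> : [set _ | A 0] = [set: T] by apply/seteqP; split.
  exact: probability_setT.
rewrite memNset//; have -> : [set _ | A 0] = set0 :> set T by apply/seteqP; split.
exact: measure0.
Qed.

Lemma gaussian_law (A : set R) : 0 < V -> measurable A ->
  P (Y @^-1` A) = normal_prob 0 (Num.sqrt V) A.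
Proof.
move=> V_gt0 mA; have sd_gt0 : 0 < Num.sqrt V by rewrite sqrtr_gt0.
have [nu [nuE nu_cos]] := exists_normal sd_gt0.
have mid : measurable_fun setT (fun x : R => x) by exact: measurable_id.
rewrite -nuE//; apply: (eq_law_of_expect mY mid (eq_expect_of_cos mY mid _) mA).
by move=> a b; rewrite Y_char nu_cos sqr_sqrtr.
Qed.

End GaussianLaw.

Section GaussianProcessSpec.
Context {R : realType} {d : measure_display} {T : measurableType d} (P : probability T R).
Variables (G : T -> R -> R) (C : R -> R -> R).
Hypotheses (symC : symmetric_kernel C) (pC : nonneg_definite C)
  (mG : measurable_process G) (G_char : gaussian_char P G C).

Lemma gaussian_char_scale s (a b : R) : nonneg_times s ->
  expect P (fun w => cos (a * linform s (G w) + b)) = expR (- (a ^+ 2 * quadform C s / 2)) * cos b.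
Proof.
move=> s0; rewrite -quadform_scale -G_char; last exact: (times_in_scale (D := fun t => 0 <= t)).
by congr expect; apply/funext => w; rewrite linform_scale.
Qed.

Lemma centred_gaussian_process_of_char :
  (forall w, cadlag (G w)) -> centred_gaussian_process P G.
Proof.
move=> G_cadlag; split => //; split => // s s0.
have Q0 := pC s0; exists (Num.sqrt (quadform C s)); split; first exact: sqrtr_ge0.
have mY := measurable_linform mG s0; have Y_char a b := gaussian_char_scale a b s0.
move=> A mA; have [|sd_neq0] := eqVneq (Num.sqrt (quadform C s)) 0.
  move=> /eqP; rewrite sqrtr_eq0 => Q_le0; apply: (gaussian_law_degenerate mY Y_char _ mA).
  by apply/eqP; rewrite eq_le Q0 andbT.
by apply: (gaussian_law mY Q0 Y_char) => //; rewrite -sqrtr_gt0 lt_neqAle eq_sym sd_neq0 sqrtr_ge0.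
Qed.

Lemma gaussian_linform_sqr s : nonneg_times s ->
  P.-integrable setT (EFin \o (fun w => linform s (G w) ^+ 2)) /\
  \int[P]_w (linform s (G w) ^+ 2) = quadform C s.
Proof.
move=> s0; have mY := measurable_linform mG s0.
have moment : (\int[P]_w (linform s (G w) ^+ 2)%:E)%E = (quadform C s)%:E.
  apply: gaussian_second_moment => //; first exact: pC.
  move=> a; have := gaussian_char_scale a 0 s0; rewrite cos0 mulr1 => <-.
  by congr expect; apply/funext => w; rewrite addr0.
split; last by rewrite /Rintegral moment.
apply/integrableP; split; first by apply/measurable_EFinP; exact: measurable_funX.
rewrite (_ : (fun x => _) = (fun w => (linform s (G w) ^+ 2)%:E)) ?moment ?ltry//.
by apply/funext => w /=; rewrite ger0_norm// sqr_ge0.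
Qed.

Lemma gaussian_covariance (s t : R) : 0 <= s -> 0 <= t ->
  (\int[P]_w (G w s * G w t)%:E)%E = (C s t)%:E.
Proof.
move=> s0 t0.
have single u : 0 <= u -> nonneg_times [:: (u, 1 : R)] by move=> u0 p; rewrite inE => /eqP ->.
have [int_s moment_s] := gaussian_linform_sqr (single s s0).
have [int_t moment_t] := gaussian_linform_sqr (single t t0).
have [int_st moment_st] := gaussian_linform_sqr (nonneg_times_increment s0 t0).
pose squares w := linform [:: (s, 1)] (G w) ^+ 2 + linform [:: (t, 1)] (G w) ^+ 2.
pose polar w := squares w - linform (increment_coefs s t) (G w) ^+ 2.
have int_squares : P.-integrable setT (EFin \o squares).
  exact: (integrableD measurableT int_s int_t).
have int_polar : P.-integrable setT (EFin \o polar).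
  exact: (integrableB measurableT int_squares int_st).
have -> : (fun w => (G w s * G w t)%:E) = EFin \o (fun w => 2^-1 * polar w).
  apply/funext => w; rewrite /= /polar /squares linform_increment /linform !big_seq1/=.
  by congr (_%:E); field.
have int_half : P.-integrable setT (EFin \o (fun w => 2^-1 * polar w)).
  exact: (integrableZl measurableT 2^-1 int_polar).
rewrite -(fineK (integrable_fin_num measurableT int_half)); congr (_%:E).
transitivity (\int[P]_w (2^-1 * polar w)) => //.
rewrite (RintegralZl _ measurableT int_polar) (RintegralB measurableT int_squares int_st).
rewrite (RintegralD measurableT int_s int_t) moment_s moment_t moment_st quadform_increment//.
by rewrite /quadform !big_seq1/=; field.
Qed.

End GaussianProcessSpec.

(** * Unfolded radii *)

Section DistributionFunctions.
Context {R : realType} {d : measure_display} {T : measurableType d} (P : probability T R).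
Variable z : nat -> T -> R.

Definition cdf_at j (x : R) := prob P [set w | z j w <= x].

Definition strict_cdf_at j (x : R) := prob P [set w | z j w < x].

Lemma cdf_at_ge0 j x : 0 <= cdf_at j x.
Proof. exact: prob_ge0. Qed.

Lemma strict_cdf_at_ge0 j x : 0 <= strict_cdf_at j x.
Proof. exact: prob_ge0. Qed.

Hypothesis mz : forall j, measurable_fun setT (z j).

Lemma cdf_at_le1 j x : cdf_at j x <= 1.
Proof. by apply: prob_le1; exact: measurable_set_le. Qed.

Lemma cdf_at_mono j (x y : R) : x <= y -> cdf_at j x <= cdf_at j y.
Proof. by move=> xy; apply: le_prob; [exact: measurable_set_le..|move=> w /= /le_trans; exact]. Qed.

Lemma strict_cdf_at_mono j (x y : R) : x <= y -> strict_cdf_at j x <= strict_cdf_at j y.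
Proof.
by move=> xy; apply: le_prob; [exact: measurable_set_lt..|move=> w /= /lt_le_trans; exact].
Qed.

Lemma strict_cdf_at_left_cvg j (x : R) :
  strict_cdf_at j (x - n.+1%:R^-1) @[n --> \oo] --> strict_cdf_at j x.
Proof.
apply: prob_cvg_ae; [by move=> n; exact: measurable_set_lt|exact: measurable_set_lt|apply/aeW => w].
have [zx|xz] := ltP (z j w) x; last first.
  apply: nearW => n; have n0 : (0 : R) <= n.+1%:R^-1 by rewrite invr_ge0.
  by apply/idP/idP; rewrite !inE/=; move: (n.+1%:R^-1) n0 => y y0 ?; lra.
have gap0 : 0 < x - z j w by rewrite subr_gt0.
have := near_infty_natSinv_lt (PosNum gap0).
by apply: filterS => n /= n_lt; apply/idP/idP; rewrite !inE/=;
  move: (n.+1%:R^-1) n_lt => y y_lt ?; lra.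
Qed.

Lemma strict_cdf_at_right_cvg j (x : R) :
  strict_cdf_at j (x + n.+1%:R^-1) @[n --> \oo] --> cdf_at j x.
Proof.
apply: prob_cvg_ae; [by move=> n; exact: measurable_set_lt|exact: measurable_set_le|apply/aeW => w].
have [zx|xz] := leP (z j w) x.
  by apply: nearW => n; rewrite !mem_set//= (le_lt_trans zx)// ltrDl invr_gt0.
have gap0 : 0 < z j w - x by rewrite subr_gt0.
have := near_infty_natSinv_lt (PosNum gap0).
by apply: filterS => n /= n_lt; apply/idP/idP; rewrite !inE/=;
  move: (n.+1%:R^-1) n_lt => y y_lt ?; lra.
Qed.

Lemma strict_cdf_at_infty_cvg j : strict_cdf_at j n%:R @[n --> \oo] --> (1 : R).
Proof.
rewrite -[X in _ --> X](prob_setT P); apply: prob_cvg_ae => //.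
  by move=> n; exact: measurable_set_lt.
apply/aeW => w; near=> n; rewrite !mem_set//=.
by near: n; exact: nbhs_infty_gtr.
Unshelve. all: by end_near. Qed.

End DistributionFunctions.

Section Unfolding.
Context {R : realType} {d : measure_display} {T : measurableType d} (P : probability T R).
Variables (z : nat -> T -> R) (total : R -> R).
Local Notation F := (strict_cdf_at P z).
Hypotheses (mz : forall j, measurable_fun setT (z j))
  (total_cvg : forall x : R, \sum_(j < n) F j x @[n --> \oo] --> total x)
  (total_nonpos : forall x : R, x <= 0 -> total x = 0).

Definition unfolded j w := total (z j w).

Local Notation p := (cdf_at P unfolded).

Lemma sum_le_total n (x : R) : \sum_(j < n) F j x <= total x.
Proof.
have incr : {homo (fun k => \sum_(j < k) F j x) : k l / (k <= l)%N >-> k <= l}.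
  move=> k l kl; rewrite -(subnKC kl) big_split_ord/= lerDl.
  by apply: sumr_ge0 => i _; exact: strict_cdf_at_ge0.
rewrite -(cvg_lim (@Rhausdorff R) (@total_cvg x)).
exact: (nondecreasing_cvgn_le incr (cvgP _ (@total_cvg x))).
Qed.

Lemma total_le (x c : R) : (forall n, \sum_(j < n) F j x <= c) -> total x <= c.
Proof.
move=> sum_le; rewrite -(cvg_lim (@Rhausdorff R) (@total_cvg x)).
by apply: limr_le; [exact: cvgP (@total_cvg x)|exact: nearW].
Qed.

Lemma total_mono (x y : R) : x <= y -> total x <= total y.
Proof.
move=> xy; apply: total_le => n; apply: le_trans (sum_le_total n y).
by apply: ler_sum => i _; exact: strict_cdf_at_mono.
Qed.

Lemma measurable_total : measurable_fun setT total.
Proof. by apply: nondecreasing_measurable => // x y; exact: total_mono. Qed.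

Lemma measurable_unfolded j : measurable_fun setT (unfolded j).
Proof. exact: measurableT_comp measurable_total (mz j). Qed.

Lemma total_left_le (x r : R) : (forall y, y < x -> total y <= r) -> total x <= r.
Proof.
move=> left_le; apply: total_le => n.
have sum_cvg : \sum_(j < n) F j (x - m.+1%:R^-1) @[m --> \oo] --> \sum_(j < n) F j x.
  by apply: cvg_sum_seq => j _; exact: strict_cdf_at_left_cvg.
rewrite -(cvg_lim (@Rhausdorff R) sum_cvg); apply: limr_le; first exact: cvgP sum_cvg.
apply: nearW => m; apply: le_trans (sum_le_total n _) _; apply: left_le.
by rewrite gtrBl invr_gt0.
Qed.

Lemma total_unbounded (r : R) : exists x, r < total x.
Proof.
pose n := (Num.truncn `|r|).+2.
have : \sum_(j < n) F j m%:R @[m --> \oo] --> \sum_(j < n) (1 : R).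
  by apply: cvg_sum_seq => j _; exact: strict_cdf_at_infty_cvg.
rewrite sumr_const card_ord => /cvgrPdist_lt/(_ 1 ltr01)[m _ /(_ m (leqnn _))].
rewrite ltr_norml => /andP[_ sum_gt]; exists m%:R; apply: lt_le_trans (sum_le_total n _).
have /andP[_ r_lt] := truncn_itv (normr_ge0 r).
have : n%:R = (Num.truncn `|r|).+1%:R + 1 :> R by rewrite natr1.
have := ler_norm r; rewrite /= in sum_gt; lra.
Qed.

Lemma total_level (r : R) : 0 <= r -> exists x0, forall x, (total x <= r) = (x <= x0).
Proof.
move=> r0; pose A := [set x | total x <= r].
have [u ru] := total_unbounded r.
have A0 : A 0 by rewrite /A/= total_nonpos.
have Au : ubound A u.
  by move=> x; rewrite /A/= => xr; rewrite leNgt; apply/negP => ux;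
    have := total_mono (ltW ux); lra.
have supA : has_sup A by split; [exists 0|exists u].
exists (sup A) => x; apply/idP/idP => [xr|x_le]; first exact: sup_upper_bound.
apply: le_trans (total_mono x_le) _; apply: total_left_le => y y_lt.
have [v /= vr yv] : exists2 v, A v & y < v.
  have e0 : 0 < sup A - y by rewrite subr_gt0.
  by have [v Av v_gt] := sup_adherent e0 supA; exists v => //; lra.
exact: le_trans (total_mono (ltW yv)) vr.
Qed.

Lemma total_sum_uniform (x e : R) : 0 < e ->
  exists N, forall n y, (N <= n)%N -> y <= x -> total y <= \sum_(j < n) F j y + e.
Proof.
move=> e0; have /cvgrPdist_le/(_ _ e0)[N _ /(_ N (leqnn N))] := @total_cvg x.
rewrite ler_norml => /andP[_ /= tail_le]; exists N => n y Nn yx; apply: total_le => k.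
have [kn|/ltnW nk] := leqP k n.
  rewrite -(subnKC kn) big_split_ord/= -addrA lerDl addr_ge0 ?(ltW e0)// sumr_ge0// => i _.
  exact: strict_cdf_at_ge0.
rewrite -(subnKC nk) big_split_ord/= lerD2l.
apply: (@le_trans _ _ (\sum_(i < k - n) F (n + i) x)).
  by apply: ler_sum => i _; exact: strict_cdf_at_mono.
have := sum_le_total (n + (k - n)) x; rewrite big_split_ord/=.
have : \sum_(j < N) F j x <= \sum_(j < n) F j x.
  by rewrite -(subnKC Nn) big_split_ord/= lerDl sumr_ge0// => i _; exact: strict_cdf_at_ge0.
lra.
Qed.

Section Level.
Variables (r x0 : R).
Hypothesis x0P : forall x, (total x <= r) = (x <= x0).

Let cdf_unfoldedE j : p j r = cdf_at P z j x0.
Proof. by congr prob; apply/seteqP; split => w /=; rewrite /unfolded x0P. Qed.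

Let strict_cdf_sum_cvg n : \sum_(j < n) F j (x0 + m.+1%:R^-1) @[m --> \oo] --> \sum_(j < n) p j r.
Proof. by apply: cvg_sum_seq => j _; rewrite cdf_unfoldedE; exact: strict_cdf_at_right_cvg. Qed.

Lemma level_lower (e : R) : 0 < e -> exists N, forall n, (N <= n)%N -> r - e <= \sum_(j < n) p j r.
Proof.
move=> e0; have [N uniform] := total_sum_uniform (x0 + 1) e0; exists N => n Nn.
rewrite -(cvg_lim (@Rhausdorff R) (@strict_cdf_sum_cvg n)); apply: limr_ge.
  exact: cvgP (@strict_cdf_sum_cvg n).
apply: nearW => m.
have : r < total (x0 + m.+1%:R^-1) by rewrite ltNge x0P -ltNge ltrDl invr_gt0.
have : total (x0 + m.+1%:R^-1) <= \sum_(j < n) F j (x0 + m.+1%:R^-1) + e.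
  by apply: uniform => //; rewrite lerD2l invf_le1 ?ltr0n// ler1n.
lra.
Qed.

Lemma level_bounded n : \sum_(j < n) p j r <= total (x0 + 1).
Proof.
apply: le_trans (sum_le_total n _); apply: ler_sum => j _; rewrite cdf_unfoldedE; apply: le_prob.
- exact: measurable_set_le.
- exact: measurable_set_lt.
- by move=> w /=; lra.
Qed.

Lemma level_value j : p j r <= p j (total x0).
Proof.
rewrite cdf_unfoldedE; apply: le_prob; first exact: measurable_set_le.
  exact/measurable_set_le/measurable_unfolded.
by move=> w /= ?; exact: total_mono.
Qed.

Lemma level_below n (r' : R) : r' < total x0 -> \sum_(j < n) p j r' <= r.
Proof.
move=> r'_lt; have total_r : total x0 <= r by rewrite x0P.
apply: le_trans total_r; apply: le_trans (sum_le_total n _); apply: ler_sum => j _; apply: le_prob.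
- exact/measurable_set_le/measurable_unfolded.
- exact: measurable_set_lt.
- move=> w /= z_le; rewrite ltNge; apply/negP => x0z.
  by have := total_mono x0z; rewrite /unfolded in z_le; lra.
Qed.

End Level.

Lemma unfolded_lower (r e : R) : 0 <= r -> 0 < e ->
  exists N, forall n, (N <= n)%N -> r - e <= \sum_(j < n) p j r.
Proof. by move=> r0 e0; have [x0 x0P] := total_level r0; exact: level_lower x0P _ e0. Qed.

(* The jumps of [total] are bounded because the sum is [c * Sig r + O(1)] with [Sig] continuous. *)
Lemma unfolded_upper (Sig : R -> R) (c E r0 : R) : 0 <= c -> 0 <= r0 ->
  (forall (r : R) n, r0 <= r -> \sum_(j < n) p j r <= c * Sig r + E) ->
  (forall r : R, r0 <= r -> exists n, c * Sig r - E <= \sum_(j < n) p j r) ->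
  (forall r : R, r0 < r -> Sig x @[x --> r^'-] --> Sig r) ->
  exists M : R, forall (r : R) n, 0 <= r -> \sum_(j < n) p j r <= r + M.
Proof.
move=> c0 r00 sum_le sum_ge Sig_left.
have mono j := @cdf_at_mono _ _ _ P unfolded measurable_unfolded j.
have [y0 y0P] := total_level r00.
exists (maxr (2 * E) (total (y0 + 1))) => r n r_ge0; have [x0 x0P] := total_level r_ge0.
have total_r : total x0 <= r by rewrite x0P.
apply: (@le_trans _ _ (\sum_(j < n) p j (total x0))); first by apply: ler_sum => j _;
  exact: level_value.
have [small|large] := leP (total x0) r0.
  apply: (@le_trans _ _ (\sum_(j < n) p j r0)); first by apply: ler_sum => j _; exact: mono.
  by apply: (le_trans (level_bounded y0P n)); rewrite ler_wpDl// le_max lexx orbT.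
have Sig_le : c * Sig (total x0) <= r + E.
  have left_cvg : c * Sig x @[x --> (total x0)^'-] --> c * Sig (total x0) by apply: cvgMl_tmp;
    exact: Sig_left.
  rewrite -(cvg_lim (@Rhausdorff R) left_cvg); apply: limr_le; first exact: cvgP left_cvg.
  near=> y.
  have y_lt : y < total x0 by near: y; exact: nbhs_left_lt.
  have y_ge : r0 <= y by near: y; exact: nbhs_left_ge.
  by have [k k_ge] := sum_ge y y_ge; have := level_below x0P k y_lt; lra.
have := sum_le (total x0) n (ltW large).
have : 2 * E <= maxr (2 * E) (total (y0 + 1)) by rewrite le_max lexx.
lra.
Unshelve. all: by end_near. Qed.

End Unfolding.

(** * Tail functions and Riemann sums *)

Record tail_function {R : realType} (Phi : R -> R) : Prop := {
  tail_ge0 : forall x, 0 <= Phi x;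
  tail_le1 : forall x, Phi x <= 1;
  tail_nonincreasing : forall x y, x <= y -> Phi y <= Phi x;
  tail_cvg : forall (x_ : nat -> R) (x : R), x_ n @[n --> \oo] --> x ->
    Phi (x_ n) @[n --> \oo] --> Phi x;
  tail_summable : exists K, forall n, \sum_(j < n) Phi j.+1%:R <= K }.

Section TailOfLaw.
Context {R : realType}.
Variables (Phi : R -> R) (nu : probability R R).
Hypotheses (nu_dom : nu `<< (@lebesgue_measure R)) (nu_moment : (\int[nu]_x (`|x|)%:E < +oo)%E)
  (PhiE : forall x, Phi x = prob nu `]x, +oo[%classic).

Lemma law_tail_cvg (x_ : nat -> R) (x : R) :
  x_ n @[n --> \oo] --> x -> Phi (x_ n) @[n --> \oo] --> Phi x.
Proof.
move=> x_x; rewrite PhiE; under eq_fun do rewrite PhiE.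
apply: prob_cvg_ae => //.
have nu_x0 : nu [set x] = 0%E.
  by move/null_content_dominatesP: nu_dom; apply => //; exact: lebesgue_measure_set1.
exists [set x]; split => // y /= y_ncvg; apply: contrapT => /eqP yx; apply: y_ncvg.
have dist0 : 0 < `|y - x| by rewrite normr_gt0 subr_eq0.
move/cvgrPdist_lt: x_x => /(_ _ dist0); apply: filterS => n.
have [xy|xy] := ltP x y.
  rewrite [`|y - x|]gtr0_norm ?subr_gt0// ltr_norml => /andP[? ?].
  by rewrite !mem_set//= in_itv/= andbT; lra.
rewrite [`|y - x|]ler0_norm ?subr_le0// ltr_norml => /andP[? ?].
by rewrite !memNset//= in_itv/= andbT; apply/negP; rewrite -leNgt; lra.
Qed.

Lemma sum_indic_ray_le (x : R) n :
  \sum_(j < n) \1_(`]j.+1%:R, +oo[%classic) x <= `|x|.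
Proof.
elim: n => [|n IH]; first by rewrite big_ord0.
rewrite big_ord_recr/=; have [n_lt|x_le] := ltP n.+1%:R x; last first.
  rewrite [X in _ + X](_ : _ = 0) ?addr0//.
  by rewrite indicE memNset//= in_itv/= andbT; apply/negP; rewrite -leNgt.
rewrite (le_trans _ (ler_norm x))// (le_trans _ (ltW n_lt))// -natr1 lerD//.
rewrite -[X in _ <= X%:R](card_ord n) -sumr_const; apply: ler_sum => j _.
by rewrite indicE; case: (_ \in _).
Qed.

Lemma law_tail_summable n : \sum_(j < n) Phi j.+1%:R <= fine (\int[nu]_x (`|x|)%:E)%E.
Proof.
have bray j : bmfun (\1_(`]j.+1%:R, +oo[%classic) : R -> R) by exact: bmfun_indic.
have -> : \sum_(j < n) Phi j.+1%:R = expect nu (fun x =>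
  \sum_(j < n) \1_(`]j.+1%:R, +oo[%classic) x).
  by rewrite expect_sum//; apply: eq_bigr => j _; rewrite expect_indic// PhiE.
have bsum := bmfun_sum (index_enum 'I_n) xpredT (fun j : 'I_n => bray j).
have moment_fin : (\int[nu]_x (`|x|)%:E)%E \is a fin_num.
  by rewrite ge0_fin_numE//; apply: integral_ge0 => x _; rewrite lee_fin.
rewrite -lee_fin (fineK moment_fin) -(integral_expect nu bsum); apply: ge0_le_integral => //.
- by move=> x _; rewrite lee_fin sumr_ge0.
- by apply/measurable_EFinP; exact: bsum.1.
- by apply/measurable_EFinP; exact: normr_measurable.
- by move=> x _; rewrite lee_fin sum_indic_ray_le.
Qed.

End TailOfLaw.

Lemma Phi_tail_tail_function {R : realType} (Phi : R -> R) : Phi_tail Phi -> tail_function Phi.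
Proof.
move=> [nu [nu_dom [nu_moment PhiE]]]; split.
- by move=> x; rewrite PhiE fine_ge0.
- by move=> x; rewrite PhiE; exact: (@prob_le1 _ _ _ nu).
- move=> x y xy; rewrite !PhiE; apply: (@le_prob _ _ _ nu) => // u /=.
  by rewrite !in_itv/= !andbT; exact: le_lt_trans.
- exact: (law_tail_cvg nu_dom PhiE).
- by exists (fine (\int[nu]_x (`|x|)%:E)%E); exact: (law_tail_summable nu_moment PhiE).
Qed.

Section MeshCells.
Context {R : realType}.
Local Notation leb := (@lebesgue_measure R).

Definition mesh_cell (a : R) (j : nat) : set R := `](a * j%:R), (a * j.+1%:R)]%classic.

Lemma measurable_mesh_cell a j : measurable (mesh_cell a j).
Proof. exact: measurable_itv. Qed.

Lemma integral_mesh_cell_cst (a c : R) j : 0 < a -> 0 <= c ->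
  (\int[leb]_(x in mesh_cell a j) c%:E)%E = (a * c)%:E.
Proof.
move=> a0 c0; rewrite integral_cst; last exact: measurable_mesh_cell.
transitivity (c%:E * a%:E)%E; last by rewrite -EFinM mulrC.
congr (_ * _)%E; rewrite [LHS]lebesgue_measure_itv/= lte_fin ltr_pM2l// ltr_nat ltnSn -EFinB.
by rewrite -natr1 mulrDr mulr1 addrAC subrr add0r.
Qed.

Lemma ge0_integral_mesh_cells (f : R -> \bar R) (a : R) n : 0 < a ->
  measurable_fun setT f -> (forall x, 0 <= f x)%E ->
  (\int[leb]_(x in `]0%R, (a * n%:R)%R]%classic) f x =
   \sum_(j < n) \int[leb]_(x in mesh_cell a j) f x)%E.
Proof.
move=> a0 mf f0; elim: n => [|n IH]; first by rewrite big_ord0 mulr0 set_itvoc0 integral_set0.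
have an : 0 <= a * n%:R by rewrite mulr_ge0// ltW.
have anS : a * n%:R <= a * n.+1%:R by rewrite ler_pM2l// ler_nat.
have -> : `]0, (a * n.+1%:R)]%classic = `]0, (a * n%:R)]%classic `|` mesh_cell a n :> set R.
  apply/seteqP; split => x /=; rewrite /mesh_cell/= !in_itv/=.
    by move=> /andP[x0 xn]; have [?|?] := leP x (a * n%:R); [left|right]; rewrite ?x0 ?xn.
  by move=> [/andP[-> x_le]|/andP[x_gt ->]]; rewrite ?andbT ?(le_trans x_le)// (le_lt_trans an).
rewrite ge0_integral_setU ?IH ?big_ord_recr//=.
- exact: measurable_mesh_cell.
- exact: measurable_funTS.
- by apply/disj_set2P/seteqP; split => x //=;
    rewrite /mesh_cell/= !in_itv/= => -[/andP[_ ?] /andP[? _]]; lra.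
Qed.

Variable g : R -> R.
Hypotheses (g_ge0 : forall x, 0 <= g x) (g_nonincr : forall x y : R, x <= y -> g y <= g x).

Lemma measurable_nonincreasing_EFin (D : set R) : measurable D -> measurable_fun D (EFin \o g).
Proof. by move=> mD; apply/measurable_EFinP; apply: nonincreasing_measurable. Qed.

Lemma nonincreasing_riemann_bounds (a : R) n : 0 < a ->
  ((\sum_(j < n) a * g (a * j.+1%:R))%:E <= \int[leb]_(x in `]0%R, (a * n%:R)%R]%classic) (g x)%:E
   <= (\sum_(j < n) a * g (a * j%:R))%:E)%E.
Proof.
move=> a0; rewrite ge0_integral_mesh_cells//; last exact: measurable_nonincreasing_EFin.
have mg D mD := @measurable_nonincreasing_EFin D mD.
rewrite -!sumEFin; apply/andP; split; apply: lee_sum => j _; rewrite -(integral_mesh_cell_cst j)//.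
- apply: ge0_le_integral; [exact: measurable_mesh_cell|by move=> x _; rewrite lee_fin|
    exact: measurable_cst|by apply: mg; exact: measurable_mesh_cell|].
  by move=> x; rewrite /mesh_cell/= in_itv/= => /andP[_ ?]; rewrite lee_fin g_nonincr.
- apply: ge0_le_integral; [exact: measurable_mesh_cell|by move=> x _; rewrite lee_fin|
    by apply: mg; exact: measurable_mesh_cell|exact: measurable_cst|].
  by move=> x; rewrite /mesh_cell/= in_itv/= => /andP[/ltW ? _]; rewrite lee_fin g_nonincr.
Qed.

Lemma riemann_left_le_right (a : R) n : 0 < a ->
  \sum_(j < n) a * g (a * j%:R) <= \sum_(j < n) a * g (a * j.+1%:R) + a * g 0.
Proof.
move=> a0; suff -> : \sum_(j < n) a * g (a * j%:R) =
    \sum_(j < n) a * g (a * j.+1%:R) + a * g 0 - a * g (a * n%:R).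
  by rewrite gerBl mulr_ge0// ltW.
elim: n => [|n IH]; first by rewrite !big_ord0 mulr0 add0r subrr.
by rewrite !big_ord_recr/= IH; ring.
Qed.

Lemma nonincreasing_riemann_dist (a : R) n : 0 < a ->
  \sum_(j < n) a * g (a * j.+1%:R) <= \int[leb]_(x in `]0%R, (a * n%:R)%R]%classic) g x
    <= \sum_(j < n) a * g (a * j.+1%:R) + a * g 0.
Proof.
move=> a0; have /andP[right_le le_left] := nonincreasing_riemann_bounds n a0.
have intE : (\int[leb]_(x in `]0%R, (a * n%:R)%R]%classic) (g x)%:E)%E =
    (\int[leb]_(x in `]0%R, (a * n%:R)%R]%classic) g x)%:E.
  rewrite fineK// ge0_fin_numE; first exact: le_lt_trans le_left (ltry _).
  by apply: integral_ge0 => x _; rewrite lee_fin.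
rewrite intE !lee_fin in right_le le_left.
by rewrite right_le (le_trans le_left)// riemann_left_le_right.
Qed.

End MeshCells.

Section TailDominated.
Context {R : realType}.
Local Notation leb := (@lebesgue_measure R).
Local Notation pos_half_line := (`]0, +oo[%classic : set R).
Variable Phi : R -> R.
Hypothesis tailPhi : tail_function Phi.

Record tail_dominated (k : R) (g : R -> R) : Prop := {
  dominated_nonincreasing : forall x y, x <= y -> g y <= g x;
  dominated_itv : forall x, 0 <= g x <= 1;
  dominated_le : forall x, 0 < x -> g x <= Phi (k * x) }.

Lemma tail_dominated_scale (k l : R) : 0 < k -> k <= l -> tail_dominated k (fun x => Phi (l * x)).
Proof.
move=> k0 kl; have l0 : 0 < l by exact: lt_le_trans kl.
split=> [x y xy|x|x x0].
- by apply: (tail_nonincreasing tailPhi); rewrite ler_pM2l.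
- by rewrite (tail_ge0 tailPhi) (tail_le1 tailPhi).
- by apply: (tail_nonincreasing tailPhi); rewrite ler_pM2r.
Qed.

Lemma tail_dominatedM k (g h : R -> R) : tail_dominated k g -> tail_dominated k h ->
  tail_dominated k (fun x => g x * h x).
Proof.
move=> [g_nonincr g01 g_le] [h_nonincr h01 _]; split=> [x y xy|x|x x0].
- have /andP[? _] := g01 y; have /andP[? _] := h01 y; apply: ler_pM => //;
    [exact: g_nonincr|exact: h_nonincr].
- have /andP[? ?] := g01 x; have /andP[? ?] := h01 x; by rewrite mulr_ge0// mulr_ile1.
- have /andP[? _] := g01 x; have /andP[? ?] := h01 x; apply: le_trans (g_le x x0).
  by rewrite ler_piMr.
Qed.

Lemma tail_dominated_ge0 k g x : tail_dominated k g -> 0 <= g x.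
Proof. by move=> dom_g; have /andP[] := dominated_itv dom_g x. Qed.

Lemma measurable_tail_dominated k g D :
  tail_dominated k g -> measurable D -> measurable_fun D (EFin \o g).
Proof.
by move=> dom_g; apply: measurable_nonincreasing_EFin; exact: dominated_nonincreasing dom_g.
Qed.

Lemma bigcup_scaled_itv (a : R) : 0 < a -> \bigcup_n `]0, (a * n%:R)]%classic = pos_half_line.
Proof.
move=> a0; apply/seteqP; split => x; first by move=> [n _] /=; rewrite !in_itv/= andbT => /andP[].
rewrite /= in_itv/= andbT => x0; exists (Num.truncn (x / a)).+1 => //=.
rewrite in_itv/= x0/= mulrC -ler_pdivrMr// ltW//.
by have /andP[] := truncn_itv (divr_ge0 (ltW x0) (ltW a0)).
Qed.

Lemma integrable_scaled_tail (k : R) :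
  0 < k -> leb.-integrable pos_half_line (EFin \o (fun x => Phi (k * x))).
Proof.
move=> k0; have dom_k := tail_dominated_scale k0 (lexx k);
  have mg := measurable_tail_dominated dom_k.
apply/integrableP; split; first exact: mg.
under eq_integral do rewrite /= (ger0_norm (tail_ge0 tailPhi _)).
have a0 : 0 < k^-1 by rewrite invr_gt0.
have [K sum_le] := tail_summable tailPhi.
have int_cvg : (\int[leb]_(x in `]0%R, (k^-1 * n%:R)%R]%classic) (Phi (k * x))%:E)%E
  @[n --> \oo] -->
    (\int[leb]_(x in pos_half_line) (Phi (k * x))%:E)%E.
  rewrite -(bigcup_scaled_itv a0).
  apply: (@ge0_nondecreasing_set_cvg_integral _ (measurableTypeR R)).
  - move=> m n mn; apply/subsetPset => x /=; rewrite !in_itv/= => /andP[-> /le_trans]; apply.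
    by rewrite ler_pM2l// ler_nat.
  - by move=> n; exact: measurable_itv.
  - by move=> n; exact: mg.
  - by move=> n x _; rewrite lee_fin (tail_ge0 tailPhi).
apply: (@le_lt_trans _ _ (k^-1 * K + k^-1)%:E); last exact: ltry.
rewrite -(cvg_lim (@ereal_hausdorff R) int_cvg); apply: lime_le; first exact: cvgP int_cvg.
apply: nearW => n; have g0 x := tail_dominated_ge0 x dom_k.
have /andP[_] := nonincreasing_riemann_bounds g0 (dominated_nonincreasing dom_k) n a0.
move=> /le_trans; apply; rewrite lee_fin (le_trans (riemann_left_le_right g0 n a0))// lerD//.
  rewrite -mulr_sumr ler_pM2l// (le_trans _ (sum_le n))//; apply: ler_sum => j _.
  by rewrite mulrA divff ?lt0r_neq0// mul1r.
by rewrite ger_pMr// (tail_le1 tailPhi).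
Qed.

Lemma integrable_tail_dominated k g : 0 < k -> tail_dominated k g ->
  leb.-integrable pos_half_line (EFin \o g).
Proof.
move=> k0 dom_g; have mg : measurable_fun pos_half_line (EFin \o g).
  exact: (measurable_tail_dominated dom_g).
apply: (@le_integrable _ _ _ leb _ (measurable_itv _) _ (EFin \o (fun x => Phi (k * x)))) => //;
  last exact: integrable_scaled_tail.
move=> x; rewrite /= in_itv/= andbT => x0.
by rewrite lee_fin !ger0_norm ?(tail_ge0 tailPhi) ?(tail_dominated_ge0 _ dom_g)//;
  exact: (dominated_le dom_g).
Qed.

Definition open_initial_segment (ap : \bar R) : set R := [set x : R | (0 < x)%R /\ (x%:E < ap)%E].

Lemma open_initial_segment_infty : open_initial_segment +oo%E = pos_half_line.
Proof.
by rewrite /open_initial_segment; apply/seteqP; split => x /=; rewrite in_itv/= ltry andbT; [case|].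
Qed.

Lemma measurable_open_initial_segment ap : measurable (open_initial_segment ap).
Proof.
case: ap => [a| |].
- have -> : open_initial_segment a%:E = `]0, a[%classic.
    rewrite /open_initial_segment; apply/seteqP; split => x /=; rewrite in_itv/= lte_fin.
      by move=> [-> ->].
    by move=> /andP[].
  exact: measurable_itv.
- by rewrite open_initial_segment_infty; exact: measurable_itv.
- have -> : open_initial_segment -oo%E = set0.
    by apply/seteqP; split => x //= [_]; rewrite ltNge leNye.
  exact: measurable0.
Qed.

Lemma integrable_open_initial_segment k g ap : 0 < k -> tail_dominated k g ->
  leb.-integrable (open_initial_segment ap) (EFin \o g).
Proof.
move=> k0 dom_g; apply: (@integrableS _ _ _ leb pos_half_line)
  (integrable_tail_dominated k0 dom_g) => //.
  exact: measurable_open_initial_segment.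
by move=> x [x0 _]; rewrite /= in_itv/= x0.
Qed.

Lemma near_mem_open_initial_segment (b_ : nat -> R) (ap : \bar R) (x : R) :
  (b_ n)%:E @[n --> \oo] --> ap -> 0 < x -> x%:E <> ap ->
  \forall n \near \oo, (x \in `]0%R, b_ n]%classic) = (x \in open_initial_segment ap).
Proof.
move=> b_ap x0 x_neq; suff : \forall n \near \oo, (x <= b_ n) = (x%:E < ap)%E.
  by apply: filterS => n le_lt; apply/idP/idP; rewrite !inE/= in_itv/= x0 le_lt //= => -[].
case: ap b_ap x_neq => [a| |] b_ap x_neq.
- have {}b_ap : b_ n @[n --> \oo] --> a by exact: (fine_cvg b_ap).
  have dist0 : 0 < `|a - x| by rewrite normr_gt0 subr_eq0; apply/eqP => ax;
    apply: x_neq; rewrite ax.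
  move/cvgrPdist_lt: b_ap => /(_ _ dist0); apply: filterS => n; rewrite lte_fin.
  have [xa|ax] := ltP x a.
    by rewrite [`|a - x|]gtr0_norm ?subr_gt0// ltr_norml => /andP[? ?]; lra.
  by rewrite [`|a - x|]ler0_norm ?subr_le0// ltr_norml => /andP[? ?]; lra.
- by move/cvgeyPge: b_ap => /(_ x); apply: filterS => n; rewrite lee_fin ltry => ->.
- move/cvgeNyPle: b_ap => /(_ (x - 1)); apply: filterS => n; rewrite lee_fin ltNge leNye/= => ?.
  lra.
Qed.

Lemma integral_initial_segment_cvg (g_ : nat -> R -> R) (g : R -> R) (b_ : nat -> R)
  (ap : \bar R) (k : R) :
  0 < k -> (forall n, tail_dominated k (g_ n)) -> tail_dominated k g ->
  (forall x, g_ n x @[n --> \oo] --> g x) -> (b_ n)%:E @[n --> \oo] --> ap ->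
  (\int[leb]_(x in `]0%R, b_ n]%classic) (g_ n x)%:E)%E @[n --> \oo] -->
  (\int[leb]_(x in open_initial_segment ap) (g x)%:E)%E.
Proof.
move=> k0 dom_g_ dom_g g_g b_ap; have m_seg := measurable_open_initial_segment ap.
have to_half_line (D : set R) (h : R -> R) : D `<=` pos_half_line ->
    (\int[leb]_(x in D) (h x)%:E)%E = (\int[leb]_(x in pos_half_line) ((EFin \o h) \_ D) x)%E.
  by move=> D_pos; rewrite -integral_mkcondr setIidr.
rewrite to_half_line => [|x [x0 _]]; last by rewrite /= in_itv/= x0.
under eq_fun => n.
  by rewrite to_half_line => [|x]; [over|rewrite /= !in_itv/= andbT => /andP[]].
have [] := @dominated_convergence _ _ _ leb pos_half_line (measurable_itv _)
  (fun n => (EFin \o g_ n) \_ `]0%R, b_ n]%classic) ((EFin \o g) \_ (open_initial_segment ap))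
  (EFin \o (fun x => Phi (k * x))).
- move=> n; apply: measurable_funTS; apply/(measurable_restrictT _ _).1 => //.
  exact: measurable_tail_dominated (dom_g_ n) _.
- apply: measurable_funTS; apply/(measurable_restrictT _ _).1 => //.
  by apply: (measurable_tail_dominated dom_g).
- exists [set fine ap]; split; [exact: measurable_set1|exact: lebesgue_measure_set1|].
  move=> x /= x_ncvg; apply: contrapT => /eqP x_neq; apply: x_ncvg; rewrite /= in_itv/= andbT => x0.
  have x_ap : x%:E <> ap by move=> xE; move: x_neq; rewrite -xE/= eqxx.
  have mem_near := near_mem_open_initial_segment b_ap x0 x_ap.
  rewrite /patch; case: ifPn => x_seg.
    have gx_cvg : (g_ n x)%:E @[n --> \oo] --> (g x)%:E by apply: cvg_EFin;
      [exact: nearW|exact: g_g].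
    apply: cvg_trans gx_cvg; apply: near_eq_cvg.
    by move: mem_near; apply: filterS => n ->; rewrite x_seg.
  by apply: cvg_near_cst; move: mem_near; apply: filterS => n ->; rewrite (negbTE x_seg).
- exact: integrable_scaled_tail.
- apply/aeW => x n; rewrite /= in_itv/= andbT => x0.
  rewrite /patch; case: ifPn => _; last by rewrite abse0 lee_fin (tail_ge0 tailPhi).
  by rewrite /= lee_fin ger0_norm ?(tail_dominated_ge0 _ (dom_g_ n))//;
    exact: (dominated_le (dom_g_ n)).
by move=> _ _; exact.
Qed.

Lemma riemann_sum_cvg (a_ : nat -> R) (N_ : nat -> nat) (g_ : nat -> R -> R) (g : R -> R)
  (ap : \bar R) (k : R) :
  0 < k -> (forall n, 0 < a_ n) -> a_ n @[n --> \oo] --> 0 ->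
  (forall n, tail_dominated k (g_ n)) -> tail_dominated k g ->
  (forall x, g_ n x @[n --> \oo] --> g x) -> (a_ n * (N_ n)%:R)%:E @[n --> \oo] --> ap ->
  \sum_(j < N_ n) a_ n * g_ n (a_ n * j.+1%:R) @[n --> \oo] -->
  \int[leb]_(x in open_initial_segment ap) g x.
Proof.
move=> k0 a0 a_cvg0 dom_g_ dom_g g_g aN_ap.
have int_fin := @integrable_fin_num _ _ _ leb _ (measurable_open_initial_segment ap) _
  (integrable_open_initial_segment ap k0 dom_g).
have int_cvg := integral_initial_segment_cvg k0 dom_g_ dom_g g_g aN_ap.
rewrite -(fineK int_fin) in int_cvg; have {}int_cvg := fine_cvg int_cvg.
pose J n := \int[leb]_(x in `]0%R, (a_ n * (N_ n)%:R)%R]%classic) g_ n x.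
have J_cvg : J n @[n --> \oo] --> \int[leb]_(x in open_initial_segment ap) g x by exact: int_cvg.
apply: (@squeeze_cvgr _ _ _ _ (fun n => J n - a_ n) J); last 2 first.
- by rewrite -[X in _ --> X]subr0; apply: cvgB.
- exact: J_cvg.
apply: nearW => n; have g_ge0 x := tail_dominated_ge0 x (dom_g_ n).
have /andP[] := nonincreasing_riemann_dist g_ge0 (dominated_nonincreasing (dom_g_ n)) (N_ n) (a0 n).
move=> sum_le J_le; rewrite sum_le andbT lerBlDr (le_trans J_le)// lerD2l ger_pMr//.
by have /andP[] := dominated_itv (dom_g_ n) 0.
Qed.

Lemma tail_riemann_bounds : exists c : R, 0 <= c /\ forall a : R, 0 < a ->
  (forall n, \sum_(j < n) a * Phi (a * j.+1%:R) <= c) /\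
  exists n, c - 2 * a <= \sum_(j < n) a * Phi (a * j.+1%:R).
Proof.
have dom1 : tail_dominated 1 Phi.
  by have := tail_dominated_scale ltr01 (lexx 1); under eq_fun do rewrite mul1r.
pose integral_to a n := (\int[leb]_(x in `]0%R, (a * n%:R)%R]%classic) (Phi x)%:E)%E.
pose c := \int[leb]_(x in open_initial_segment +oo%E) Phi x.
have Phi_ge0 := tail_ge0 tailPhi.
exists c; split; first by apply: fine_ge0; apply: integral_ge0 => x _; rewrite lee_fin.
have int_fin := @integrable_fin_num _ _ _ leb _ (measurable_open_initial_segment +oo%E) _
  (integrable_open_initial_segment +oo%E ltr01 dom1).
move=> a a0; have riemann n := nonincreasing_riemann_dist Phi_ge0 (tail_nonincreasing tailPhi) n a0.
split => [n|].
  have /andP[sum_le _] := nonincreasing_riemann_bounds Phi_ge0 (tail_nonincreasing tailPhi) n a0.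
  rewrite -lee_fin (le_trans sum_le)// fineK//; apply: ge0_subset_integral => //.
  - exact: measurable_open_initial_segment.
  - exact: measurable_tail_dominated dom1 (measurable_open_initial_segment _).
  - by move=> x _; rewrite lee_fin.
  - by move=> x /=; rewrite in_itv/= => /andP[x0 _]; split; rewrite ?ltry.
have int_cvg : fine (integral_to a n) @[n --> \oo] --> c.
  apply: (@fine_cvg _ _ _ _ (integral_to a)); rewrite /c /Rintegral fineK//.
  apply: (@integral_initial_segment_cvg (fun=> Phi) Phi (fun n => a * n%:R) +oo%E 1) => //.
    by move=> x; exact: cvg_cst.
  apply/cvgeyPge => A; near=> n; rewrite lee_fin mulrC -ler_pdivrMr//.
  by near: n; exact: nbhs_infty_ger.
move/cvgrPdist_lt: int_cvg => /(_ _ a0)[n _ /(_ n (leqnn _))] /=;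
  rewrite ltr_norml => /andP[_ near_c].
exists n; have /andP[_] := riemann n; rewrite /Rintegral -/(integral_to a n).
have : a * Phi 0 <= a by rewrite ger_pMr// (tail_le1 tailPhi).
lra.
Unshelve. all: by end_near. Qed.

End TailDominated.

Section SobolevSum.
Context {R : realType}.
Local Notation leb := (@lebesgue_measure R).
Variables (Psi g : R -> R).
Hypotheses (int_Psi : leb.-integrable setT (EFin \o Psi)) (int_g : leb.-integrable setT (EFin \o g))
  (Psi_primitive : forall x y : R, x <= y ->
     (\int[leb]_(u in `[x, y]) (g u)%:E)%E = (Psi y - Psi x)%:E).

Let mPsi : measurable_fun setT Psi.
Proof. by have := measurable_int _ int_Psi; move/measurable_EFinP. Qed.

Let mg : measurable_fun setT g.
Proof. by have := measurable_int _ int_g; move/measurable_EFinP. Qed.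

Lemma measurable_norm_EFin (f : R -> R) (D : set R) :
  measurable_fun setT f -> measurable_fun D (fun x => `|f x|%:E).
Proof.
move=> mf; apply: (@measurable_funTS _ _ _ _ D); apply/measurable_EFinP.
exact: measurableT_comp.
Qed.

Lemma integral_norm_fin_num (f : R -> R) (D : set R) : measurable D ->
  leb.-integrable setT (EFin \o f) -> (\int[leb]_(x in D) `|f x|%:E)%E \is a fin_num.
Proof.
move=> mD int_f; have mf : measurable_fun setT f by have := measurable_int _ int_f;
  move/measurable_EFinP.
rewrite ge0_fin_numE; last by apply: integral_ge0 => x _; rewrite lee_fin.
have [_] := integrableP _ _ _ int_f; apply: le_lt_trans.
by apply: ge0_subset_integral => //; exact: measurable_norm_EFin.
Qed.

Lemma norm_primitive_le (x y b : R) : b < x -> x <= y ->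
  `|Psi y| <= `|Psi x| + fine (\int[leb]_(u in `]b, y]%classic) `|g u|%:E).
Proof.
move=> bx xy; suff : `|Psi y - Psi x| <= fine (\int[leb]_(u in `]b, y]%classic) `|g u|%:E).
  by have := ler_normD (Psi x) (Psi y - Psi x); rewrite addrC subrK; lra.
rewrite -lee_fin fineK; last by apply: integral_norm_fin_num => //; exact: measurable_itv.
have -> : `|Psi y - Psi x|%:E = `|\int[leb]_(u in `[x, y]) (g u)%:E|%E by rewrite Psi_primitive.
apply: (@le_trans _ _ (\int[leb]_(u in `[x, y]) `|g u|%:E)%E).
  apply: (le_abse_integral leb (measurable_itv `[x, y])).
  by apply/measurable_EFinP; exact: measurable_funTS.
apply: ge0_subset_integral => //; first exact: measurable_norm_EFin.
by move=> u /=; rewrite !in_itv/= => /andP[xu ->]; rewrite andbT (lt_le_trans bx xu).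
Qed.

Lemma sobolev_mesh_cell (a : R) j : 0 < a ->
  ((a * `|Psi (a * j.+1%:R)|)%:E <=
   \int[leb]_(x in mesh_cell a j) `|Psi x|%:E + a%:E * \int[leb]_(x in mesh_cell a j) `|g x|%:E)%E.
Proof.
move=> a0; have m_cell := @measurable_mesh_cell R a j;
  have mPsi_cell := @measurable_norm_EFin Psi (mesh_cell a j) mPsi.
have var_fin := integral_norm_fin_num m_cell int_g.
have var_ge0 : 0 <= fine (\int[leb]_(x in mesh_cell a j) `|g x|%:E).
  by apply: fine_ge0; apply: integral_ge0 => x _; rewrite lee_fin.
rewrite -[X in (_ + _ * X)%E](fineK var_fin) -EFinM -(integral_mesh_cell_cst j a0 var_ge0).
rewrite -(integral_mesh_cell_cst j a0 (normr_ge0 _)).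
rewrite -ge0_integralD//; do ?[by move=> x _; rewrite lee_fin].
apply: ge0_le_integral => //.
- by apply: emeasurable_funD => //; exact: measurable_cst.
- by move=> x; rewrite /mesh_cell/= in_itv/= => /andP[? ?];
    rewrite -EFinD lee_fin norm_primitive_le.
Qed.

Lemma sobolev_riemann_bounded : exists K : R, 0 <= K /\ forall (a : R) n, 0 < a -> a <= 1 ->
  \sum_(j < n) a * `|Psi (a * j.+1%:R)| <= K.
Proof.
exists (fine (\int[leb]_x `|Psi x|%:E) + fine (\int[leb]_x `|g x|%:E)); split.
  by apply: addr_ge0; apply: fine_ge0; apply: integral_ge0 => x _; rewrite lee_fin.
move=> a n a0 a1; rewrite -lee_fin EFinD !fineK; [|exact: integral_norm_fin_num..].
have cells_le (f : R -> R) : measurable_fun setT f ->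
    (\sum_(j < n) \int[leb]_(x in mesh_cell a j) `|f x|%:E <= \int[leb]_x `|f x|%:E)%E.
  move=> mf; rewrite -ge0_integral_mesh_cells//; last exact: measurable_norm_EFin.
  by apply: ge0_subset_integral => //; exact: measurable_norm_EFin.
rewrite -sumEFin; apply: (@le_trans _ _ (\sum_(j < n) (\int[leb]_(x in mesh_cell a j) `|Psi x|%:E +
    \int[leb]_(x in mesh_cell a j) `|g x|%:E))%E).
  apply: lee_sum => j _; apply: (le_trans (sobolev_mesh_cell j a0)); rewrite leeD2l//.
  rewrite -[leRHS]mul1e lee_wpmul2r ?lee_fin//.
  by apply: integral_ge0 => x _; rewrite lee_fin.
by rewrite big_split/= leeD ?cells_le.
Qed.

End SobolevSum.

Record tail_approximation {R : realType} (p : nat -> R -> R) (Sig Phi : R -> R)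
  (E r0 : R) : Prop := {
  approximation_r0_gt0 : 0 < r0;
  approximation_const_ge0 : 0 <= E;
  approximation_Sig_ge1 : forall r : R, r0 <= r -> 1 <= Sig r;
  approximation_sum_le : forall (r : R) n, r0 <= r ->
    \sum_(j < n) `|p j r - Phi (j.+1%:R / Sig r)| <= E }.

Lemma exists_tail_approximation {R : realType} (p : nat -> R -> R) (Sig Phi Psi : R -> R)
    (theta : R -> nat -> R) (C : R) :
  Sig x @[x --> +oo] --> +oo -> W11 Psi -> (forall r k, 0 <= theta r k) ->
  (fun r => \sum_(1 <= k <oo) (theta r k)%:E)%E x @[x --> +oo] --> 0%E -> 0 < C ->
  (\forall r \near +oo, forall k : nat, (0 < k)%N ->
     `|p k r - Phi (k%:R / Sig r) - (Sig r)^-1 * Psi (k%:R / Sig r)| <= C * theta r k) ->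
  exists E r0 : R, tail_approximation (fun j => p j.+1) Sig Phi E r0.
Proof.
move=> Sig_infty [int_Psi [g [int_g Psi_primitive]]] theta_ge0 theta_cvg C0 p_expansion.
have [K [K0 Psi_sum_le]] := sobolev_riemann_bounded int_Psi int_g Psi_primitive.
have Sig_ge1 : \forall r \near +oo, 1 <= Sig r by move/cvgryPge: Sig_infty => /(_ 1).
have theta_le1 : \forall r \near +oo, (\sum_(1 <= k <oo) (theta r k)%:E <= 1)%E.
  have /fine_cvgP[theta_fin /cvgr0Pnorm_le/(_ _ ltr01) theta_near] := theta_cvg.
  near=> r; have fin_r : (\sum_(1 <= k <oo) (theta r k)%:E)%E \is a fin_num by near: r.
  by rewrite -(fineK fin_r) lee_fin (le_trans (ler_norm _))//; near: r; exact: theta_near.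
have [r0 [_ beyond]] : \forall r \near +oo,
  [/\ 1 <= Sig r, (\sum_(1 <= k <oo) (theta r k)%:E <= 1)%E &
    forall k : nat, (0 < k)%N ->
      `|p k r - Phi (k%:R / Sig r) - (Sig r)^-1 * Psi (k%:R / Sig r)| <= C * theta r k].
  by near=> r; split; near: r.
have r0_lt (r : R) : `|r0| + 1 <= r -> r0 < r by have := ler_norm r0; lra.
exists (K + C), (`|r0| + 1); split; [by rewrite ltr_wpDl|by rewrite addr_ge0// ltW|
  by move=> r /r0_lt/beyond[]|].
move=> r n /r0_lt/beyond[Sig1 theta1 expansion].
have a0 : 0 < (Sig r)^-1 by rewrite invr_gt0 (lt_le_trans ltr01).
have a1 : (Sig r)^-1 <= 1 by rewrite invf_le1// (lt_le_trans ltr01).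
have theta_sum : \sum_(j < n) theta r j.+1 <= 1.
  rewrite -lee_fin; apply: le_trans theta1; rewrite -sumEFin.
  have := @nneseries_lim_ge R (fun k => (theta r k)%:E) xpredT 1 n.+1.
  by rewrite big_add1/= big_mkord; apply => k _ _; rewrite lee_fin.
have C_sum : C * \sum_(j < n) theta r j.+1 <= C by rewrite ler_piMr// ltW.
apply: le_trans (lerD (Psi_sum_le _ n a0 a1) C_sum).
rewrite mulr_sumr -big_split/=; apply: ler_sum => j _.
have := expansion j.+1 isT; rewrite (mulrC (Sig r)^-1 j.+1%:R).
move: (p _ _ - _) (Psi _) => x y xy_le.
rewrite -{1}(subrKC ((Sig r)^-1 * y) x) (le_trans (ler_normD _ _))// lerD//.
by rewrite normrM (gtr0_norm a0).
Unshelve. all: by end_near. Qed.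

(** * Asymptotic covariances *)

Record counting_asymptotics {R : realType} (p : nat -> R -> R) (Sig Phi : R -> R)
  (c r0 M : R) : Prop := {
  asymptotics_c_gt0 : 0 < c;
  asymptotics_r0_gt0 : 0 < r0;
  asymptotics_M_ge0 : 0 <= M;
  asymptotics_itv : forall j r, 0 <= p j r <= 1;
  asymptotics_Sig_ge1 : forall r : R, r0 <= r -> 1 <= Sig r;
  asymptotics_Sig_linear : forall r : R, r0 <= r -> `|c * Sig r - r| <= M;
  asymptotics_tail : forall (r : R) n, r0 <= r ->
    \sum_(j < n) `|p j r - Phi (j.+1%:R / Sig r)| <= M;
  asymptotics_at0 : forall n, \sum_(j < n) p j 0 <= M;
  asymptotics_increment : forall n (s t : R), 0 <= s -> s <= t ->
    \sum_(j < n) (p j t - p j s) <= (t - s) + M }.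

Lemma approximation_sum_bounds {R : realType} (p : nat -> R -> R) (Sig Phi : R -> R) (E r0 : R) :
  tail_function Phi -> tail_approximation p Sig Phi E r0 ->
  exists c : R, 0 <= c /\ forall r : R, r0 <= r ->
    (forall n, \sum_(j < n) p j r <= c * Sig r + E) /\
    exists n, c * Sig r - (E + 2) <= \sum_(j < n) p j r.
Proof.
move=> tailPhi approx; have [c [c0 riemann]] := tail_riemann_bounds tailPhi.
exists c; split=> // r r_ge; have Sig1 := approximation_Sig_ge1 approx r_ge.
have a0 : 0 < (Sig r)^-1 by rewrite invr_gt0; lra.
have [sum_le [n0 sum_ge]] := riemann _ a0.
have sumE n : \sum_(j < n) Phi (j.+1%:R / Sig r) =
    Sig r * \sum_(j < n) (Sig r)^-1 * Phi ((Sig r)^-1 * j.+1%:R).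
  rewrite mulr_sumr; apply: eq_bigr => j _; rewrite mulrA divff ?mul1r;
    last by rewrite lt0r_neq0//; lra.
  by rewrite mulrC.
have dist n : `|\sum_(j < n) p j r - \sum_(j < n) Phi (j.+1%:R / Sig r)| <= E.
  by apply: le_trans (approximation_sum_le approx n r_ge); rewrite -sumrB; exact: ler_norm_sum.
split => [n|].
  have := dist n; rewrite sumE ler_norml => /andP[_].
  by have := ler_wpM2l (le_trans ler01 Sig1) (sum_le n); lra.
exists n0; have := dist n0; rewrite sumE ler_norml => /andP[].
have := ler_wpM2l (le_trans ler01 Sig1) sum_ge.
by rewrite mulrBr (mulrCA (Sig r)) divff; [lra|rewrite lt0r_neq0//; lra].
Qed.

Section UnfoldedAsymptotics.
Context {R : realType} {d : measure_display} {T : measurableType d} (P : probability T R).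
Variables (z : nat -> T -> R) (total Sig Phi : R -> R) (E r0 : R).
Local Notation p := (cdf_at P (unfolded z total)).
Hypotheses (mz : forall j, measurable_fun setT (z j))
  (total_cvg : forall x : R, \sum_(j < n) strict_cdf_at P z j x @[n --> \oo] --> total x)
  (total_nonpos : forall x : R, x <= 0 -> total x = 0)
  (tailPhi : tail_function Phi) (approx : tail_approximation p Sig Phi E r0)
  (Sig_left : forall r : R, r0 < r -> Sig x @[x --> r^'-] --> Sig r).

Lemma unfolded_counting_asymptotics : exists c M : R, counting_asymptotics p Sig Phi c r0 M.
Proof.
have [r0_gt0 E0 Sig1 approx_le] := approx.
have [c [c0 sum_bounds]] := approximation_sum_bounds tailPhi approx.
have lower := unfolded_lower mz total_cvg total_nonpos.
have sum_ge r (r_ge : r0 <= r) := (sum_bounds r r_ge).2.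
have sum_le (r : R) n : r0 <= r -> \sum_(j < n) p j r <= c * Sig r + (E + 2).
  by move=> r_ge; have := (sum_bounds r r_ge).1 n; lra.
have [M upper] := unfolded_upper mz total_cvg total_nonpos c0 (ltW r0_gt0) sum_le sum_ge Sig_left.
have Sig_ge (r : R) : r0 <= r -> r - 1 <= c * Sig r + E.
  move=> r_ge; have [N sum_gt] := lower r 1 (le_trans (ltW r0_gt0) r_ge) ltr01.
  exact: le_trans (sum_gt N (leqnn N)) ((sum_bounds r r_ge).1 N).
have M0 : 0 <= M by have := upper 0 0%N (lexx 0); rewrite big_ord0 add0r.
have mp := @cdf_at_mono _ _ _ P _ (measurable_unfolded mz total_cvg).
have c_gt0 : 0 < c.
  rewrite lt_neqAle c0 andbT; apply/eqP => c_eq0.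
  by have := Sig_ge (r0 + E + 2); rewrite -c_eq0 mul0r; lra.
exists c, (M + E + 2); split => //.
- by rewrite !addr_ge0.
- by move=> j r; rewrite cdf_at_ge0 cdf_at_le1//; exact: measurable_unfolded total_cvg.
- move=> r r_ge; have [n n_ge] := sum_ge r r_ge.
  have := upper r n (le_trans (ltW r0_gt0) r_ge); have := Sig_ge r r_ge.
  by rewrite ler_norml => ? ?; apply/andP; split; lra.
- by move=> r n r_ge; have := approx_le r n r_ge; lra.
- by move=> n; have := upper 0 n (lexx 0); lra.
move=> n s t s0 st; have [N sum_ge_s] := lower s 1 s0 ltr01.
apply: (@le_trans _ _ (\sum_(j < maxn n N) (p j t - p j s))).
  rewrite -[maxn n N](subnKC (leq_maxl n N)) big_split_ord/= lerDl; apply: sumr_ge0 => i _.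
  by rewrite subr_ge0; exact: mp.
rewrite sumrB; have := sum_ge_s _ (leq_maxr n N); have := upper t (maxn n N) (le_trans s0 st).
lra.
Qed.

End UnfoldedAsymptotics.

Section LimitCovariance.
Context {R : realType}.
Local Notation leb := (@lebesgue_measure R).
Variables (p : nat -> R -> R) (Sig Phi : R -> R) (c r0 M : R).
Hypotheses (tailPhi : tail_function Phi) (asymp : counting_asymptotics p Sig Phi c r0 M).
Variables (R_ : nat -> R) (N_ : nat -> nat) (ap : \bar R).
Hypotheses (R_ge : forall n, r0 <= R_ n) (R_infty : R_ n @[n --> \oo] --> +oo)
  (N_ap : ((N_ n)%:R / Sig (R_ n))%:E @[n --> \oo] --> ap).

Let c0 := asymptotics_c_gt0 asymp.
Let r0_gt0 := asymptotics_r0_gt0 asymp.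

Lemma counting_radius_gt0 n : 0 < R_ n.
Proof. exact: lt_le_trans r0_gt0 (R_ge n). Qed.

Lemma counting_scale_gt0 n : 0 < Sig (R_ n).
Proof. exact: lt_le_trans ltr01 (asymptotics_Sig_ge1 asymp (R_ge n)). Qed.

Let R0 := counting_radius_gt0.
Let S0 := counting_scale_gt0.

Lemma near_scaled_radius_ge (t A : R) : 0 < t -> \forall n \near \oo, A <= t * R_ n.
Proof.
move=> t0; move/cvgryPge: R_infty => /(_ (A / t)); apply: filterS => n.
by rewrite ler_pdivrMr// mulrC.
Qed.

Lemma scale_over_radius_cvg (t : R) : 0 < t -> Sig (t * R_ n) / R_ n @[n --> \oo] --> t / c.
Proof.
move=> t0; apply/cvgrPdist_le => e e0; near=> n.
have tR_ge : r0 <= t * R_ n by near: n; exact: (near_scaled_radius_ge r0 t0).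
have -> : t / c - Sig (t * R_ n) / R_ n = - ((c * Sig (t * R_ n) - t * R_ n) / (c * R_ n)).
  by field; rewrite !lt0r_neq0.
rewrite normrN normrM normfV [`|c * R_ n|]gtr0_norm ?mulr_gt0// ler_pdivrMr ?mulr_gt0//.
rewrite (le_trans (asymptotics_Sig_linear asymp tR_ge))// mulrA.
by near: n; exact: (near_scaled_radius_ge M (mulr_gt0 e0 c0)).
Unshelve. all: by end_near. Qed.

Lemma radius_over_scale_cvg : R_ n * (Sig (R_ n))^-1 @[n --> \oo] --> c.
Proof.
have inv_c : 1 / c != 0 by rewrite mul1r invr_eq0 lt0r_neq0.
have -> : (fun n => R_ n * (Sig (R_ n))^-1) = (fun n => (Sig (1 * R_ n) / R_ n)^-1).
  by apply/funext => n; rewrite mul1r invfM invrK mulrC.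
by rewrite -[c]invrK -[c^-1]mul1r; apply: cvgV inv_c (scale_over_radius_cvg ltr01).
Qed.

Lemma inv_scale_cvg0 : (Sig (R_ n))^-1 @[n --> \oo] --> 0.
Proof.
have inv_R : (R_ n)^-1 @[n --> \oo] --> 0 by apply/gtr0_cvgV0 => //; exact: nearW.
have -> : (fun n => (Sig (R_ n))^-1) = (fun n => (R_ n)^-1 * (R_ n * (Sig (R_ n))^-1)).
  by apply/funext => n; rewrite mulrA mulVf ?mul1r// lt0r_neq0.
by rewrite -(mul0r c); exact: cvgM inv_R radius_over_scale_cvg.
Qed.

Lemma scale_ratio_cvg (t : R) : 0 < t -> Sig (R_ n) / Sig (t * R_ n) @[n --> \oo] --> t^-1.
Proof.
move=> t0; have tc : t / c != 0 by rewrite mulf_neq0// ?invr_eq0 lt0r_neq0.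
have -> : t^-1 = 1 / c * (t / c)^-1 by field; rewrite !lt0r_neq0.
apply: cvg_trans (cvgM (scale_over_radius_cvg ltr01) (cvgV tc (scale_over_radius_cvg t0))).
apply: near_eq_cvg; near=> n.
have tR_ge : r0 <= t * R_ n by near: n; exact: (near_scaled_radius_ge r0 t0).
have S_gt0 : 0 < Sig (t * R_ n) by exact: lt_le_trans ltr01 (asymptotics_Sig_ge1 asymp tR_ge).
by rewrite /= mul1r; field; rewrite !lt0r_neq0.
Unshelve. all: by end_near. Qed.

(* Truncating the ratio from below keeps all the rescaled tails dominated by a single one. *)
Let ratio (s : R) n := maxr (Sig (R_ n) / Sig (s * R_ n)) (2 * s)^-1.

Let near_ratioE (s : R) : 0 < s ->
  \forall n \near \oo, r0 <= s * R_ n /\ ratio s n = Sig (R_ n) / Sig (s * R_ n).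
Proof.
move=> s0; have gap0 : 0 < s^-1 / 2 by rewrite divr_gt0// invr_gt0.
near=> n; split; first by near: n; exact: (near_scaled_radius_ge r0 s0).
rewrite /ratio max_l// invfM mulrC.
have : `|s^-1 - Sig (R_ n) / Sig (s * R_ n)| < s^-1 / 2.
  by near: n; move/cvgrPdist_lt: (scale_ratio_cvg s0) => /(_ _ gap0).
rewrite ltr_norml => /andP[_]; lra.
Unshelve. all: by end_near. Qed.

Let ratio_cvg (s : R) : 0 < s -> ratio s n @[n --> \oo] --> s^-1.
Proof.
move=> s0; apply: cvg_trans (scale_ratio_cvg s0); apply: near_eq_cvg.
by have := near_ratioE s0; apply: filterS => n [_ ->].
Qed.

Let ratio_dominated (s k : R) n : 0 < k -> k <= (2 * s)^-1 ->
  tail_dominated Phi k (fun x => Phi (ratio s n * x)).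
Proof.
move=> k0 ks; apply: tail_dominated_scale => //.
by rewrite /ratio le_max ks orbT.
Qed.

Let limit_dominated (s k : R) : 0 < s -> 0 < k -> k <= (2 * s)^-1 ->
  tail_dominated Phi k (fun x => Phi (s^-1 * x)).
Proof.
move=> s0 k0 ks; apply: tail_dominated_scale => //; apply: (le_trans ks).
by rewrite lef_pV2 ?posrE ?mulr_gt0// ler_peMl ?(ltW s0)// ler1n.
Qed.

Let a n := (Sig (R_ n))^-1.

Let a0 n : 0 < a n. Proof. by rewrite invr_gt0. Qed.

Let aN_ap : (a n * (N_ n)%:R)%:E @[n --> \oo] --> ap.
Proof. by under eq_fun do rewrite mulrC. Qed.

Let ratio_tail_cvg (s x : R) : 0 < s -> Phi (ratio s n * x) @[n --> \oo] --> Phi (s^-1 * x).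
Proof. by move=> s0; apply: (tail_cvg tailPhi); apply: cvgMr_tmp; exact: ratio_cvg. Qed.

Let tail_sum_cvg (s : R) : 0 < s ->
  \sum_(j < N_ n) a n * Phi (ratio s n * (a n * j.+1%:R)) @[n --> \oo] -->
  \int[leb]_(x in open_initial_segment ap) Phi (s^-1 * x).
Proof.
move=> s0; have k0 : 0 < (2 * s)^-1 by rewrite invr_gt0 mulr_gt0.
apply: (riemann_sum_cvg tailPhi (g_ := fun n x => Phi (ratio s n * x)) k0 a0 inv_scale_cvg0) => //.
- by move=> n; exact: ratio_dominated.
- exact: limit_dominated.
- by move=> x; exact: ratio_tail_cvg.
Qed.

Let tail_product_sum_cvg (s t : R) : 0 < s -> 0 < t ->
  \sum_(j < N_ n) a n * (Phi (ratio s n * (a n * j.+1%:R)) * Phi (ratio t n * (a n * j.+1%:R)))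
    @[n --> \oo] -->
  \int[leb]_(x in open_initial_segment ap) (Phi (s^-1 * x) * Phi (t^-1 * x)).
Proof.
move=> s0 t0; pose k := minr (2 * s)^-1 (2 * t)^-1.
have k0 : 0 < k by rewrite lt_min !invr_gt0 !mulr_gt0.
have ks : k <= (2 * s)^-1 by rewrite ge_min lexx.
have kt : k <= (2 * t)^-1 by rewrite ge_min lexx orbT.
apply: (riemann_sum_cvg tailPhi (g_ := fun n x => Phi (ratio s n * x) * Phi (ratio t n * x))
  k0 a0 inv_scale_cvg0) => //.
- by move=> n; apply: tail_dominatedM; exact: ratio_dominated.
- by apply: tail_dominatedM; exact: limit_dominated.
- by move=> x; apply: cvgM; exact: ratio_tail_cvg.
Qed.

Definition covariance_integral (s t : R) : R :=
  \int[leb]_(x in open_initial_segment ap) (Phi (x / s) * (1 - Phi (x / t))).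

Let int_tail (s : R) : 0 < s ->
  leb.-integrable (open_initial_segment ap) (EFin \o (fun x => Phi (s^-1 * x))).
Proof.
move=> s0; have s_inv : 0 < s^-1 by rewrite invr_gt0.
exact: integrable_open_initial_segment s_inv (tail_dominated_scale tailPhi s_inv (lexx _)).
Qed.

Let int_tail_product (s t : R) : 0 < s -> 0 < t ->
  leb.-integrable (open_initial_segment ap) (EFin \o (fun x => Phi (s^-1 * x) * Phi (t^-1 * x))).
Proof.
move=> s0 t0; pose k := minr s^-1 t^-1.
have k0 : 0 < k by rewrite lt_min !invr_gt0 s0.
apply: (integrable_open_initial_segment tailPhi ap k0); apply: tail_dominatedM.
  by apply: tail_dominated_scale => //; rewrite ge_min lexx.
by apply: tail_dominated_scale => //; rewrite ge_min lexx orbT.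
Qed.

Let covariance_integrandE (s t x : R) :
  Phi (x / s) * (1 - Phi (x / t)) = Phi (s^-1 * x) - Phi (s^-1 * x) * Phi (t^-1 * x).
Proof. by rewrite ![x / _]mulrC; ring. Qed.

Lemma integrable_covariance_integrand (s t : R) : 0 < s -> 0 < t ->
  leb.-integrable (open_initial_segment ap) (EFin \o (fun x => Phi (x / s) * (1 - Phi (x / t)))).
Proof.
move=> s0 t0; rewrite (funext (covariance_integrandE s t)).
exact: (@integrableB _ _ _ leb _ (measurable_open_initial_segment ap) _ _ (int_tail s0)
  (int_tail_product s0 t0)).
Qed.

Lemma covariance_integralE (s t : R) : 0 < s -> 0 < t ->
  covariance_integral s t = \int[leb]_(x in open_initial_segment ap) Phi (s^-1 * x) -
    \int[leb]_(x in open_initial_segment ap) (Phi (s^-1 * x) * Phi (t^-1 * x)).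
Proof.
move=> s0 t0; rewrite /covariance_integral (funext (covariance_integrandE s t)).
exact: (@RintegralB _ _ _ leb _ _ _ (measurable_open_initial_segment ap) (int_tail s0)
  (int_tail_product s0 t0)).
Qed.

Let tail_covariance_sum s t n := \sum_(j < N_ n) a n * Phi (ratio s n * (a n * j.+1%:R)) -
  \sum_(j < N_ n) a n * (Phi (ratio s n * (a n * j.+1%:R)) * Phi (ratio t n * (a n * j.+1%:R))).

Let tail_covariance_sum_cvg (s t : R) : 0 < s -> 0 < t ->
  tail_covariance_sum s t n @[n --> \oo] --> covariance_integral s t.
Proof.
by move=> s0 t0; rewrite covariance_integralE//; apply: cvgB;
  [exact: tail_sum_cvg|exact: tail_product_sum_cvg].
Qed.

Let dist_covariance_terms (x y u v : R) : 0 <= y <= 1 -> 0 <= u <= 1 ->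
  `|x * (1 - y) - (u - u * v)| <= `|x - u| + `|y - v|.
Proof.
move=> /andP[y0 y1] /andP[u0 u1].
have -> : x * (1 - y) - (u - u * v) = (x - u) * (1 - y) - u * (y - v) by ring.
rewrite (le_trans (ler_normB _ _))// !normrM (ger0_norm u0) [`|1 - y|]ger0_norm ?subr_ge0//.
by apply: lerD; [rewrite ler_piMr// gerBl|rewrite ler_piMl].
Qed.

Let dist_tail_covariance_sum (s t : R) : 0 < s -> 0 < t -> \forall n \near \oo,
  `|a n * \sum_(j < N_ n) p j (s * R_ n) * (1 - p j (t * R_ n)) - tail_covariance_sum s t n| <=
  a n * (2 * M).
Proof.
move=> s0 t0; near=> n.
have rescaled (u : R) j : r0 <= u * R_ n -> ratio u n = Sig (R_ n) / Sig (u * R_ n) ->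
    ratio u n * (a n * j.+1%:R) = j.+1%:R / Sig (u * R_ n).
  move=> /(asymptotics_Sig_ge1 asymp) Sig1 ->; have := S0 n.
  by rewrite /a => S_gt0; field; rewrite !lt0r_neq0//; lra.
have [sR ratio_s] : r0 <= s * R_ n /\ ratio s n = Sig (R_ n) / Sig (s * R_ n) by near: n;
  exact: near_ratioE.
have [tR ratio_t] : r0 <= t * R_ n /\ ratio t n = Sig (R_ n) / Sig (t * R_ n) by near: n;
  exact: near_ratioE.
rewrite /tail_covariance_sum.
under [X in _ - (X - _)]eq_bigr do rewrite rescaled//.
under [X in _ - (_ - X)]eq_bigr do rewrite !rescaled//.
rewrite -!mulr_sumr -!mulrBr normrM (gtr0_norm (a0 n)) -sumrB -sumrB ler_pM2l//.
rewrite (le_trans (ler_norm_sum _ _ _))// mulr_natl mulr2n.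
have := lerD (asymptotics_tail asymp (N_ n) sR) (asymptotics_tail asymp (N_ n) tR).
rewrite -big_split/=; apply: le_trans; apply: ler_sum => j _; apply: dist_covariance_terms.
  exact: (asymptotics_itv asymp).
by rewrite (tail_ge0 tailPhi) (tail_le1 tailPhi).
Unshelve. all: by end_near. Qed.

Lemma covariance_sum_cvg (s t : R) : 0 < s -> 0 < t ->
  (Sig (R_ n))^-1 * \sum_(j < N_ n) p j (s * R_ n) * (1 - p j (t * R_ n)) @[n --> \oo] -->
  covariance_integral s t.
Proof.
move=> s0 t0.
have error_cvg0 : a n * (2 * M) @[n --> \oo] --> 0.
  by rewrite -(mul0r (2 * M)); apply: cvgMr_tmp; exact: inv_scale_cvg0.
have dist_cvg0 : a n * \sum_(j < N_ n) p j (s * R_ n) * (1 - p j (t * R_ n)) -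
    tail_covariance_sum s t n @[n --> \oo] --> 0.
  apply/cvgr0Pnorm_le => e e0; move/cvgr0Pnorm_le: error_cvg0 => /(_ _ e0) error_le.
  near=> n; apply: (@le_trans _ _ (a n * (2 * M))); first by near: n;
    exact: dist_tail_covariance_sum.
  by rewrite (le_trans (ler_norm _))//; near: n.
rewrite -[X in _ --> X]add0r; apply: cvg_trans (cvgD dist_cvg0 (tail_covariance_sum_cvg s0 t0)).
by apply: near_eq_cvg; apply: nearW => n; rewrite /= subrK.
Unshelve. all: by end_near. Qed.

Definition limit_covariance (s t : R) : R :=
  if (0 < s) && (0 < t) then covariance_integral (minr s t) (maxr s t) else 0.

Lemma limit_covariance_sym : symmetric_kernel limit_covariance.
Proof. by move=> s t; rewrite /limit_covariance andbC minC maxC. Qed.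

Definition indicator_covariance j (x y : R) : R := p j (minr x y) - p j x * p j y.

Lemma indicator_covariance_sum_cvg (s t : R) : 0 <= s -> 0 <= t ->
  (Sig (R_ n))^-1 * \sum_(j < N_ n) indicator_covariance j (s * R_ n) (t * R_ n) @[n --> \oo] -->
  limit_covariance s t.
Proof.
wlog st : s t / s <= t => [H s0 t0|s0 t0].
  have [st|/ltW ts] := leP s t; first exact: H.
  rewrite limit_covariance_sym; apply: cvg_trans (H t s ts t0 s0); apply: near_eq_cvg;
    apply: nearW => n.
  by congr (_ * _); apply: eq_bigr => j _; rewrite /indicator_covariance minC [p _ _ * _]mulrC.
have sumE n : \sum_(j < N_ n) indicator_covariance j (s * R_ n) (t * R_ n) =
    \sum_(j < N_ n) p j (s * R_ n) * (1 - p j (t * R_ n)).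
  by apply: eq_bigr => j _; rewrite /indicator_covariance min_l ?ler_pM2r//; ring.
under eq_fun do rewrite sumE.
have [s_gt0|s_le0] := ltP 0 s.
  have t_gt0 : 0 < t by exact: lt_le_trans st.
  by rewrite /limit_covariance s_gt0 t_gt0/= min_l// max_r//; exact: covariance_sum_cvg.
have {s0 s_le0}-> : s = 0 by apply/eqP; rewrite eq_le s_le0 s0.
have -> : limit_covariance 0 t = 0 by rewrite /limit_covariance ltxx.
apply: (@squeeze_cvgr _ _ _ _ (fun=> 0) (fun n => a n * M)); last 2 first.
- exact: cvg_cst.
- by rewrite -(mul0r M); apply: cvgMr_tmp; exact: inv_scale_cvg0.
have p01 := asymptotics_itv asymp; apply: nearW => n; apply/andP; split.
  rewrite mulr_ge0 ?(ltW (a0 n))// sumr_ge0// => j _.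
  by have /andP[? ?] := p01 j (0 * R_ n); have /andP[? ?] := p01 j (t * R_ n);
    rewrite mulr_ge0// subr_ge0.
apply: ler_wpM2l; first exact: ltW (a0 n).
apply: le_trans (asymptotics_at0 asymp (N_ n)); apply: ler_sum => j _.
have /andP[? _] := p01 j 0; have /andP[? _] := p01 j (t * R_ n).
by rewrite mul0r ler_piMr// gerBl.
Qed.

Lemma limit_covariance_increment_le (s t : R) : 0 <= s -> s <= t ->
  limit_covariance s s + limit_covariance t t - 2 * limit_covariance s t <= c * (t - s).
Proof.
move=> s0 st; have t0 := le_trans s0 st.
pose cov_sum u v n := a n * \sum_(j < N_ n) indicator_covariance j (u * R_ n) (v * R_ n).
have incr_cvg : cov_sum s s n + cov_sum t t n - 2 * cov_sum s t n @[n --> \oo] -->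
    limit_covariance s s + limit_covariance t t - 2 * limit_covariance s t.
  by apply: cvgB; [apply: cvgD|apply: cvgMl_tmp]; exact: indicator_covariance_sum_cvg.
have bound_cvg : (t - s) * (R_ n * a n) + a n * M @[n --> \oo] --> c * (t - s).
  have -> : c * (t - s) = (t - s) * c + 0 * M by ring.
  by apply: cvgD; [apply: cvgMl_tmp; exact: radius_over_scale_cvg|apply: cvgMr_tmp; exact: inv_scale_cvg0].
rewrite -(cvg_lim (@Rhausdorff R) incr_cvg) -(cvg_lim (@Rhausdorff R) bound_cvg); apply: ler_lim.
- exact: cvgP incr_cvg.
- exact: cvgP bound_cvg.
apply: nearW => n /=; rewrite /cov_sum.
have sR : 0 <= s * R_ n by rewrite mulr_ge0// ltW.
have stR : s * R_ n <= t * R_ n by rewrite ler_pM2r.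
have -> : (t - s) * (R_ n * a n) + a n * M = a n * ((t * R_ n - s * R_ n) + M) by ring.
apply: le_trans (ler_wpM2l (ltW (a0 n)) (asymptotics_increment asymp (N_ n) sR stR)).
rewrite -!mulrDr (mulrCA 2) -mulrBr ler_pM2l// mulr_sumr -big_split/= -sumrB; apply: ler_sum => j _.
rewrite /indicator_covariance !minxx min_l//.
move: (p j (s * R_ n)) (p j (t * R_ n)) => x y; rewrite -subr_ge0.
by rewrite (_ : _ - _ = (y - x) ^+ 2) ?sqr_ge0//; ring.
Qed.

End LimitCovariance.

(** * Central limit theorem for the counting process *)

Section TriangularArray.
Context {R : realType} {d : measure_display} {T : measurableType d} (P : probability T R).
Variables (z : nat -> T -> R) (phi : nat -> nat -> R -> R) (N_ : nat -> nat) (b : nat -> R) (v : R).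
Local Notation sum n := (partial_sum z (phi n) (N_ n)).
Local Notation variance n := (\sum_(i < N_ n) expect P (fun w => phi n i (z i w) ^+ 2)).
Hypotheses (mz : forall i, measurable_fun setT (z i)) (indz : independent_seq P z)
  (bphi : forall n i, bmfun (phi n i))
  (centred : forall n i, expect P (fun w => phi n i (z i w)) = 0)
  (b_ge0 : forall n, 0 <= b n) (phi_le : forall n i x, `|phi n i x| <= b n)
  (b_cvg0 : b n @[n --> \oo] --> 0) (variance_cvg : variance n @[n --> \oo] --> v).

Let mphi n i : measurable_fun setT (phi n i). Proof. exact: (bphi n i).1. Qed.

Let near_char : \forall n \near \oo,
  `|expect P (fun w => cos (sum n w)) - expR (- (variance n / 2))| <= 2 * (b n * variance n) /\
  `|expect P (fun w => sin (sum n w))| <= b n * variance n.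
Proof.
near=> n; have b01 : 0 <= b n <= 1.
  rewrite b_ge0 (le_trans (ler_norm _))//; near: n.
  by move/cvgr0Pnorm_le: b_cvg0; exact.
rewrite mulrA; exact: (char_partial_sum_bound mz indz (mphi n) (bphi n) (centred n) (N_ n)
  b01 (phi_le n)).
Unshelve. all: by end_near. Qed.

Let error_cvg0 (k : R) : k * (b n * variance n) @[n --> \oo] --> 0.
Proof.
by rewrite [X in _ --> X](_ : 0 = k * (0 * v)); [apply: cvgMl_tmp; exact: cvgM|rewrite mul0r mulr0].
Qed.

Lemma triangular_array_cos_cvg : expect P (fun w => cos (sum n w)) @[n --> \oo] -->
  expR (- (v / 2)).
Proof.
have exp_cvg : expR (- (variance n / 2)) @[n --> \oo] --> expR (- (v / 2)).
  by apply: continuous_cvg; [exact: continuous_expR|apply: cvgN; apply: cvgMr_tmp].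
have dist_cvg0 : expect P (fun w => cos (sum n w)) - expR (- (variance n / 2)) @[n --> \oo] --> 0.
  apply/cvgr0Pnorm_le => e e0; have /cvgr0Pnorm_le/(_ _ e0) error_le := error_cvg0 2.
  near=> n; apply: (@le_trans _ _ (2 * (b n * variance n))); first by near: n;
    apply: filterS near_char => ? [].
  by rewrite (le_trans (ler_norm _))//; near: n.
rewrite -[X in _ --> X]add0r; apply: cvg_trans (cvgD dist_cvg0 exp_cvg).
by apply: near_eq_cvg; apply: nearW => n; rewrite /= subrK.
Unshelve. all: by end_near. Qed.

Lemma triangular_array_sin_cvg : expect P (fun w => sin (sum n w)) @[n --> \oo] --> 0.
Proof.
apply/cvgr0Pnorm_le => e e0; have /cvgr0Pnorm_le/(_ _ e0) error_le := error_cvg0 1.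
near=> n; apply: (@le_trans _ _ (b n * variance n)); first by near: n;
  apply: filterS near_char => ? [].
by rewrite (le_trans (ler_norm _))// -[b n * _]mul1r; near: n.
Unshelve. all: by end_near. Qed.

Lemma triangular_array_char_cvg (t : R) :
  expect P (fun w => cos (sum n w + t)) @[n --> \oo] --> expR (- (v / 2)) * cos t.
Proof.
have msum n : measurable_fun setT (sum n).
  by apply: measurable_sum => i; exact: measurableT_comp.
rewrite (funext (fun n => expect_cosD P t (msum n))) -[X in _ --> X]subr0 -(mul0r (sin t)).
apply: cvgB; apply: cvgMr_tmp; first exact: triangular_array_cos_cvg.
exact: triangular_array_sin_cvg.
Qed.

End TriangularArray.

Lemma indic_itv_oc {R : realType} (a b x : R) : a <= b ->
  \1_(`]a, b]%classic) x = ((x <= b)%R)%:R - ((x <= a)%R)%:R :> R.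
Proof.
move=> ab; rewrite indicE; have [xa|ax] := leP x a.
  by rewrite (le_trans xa ab) subrr memNset//= in_itv/= ltNge xa.
by rewrite subr0; congr ((nat_of_bool _)%:R); apply/idP/idP; rewrite inE/= in_itv/= ax.
Qed.

Section Counting.
Context {R : realType} {d : measure_display} {T : measurableType d} (P : probability T R).
Variable zeta : nat -> T -> R.
Local Notation p := (cdf_at P zeta).

Definition centred_count n (r : R) w : R := \sum_(j < n) (((zeta j w <= r)%R)%:R - p j r).

Definition centred_hits (B : set R) n w : R :=
  \sum_(j < n) (\1_B (zeta j w) - prob P (zeta j @^-1` B)).

Hypotheses (mz : forall i, measurable_fun setT (zeta i)) (indz : independent_seq P zeta).

Lemma bmfun_le_at j (r : R) : bmfun (fun w => ((zeta j w <= r)%R)%:R : R).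
Proof.
by rewrite -(funext (indic_set_le (zeta j) r)); apply: bmfun_indic; exact: measurable_set_le.
Qed.

Lemma expect_le_at j (r : R) : expect P (fun w => ((zeta j w <= r)%R)%:R) = p j r.
Proof. by rewrite -(funext (indic_set_le (zeta j) r)) expect_indic//; exact: measurable_set_le. Qed.

Lemma measurable_centred_count n r : measurable_fun setT (centred_count n r).
Proof. by apply: measurable_sum => j; apply: measurable_funB => //; exact: (bmfun_le_at j r).1. Qed.

Lemma centred_count_hits n r w : centred_count n r w = centred_hits `]-oo, r]%classic n w.
Proof.
apply: eq_bigr => j _; congr (_ - _).
by rewrite indicE; congr ((nat_of_bool _)%:R); apply/idP/idP; rewrite inE/= in_itv.
Qed.

Lemma prob_itv_oc j (a b : R) : a <= b -> prob P (zeta j @^-1` `]a, b]%classic) = p j b - p j a.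
Proof.
move=> ab; rewrite -!expect_le_at -expectB; [|exact: bmfun_le_at..].
rewrite -expect_indic; last by apply: measurable_preimage (measurable_itv _).
by congr expect; apply/funext => w; rewrite -indic_itv_oc.
Qed.

Lemma centred_count_increment n (a b : R) w : a <= b ->
  centred_count n b w - centred_count n a w = centred_hits `]a, b]%classic n w.
Proof.
move=> ab; rewrite /centred_count -sumrB; apply: eq_bigr => j _; rewrite prob_itv_oc//.
by rewrite indic_itv_oc//; ring.
Qed.

Lemma centred_count_between n (a b e : R) w : a <= b -> b <= e ->
  `|centred_count n b w - centred_count n a w| <=
  `|centred_count n e w - centred_count n a w| + \sum_(j < n) (p j e - p j a).
Proof.
move=> ab be; pose hits (x y : R) := \sum_(j < n)
  (((zeta j w <= y)%R)%:R - ((zeta j w <= x)%R)%:R) : R.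
have incrE (x y : R) : centred_count n y w - centred_count n x w =
  hits x y - \sum_(j < n) (p j y - p j x).
  by rewrite /centred_count /hits -!sumrB; apply: eq_bigr => j _; ring.
have le_mono (x y : R) j : x <= y -> ((zeta j w <= x)%R)%:R <= ((zeta j w <= y)%R)%:R :> R.
  by move=> xy; have [zx|_] := leP (zeta j w) x; rewrite ?(le_trans zx xy).
have p_mono := @cdf_at_mono _ _ _ P zeta mz.
have hits_ge0 : 0 <= hits a b by apply: sumr_ge0 => j _; rewrite subr_ge0 le_mono.
have hits_le : hits a b <= hits a e by apply: ler_sum => j _; rewrite lerD2r le_mono.
have p_ge0 : 0 <= \sum_(j < n) (p j b - p j a) by apply: sumr_ge0 => j _; rewrite subr_ge0 p_mono.
have p_le : \sum_(j < n) (p j b - p j a) <= \sum_(j < n) (p j e - p j a).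
  by apply: ler_sum => j _; rewrite lerD2r p_mono.
rewrite !incrE; have := ler_norm (hits a e - \sum_(j < n) (p j e - p j a)).
by have := normr_ge0 (hits a e - \sum_(j < n) (p j e - p j a)); rewrite ler_norml => ? ?;
  apply/andP; split; lra.
Qed.

Section Hits.
Variable B : set R.
Hypothesis mB : measurable B.
Local Notation q j := (prob P (zeta j @^-1` B)).

Let bmfun_hit j : bmfun (fun w => \1_B (zeta j w) : R).
Proof. exact: bmfun_comp (bmfun_indic mB) (mz j). Qed.

Let expect_hit j : expect P (fun w => \1_B (zeta j w)) = q j.
Proof. by rewrite -expect_indic//; exact: measurable_preimage. Qed.

Lemma centred_hits_pow4_le n (Q : R) : \sum_(j < n) q j <= Q ->
  expect P (fun w => centred_hits B n w ^+ 4) <= 3 * Q ^+ 2 + Q.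
Proof.
move=> sum_q; have q01 j : 0 <= q j <= 1 by rewrite prob_ge0 prob_le1//; exact: measurable_preimage.
pose phi j (x : R) : R := \1_B x - q j.
have bphi j : bmfun (phi j) by apply: bmfunB; [exact: bmfun_indic|exact: bmfun_cst].
have centred j : expect P (fun w => phi j (zeta j w)) = 0.
  by rewrite /phi expectB ?expect_hit ?expect_cst ?subrr//; exact: bmfun_cst.
have phi_le1 j x : `|phi j x| <= 1.
  have /andP[? ?] := q01 j; rewrite /phi indicE ler_norml.
  by case: (_ \in _) => /=; apply/andP; split; lra.
have variance_le j : expect P (fun w => phi j (zeta j w) ^+ 2) <= q j.
  have -> : (fun w => phi j (zeta j w) ^+ 2) =
    (fun w => (1 - 2 * q j) * \1_B (zeta j w) + q j ^+ 2).
    by apply/funext => w; rewrite /phi indicE; case: (_ \in _) => /=; ring.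
  rewrite expectD; [|exact: bmfunZ|exact: bmfun_cst].
  rewrite expectZ// expect_hit expect_cst.
  by have := sqr_ge0 (q j); rewrite expr2; lra.
rewrite -[centred_hits B n]/(partial_sum zeta phi n).
apply: (le_trans (expect_partial_sum_pow4_le mz indz bphi centred n phi_le1 variance_le)).
have : (\sum_(j < n) q j) ^+ 2 <= Q ^+ 2.
  have sum_ge0 : 0 <= \sum_(j < n) q j by apply: sumr_ge0 => j _; exact: prob_ge0.
  by rewrite ler_sqr ?nnegrE//; exact: le_trans sum_q.
lra.
Qed.

Lemma centred_hits_tail n (Q e : R) : \sum_(j < n) q j <= Q -> 0 < e ->
  prob P [set w | e < `|centred_hits B n w|] <= (3 * Q ^+ 2 + Q) / e ^+ 4.
Proof.
move=> sum_q e0; have bhits : bmfun (centred_hits B n).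
  by apply: bmfun_sum => j; apply: bmfunB; [exact: bmfun_hit|exact: bmfun_cst].
apply: (le_trans (markov_pow P 4 bhits e0)); rewrite ler_pM2r ?invr_gt0 ?exprn_gt0//.
apply: le_trans (centred_hits_pow4_le sum_q).
rewrite le_eqVlt; apply/predU1P; left; congr expect; apply/funext => w.
by rewrite -normrX ger0_norm// exprn_even_ge0.
Qed.

End Hits.
End Counting.

Section CountingCLT.
Context {R : realType} {d : measure_display} {T : measurableType d} (P : probability T R).
Variable zeta : nat -> T -> R.
Hypotheses (mz : forall i, measurable_fun setT (zeta i)) (indz : independent_seq P zeta).
Local Notation p := (cdf_at P zeta).
Variables (R_ S_ : nat -> R) (N_ : nat -> nat).

Definition rescaled_count n w (t : R) : R :=
  centred_count P zeta (N_ n) (t * R_ n) w / Num.sqrt (S_ n).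

Lemma measurable_rescaled_count n : measurable_process (rescaled_count n).
Proof. by move=> t _; apply: measurable_funM => //; exact: measurable_centred_count. Qed.

Hypotheses (S0 : forall n, 0 < S_ n) (S_inv : (S_ n)^-1 @[n --> \oo] --> 0).

Lemma inv_sqrt_scale_cvg (B : R) : B / Num.sqrt (S_ n) @[n --> \oo] --> 0.
Proof.
apply: (@cvg0_of_sqr_le _ _ (fun n => B ^+ 2 * (S_ n)^-1)).
  by move=> n; rewrite exprMn exprVn sqr_sqrtr// ltW.
by rewrite -(mulr0 (B ^+ 2)); apply: cvgMl_tmp.
Qed.

Variable C : R -> R -> R.
Hypothesis covariance_cvg : forall s t : R, 0 <= s -> 0 <= t ->
  (S_ n)^-1 * \sum_(j < N_ n) indicator_covariance p j (s * R_ n) (t * R_ n) @[n --> \oo] --> C s t.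

Let centred_indicator n j (x t : R) : R := ((x <= t * R_ n)%R)%:R - p j (t * R_ n).

Let bmfun_centred_indicator n j t : bmfun (fun x => centred_indicator n j x t).
Proof.
apply: bmfunB; last exact: bmfun_cst.
by rewrite -(funext (indic_set_le id (t * R_ n))); apply: bmfun_indic; exact: measurable_set_le.
Qed.

Let norm_centred_indicator_le1 n j x t : `|centred_indicator n j x t| <= 1.
Proof.
rewrite /centred_indicator; have := cdf_at_ge0 P zeta j (t * R_ n);
  have := cdf_at_le1 P mz j (t * R_ n).
by move: (p j _) => y; case: (x <= _); rewrite /= ler_norml => ? ?; apply/andP; split; lra.
Qed.

Let expect_centred_indicator n j t : expect P (fun w => centred_indicator n j (zeta j w) t) = 0.
Proof.
have ble := bmfun_le_at mz j (t * R_ n).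
by rewrite /centred_indicator expectB ?expect_le_at ?expect_cst ?subrr//; exact: bmfun_cst.
Qed.

Let expect_centred_indicatorM n j (s t : R) :
  expect P (fun w => centred_indicator n j (zeta j w) s * centred_indicator n j (zeta j w) t) =
  indicator_covariance p j (s * R_ n) (t * R_ n).
Proof.
have -> : (fun w => centred_indicator n j (zeta j w) s * centred_indicator n j (zeta j w) t) =
  (fun w => ((((zeta j w <= minr (s * R_ n) (t * R_ n))%R)%:R -
      p j (t * R_ n) * ((zeta j w <= s * R_ n)%R)%:R) -
     p j (s * R_ n) * ((zeta j w <= t * R_ n)%R)%:R) + p j (s * R_ n) * p j (t * R_ n)).
  apply/funext => w; rewrite /centred_indicator le_min.
  by case: (_ <= _); case: (_ <= _) => /=; ring.
have ble := bmfun_le_at mz j.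
rewrite expectD; [|by apply: bmfunB; [apply: bmfunB => //|]; exact: bmfunZ|exact: bmfun_cst].
rewrite expectB; [|by apply: bmfunB => //; exact: bmfunZ|exact: bmfunZ].
rewrite expectB//; last exact: bmfunZ.
rewrite expect_cst !expectZ// !(expect_le_at P mz).
rewrite /indicator_covariance; ring.
Qed.

Section FiniteDimensional.
Variable s : seq (R * R).
Hypothesis s_ge0 : nonneg_times s.

Let phi n j (x : R) : R := linform s (centred_indicator n j x) / Num.sqrt (S_ n).

Let bmfun_phi n j : bmfun (phi n j).
Proof.
apply: bmfunM; last exact: bmfun_cst.
by rewrite /linform; apply: bmfun_sum => q; apply: bmfunZ; exact: bmfun_centred_indicator.
Qed.

Let linform_rescaled_count n w : linform s (rescaled_count n w) = partial_sum zeta (phi n) (N_ n) w.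
Proof.
rewrite /partial_sum /phi /linform -mulr_suml exchange_big/= mulr_suml; apply: eq_bigr => q _.
by rewrite /rescaled_count /centred_count mulrA; congr (_ / _); rewrite mulr_sumr.
Qed.

Let bmfun_at n j t : bmfun (fun w => centred_indicator n j (zeta j w) t).
Proof. exact: bmfun_comp (bmfun_centred_indicator n j t) (mz j). Qed.

Let expect_phi n j : expect P (fun w => phi n j (zeta j w)) = 0.
Proof.
rewrite /phi; under eq_fun do rewrite mulrC.
rewrite expectZ; last by apply: bmfun_sum => q; exact: bmfunZ.
rewrite expect_sum => [|q]; last exact: bmfunZ.
by rewrite big1 ?mulr0// => q _; rewrite expectZ// expect_centred_indicator mulr0.
Qed.

Let norm_phi_le n j x : `|phi n j x| <= (\sum_(q <- s) `|q.2|) / Num.sqrt (S_ n).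
Proof.
rewrite /phi normrM normfV (ger0_norm (sqrtr_ge0 _)) ler_wpM2r ?invr_ge0 ?sqrtr_ge0//.
rewrite (le_trans (ler_norm_sum _ _ _))//; apply: ler_sum => q _.
by rewrite normrM ler_piMr// norm_centred_indicator_le1.
Qed.

Let expect_phi_sqr n j : expect P (fun w => phi n j (zeta j w) ^+ 2) =
  (S_ n)^-1 * quadform (fun a b => indicator_covariance p j (a * R_ n) (b * R_ n)) s.
Proof.
have -> : (fun w => phi n j (zeta j w) ^+ 2) = (fun w => (S_ n)^-1 *
    quadform
      (fun a b => centred_indicator n j (zeta j w) a * centred_indicator n j (zeta j w) b) s).
  by apply/funext => w; rewrite /phi exprMn exprVn sqr_sqrtr ?(ltW (S0 n))// quadform_rank1 mulrC.
have bprod (q r : R * R) : bmfun (fun w => q.2 * r.2 *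
    (centred_indicator n j (zeta j w) q.1 * centred_indicator n j (zeta j w) r.1)).
  by apply: bmfunZ; exact: bmfunM.
rewrite expectZ; last by apply: bmfun_sum => q; exact: bmfun_sum.
congr (_ * _); rewrite /quadform expect_sum => [|q]; last exact: bmfun_sum.
apply: eq_bigr => q _; rewrite expect_sum//; apply: eq_bigr => r _.
by rewrite expectZ ?expect_centred_indicatorM//; exact: bmfunM.
Qed.

Let variance_cvg :
  \sum_(j < N_ n) expect P (fun w => phi n j (zeta j w) ^+ 2) @[n --> \oo] --> quadform C s.
Proof.
have -> : (fun n => \sum_(j < N_ n) expect P (fun w => phi n j (zeta j w) ^+ 2)) = (fun n =>
    quadform (fun a b =>
      (S_ n)^-1 * \sum_(j < N_ n) indicator_covariance p j (a * R_ n) (b * R_ n)) s).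
  apply/funext => n; rewrite quadformZ; under eq_bigr do rewrite expect_phi_sqr.
  rewrite -mulr_sumr; congr (_ * _); rewrite /quadform exchange_big/=; apply: eq_bigr => q _.
  by rewrite exchange_big/=; apply: eq_bigr => r _; rewrite mulr_sumr.
exact: cvg_quadform.
Qed.

Lemma quadform_limit_ge0 : 0 <= quadform C s.
Proof.
rewrite -(cvg_lim (@Rhausdorff R) variance_cvg); apply: limr_ge; first exact: cvgP variance_cvg.
by apply: nearW => n; apply: sumr_ge0 => j _; apply: expect_ge0 => w; exact: sqr_ge0.
Qed.

Lemma rescaled_count_char_cvg b :
  expect P (fun w => cos (linform s (rescaled_count n w) + b)) @[n --> \oo] -->
  expR (- (quadform C s / 2)) * cos b.
Proof.
under eq_fun => n do under eq_fun do rewrite linform_rescaled_count.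
apply: (triangular_array_char_cvg mz indz bmfun_phi expect_phi _ norm_phi_le _ variance_cvg).
  by move=> n; rewrite divr_ge0 ?sqrtr_ge0// sumr_ge0.
exact: inv_sqrt_scale_cvg.
Qed.

End FiniteDimensional.

Lemma limit_nonneg_definite : nonneg_definite C.
Proof. by move=> s; exact: quadform_limit_ge0. Qed.

End CountingCLT.

(** * Tightness of the counting process *)

Lemma dyadic_between {R : realType} (x y : R) : 0 < y -> 2 * y <= x ->
  exists i, y <= x / 2 ^+ i.+1 < 2 * y.
Proof.
move=> y0 yx; have small : exists i, x / 2 ^+ i < 2 * y.
  have /cvgr0Pnorm_lt/(_ (2 * y)) := cvg_half_pow x.
  rewrite mulr_gt0// => /(_ isT)[i _ /(_ i (leqnn _))] /= small_i.
  by exists i; exact: le_lt_trans (ler_norm _) small_i.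
case: (ex_minnP small) => -[|i]; first by rewrite divr1; lra.
move=> small_i i_min; exists i; rewrite small_i andbT.
have : 2 * y <= x / 2 ^+ i by rewrite leNgt; apply/negP => /i_min; rewrite ltnn.
rewrite exprS invfM mulrCA.
by move: (x / 2 ^+ i) => u; lra.
Qed.

Section Tightness.
Context {R : realType} {d : measure_display} {T : measurableType d} (P : probability T R).
Variable zeta : nat -> T -> R.
Hypotheses (mz : forall i, measurable_fun setT (zeta i)) (indz : independent_seq P zeta).
Local Notation p := (cdf_at P zeta).
Variables (R_ S_ : nat -> R) (N_ : nat -> nat) (c M : R).
Hypotheses (R0 : forall n, 0 < R_ n) (S0 : forall n, 0 < S_ n)
  (S_inv : (S_ n)^-1 @[n --> \oo] --> 0)
  (RS_cvg : R_ n * (S_ n)^-1 @[n --> \oo] --> c) (c0 : 0 < c) (M0 : 0 <= M)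
  (p_at0 : forall n, \sum_(j < n) p j 0 <= M)
  (p_increment : forall n (s t : R), 0 <= s -> s <= t ->
    \sum_(j < n) (p j t - p j s) <= (t - s) + M).
Local Notation X := (rescaled_count P zeta R_ S_ N_).

Let sqrt_gt0 n : 0 < Num.sqrt (S_ n). Proof. by rewrite sqrtr_gt0. Qed.

Lemma rescaled_hits_tail n (B : set R) (Q y e : R) : measurable B ->
  \sum_(j < N_ n) prob P (zeta j @^-1` B) <= Q -> 1 <= Q -> Q <= y * S_ n -> 0 < e ->
  prob P [set w | e < `|centred_hits P zeta B (N_ n) w / Num.sqrt (S_ n)|] <= 4 * y ^+ 2 / e ^+ 4.
Proof.
move=> mB sum_q Q1 Qy e0.
have -> : [set w | e < `|centred_hits P zeta B (N_ n) w / Num.sqrt (S_ n)|] =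
    [set w | e * Num.sqrt (S_ n) < `|centred_hits P zeta B (N_ n) w|].
  by apply/seteqP; split => w /=; rewrite normrM normfV (gtr0_norm (sqrt_gt0 n)) ltr_pdivlMr.
have threshold0 : 0 < e * Num.sqrt (S_ n) by rewrite mulr_gt0.
apply: (le_trans (centred_hits_tail mz indz mB sum_q threshold0)).
rewrite [(e * _) ^+ 4]exprMn (exprM (Num.sqrt _) 2 2) sqr_sqrtr ?(ltW (S0 n))//.
rewrite ler_pdivrMr ?mulr_gt0 ?exprn_gt0// [leRHS]mulrA divfK ?expf_neq0 ?lt0r_neq0//.
rewrite -[leRHS]mulrA -exprMn.
apply: (@le_trans _ _ (4 * Q ^+ 2)); last by rewrite ler_pM2l// ler_sqr ?nnegrE//; lra.
have : Q <= Q ^+ 2 by rewrite expr2 ler_peMl//; lra.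
lra.
Qed.

Let near_ratio_le : \forall n \near \oo, R_ n <= 2 * c * S_ n.
Proof.
move/cvgrPdist_le: RS_cvg => /(_ _ c0); apply: filterS => n; rewrite ler_norml => /andP[le_c _].
by rewrite -ler_pdivrMr//; lra.
Qed.

Let near_scale_ge1 : \forall n \near \oo, 1 <= S_ n.
Proof.
move/cvgr0Pnorm_le: S_inv => /(_ 1 ltr01); apply: filterS => n /(le_trans (ler_norm _)).
by rewrite invf_le1.
Qed.

Lemma rescaled_count_tight (t e : R) : 0 <= t -> 0 < e ->
  exists A : R, 0 < A /\ \forall n \near \oo, prob P [set w | A < `|X n w t|] <= e.
Proof.
move=> t0 e0; pose K := 2 * c * t + 2 * M + 1; pose A := 1 + 4 * K ^+ 2 / e.
have ct0 : 0 <= c * t by rewrite mulr_ge0// ltW.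
have L0 : 0 <= 4 * K ^+ 2 / e by rewrite divr_ge0 ?(ltW e0)// mulr_ge0// sqr_ge0.
have A1 : 1 <= A by rewrite lerDl.
have A0 : 0 < A by lra.
exists A; split => //; near=> n.
have R_le : R_ n <= 2 * c * S_ n by near: n.
have S1 : 1 <= S_ n by near: n.
have tR0 : 0 <= t * R_ n by rewrite mulr_ge0// ltW.
pose B : set R := `]-oo, (t * R_ n)]%classic.
have sum_q : \sum_(j < N_ n) prob P (zeta j @^-1` B) <= t * R_ n + 2 * M + 1.
  have -> : \sum_(j < N_ n) prob P (zeta j @^-1` B) = \sum_(j < N_ n) p j (t * R_ n).
    by apply: eq_bigr => j _; congr prob; apply/seteqP; split => w /=; rewrite /B/= in_itv.
  by have := p_increment (N_ n) (lexx 0) tR0; have := p_at0 (N_ n); rewrite sumrB; lra.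
have Q_le : t * R_ n + 2 * M + 1 <= K * S_ n.
  have : t * R_ n <= t * (2 * c * S_ n) by rewrite ler_wpM2l.
  have : (2 * M + 1) * 1 <= (2 * M + 1) * S_ n by rewrite ler_wpM2l// addr_ge0// mulr_ge0.
  by rewrite /K; lra.
have -> : [set w | A < `|X n w t|] =
    [set w | A < `|centred_hits P zeta B (N_ n) w / Num.sqrt (S_ n)|].
  by apply/seteqP; split => w /=; rewrite /rescaled_count centred_count_hits.
have Q1 : 1 <= t * R_ n + 2 * M + 1 by rewrite lerDr addr_ge0// mulr_ge0.
apply: (le_trans (rescaled_hits_tail (measurable_itv _) sum_q Q1 Q_le A0)).
rewrite ler_pdivrMr ?exprn_gt0// -ler_pdivrMl// mulrC (@le_trans _ _ A)//; first by rewrite lerDr.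
by rewrite exprS ler_peMr ?exprn_ege1// ltW.
Unshelve. all: by end_near. Qed.

Lemma rescaled_count_increment_tail n q k (e : R) : 0 < e -> R_ n <= 2 * c * S_ n ->
  M <= R_ n / 2 ^+ q -> 1 <= R_ n / 2 ^+ q ->
  prob P [set w | e < `|dyadic_increment q (X n w) k|] <= 64 * c ^+ 2 * (2 ^- q) ^+ 2 / e ^+ 4.
Proof.
move=> e0 R_le M_le one_le; have k0 : 0 <= k%:R / 2 ^+ q :> R by rewrite divr_ge0// exprn_ge0.
have q0 : 0 < 2 ^- q :> R by rewrite invr_gt0 exprn_gt0.
have kR0 : 0 <= k%:R / 2 ^+ q * R_ n by rewrite mulr_ge0// ltW.
have kR_le : k%:R / 2 ^+ q * R_ n <= k.+1%:R / 2 ^+ q * R_ n.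
  by rewrite ler_pM2r// -subr_ge0 dyadic_succB ltW.
pose B : set R := `](k%:R / 2 ^+ q * R_ n), (k.+1%:R / 2 ^+ q * R_ n)]%classic.
have sum_q : \sum_(j < N_ n) prob P (zeta j @^-1` B) <= 2 * (R_ n / 2 ^+ q).
  rewrite (eq_bigr _ (fun (j : 'I_(N_ n)) _ => prob_itv_oc P mz j kR_le)).
  by apply: le_trans (p_increment _ kR0 kR_le) _; rewrite -mulrBl dyadic_succB; lra.
have -> : [set w | e < `|dyadic_increment q (X n w) k|] =
    [set w | e < `|centred_hits P zeta B (N_ n) w / Num.sqrt (S_ n)|].
  apply/seteqP; split => w /=;
  by rewrite /dyadic_increment /rescaled_count -mulrBl (centred_count_increment P mz _ _ kR_le).
have -> : 64 * c ^+ 2 * (2 ^- q) ^+ 2 = 4 * (4 * c * 2 ^- q) ^+ 2 by ring.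
apply: (rescaled_hits_tail (measurable_itv _) sum_q) => //; first by lra.
have -> : 4 * c * 2 ^- q * S_ n = 2 * (2 * c * S_ n / 2 ^+ q) by ring.
by rewrite ler_pM2l// ler_pM2r.
Qed.

Lemma measurable_rescaled_count_increment n q k :
  measurable_fun setT (fun w => dyadic_increment q (X n w) k).
Proof.
have mX := measurable_rescaled_count P mz R_ S_ N_ n.
by apply: measurable_funB; apply: mX; rewrite divr_ge0// exprn_ge0.
Qed.

Lemma prob_large_levels_le n j m i : R_ n <= 2 * c * S_ n ->
  (forall k, (k < i)%N -> M <= R_ n / 2 ^+ (m + k).+1 /\ 1 <= R_ n / 2 ^+ (m + k).+1) ->
  measurable [set w | exists2 k, (k < i)%N & large_increment (X n) j (m + k) w] /\
  prob P [set w | exists2 k, (k < i)%N & large_increment (X n) j (m + k) w] <=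
  32 * c ^+ 2 * j%:R / (1 - chaining_ratio) * chaining_ratio ^+ m.
Proof.
move=> R_le fine_levels; have /andP[rho0 rho1] := @chaining_ratio_itv R.
have m_incr := measurable_rescaled_count_increment n.
have [|mU PU] := @prob_bigcup_ord_le _ _ _ P (fun k => large_increment (X n) j (m + k)) i
  (fun k => 64 * c ^+ 2 / 2 * j%:R * chaining_ratio ^+ (m + k))
  (fun k => measurable_large_increment m_incr j (m + k)).
  move=> k ki; have [M_le one_le] := fine_levels k ki.
  by apply: (prob_large_increment_le m_incr) => l e e0; exact: rescaled_count_increment_tail.
split => //; apply: (le_trans PU); rewrite -mulr_sumr.
have -> : 64 * c ^+ 2 / 2 * j%:R = 32 * c ^+ 2 * j%:R by field.
rewrite -[leRHS]mulrA; apply: ler_wpM2l; first by rewrite !mulr_ge0// ltW.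
have := @geometric_le_lim R i (chaining_ratio ^+ m) _ (exprn_ge0 m (ltW rho0)) rho0.
rewrite (ger0_norm (ltW rho0)) => /(_ rho1); rewrite /series/= big_mkord mulrC.
by apply: le_trans; rewrite le_eqVlt; apply/predU1P; left; apply: eq_bigr => k _; rewrite exprD.
Qed.

Lemma rescaled_count_dist_floor n q w (t : R) : 0 <= t ->
  `|X n w t - X n w (dyadic_floor q t)| <=
  `|dyadic_increment q (X n w) (Num.truncn (2 ^+ q * t))| + (R_ n / 2 ^+ q + M) / Num.sqrt (S_ n).
Proof.
move=> t0; have p0 : 0 < 2 ^+ q :> R by rewrite exprn_gt0.
have /andP[k_le k_gt] := truncn_itv (mulr_ge0 (ltW p0) t0).
move: (Num.truncn _) (dyadic_floor_eq (m := q) (n := Num.truncn (2 ^+ q * t)) (t := t)) k_le k_gt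
  => k floorE k_le k_gt.
have le_t : k%:R / 2 ^+ q <= t by rewrite ler_pdivrMr// mulrC.
have lt_t : t < k.+1%:R / 2 ^+ q by rewrite ltr_pdivlMr// mulrC.
rewrite floorE// /dyadic_increment /rescaled_count -!mulrBl !normrM normfV (gtr0_norm (sqrt_gt0 n)).
rewrite -mulrDl ler_pM2r ?invr_gt0//.
have kR_le : k%:R / 2 ^+ q * R_ n <= t * R_ n by rewrite ler_pM2r.
have tR_le : t * R_ n <= k.+1%:R / 2 ^+ q * R_ n by rewrite ler_pM2r// ltW.
apply: le_trans (centred_count_between P mz _ _ kR_le tR_le) _; rewrite lerD2l.
have kR0 : 0 <= k%:R / 2 ^+ q * R_ n by rewrite mulr_ge0 ?(ltW (R0 n))// divr_ge0// ltW.
apply: le_trans (p_increment _ kR0 (le_trans kR_le tR_le)) _.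
by rewrite -mulrBl dyadic_succB mulrC.
Qed.

Lemma not_large_levels_dist n j m i w :
  ~ (exists2 k, (k < i.+1)%N & large_increment (X n) j.+1 (m + k) w) ->
  forall t, 0 <= t <= j%:R -> `|X n w t - X n w (dyadic_floor m t)| <=
    11 * (9 / 10) ^+ m + (R_ n / 2 ^+ (m + i).+1 + M) / Num.sqrt (S_ n).
Proof.
move=> not_large t /andP[t0 tj]; set q := (m + i).+1.
have regular k : (m <= k < m + i.+1)%N -> ~ large_increment (X n) j.+1 k w.
  by move=> mki large_k; apply: not_large; exists (k - m)%N; [lia|rewrite subnKC//; lia].
have tjS : t < j.+1%:R by rewrite (le_lt_trans tj)// ltr_nat.
have chain := not_large_increment_dist regular (t := t); rewrite t0 (ltW tjS) addnS in chain.
have last_increment : `|dyadic_increment q (X n w) (Num.truncn (2 ^+ q * t))| <=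
  (9 / 10) ^+ (m + i).
  rewrite leNgt; apply/negP => large_last; apply: (regular (m + i)%N); first by lia.
  exists (Num.truncn (2 ^+ q * t)) => //; rewrite -(ltr_nat R) natrM natrX.
  have p0 : 0 < 2 ^+ q :> R by rewrite exprn_gt0.
  have /andP[k_le _] := truncn_itv (mulr_ge0 (ltW p0) t0).
  by rewrite (le_lt_trans k_le)// mulrC ltr_pM2r.
have radius_le : (9 / 10) ^+ (m + i) <= (9 / 10) ^+ m :> R.
  by rewrite exprD ler_piMr ?exprn_ge0// exprn_ile1//; lra.
rewrite (le_trans (ler_distD (X n w (dyadic_floor q t)) _ _))//.
by have := rescaled_count_dist_floor n q w t0; have := chain isT; lra.
Qed.

Let near_scale_large (B eta : R) : 0 < eta -> \forall n \near \oo, B <= eta * Num.sqrt (S_ n).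
Proof.
move=> eta0; have /cvgr0Pnorm_le/(_ 1 ltr01) := inv_sqrt_scale_cvg S0 S_inv (B / eta).
apply: filterS => n /(le_trans (ler_norm _)).
by rewrite ler_pdivrMr// mul1r ler_pdivrMr// mulrC.
Qed.

Let near_mesh_large m (eta : R) : 0 < eta ->
  \forall n \near \oo, eta * Num.sqrt (S_ n) <= R_ n / 2 ^+ m.
Proof.
move=> eta0; have half_c : 0 < c / 2 by rewrite divr_gt0.
have p0 : 0 < 2 ^+ m :> R by rewrite exprn_gt0.
have R_ge : \forall n \near \oo, c / 2 * S_ n <= R_ n.
  move/cvgrPdist_le: RS_cvg => /(_ _ half_c); apply: filterS => n;
    rewrite ler_norml => /andP[_ ge_c].
  by rewrite -ler_pdivlMr//; lra.
near=> n; rewrite ler_pdivlMr//; apply: (@le_trans _ _ (c / 2 * S_ n)); last by near: n.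
have sqrtE : S_ n = Num.sqrt (S_ n) * Num.sqrt (S_ n) by rewrite -expr2 sqr_sqrtr// ltW.
rewrite [in leRHS]sqrtE mulrA mulrAC ler_pM2r//.
by near: n; exact: near_scale_large.
Unshelve. all: by end_near. Qed.

Lemma rescaled_count_modulus (j : nat) (dl e : R) : 0 < dl -> 0 < e ->
  exists m0, forall m, (m0 <= m)%N ->
  \forall n \near \oo, uniformly_close P (X n) (fun w => sampled m (X n w)) j dl e.
Proof.
move=> dl0 e0; have /andP[rho0 rho1] := @chaining_ratio_itv R.
pose D := 32 * c ^+ 2 * j.+1%:R / (1 - chaining_ratio).
have D_cvg0 : D * chaining_ratio ^+ m @[m --> \oo] --> 0.
  by rewrite -(mulr0 D); apply: cvgMl_tmp; apply: cvg_expr; rewrite (ger0_norm (ltW rho0)).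
have /cvgr0Pnorm_le/(_ _ e0)[m1 _ prob_small] := D_cvg0.
have eta0 : 0 < dl / 8 by rewrite divr_gt0.
have dl4 : 0 < dl / 4 by rewrite divr_gt0.
have /cvgr0Pnorm_le/(_ _ dl4)[m2 _ radius_small] := @chaining_radius_cvg R 11.
exists (maxn m1 m2) => m; rewrite geq_max => /andP[/prob_small Dm_le /radius_small radius_le].
have {}Dm_le := le_trans (ler_norm _) Dm_le; have {}radius_le := le_trans (ler_norm _) radius_le.
near=> n.
have R_le : R_ n <= 2 * c * S_ n by near: n.
have M_le : M <= dl / 8 * Num.sqrt (S_ n) by near: n; exact: near_scale_large.
have one_le : 1 <= dl / 8 * Num.sqrt (S_ n) by near: n; exact: near_scale_large.
have mesh_ge : 2 * (dl / 8 * Num.sqrt (S_ n)) <= R_ n / 2 ^+ m.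
  by rewrite mulrA; near: n; apply: near_mesh_large; exact: mulr_gt0.
(* The finest level has mesh comparable with the standard deviation [sqrt (S_ n)]. *)
have [i] := dyadic_between (mulr_gt0 eta0 (sqrt_gt0 n)) mesh_ge.
have -> : R_ n / 2 ^+ m / 2 ^+ i.+1 = R_ n / 2 ^+ (m + i).+1 by rewrite -addnS exprD invfM mulrA.
move=> /andP[finest_ge finest_lt].
have fine_levels k : (k < i.+1)%N -> dl / 8 * Num.sqrt (S_ n) <= R_ n / 2 ^+ (m + k).+1.
  move=> ki; apply: (le_trans finest_ge); rewrite ler_pM2l// lef_pV2 ?posrE ?exprn_gt0//.
  by rewrite ler_eXn2l ?ltr1n// ltnS leq_add2l.
have [|mU PU] := @prob_large_levels_le n j.+1 m i.+1 R_le.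
  by move=> k /fine_levels level_ge; split; exact: le_trans level_ge.
exists (~` [set w | exists2 k, (k < i.+1)%N & large_increment (X n) j.+1 (m + k) w]); split.
- exact: measurableC.
- by rewrite setCK (le_trans PU).
move=> w not_large t tj; apply: (le_trans (not_large_levels_dist not_large tj)).
have : (R_ n / 2 ^+ (m + i).+1 + M) / Num.sqrt (S_ n) <= dl / 2 by rewrite ler_pdivrMr//; lra.
lra.
Unshelve. all: by end_near. Qed.

End Tightness.

(** * Sample paths *)

Section Cadlag.
Context {R : realType}.
Implicit Types (x y : R -> R).

Lemma cadlag_uniform x : (forall (j : nat) (dl : R), 0 < dl -> exists2 y, cadlag y &
  forall t, 0 <= t <= j%:R -> `|x t - y t| <= dl) -> cadlag x.
Proof.
move=> approx; split => t t0.
  apply/cvgrPdist_le => e e0; have e3 : 0 < e / 3 by rewrite divr_gt0.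
  have [y [y_right _] xy] := approx (Num.truncn t).+2 _ e3.
  have tj : t < (Num.truncn t).+2%:R.
    by have /andP[_ /lt_trans] := truncn_itv t0; apply; rewrite ltr_nat.
  have /cvgrPdist_le/(_ _ e3) y_near := y_right t t0.
  near=> u.
  have tu : t < u by near: u; exact: nbhs_right_gt.
  have uj : u <= (Num.truncn t).+2%:R by near: u; exact: nbhs_right_le.
  have yt_yu : `|y t - y u| <= e / 3 by near: u.
  have xt_yt : `|x t - y t| <= e / 3 by apply: xy; rewrite t0 ltW.
  have xu_yu : `|x u - y u| <= e / 3 by apply: xy; rewrite uj (ltW (le_lt_trans t0 tu)).
  have -> : x t - x u = (x t - y t) + (y t - y u) - (x u - y u) by ring.
  by apply: le_trans (ler_normB _ _) _; have := ler_normD (x t - y t) (y t - y u); lra.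
apply: cauchy_cvg; apply: cauchy_exP => e e0; have e3 : 0 < e / 3 by rewrite divr_gt0.
have [y [_ y_left] xy] := approx (Num.truncn t).+1 _ e3.
have /cvg_ex[l /= yl] := y_left t t0.
have /cvgrPdist_le/(_ _ e3) y_near := yl.
have /andP[_ tj] := truncn_itv (ltW t0).
exists l; rewrite /nbhs/=; near=> u.
have ut : u < t by near: u; exact: nbhs_left_lt.
have u0 : 0 < u by near: u; exact: nbhs_left_gt.
have l_yu : `|l - y u| <= e / 3 by near: u.
have xu_yu : `|x u - y u| <= e / 3 by apply: xy; rewrite (ltW u0) (ltW (lt_trans ut tj)).
rewrite -ball_normE/=; have -> : l - x u = (l - y u) - (x u - y u) by ring.
by apply: le_lt_trans (ler_normB _ _) _; lra.
Unshelve. all: by end_near. Qed.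

Lemma cadlagD x y : cadlag x -> cadlag y -> cadlag (fun t => x t + y t).
Proof.
move=> [x_right x_left] [y_right y_left]; split => t t0.
  by apply: cvgD; [exact: x_right|exact: y_right].
by apply: is_cvgD; [exact: x_left|exact: y_left].
Qed.

Lemma cadlagMr x (c : R) : cadlag x -> cadlag (fun t => x t * c).
Proof.
move=> [x_right x_left]; split => t t0; first by apply: cvgMr_tmp; exact: x_right.
by have /cvg_ex[l /= xl] := x_left t t0; apply/cvg_ex; exists (l * c); exact: cvgMr_tmp.
Qed.

Lemma cadlagB x y : cadlag x -> cadlag y -> cadlag (fun t => x t - y t).
Proof.
move=> cx cy; apply: cadlagD => //; have := cadlagMr (-1) cy.
by under eq_fun do rewrite mulrN1.
Qed.

Lemma cadlag_sum n (x : nat -> R -> R) :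
  (forall j, cadlag (x j)) -> cadlag (fun t => \sum_(j < n) x j t).
Proof.
move=> cx; elim: n => [|n IH].
  by under eq_fun do rewrite big_ord0; exact: cadlag_cst.
by under eq_fun do rewrite big_ord_recr/=; exact: cadlagD.
Qed.

Lemma near_le_scale_right (z r t : R) (u : nat -> R) : 0 < r -> (forall n, t < u n) ->
  u n @[n --> \oo] --> t -> \forall n \near \oo, (z <= u n * r) = (z <= t * r).
Proof.
move=> r0 tu u_t; have [z_le|z_gt] := leP z (t * r).
  by apply: nearW => n; rewrite (le_trans z_le)// ler_pM2r// ltW.
have gap0 : 0 < z / r - t by rewrite subr_gt0 ltr_pdivlMr.
have /cvgrPdist_lt/(_ _ gap0) := u_t; apply: filterS => n; rewrite ltr_norml => /andP[? _].
by apply/negbTE; rewrite -ltNge -ltr_pdivlMr//; lra.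
Qed.

Lemma near_le_scale_left (z r t : R) (u : nat -> R) : 0 < r -> (forall n, u n < t) ->
  u n @[n --> \oo] --> t -> \forall n \near \oo, (z <= u n * r) = (z < t * r).
Proof.
move=> r0 tu u_t; have [z_lt|z_ge] := ltP z (t * r); last first.
  by apply: nearW => n; apply/negbTE; rewrite -ltNge (lt_le_trans _ z_ge)// ltr_pM2r.
have gap0 : 0 < t - z / r by rewrite subr_gt0 ltr_pdivrMr.
have /cvgrPdist_lt/(_ _ gap0) := u_t; apply: filterS => n; rewrite ltr_norml => /andP[_ ?].
by rewrite -ler_pdivrMr//; lra.
Qed.

Lemma cadlag_le_scale (z r : R) : 0 < r -> cadlag (fun t => ((z <= t * r)%R)%:R).
Proof.
move=> r0; split => t t0.
  apply/cvg_at_rightP => u [tu u_t]; apply: cvg_near_cst.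
  by have := near_le_scale_right z r0 tu u_t; apply: filterS => n ->.
apply/cvg_ex; exists (((z < t * r)%R)%:R); apply/cvg_at_leftP => u [tu u_t]; apply: cvg_near_cst.
by have := near_le_scale_left z r0 tu u_t; apply: filterS => n ->.
Qed.

End Cadlag.

Section CountingPaths.
Context {R : realType} {d : measure_display} {T : measurableType d} (P : probability T R).
Variable zeta : nat -> T -> R.
Hypothesis mz : forall i, measurable_fun setT (zeta i).
Local Notation p := (cdf_at P zeta).
Local Notation count := (centred_count P zeta).

Lemma cadlag_cdf_at j (r : R) : 0 < r -> cadlag (fun t => p j (t * r)).
Proof.
move=> r0; split => t t0.
  apply/cvg_at_rightP => u [tu u_t]; apply: prob_cvg_ae.
  - by move=> n; exact: measurable_set_le.
  - exact: measurable_set_le.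
  - apply/aeW => w; have := near_le_scale_right (zeta j w) r0 tu u_t.
    by apply: filterS => n leE; apply/idP/idP; rewrite !inE/= leE.
apply/cvg_ex; exists (strict_cdf_at P zeta j (t * r)).
apply/cvg_at_leftP => u [tu u_t]; apply: prob_cvg_ae.
- by move=> n; exact: measurable_set_le.
- exact: measurable_set_lt.
- apply/aeW => w; have := near_le_scale_left (zeta j w) r0 tu u_t.
  by apply: filterS => n leE; apply/idP/idP; rewrite !inE/= leE.
Qed.

Lemma cadlag_centred_count n (r c : R) w : 0 < r -> cadlag (fun t => count n (t * r) w / c).
Proof.
move=> r0; apply: cadlagMr.
apply: (@cadlag_sum _ n (fun j t => ((zeta j w <= t * r)%R)%:R - p j (t * r))) => j.
by apply: cadlagB; [exact: cadlag_le_scale|exact: cadlag_cdf_at].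
Qed.

Definition centred_count_infty (r : R) w : R := limn (fun n => count n r w).

Definition no_hit_beyond N (r : R) := [set w | forall i, (N <= i)%N -> r < zeta i w].

Lemma centred_count_infty_dist N (r r1 dl : R) w : r <= r1 -> no_hit_beyond N r1 w ->
  (forall m, \sum_(i < m) p (N + i) r1 <= dl) -> `|centred_count_infty r w - count N r w| <= dl.
Proof.
move=> rr1 no_hit tail_le; pose tail m := \sum_(i < m) p (N + i) r.
have countE m : count (N + m) r w = count N r w - tail m.
  rewrite /centred_count big_split_ord/= -sumrN; congr (_ + _); apply: eq_bigr => i _.
  by rewrite leNgt (le_lt_trans rr1)/= ?sub0r// no_hit// leq_addr.
have tail_r_le m : tail m <= dl.
  by apply: le_trans (tail_le m); apply: ler_sum => i _; exact: cdf_at_mono.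
have tail_incr : {homo tail : m n / (m <= n)%N >-> m <= n}.
  move=> m n mn; rewrite -(subnKC mn) /tail big_split_ord/= lerDl sumr_ge0// => i _.
  exact: cdf_at_ge0.
have tail_cvg : cvgn tail by apply: nondecreasing_is_cvgn => //; exists dl => _ [m _ <-].
have lim_le : limn tail <= dl by apply: limr_le => //; exact: nearW.
have lim_ge0 : 0 <= limn tail.
  by apply: limr_ge => //; apply: nearW => m; apply: sumr_ge0 => i _; exact: cdf_at_ge0.
have count_cvg : count (m + N) r w @[m --> \oo] --> count N r w - limn tail.
  by under eq_fun do rewrite addnC countE; apply: cvgB; [exact: cvg_cst|exact: tail_cvg].
have -> : centred_count_infty r w = count N r w - limn tail.
  by apply: (cvg_lim (@Rhausdorff R)); move: count_cvg;
    rewrite (cvg_shiftn N (fun n => count n r w)).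
by rewrite addrAC subrr add0r normrN ger0_norm.
Qed.

Lemma measurable_no_hit_beyond N r : measurable (no_hit_beyond N r).
Proof.
have -> : no_hit_beyond N r = \bigcap_(i in [set i | (N <= i)%N]) ~` [set w | zeta i w <= r].
  by apply/seteqP; split => w no_hit i Ni /=;
    [apply/negP; rewrite -ltNge|rewrite ltNge; apply/negP]; exact: no_hit.
by apply: bigcap_measurableType => i _; apply: measurableC; exact: measurable_set_le.
Qed.

Lemma nneseries_prob_le (A : nat -> set T) (e : R) : (forall i, measurable (A i)) ->
  (forall m, \sum_(i < m) prob P (A i) <= e) -> (\sum_(0 <= i <oo) P (A i) <= e%:E)%E.
Proof.
move=> mA sum_le; apply: lime_le; first by apply: is_cvg_nneseries => n _ _.
apply: nearW => m; have := sum_le m; rewrite -lee_fin; apply: le_trans.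
rewrite big_mkord -sumEFin; apply: lee_sum => i _.
by have := EFin_prob P (mA i); rewrite -[X in _ -> (X <= _)%E]/(P (A i)) => ->.
Qed.

Lemma prob_hit_beyond_le N (r e : R) :
  (forall m, \sum_(i < m) p (N + i) r <= e) -> prob P (~` no_hit_beyond N r) <= e.
Proof.
move=> tail_le; pose A i := [set w | zeta (N + i)%N w <= r].
have mA i : measurable (A i) by exact: measurable_set_le.
have hitE : ~` no_hit_beyond N r = \bigcup_i A i.
  apply/seteqP; split => w.
    move=> /existsNP[i /not_implyP[Ni /negP]]; rewrite -leNgt => hit; exists (i - N)%N => //.
    by rewrite /A/= subnKC.
  by move=> [i _] /= hit /(_ _ (leq_addr i N)); rewrite ltNge hit.
have mU : measurable (\bigcup_i A i) by exact: bigcup_measurable.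
rewrite hitE -lee_fin -EFin_prob//; apply: le_trans (nneseries_prob_le mA tail_le).
exact: (@measure_sigma_subadditive _ _ _ P).
Qed.

Hypothesis sum_bounded : forall r : R, 0 <= r -> exists M : R, forall n, \sum_(j < n) p j r <= M.

Lemma exists_cdf_tail_le (r e : R) : 0 <= r -> 0 < e ->
  exists N0, forall N m, (N0 <= N)%N -> \sum_(i < m) p (N + i) r <= e.
Proof.
move=> r0 e0; have [M sum_le] := sum_bounded r0.
have incr : {homo (fun m => \sum_(i < m) p i r) : m n / (m <= n)%N >-> m <= n}.
  by move=> m n mn; rewrite -(subnKC mn) big_split_ord/= lerDl sumr_ge0// => i _; exact: cdf_at_ge0.
have sum_cvg : cvgn (fun m => \sum_(i < m) p i r).
  by apply: nondecreasing_is_cvgn => //; exists M => _ [m _ <-].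
move/cvgrPdist_le: (sum_cvg) => /(_ _ e0)[N0 _ near_lim]; exists N0 => N m N0N.
have := nondecreasing_cvgn_le incr sum_cvg (N + m)%N; rewrite big_split_ord/= => le_lim.
by have := near_lim N N0N; rewrite /= ler_norml => /andP[_ ?]; lra.
Qed.

Definition locally_finite w := forall k : nat, exists N, no_hit_beyond N k%:R w.

Lemma locally_finite_ae : {ae P, forall w, locally_finite w}.
Proof.
pose A (k j : nat) := [set w | zeta j w <= k%:R].
have mA k j : measurable (A k j) by exact: measurable_set_le.
have m_lim_sup k : measurable (lim_sup_set (A k)).
  by apply: bigcap_measurable => // n _; exact: bigcup_measurable.
suff : P.-negligible (~` [set w | locally_finite w]) by [].
apply: (@negligibleS _ _ _ P (\bigcup_k lim_sup_set (A k))).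
  move=> w /existsNP[k /forallNP hits]; exists k => // N _.
  by have /existsNP[i /not_implyP[Ni /negP]] := hits N; rewrite -leNgt => hit; exists i.
apply: negligible_bigcup => k; apply/(negligibleP _ (m_lim_sup k)); apply: lim_sup_set_cvg0 => //.
have [M sum_le] := sum_bounded (ler0n R k).
by apply: le_lt_trans (nneseries_prob_le (mA k) sum_le) (ltry _).
Qed.

Lemma cadlag_centred_count_infty (r c : R) w :
  0 < r -> locally_finite w -> cadlag (fun t => centred_count_infty (t * r) w / c).
Proof.
move=> r0 finite_w; apply: cadlag_uniform => j dl dl0.
pose k := (Num.truncn (j%:R * r)).+1.
have jr_le : j%:R * r <= k%:R.
  by have /andP[_ /ltW] := truncn_itv (mulr_ge0 (ler0n R j) (ltW r0)).
have [N1 no_hit] := finite_w k.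
have c1 : 0 < `|c^-1| + 1 by rewrite ltr_pwDr.
have [N2 tail_le] := exists_cdf_tail_le (ler0n R k) (divr_gt0 dl0 c1).
exists (fun t => count (maxn N1 N2) (t * r) w / c); first exact: cadlag_centred_count.
move=> t /andP[t0 tj]; rewrite -mulrBl normrM.
have dist_le : `|centred_count_infty (t * r) w - count (maxn N1 N2) (t * r) w| <=
  dl / (`|c^-1| + 1).
  apply: (@centred_count_infty_dist _ _ k%:R).
  - by apply: le_trans jr_le; rewrite ler_pM2r.
  - by move=> i Ni; apply: no_hit; apply: leq_trans Ni; rewrite leq_maxl.
  - by move=> m; apply: tail_le; rewrite leq_maxr.
apply: (le_trans (ler_wpM2r (normr_ge0 c^-1) dist_le)).
by rewrite mulrAC ler_pdivrMr// ler_pM2l// lerDl.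
Qed.

End CountingPaths.

(** * Convergence in the Skorokhod topology *)

Record limit_process {R : realType} (Phi : R -> R) (ap : \bar R) (P : probability R R)
  (G : R -> R -> R) : Prop := {
  limit_process_measurable : measurable_process G;
  limit_process_uniform : forall w, dyadic_uniform (G w);
  limit_process_nonneg : nonneg_definite (limit_covariance Phi ap);
  limit_process_char : gaussian_char P G (limit_covariance Phi ap) }.

Lemma limit_process_centred_gaussian {R : realType} (Phi : R -> R) (ap : \bar R)
  (P : probability R R) (G : R -> R -> R) :
  limit_process Phi ap P G -> centred_gaussian_process P G.
Proof.
move=> [mG uG pC G_char]; apply: (centred_gaussian_process_of_char pC mG G_char) => w.
exact: dyadic_uniform_cadlag.
Qed.

Lemma limit_process_covariance {R : realType} (Phi : R -> R) (ap : \bar R) (P : probability R R)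
  (G : R -> R -> R) :
  tail_function Phi -> limit_process Phi ap P G -> covariance_spec P G Phi ap.
Proof.
move=> tailPhi [mG uG pC G_char] s t s0 st; have t0 : 0 < t := lt_le_trans s0 st.
rewrite (gaussian_covariance (limit_covariance_sym _ _) pC mG G_char (ltW s0) (ltW t0)).
rewrite /limit_covariance s0 t0/= min_l// max_r// /covariance_integral /Rintegral fineK//.
exact: (@integrable_fin_num _ _ _ (@lebesgue_measure R) _ (measurable_open_initial_segment ap) _
  (integrable_covariance_integrand tailPhi ap s0 t0)).
Qed.

Section CountingLimit.
Context {R : realType} {d : measure_display} {T : measurableType d} (P : probability T R).
Variable zeta : nat -> T -> R.
Hypotheses (mz : forall i, measurable_fun setT (zeta i)) (indz : independent_seq P zeta).
Local Notation p := (cdf_at P zeta).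
Variables (Sig Phi : R -> R) (c r0 M : R).
Hypotheses (tailPhi : tail_function Phi) (asymp : counting_asymptotics p Sig Phi c r0 M).

Let c0 := asymptotics_c_gt0 asymp.
Let M0 := asymptotics_M_ge0 asymp.

Lemma counting_sum_bounded (r : R) : 0 <= r -> exists K : R, forall n, \sum_(j < n) p j r <= K.
Proof.
move=> r_ge0; exists (r + 2 * M) => n.
have := asymptotics_increment asymp n (lexx 0) r_ge0; have := asymptotics_at0 asymp n.
by rewrite sumrB; lra.
Qed.

Section AlongSequence.
Variables (R_ : nat -> R) (N_ : nat -> nat) (ap : \bar R).
Hypotheses (R_ge : forall n, r0 <= R_ n) (R_infty : R_ n @[n --> \oo] --> +oo)
  (N_ap : ((N_ n)%:R / Sig (R_ n))%:E @[n --> \oo] --> ap).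
Local Notation S_ := (fun n => Sig (R_ n)).
Local Notation X := (rescaled_count P zeta R_ S_ N_).

Let R0 := counting_radius_gt0 asymp R_ge.
Let S0 := counting_scale_gt0 asymp R_ge.
Let S_inv := inv_scale_cvg0 asymp R_ge R_infty.
Let RS_cvg := radius_over_scale_cvg asymp R_ge R_infty.
Let covariance_cvg := indicator_covariance_sum_cvg tailPhi asymp R_ge R_infty N_ap.

Lemma lipschitz_limit_covariance : lipschitz_covariance (limit_covariance Phi ap) c.
Proof.
split.
- exact: limit_covariance_sym.
- exact: (limit_nonneg_definite mz S0 covariance_cvg).
- exact: ltW.
- by move=> t; rewrite /limit_covariance ltxx.
- by move=> s t s0 st; exact: (limit_covariance_increment_le tailPhi asymp R_ge R_infty N_ap s0 st).
Qed.

Lemma exists_limit_process : exists P' G, limit_process Phi ap P' G.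
Proof.
have cov_lip := lipschitz_limit_covariance.
have [P' [G [mG uG G_char]]] := exists_gaussian_process cov_lip.
by exists P', G; split => //; exact: covariance_nonneg cov_lip.
Qed.

Lemma counting_cvg_law (P' : probability R R) (G : R -> R -> R) (Y : nat -> T -> R -> R) :
  limit_process Phi ap P' G -> (forall n, {ae P, forall w, cadlag (Y n w)}) ->
  (forall (j : nat) (dl e : R), 0 < dl -> 0 < e ->
    \forall n \near \oo, uniformly_close P (Y n) (X n) j dl e) ->
  cvg_law_skorokhod \oo P Y P' G.
Proof.
move=> [mG uG pC G_char] Y_cadlag Y_close; apply: (@cvg_law_criterion _ _ _ P _ _ P' X Y G) => //.
- by move=> n; exact: measurable_rescaled_count.
- by move=> s b s0; rewrite G_char//;
  exact: (rescaled_count_char_cvg mz indz S0 S_inv covariance_cvg s0).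
- exact: (rescaled_count_tight mz indz N_ R0 S0 S_inv RS_cvg c0 M0 (asymptotics_at0 asymp)
    (asymptotics_increment asymp)).
- move=> j dl e dl0 e0; have dl2 : 0 < dl / 2 by rewrite divr_gt0.
  have e2 : 0 < e / 2 by rewrite divr_gt0.
  have [m0 modulus] := rescaled_count_modulus mz indz N_ R0 S0 S_inv RS_cvg c0 M0
    (asymptotics_increment asymp) j dl2 e2.
  exists m0 => m /modulus X_modulus; near=> n; rewrite [dl]splitr [e]splitr.
  apply: (@uniformly_close_trans _ _ _ _ _ (X n)); first by near: n; exact: Y_close.
  by near: n.
- by move=> w; exact: dyadic_uniform_cadlag.
Unshelve. all: by end_near. Qed.

Lemma finite_counting_cvg_law (P' : probability R R) (G : R -> R -> R) :
  limit_process Phi ap P' G -> cvg_law_skorokhod \oo P X P' G.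
Proof.
move=> limG; apply: (counting_cvg_law limG) => [n|j dl e dl0 e0].
  by apply/aeW => w; exact: cadlag_centred_count.
apply: nearW => n; exists setT; split => //; first by rewrite setCT /prob measure0 ltW.
by move=> w _ t _; rewrite subrr normr0 ltW.
Qed.

End AlongSequence.

Lemma exists_truncation (R_ : nat -> R) : (forall n, r0 <= R_ n) -> exists N_ : nat -> nat,
  (forall n, n%:R * Sig (R_ n) <= (N_ n)%:R) /\
  forall n m, \sum_(i < m) p (N_ n + i) (n%:R * R_ n) <= n.+1%:R^-1.
Proof.
move=> R_ge; suff /choice[N_ N_spec] : forall n, exists N : nat, n%:R * Sig (R_ n) <= N%:R /\
    forall m, \sum_(i < m) p (N + i) (n%:R * R_ n) <= n.+1%:R^-1.
  by exists N_; split=> n; have [] := N_spec n.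
move=> n; have S_ge0 : 0 <= n%:R * Sig (R_ n) by rewrite mulr_ge0// ltW//
  (counting_scale_gt0 asymp R_ge).
have R_ge0 : 0 <= n%:R * R_ n by rewrite mulr_ge0// ltW// (counting_radius_gt0 asymp R_ge).
have n0 : (0 : R) < n.+1%:R^-1 by rewrite invr_gt0.
have [N0 tail_le] := exists_cdf_tail_le counting_sum_bounded R_ge0 n0.
exists (maxn N0 (Num.truncn (n%:R * Sig (R_ n))).+1); split => [|m]; last by apply: tail_le;
  rewrite leq_maxl.
by have /andP[_ /ltW S_le] := truncn_itv S_ge0; rewrite (le_trans S_le)// ler_nat leq_maxr.
Qed.

Lemma truncation_ratio_cvg (R_ : nat -> R) (N_ : nat -> nat) : (forall n, r0 <= R_ n) ->
  (forall n, n%:R * Sig (R_ n) <= (N_ n)%:R) -> ((N_ n)%:R / Sig (R_ n))%:E @[n --> \oo] --> +oo%E.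
Proof.
move=> R_ge N_ge; have S0 := counting_scale_gt0 asymp R_ge.
apply/cvgeyPge => A; near=> n; rewrite lee_fin ler_pdivlMr// (le_trans _ (N_ge n))// ler_pM2r//.
by near: n; exact: nbhs_infty_ger.
Unshelve. all: by end_near. Qed.

Lemma infinite_counting_cvg_law (R_ : nat -> R) (P' : probability R R) (G : R -> R -> R) :
  (forall n, r0 <= R_ n) -> R_ n @[n --> \oo] --> +oo -> limit_process Phi +oo%E P' G ->
  cvg_law_skorokhod \oo P
    (fun n w t => centred_count_infty P zeta (t * R_ n) w / Num.sqrt (Sig (R_ n))) P' G.
Proof.
move=> R_ge R_infty limG; have [N_ [N_ge tail_le]] := exists_truncation R_ge.
have R0 := counting_radius_gt0 asymp R_ge.
apply: (counting_cvg_law R_ge R_infty (truncation_ratio_cvg R_ge N_ge) limG) => [n|j dl e dl0 e0].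
  have := locally_finite_ae mz counting_sum_bounded; apply: filterS => w.
  exact: (cadlag_centred_count_infty mz counting_sum_bounded).
near=> n; exists (no_hit_beyond zeta (N_ n) (n%:R * R_ n)).
have inv_dl : n.+1%:R^-1 <= dl by near: n; exact: near_infty_natSinv_le.
have inv_e : n.+1%:R^-1 <= e by near: n; exact: near_infty_natSinv_le.
split; [exact: measurable_no_hit_beyond|by rewrite (le_trans _ inv_e)// prob_hit_beyond_le|].
move=> w no_hit t /andP[t0 tj]; rewrite /rescaled_count -mulrBl normrM normfV
  (ger0_norm (sqrtr_ge0 _)).
have dist_le :
    `|centred_count_infty P zeta (t * R_ n) w - centred_count P zeta (N_ n) (t * R_ n) w| <=
    n.+1%:R^-1.
  apply: (centred_count_infty_dist mz _ no_hit (tail_le n));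
    rewrite ler_pM2r// (le_trans tj)// ler_nat.
  by near: n; exact: nbhs_infty_ge.
have sqrt_ge1 : 1 <= Num.sqrt (Sig (R_ n)) by rewrite -sqrtr1 ler_wsqrtr//
  (asymptotics_Sig_ge1 asymp).
rewrite ler_pdivrMr; last exact: lt_le_trans sqrt_ge1.
by rewrite (le_trans dist_le)// (le_trans inv_dl)// ler_peMr// ltW.
Unshelve. all: by end_near. Qed.

End CountingLimit.

Lemma near_maxl {R : realType} (u : nat -> R) (r0 : R) :
  u n @[n --> \oo] --> +oo -> \forall n \near \oo, maxr (u n) r0 = u n.
Proof. by move/cvgryPge => /(_ r0); apply: filterS => n r0u; rewrite max_l. Qed.

Lemma cvg_maxl_infty {R : realType} (u : nat -> R) (r0 : R) :
  u n @[n --> \oo] --> +oo -> maxr (u n) r0 @[n --> \oo] --> +oo.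
Proof.
move=> u_infty; apply: cvg_trans (u_infty); apply: near_eq_cvg.
by have := near_maxl r0 u_infty; apply: filterS => n ->.
Qed.

Section LawTransfer.
Context {R : realType} {d d' : measure_display} {T : measurableType d} {T' : measurableType d'}.
Variables (P : probability T R) (P' : probability T' R) (G : T' -> R -> R).

Lemma cvg_law_skorokhod_eventually (X Y : nat -> T -> R -> R) : (\forall n \near \oo, X n = Y n) ->
  cvg_law_skorokhod \oo P X P' G -> cvg_law_skorokhod \oo P Y P' G.
Proof.
move=> XY X_cvg H bH cH; apply: cvg_trans (X_cvg H bH cH); apply: near_eq_cvg.
by move: XY; apply: filterS => n ->.
Qed.

Lemma cvg_law_skorokhod_pinfty (X : R -> T -> R -> R) (r0 : R) :
  (forall R_ : nat -> R, (forall n, r0 <= R_ n) -> R_ n @[n --> \oo] --> +oo ->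
    cvg_law_skorokhod \oo P (fun n => X (R_ n)) P' G) ->
  cvg_law_skorokhod +oo P X P' G.
Proof.
move=> X_cvg H bH cH; apply/cvge_pinftyP => u u_infty.
apply: (@cvg_law_skorokhod_eventually (fun n => X (maxr (u n) r0)) (fun n => X (u n))) => //.
  by have := near_maxl r0 u_infty; apply: filterS => n ->.
by apply: X_cvg; [move=> n; rewrite le_max lexx orbT|exact: cvg_maxl_infty].
Qed.

End LawTransfer.

Section CountingLimitTheorems.
Context {R : realType} {d : measure_display} {T : measurableType d} (P : probability T R).
Variable zeta : nat -> T -> R.
Hypotheses (mz : forall i, measurable_fun setT (zeta i)) (indz : independent_seq P zeta).
Variables (Sig Phi : R -> R) (c r0 M : R).
Hypotheses (tailPhi : tail_function Phi)
  (asymp : counting_asymptotics (cdf_at P zeta) Sig Phi c r0 M).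

Theorem finite_counting_limit (R_ : nat -> R) (ap : \bar R) : R_ n @[n --> \oo] --> +oo ->
  (n%:R / Sig (R_ n))%:E @[n --> \oo] --> ap ->
  exists (P' : probability R R) (G : R -> R -> R),
  [/\ centred_gaussian_process P' G, covariance_spec P' G Phi ap &
    cvg_law_skorokhod \oo P
      (fun n w t => centred_count P zeta n (t * R_ n) w / Num.sqrt (Sig (R_ n))) P' G].
Proof.
move=> R_infty N_ap; pose R' n := maxr (R_ n) r0.
have R'_ge n : r0 <= R' n by rewrite le_max lexx orbT.
have R'E : \forall n \near \oo, R' n = R_ n := near_maxl r0 R_infty.
have R'_infty : R' n @[n --> \oo] --> +oo := cvg_maxl_infty r0 R_infty.
have N_ap' : (n%:R / Sig (R' n))%:E @[n --> \oo] --> ap.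
  by apply: cvg_trans N_ap; apply: near_eq_cvg; move: R'E; apply: filterS => n ->.
have [P' [G limG]] := exists_limit_process mz tailPhi asymp (N_ := id) R'_ge R'_infty N_ap'.
exists P', G; split.
- exact: limit_process_centred_gaussian limG.
- exact: limit_process_covariance tailPhi limG.
apply: cvg_law_skorokhod_eventually
  (finite_counting_cvg_law mz indz tailPhi asymp (N_ := id) R'_ge R'_infty N_ap' limG).
by move: R'E; apply: filterS => n; rewrite /rescaled_count => ->.
Qed.

Theorem infinite_counting_limit : exists (P' : probability R R) (G : R -> R -> R),
  [/\ centred_gaussian_process P' G, covariance_spec P' G Phi +oo%E &
    cvg_law_skorokhod +oo P
      (fun r w t => centred_count_infty P zeta (t * r) w / Num.sqrt (Sig r)) P' G].
Proof.
pose R_ n : R := r0 + n%:R; have R_ge n : r0 <= R_ n by rewrite lerDl.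
have R_infty : R_ n @[n --> \oo] --> +oo.
  apply/cvgryPge => A; near=> n; have A_le : A - r0 <= n%:R by near: n; exact: nbhs_infty_ger.
  by rewrite /R_; lra.
have [N_ [N_ge _]] := exists_truncation asymp R_ge.
have [P' [G limG]] := exists_limit_process mz tailPhi asymp R_ge R_infty
  (truncation_ratio_cvg asymp R_ge N_ge).
exists P', G; split.
- exact: limit_process_centred_gaussian limG.
- exact: limit_process_covariance tailPhi limG.
apply: (@cvg_law_skorokhod_pinfty _ _ _ _ _ _ _ _ _ r0) => R' R'_ge R'_infty.
exact: (infinite_counting_cvg_law mz indz tailPhi asymp R'_ge R'_infty limG).
Unshelve. all: by end_near. Qed.

End CountingLimitTheorems.

(** * Rotation-invariant determinantal processes *)

Section RotationInvariant.
Context {R : realType} (alpha : nat) (mu : {measure set (R * R)%type -> \bar R})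
  (rho : int -> R -> R).
Context {d : measure_display} {Omega : measurableType d} (P : probability Omega R)
  (X : int -> Omega -> R).
Hypotheses (lam_fin : forall r : R, (\sum_(0 <= j <oo) lam mu rho (j%:Z - alpha%:Z) r < +oo)%E)
  (mX : forall k : int, - (alpha%:Z) <= k -> measurable_fun setT (X k))
  (lawX : forall (k : int) (r : R), - (alpha%:Z) <= k -> P [set w | X k w < r] = lam mu rho k r)
  (indX : mutually_independent P [set k : int | - (alpha%:Z) <= k] X).
Local Notation total := (Tfun alpha mu rho).

Definition modulus (j : nat) (w : Omega) : R := X (j%:Z - alpha%:Z) w.

Let index_ge (j : nat) : - (alpha%:Z) <= j%:Z - alpha%:Z.
Proof. by rewrite lerDr. Qed.

Lemma measurable_modulus j : measurable_fun setT (modulus j).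
Proof. exact: mX. Qed.

Let lamE j (r : R) : lam mu rho (j%:Z - alpha%:Z) r = (strict_cdf_at P modulus j r)%:E.
Proof. by rewrite -lawX// -EFin_prob//; apply: measurable_set_lt; exact: measurable_modulus. Qed.

Lemma Tfun_cvg (r : R) : \sum_(j < n) strict_cdf_at P modulus j r @[n --> \oo] --> total r.
Proof.
have lam_ge0 (j : nat) : (0 <= lam mu rho (j%:Z - alpha%:Z) r)%E.
  by rewrite lamE lee_fin strict_cdf_at_ge0.
have series_cvg : (\sum_(0 <= j < n) lam mu rho (j%:Z - alpha%:Z) r)%E @[n --> \oo] -->
  (total r)%:E.
  rewrite fineK; first by apply: is_cvg_nneseries => j _ _.
  by rewrite ge0_fin_numE// nneseries_ge0.
have -> : (fun n => \sum_(j < n) strict_cdf_at P modulus j r) =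
    fine \o (fun n => \sum_(0 <= j < n) lam mu rho (j%:Z - alpha%:Z) r)%E.
  by apply/funext => n; rewrite /= big_mkord (eq_bigr _ (fun (j : 'I_n) _ => lamE j r)) sumEFin.
exact: fine_cvg series_cvg.
Qed.

Lemma Tfun_nonpos (r : R) : r <= 0 -> total r = 0.
Proof.
move=> r_le0; rewrite /Tfun eseries0// => j _ _; rewrite /lam.
have -> : [set z | cabs z < r] = set0.
  apply/seteqP; split => // z /=; have := sqrtr_ge0 (z.1 ^+ 2 + z.2 ^+ 2); rewrite /cabs; lra.
by rewrite integral_set0.
Qed.

Local Notation radii := (unfolded modulus total).

Lemma measurable_radii j : measurable_fun setT (radii j).
Proof. exact: measurable_unfolded measurable_modulus Tfun_cvg j. Qed.

Lemma GamE j w : Gam alpha mu rho X j.+1 w = radii j w.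
Proof. by rewrite /Gam /unfolded /modulus; congr (Tfun _ _ _ (X _ w)); lia. Qed.

Lemma prob_le_GamE j r : prob_le P (Gam alpha mu rho X) j.+1 r = cdf_at P radii j r.
Proof.
by rewrite /prob_le /cdf_at /prob; congr (fine (P _)); apply/seteqP; split => w /=; rewrite GamE.
Qed.

Lemma XiN_GamE : XiN P (Gam alpha mu rho X) = centred_count P radii.
Proof.
apply/funext => n; apply/funext => r; apply/funext => w; rewrite /XiN big_add1/= big_mkord.
by apply: eq_bigr => j _; rewrite prob_le_GamE GamE.
Qed.

Lemma XiInf_GamE : XiInf P (Gam alpha mu rho X) = centred_count_infty P radii.
Proof.
apply/funext => r; apply/funext => w; congr (limn _); apply/funext => n.
by rewrite -XiN_GamE.
Qed.

Lemma independent_radii : independent_seq P radii.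
Proof.
move=> n B mB; have mtotal := measurable_total measurable_modulus Tfun_cvg.
pose B' (k : int) := total @^-1` B (absz (k + alpha%:Z)).
have B'E (j : nat) : B' (j%:Z - alpha%:Z) = total @^-1` B j by rewrite /B' subrK absz_nat.
have mB' k : measurable (B' k) by exact: measurable_preimage.
pose S := [seq (j%:Z - alpha%:Z)%R | j <- iota 0 n].
have uniqS : uniq S by rewrite map_inj_uniq ?iota_uniq// => i j; lia.
have S_ge i : i \in S -> - (alpha%:Z) <= i by move=> /mapP[j _ ->]; exact: index_ge.
have PE (j : nat) : P (X (j%:Z - alpha%:Z) @^-1` B' (j%:Z - alpha%:Z)) =
  (prob P (radii j @^-1` B j))%:E.
  by rewrite B'E -EFin_prob//; exact: measurable_preimage (measurable_radii j) (mB j).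
have := indX uniqS S_ge mB'; rewrite big_map; under eq_bigr do rewrite PE.
rewrite prodEFin => PS; rewrite /prob.
have -> : [set w | forall i, (i < n)%N -> B i (radii i w)] =
  [set w | forall i, i \in S -> B' i (X i w)].
  apply/seteqP; split => w /= inB i.
    by move=> /mapP[j]; rewrite mem_iota => /andP[_ jn] ->; rewrite B'E; exact: inB.
  move=> ni; have := inB (i%:Z - alpha%:Z); rewrite B'E; apply.
  by apply/mapP; exists i => //; rewrite mem_iota.
rewrite PS/= -(big_mkord xpredT (fun i => fine (P (radii i @^-1` B i)))).
by rewrite /index_iota subn0.
Qed.

Lemma radii_counting_asymptotics (Sig Phi Psi : R -> R) (theta : R -> nat -> R) :
  assumptionA0 P (Gam alpha mu rho X) Sig Phi Psi theta -> tail_function Phi /\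
  exists c r0 M : R, counting_asymptotics (cdf_at P radii) Sig Phi c r0 M.
Proof.
move=> [_ [_ [Sig_cont [Sig_infty [Phi_law [Psi_W11 [theta0 [theta_cvg [C [C0 expansion]]]]]]]]]].
have tailPhi := Phi_tail_tail_function Phi_law; split => //.
have [E [r0]] := exists_tail_approximation Sig_infty Psi_W11 theta0 theta_cvg C0 expansion.
have -> : (fun j => prob_le P (Gam alpha mu rho X) j.+1) = cdf_at P radii.
  by apply/funext => j; apply/funext => r; exact: prob_le_GamE.
move=> approx; have Sig_left (r : R) : r0 < r -> Sig x @[x --> r^'-] --> Sig r.
  move=> r_gt; apply: cvg_at_left_filter.
  have /continuous_within_itvcyP[cont _] := Sig_cont; apply: cont.
  by rewrite in_itv/= (lt_trans (approximation_r0_gt0 approx) r_gt).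
have [c [M asymp]] := unfolded_counting_asymptotics measurable_modulus Tfun_cvg Tfun_nonpos
  tailPhi approx Sig_left.
by exists c, r0, M.
Qed.

End RotationInvariant.

Theorem theorem1p15 (R : realType) (alpha : nat)
    (mu : {measure set (R * R)%type -> \bar R}) (rho : int -> R -> R)
    (d : measure_display) (Omega : measurableType d) (P : probability Omega R)
    (X : int -> Omega -> R)
    (Sig Phi Psi : R -> R) (theta : R -> nat -> R) :
  radon_on_C mu ->
  (forall k : int, - (alpha%:Z) <= k -> measurable_fun setT (rho k)) ->
  (forall k : int, - (alpha%:Z) <= k -> lam_total mu rho k = 1%E) ->
  (forall r : R, (\sum_(0 <= j <oo) lam mu rho (j%:Z - alpha%:Z) r < +oo)%E) ->
  (forall k : int, - (alpha%:Z) <= k -> measurable_fun setT (X k)) ->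
  (forall (k : int) (r : R), - (alpha%:Z) <= k ->
      P [set w | X k w < r] = lam mu rho k r) ->
  mutually_independent P [set k : int | - (alpha%:Z) <= k] X ->
  assumptionA0 P (Gam alpha mu rho X) Sig Phi Psi theta ->
  (* N = infinity: a^+ = +oo, limit R -> +oo *)
  (exists (d' : measure_display) (Omega' : measurableType d')
          (P' : probability Omega' R) (G : Omega' -> R -> R),
      centred_gaussian_process P' G /\ covariance_spec P' G Phi +oo%E /\
      cvg_law_skorokhod (+oo : set_system R) P
        (fun (r : R) (w : Omega) (t : R) =>
           XiInf P (Gam alpha mu rho X) (t * r) w / Num.sqrt (Sig r))
        P' G)
  /\
  (* N < infinity: R = R(N) -> +oo, a^+ = lim N / Sig_R(N), condition (N) *)
  (forall (RN : nat -> R) (ap : \bar R),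
      RN n @[n --> \oo] --> +oo ->
      ((N%:R / Sig (RN N))%:E)%E @[N --> \oo] --> ap ->
      conditionN Sig Phi RN ap ->
      exists (d' : measure_display) (Omega' : measurableType d')
             (P' : probability Omega' R) (G : Omega' -> R -> R),
        centred_gaussian_process P' G /\ covariance_spec P' G Phi ap /\
        cvg_law_skorokhod (\oo : set_system nat) P
          (fun (N : nat) (w : Omega) (t : R) =>
             XiN P (Gam alpha mu rho X) N (t * RN N) w / Num.sqrt (Sig (RN N)))
          P' G).
Proof.
move=> _ _ _ lam_fin mX lawX indX assumptionA.
have [tailPhi [c [r0 [M asymp]]]] := radii_counting_asymptotics lam_fin mX lawX assumptionA.
have mz := measurable_radii lam_fin mX lawX.
have indz := independent_radii lam_fin mX lawX indX.
rewrite XiN_GamE XiInf_GamE; split.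
  have [P' [G [gaussG covG G_cvg]]] := infinite_counting_limit mz indz tailPhi asymp.
  by exists _, _, P', G.
move=> RN ap RN_infty N_ap _.
have [P' [G [gaussG covG G_cvg]]] := finite_counting_limit mz indz tailPhi asymp RN_infty N_ap.
by exists _, _, P', G.
Qed.
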